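(* For each positive integer $k$ there exists a finite constant $\beta_k$, independent of $n$, $a$ and $b$, such that for intervals $(a,b)$ (possibly depending on $n$), $$s_k[N_n(a,b)]=\beta_k\,\mathbb E[N_n(a,b)]+O(1)\quad\text{as }n\to\infty.$$
   Context: $P_n(x)=\sum_{j=0}^n\omega_j\sqrt{\binom nj}\,x^j$ with $\omega_j$ i.i.d. standard real Gaussian random variables. For $-\infty\le a<b\le\infty$ (where $a,b$ may depend on $n$), $N_n(a,b)$ is the number of real zeros of $P_n$ in $(a,b)$. $s_k[X]$ denotes the $k$th cumulant of a random variable $X$. *)

(* Defs.v *)
From mathcomp Require Export all_boot all_order all_algebra finmap.
From mathcomp Require Export all_classical all_reals all_analysis.

Set Implicit Arguments.
Unset Strict Implicit.
Unset Printing Implicit Defensive.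

Import Order.TTheory GRing.Theory Num.Theory.
Import numFieldNormedType.Exports.

Local Open Scope classical_set_scope.
Local Open Scope ring_scope.

Definition independent_RVs d (T : measurableType d) (R : realType)
    (P : probability T R) (I : choiceType) (X : I -> {RV P >-> R}) : Prop :=
  forall (J : {fset I}) (B : I -> set R),
    (forall i, measurable (B i)) ->
    P (\bigcap_(i in [set` J]) (X i @^-1` B i)) =
    (\prod_(i <- J) P (X i @^-1` B i))%E.

(* The laws are compared on measurable sets only: equality of [distribution]
   and [normal_prob] as functions on all sets would also constrain their
   meaningless values on non-measurable sets. *)
Definition standard_gaussian d (T : measurableType d) (R : realType)
    (P : probability T R) (X : {RV P >-> R}) : Prop :=
  forall B : set R, measurable B -> distribution P X B = normal_prob 0 1 B.

Definition elliptic_poly (R : realType) (n : nat) (c : nat -> R) : {poly R} :=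
  \poly_(j < n.+1) (c j * Num.sqrt ('C(n, j)%:R)).

(* Distinct zeros are counted. [fset_set] sends infinite sets to the empty set,
   so the zero polynomial (whose coefficients vanish with probability 0 in the
   random setting) is given the value 0. *)
Definition num_real_zeros (R : realType) (p : {poly R}) (a b : \bar R) : nat :=
  #|` fset_set [set x : R | (a < x%:E < b)%E /\ root p x] |.

Definition elliptic_zeros d (T : measurableType d) (R : realType)
    (P : probability T R) (omega : nat -> {RV P >-> R}) (n : nat)
    (a b : \bar R) : T -> R :=
  fun w => (num_real_zeros (elliptic_poly n (fun j => omega j w)) a b)%:R.

(* The k-th derivative at 0 of the cumulant generating function
   t |-> ln E[exp(t X)]; it is meaningful for k >= 1 when that expectation is finite
   near 0, in particular for every almost surely bounded X. *)
Definition cumulant d (T : measurableType d) (R : realType)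
    (P : probability T R) (k : nat) (X : T -> R) : R :=
  derive1n k (fun t : R => ln (fine (mmt_gen_fun P X t))) 0.

(* Main.v *)
(* Put x = tan t: the zeros of P_n in (a, b) become those of the process
   F(t) = sum_j c_j sqrt (C(n, j)) (cos t)^(n - j) (sin t)^j in an arc.  Its covariance is
   (cos (s - t))^n, so F is stationary, and F(s) F(t) < 0 has probability
   acos ((cos (s - t))^n) / pi; counting sign changes on finer and finer grids gives the
   mean sqrt n (B - A) / pi for the arc [A, B[.  Let f_n(l) be the k-th cumulant for an arc
   of length l / sqrt n.

   - Moments on an arc of length O(1 / sqrt n) are bounded: in the variable
     y = sqrt n tan t, having q zeros in a bounded interval bounds |c_0| by a tail of order
     2^-q.
   - Two arcs at distance h / sqrt n are independent up to an error exponentially small in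
     a power of h: splitting the coefficients at an index between the two binomial
     concentration windows changes each restriction of F by a factor e^(- c h^2) only, and
     the two halves are exactly independent.
   - Expanding the cumulant of a sum over unit blocks multilinearly, mixed second
     differences of f_n are exponentially small, hence f_n(l) = c_n l + O(1) and
     f_n(L + 1) - f_n(L) = c_n + O(e^(- c L)).
   - With common coefficients and the variable y, degrees n <= n' give the same sign changes
     on an arc of length L off an event of probability O(L^q / n); taking L to be a small
     power of n, c_n - c_n' = O(1 / sqrt n).  So c_n = beta + O(1 / sqrt n), and
     f_n(l) = beta l + O(1) because l <= pi sqrt n. *)

From HB Require Import structures.
Require Import Defs.
From mathcomp Require Import all_boot all_order all_algebra.
From mathcomp Require Import all_classical all_reals all_analysis.
From mathcomp Require Import measurable_realfun.
From mathcomp Require Import ring lra zify.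

Set Implicit Arguments.
Unset Strict Implicit.
Unset Printing Implicit Defensive.

Import Order.TTheory GRing.Theory Num.Theory.
Import numFieldNormedType.Exports.

Local Open Scope classical_set_scope.
Local Open Scope ring_scope.

(** * Standard Gaussian vectors *)

(** Three obstacles shape the argument. First, the circle closes up: an arc of length near [pi] has
    its last block next to its first one, so a mixed second difference is small only in terms of
    both the length of the arc and the room [r] left behind it, and the slope is read off at
    mid-range, far from both ends. Second, a zero count is not determined by finitely many values of
    F, while truncating the coefficients controls signs at given points only; hence counts are
    replaced by sign changes on a grid of [2 ^ G] cells, whose cost is a power of [2 ^ G] and is
    beaten by the Gaussian factor. The exact mean comes from the sign law of a Gaussian pair, and
    through Markov's inequality the same law shows that counts and grid sign changes rarely differ.
    Third, the slope multiplies a length up to [pi * sqrt n], so its mere convergence would not do;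
    the rate [1 / sqrt n] is required and dictates the exponents in the comparison of degrees.
    Cumulants follow a recursion on the block of the first letter, which differentiates well under
    exponential tilting. *)

Definition box (R : realType) (m : nat) (B : 'I_m -> set R) : set (m.-tuple R) :=
  [set c | forall i, B i (tnth c i)].

Definition mkRV d d' (T : measurableType d) (T' : measurableType d') (R : realType)
    (P : probability T R) (X : T -> T') (mX : measurable_fun setT X) : {RV P >-> T'} :=
  mfun_Sub (mem_set mX).

Definition pushP d d' (T : measurableType d) (T' : measurableType d') (R : realType)
    (P : probability T R) (X : T -> T') (mX : measurable_fun setT X) : probability T' R :=
  distribution P (mkRV P mX).

Lemma measurable_idR (R : realType) :
  measurable_fun setT (id : measurableTypeR R -> R).
Proof. by move=> _ A mA; rewrite setTI. Qed.

(* [normal_prob 0 1] lives on a copy of [R] with another measurability display. *)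
Lemma normal01_exists (R : realType) :
  {P : probability R R | forall A, P A = normal_prob 0 1 A}.
Proof.
by exists (pushP (normal_prob 0 1 : probability (measurableTypeR R) R)
  (@measurable_idR R)).
Qed.

Definition normal01 (R : realType) : probability R R := sval (normal01_exists R).

Lemma normal01E (R : realType) (A : set R) : normal01 R A = normal_prob 0 1 A.
Proof. by rewrite /normal01; case: normal01_exists. Qed.

Lemma measurable_preimage d d' (T : measurableType d) (T' : measurableType d')
    (f : T -> T') (A : set T') :
  measurable_fun setT f -> measurable A -> measurable (f @^-1` A).
Proof. by move=> mf mA; rewrite -[X in measurable X]setTI; exact: mf. Qed.

(** Independence and marginals are packed into one product formula on boxes, the form in which
    [independent_RVs] delivers them. *)
Definition std_gaussian (R : realType) (m : nat) d (T : measurableType d)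
    (P : probability T R) (X : T -> m.-tuple R) : Prop :=
  measurable_fun setT X /\
  forall B : 'I_m -> set R, (forall i, measurable (B i)) ->
    P (X @^-1` box B) = (\prod_(i < m) normal01 R (B i))%E.

Lemma measurable_box (R : realType) (m : nat) (B : 'I_m -> set R) :
  (forall i, measurable (B i)) -> measurable (box B).
Proof.
move=> mB.
have -> : box B = \bigcap_(i in [set: 'I_m]) ((@tnth m R ^~ i) @^-1` B i).
  by apply/seteqP; split => [c h i _|c h i]; apply: h.
apply: fin_bigcap_measurable => [|i _]; first exact: finite_finset.
rewrite -[X in measurable X]setTI; exact: measurable_tnth.
Qed.

Lemma measurable_tuple_box (R : realType) (m : nat) :
  @measurable _ (m.-tuple R) =
  <<s [set C | exists B : 'I_m -> set R, (forall i, measurable (B i)) /\ C = box B] >>.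
Proof.
apply/seteqP; split.
  apply: smallest_sub; first exact: smallest_sigma_algebra.
  move=> A; rewrite -bigcup_seq => -[i _] [B mB <-]; apply: sub_sigma_algebra.
  exists (fun j => if j == i then B else setT); split.
    by move=> j; case: eqP => // _; exact: measurableT.
  rewrite setTI; apply/seteqP; split => [c /= Bc j|c /(_ i)].
    by case: eqP => // ->.
  by rewrite eqxx.
apply: smallest_sub; first exact: sigma_algebra_measurable.
by move=> _ [B [mB ->]]; exact: measurable_box.
Qed.

(** Boxes are stable under intersection and generate the product sigma-algebra, so a law is
    determined by its values on them. The two vectors may live on different spaces: this is how
    statements about [omega] are moved to the canonical measure [gauss]. *)
Lemma std_gaussian_unique (R : realType) (m : nat) d (T : measurableType d)
    d' (T' : measurableType d') (P : probability T R) (P' : probability T' R)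
    (X : T -> m.-tuple R) (X' : T' -> m.-tuple R) (A : set (m.-tuple R)) :
  std_gaussian P X -> std_gaussian P' X' -> measurable A ->
  P (X @^-1` A) = P' (X' @^-1` A).
Proof.
move=> [mX PX] [mX' PX'] mA.
have -> : P (X @^-1` A) = pushP P mX A by [].
have -> : P' (X' @^-1` A) = pushP P' mX' A by [].
apply: (measure_unique _ (fun=> setT) (@measurable_tuple_box R m)) => //.
- move=> _ _ [B [mB ->]] [B' [mB' ->]]; exists (fun i => B i `&` B' i); split.
    by move=> i; apply: measurableI.
  apply/seteqP; split => c /=.
    by case=> h h' i; split.
  by move=> h; split => i; have [] := h i.
- move=> _; exists (fun=> setT); split => [_|]; first exact: measurableT.
  by apply/seteqP; split.
- by apply/seteqP; split => // c _; exists 0%N.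
- by move=> _ [B [mB ->]]; rewrite [LHS]PX// [RHS]PX'.
- by move=> _; rewrite /= probability_setT ltry.
Qed.

Lemma prodP_exists d1 (T1 : measurableType d1) d2 (T2 : measurableType d2)
    (R : realType) (P1 : probability T1 R) (P2 : probability T2 R) :
  {P : probability (T1 * T2)%type R | forall A, P A = (P1 \x P2)%E A}.
Proof. by exists (P1 \x P2)%E. Qed.

Definition prodP d1 (T1 : measurableType d1) d2 (T2 : measurableType d2)
    (R : realType) (P1 : probability T1 R) (P2 : probability T2 R) :
  probability (T1 * T2)%type R := sval (prodP_exists P1 P2).

Lemma prodP_prod d1 (T1 : measurableType d1) d2 (T2 : measurableType d2)
    (R : realType) (P1 : probability T1 R) (P2 : probability T2 R) A :
  prodP P1 P2 A = (P1 \x P2)%E A.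
Proof. by rewrite /prodP; case: prodP_exists. Qed.

Lemma prodPE d1 (T1 : measurableType d1) d2 (T2 : measurableType d2)
    (R : realType) (P1 : probability T1 R) (P2 : probability T2 R) A B :
  measurable A -> measurable B -> prodP P1 P2 (A `*` B) = (P1 A * P2 B)%E.
Proof. by move=> mA mB; rewrite prodP_prod /= product_measure1E. Qed.

Definition tcons (R : realType) (m : nat) (p : R * m.-tuple R) : m.+1.-tuple R :=
  [the m.+1.-tuple R of p.1 :: p.2].

Lemma measurable_tcons (R : realType) (m : nat) : measurable_fun setT (@tcons R m).
Proof. exact: measurable_cons. Qed.

Lemma std_gaussian_cons (R : realType) (m : nat) (P : probability (m.-tuple R) R) :
  std_gaussian P id -> std_gaussian (prodP (normal01 R) P) (@tcons R m).
Proof.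
move=> [_ PX]; split; first exact: measurable_tcons.
move=> B mB.
have -> : @tcons R m @^-1` box B = B ord0 `*` box (fun i => B (lift ord0 i)).
  apply/seteqP; split => [[x c] /= h|[x c] /= [h0 h] i].
    split; first exact: (h ord0).
    by move=> i /=; have := h (lift ord0 i); rewrite tnthS.
  by case: (unliftP ord0 i) => [j|] ->; rewrite ?tnthS //.
have mb : measurable (box (fun i => B (lift ord0 i))) by exact: measurable_box.
transitivity (normal01 R (B ord0) * P (box (fun i => B (lift ord0 i))))%E.
  apply: (@prodPE _ _ _ _ R (normal01 R) P (B ord0)); [exact: mB|exact: mb].
rewrite big_ord_recl; congr (_ * _)%E.
by rewrite -[RHS]PX.
Qed.

Lemma std_gaussian_exists (R : realType) (m : nat) :
  exists P : probability (m.-tuple R) R, std_gaussian P id.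
Proof.
elim: m => [|m [P PX]].
  exists (dirac [tuple]); split; first exact: measurable_id.
  move=> B _; rewrite big_ord0 /= diracE /=.
  by rewrite mem_set// => -[].
exists (pushP (prodP (normal01 R) P) (@measurable_tcons R m)); split; first exact: measurable_id.
by move=> B mB; have [_ h] := std_gaussian_cons PX; rewrite -[RHS]h.
Qed.

Definition gauss (R : realType) (m : nat) : probability (m.-tuple R) R :=
  projT1 (cid (@std_gaussian_exists R m)).

Lemma gaussP (R : realType) (m : nat) : std_gaussian (@gauss R m) id.
Proof. by rewrite /gauss; case: cid. Qed.

Lemma gauss_law (R : realType) (m : nat) d (T : measurableType d)
    (P : probability T R) (X : T -> m.-tuple R) (A : set (m.-tuple R)) :
  std_gaussian P X -> measurable A -> P (X @^-1` A) = gauss R m A.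
Proof. by move=> PX; apply: std_gaussian_unique PX (gaussP R m). Qed.

Lemma gauss_consE (R : realType) (m : nat) (A : set (m.+1.-tuple R)) : measurable A ->
  gauss R m.+1 A = prodP (normal01 R) (gauss R m) (@tcons R m @^-1` A).
Proof. by move=> mA; rewrite -(gauss_law (std_gaussian_cons (gaussP R m)) mA). Qed.

(** * Invariance under orthogonal maps *)

Section rotation2.
Variable R : realType.
Local Notation mu := (@lebesgue_measure R).
Local Notation Rm := (measurableTypeR R).
Local Open Scope ereal_scope.

Let leb : SigmaFiniteMeasure.type Rm R := mu.

Lemma lebesgue_measure_shift (a : R) (A : set Rm) : measurable A ->
  pushforward mu ((fun x => x + a)%R : Rm -> Rm) A = mu A.
Proof.
move=> mA.
have mf : measurable_fun setT ((fun x => x + a)%R : Rm -> Rm).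
  by apply: measurable_funD.
apply/esym/lebesgue_measure_unique => //= _ [[b c]] _ <-.
rewrite /pushforward.
have -> : ((fun x => x + a)%R : Rm -> Rm) @^-1` `]b, c]%classic =
    `](b - a)%R, (c - a)%R]%classic.
  by apply/seteqP; split => x /=; rewrite !in_itv /= ltrBlDr lerBrDr.
rewrite !lebesgue_measure_itv /= !lte_fin ltrD2r; case: ifP => // _.
by rewrite -!EFinB; congr _%:E; ring.
Qed.

Lemma ge0_integral_shift (a : R) (f : Rm -> \bar R) :
  measurable_fun setT f -> (forall x, 0 <= f x) ->
  \int[mu]_x f (x + a)%R = \int[mu]_x f x.
Proof.
move=> mf f0.
have ms : measurable_fun setT ((fun x => x + a)%R : Rm -> Rm).
  by apply: measurable_funD.
have -> : \int[mu]_x f x = \int[pushforward mu ((fun x => x + a)%R : Rm -> Rm)]_x f x.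
  by apply: eq_measure_integral => A mA _; exact/esym/lebesgue_measure_shift.
by rewrite ge0_integral_pushforward.
Qed.

Lemma measurable_shear1 a :
  measurable_fun setT (fun z : Rm * Rm => (z.1 + a * z.2, z.2)%R : Rm * Rm).
Proof.
apply/measurable_fun_pairP; split; last exact: measurable_snd.
by apply: measurable_funD => //; apply: measurable_funM.
Qed.

Lemma measurable_shear2 a :
  measurable_fun setT (fun z : Rm * Rm => (z.1, z.2 + a * z.1)%R : Rm * Rm).
Proof.
apply/measurable_fun_pairP; split; first exact: measurable_fst.
by apply: measurable_funD => //; apply: measurable_funM.
Qed.

(** Tonelli's theorem reduces a shear to a translation on each horizontal line. *)
Lemma ge0_integral_shear1 (a : R) (f : Rm * Rm -> \bar R) :
  measurable_fun setT f -> (forall z, 0 <= f z) ->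
  \int[leb \x leb]_z f (z.1 + a * z.2, z.2)%R = \int[leb \x leb]_z f z.
Proof.
move=> mf f0.
have ms : measurable_fun setT (fun z : Rm * Rm => (z.1 + a * z.2, z.2)%R : Rm * Rm).
  exact: measurable_shear1.
pose g (z : Rm * Rm) := f (z.1 + a * z.2, z.2)%R.
have mg : measurable_fun setT g by exact: (measurableT_comp mf ms).
transitivity (\int[leb]_y fubini_G leb g y); first exact: (fubini_tonelli2 g mg (fun z => f0 _)).
transitivity (\int[leb]_y fubini_G leb f y); last first.
  by apply/esym; exact: (fubini_tonelli2 f mf f0).
apply: eq_integral => y _; rewrite /fubini_G /=.
rewrite (ge0_integral_shift (a * y) (f := fun x => f (x, y))) //.
exact: (measurableT_comp mf (pair2_measurable y)).
Qed.

Lemma ge0_integral_shear2 (a : R) (f : Rm * Rm -> \bar R) :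
  measurable_fun setT f -> (forall z, 0 <= f z) ->
  \int[leb \x leb]_z f (z.1, z.2 + a * z.1)%R = \int[leb \x leb]_z f z.
Proof.
move=> mf f0.
have ms : measurable_fun setT (fun z : Rm * Rm => (z.1, z.2 + a * z.1)%R : Rm * Rm).
  exact: measurable_shear2.
pose g (z : Rm * Rm) := f (z.1, z.2 + a * z.1)%R.
have mg : measurable_fun setT g by exact: (measurableT_comp mf ms).
transitivity (\int[leb]_y fubini_F leb g y); first exact: (fubini_tonelli1 g mg (fun z => f0 _)).
transitivity (\int[leb]_y fubini_F leb f y); last first.
  by apply/esym; exact: (fubini_tonelli1 f mf f0).
apply: eq_integral => x _; rewrite /fubini_F /=.
rewrite (ge0_integral_shift (a * x) (f := fun y => f (x, y))) //.
exact: (measurableT_comp mf (pair1_measurable x)).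
Qed.

Definition rot2 (c s : R) (z : R * R) : R * R :=
  (c * z.1 + s * z.2, c * z.2 - s * z.1)%R.

Lemma measurable_rot2 c s : measurable_fun setT (rot2 c s).
Proof.
apply/measurable_fun_pairP; split => /=.
  by apply: measurable_funD; apply: measurable_funM.
by apply: measurable_funB; apply: measurable_funM.
Qed.

(* A rotation is a product of three shears. *)
Lemma ge0_integral_rot2 (c s : R) (f : Rm * Rm -> \bar R) :
  (c ^+ 2 + s ^+ 2 = 1)%R -> (s != 0)%R ->
  measurable_fun setT f -> (forall z, 0 <= f z) ->
  \int[leb \x leb]_z f (rot2 c s z) = \int[leb \x leb]_z f z.
Proof.
move=> cs s0 mf f0; pose a := ((1 - c) / s)%R.
have ms1 : measurable_fun setT (fun z : Rm * Rm => (z.1 + a * z.2, z.2)%R : Rm * Rm).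
  exact: measurable_shear1.
have ms2 : measurable_fun setT (fun z : Rm * Rm => (z.1, z.2 + (- s) * z.1)%R : Rm * Rm).
  exact: measurable_shear2.
rewrite -[RHS](ge0_integral_shear1 a) //.
rewrite -[RHS](ge0_integral_shear2 (- s)%R (f := fun z => f (z.1 + a * z.2, z.2)%R)) //;
  last exact: (measurableT_comp mf ms1).
rewrite -[RHS](ge0_integral_shear1 a
  (f := fun z => f (z.1 + a * (z.2 + (- s) * z.1), z.2 + (- s) * z.1)%R)) //; last first.
  exact: (measurableT_comp mf (measurableT_comp ms1 ms2)).
apply: eq_integral => -[x y] _ /=; rewrite /rot2 /=; congr (f (_, _)).
  have -> : (x + a * y + a * (y + - s * (x + a * y)) =
     (1 - a * s) * x + a * (2 - a * s) * y)%R by ring.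
  have as_ : (a * s = 1 - c)%R by rewrite /a divfK.
  rewrite as_; congr (_ + _ * _)%R; first by ring.
  by apply: (mulIf s0); rewrite mulrAC as_; have := cs; rewrite !expr2; lra.
have -> : (y + - s * (x + a * y) = (1 - a * s) * y - s * x)%R by ring.
by rewrite /a divfK //; congr (_ * _ - _)%R; ring.
Qed.

Let dnorm (z : Rm * Rm) : \bar R := (normal_pdf 0 1 z.1 * normal_pdf 0 1 z.2)%:E.

Let dnorm_ge0 z : 0 <= dnorm z.
Proof. by rewrite lee_fin mulr_ge0 // normal_pdf_ge0. Qed.

Let measurable_dnorm : measurable_fun setT dnorm.
Proof.
apply/measurable_EFinP; apply: measurable_funM.
  by apply: (measurableT_comp (measurable_normal_pdf 0 1)).
by apply: (measurableT_comp (measurable_normal_pdf 0 1)).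
Qed.

Let pnorm (A : set (R * R)) : \bar R := \int[leb \x leb]_(z in A) dnorm z.

Let pnorm0 : pnorm set0 = 0.
Proof. by rewrite /pnorm integral_set0. Qed.

Let pnorm_ge0 A : 0 <= pnorm A.
Proof. by apply: integral_ge0 => z _. Qed.

Let pnorm_sigma_additive : semi_sigma_additive pnorm.
Proof.
move=> A mA tA mUA; rewrite /pnorm ge0_integral_bigcup //; last first.
  exact: measurable_funTS.
by apply: is_cvg_ereal_nneg_natsum_cond => n _ _; exact: integral_ge0.
Qed.

HB.instance Definition _ := isMeasure.Build _ _ _
  pnorm pnorm0 pnorm_ge0 pnorm_sigma_additive.

Let pnormX (A B : set R) : measurable A -> measurable B ->
  pnorm (A `*` B) = normal01 R A * normal01 R B.
Proof.
move=> mA mB; rewrite /pnorm integral_mkcond.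
pose g (z : Rm * Rm) := (dnorm \_ (A `*` B)) z.
have mg : measurable_fun setT g.
  apply/(measurable_restrictT _ (measurableX mA mB)).
  exact: measurable_funTS.
have g0 z : 0 <= g z by rewrite /g patchE; case: ifP.
transitivity (\int[leb]_x fubini_F leb g x); first exact: (fubini_tonelli1 g mg g0).
have hA : measurable_fun setT (fun x : Rm => ((normal_pdf 0 1 x)%:E : \bar R)).
  by apply/measurable_EFinP; exact: measurable_normal_pdf.
have gE x y : g (x, y) = (((fun x => (normal_pdf 0 1 x)%:E) \_ A) x *
                          ((fun x => (normal_pdf 0 1 x)%:E) \_ B) y).
  rewrite /g !patchE in_setX /=; case: (x \in A); case: (y \in B) => /=;
   by rewrite ?mule0 ?mul0e // -EFinM.
under eq_integral => x _.
  rewrite /fubini_F; under eq_integral do rewrite gE.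
  rewrite ge0_integralZl //; last 3 first.
  - exact/(measurable_restrictT _ mB)/measurable_funTS.
  - by move=> y _; rewrite patchE; case: ifP => // _; rewrite lee_fin normal_pdf_ge0.
  - by rewrite patchE; case: ifP => // _; rewrite lee_fin normal_pdf_ge0.
  rewrite -integral_mkcond.
  over.
rewrite /= ge0_integralZr //.
- by rewrite -integral_mkcond !normal01E.
- exact/(measurable_restrictT _ mA)/measurable_funTS.
- by move=> y _; rewrite patchE; case: ifP => // _; rewrite lee_fin normal_pdf_ge0.
- by apply: integral_ge0 => y _; rewrite lee_fin normal_pdf_ge0.
Qed.

Let prod_normal01E (A : set (R * R)) : measurable A ->
  prodP (normal01 R) (normal01 R) A = pnorm A.
Proof. by rewrite prodP_prod; exact: (product_measure_unique pnormX). Qed.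

Let dnorm_rot c s z : (c ^+ 2 + s ^+ 2 = 1)%R -> dnorm (rot2 c s z) = dnorm z.
Proof.
move=> cs; rewrite /dnorm /normal_pdf (negbTE (oner_neq0 R)) /normal_fun /=.
congr _%:E; rewrite mulrACA [in RHS]mulrACA -!expRD; congr (_ * expR _)%R.
rewrite !subr0 -!mulrDl; congr (_ / _)%R; rewrite -!opprD; congr (- _)%R.
by transitivity ((c ^+ 2 + s ^+ 2) * (z.1 ^+ 2 + z.2 ^+ 2))%R; [ring|rewrite cs mul1r].
Qed.

(** The map [rot2] preserves the product Lebesgue measure, and the density of two independent
    standard Gaussians depends on [z.1 ^+ 2 + z.2 ^+ 2] only. *)
Lemma prod_normal01_rot2 c s (A : set (R * R)) :
  (c ^+ 2 + s ^+ 2 = 1)%R -> (s != 0)%R -> measurable A ->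
  prodP (normal01 R) (normal01 R) (rot2 c s @^-1` A) =
  prodP (normal01 R) (normal01 R) A.
Proof.
move=> cs s0 mA; have mr := @measurable_rot2 c s.
have mrA : measurable (rot2 c s @^-1` A) by rewrite -[X in measurable X]setTI; exact: mr.
rewrite prod_normal01E // [RHS]prod_normal01E // /pnorm.
rewrite [LHS]integral_mkcond [RHS]integral_mkcond.
rewrite -[RHS](ge0_integral_rot2 cs s0).
- apply: eq_integral => z _; rewrite !patchE /= dnorm_rot //.
- exact/(measurable_restrictT _ mA)/measurable_funTS.
- by move=> z; rewrite patchE; case: ifP.
Qed.

(** The factorization into shears divides by [s]; when [s = 0] the map is plus or minus the identity
    and is treated apart. *)
Lemma prod_normal01_rot c s (A : set (R * R)) :
  (c ^+ 2 + s ^+ 2 = 1)%R -> measurable A ->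
  prodP (normal01 R) (normal01 R) (rot2 c s @^-1` A) =
  prodP (normal01 R) (normal01 R) A.
Proof.
move=> cs mA; have [s0|s0] := eqVneq s 0%R; last exact: prod_normal01_rot2.
move: cs; rewrite s0 expr0n /= addr0 => /eqP; rewrite sqrf_eq1 => /orP[]/eqP ->.
  congr (prodP _ _ _); apply/seteqP.
  by split => -[x y]; rewrite /preimage /rot2 /= !mul1r !mul0r addr0 subr0.
(* A half turn is a quarter turn done twice, and a quarter turn has [s = 1]. *)
have cs01 : (0 ^+ 2 + 1 ^+ 2 = 1 :> R)%R by rewrite expr0n expr1n add0r.
rewrite -[RHS](prod_normal01_rot2 cs01 (oner_neq0 R)) //.
rewrite -[RHS](prod_normal01_rot2 cs01 (oner_neq0 R)) //.
- congr (prodP _ _ _); apply/seteqP.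
  by split => -[x y]; rewrite /preimage /rot2 /= !mul1r !mul0r !mulN1r !(addr0, subr0, add0r, sub0r).
- by rewrite -[X in measurable X]setTI; exact: measurable_rot2.
Qed.

(** The half turn of the plane acts on the first coordinate as the change of sign. *)
Lemma normal01N (A : set R) : measurable A -> normal01 R ((fun x => (- x)%R) @^-1` A) = normal01 R A.
Proof.
move=> mA.
have mNA : measurable ((fun x : R => (- x)%R) @^-1` A).
  by apply: (measurable_preimage (f := fun x : R => (- x)%R)) => //; exact: measurable_funN.
have h : forall B, measurable B -> normal01 R B = prodP (normal01 R) (normal01 R) (B `*` setT).
  move=> B mB; rewrite (@prodPE _ _ _ _ _ (normal01 R) (normal01 R) B setT mB measurableT).
  by rewrite probability_setT mule1.
rewrite !h // -(@prod_normal01_rot (-1) 0).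
- congr (prodP _ _ _); apply/seteqP.
  by split => -[x y]; rewrite /preimage /rot2 /= mul0r mulN1r addr0 opprK.
- by rewrite sqrrN expr1n expr0n addr0.
- exact: (measurableX mNA measurableT).
Qed.

End rotation2.

Section linear_images.
Variable R : realType.

Definition lact (k m : nat) (W : 'M[R]_(k, m)) (c : m.-tuple R) : k.-tuple R :=
  [tuple \sum_(j < m) W i j * tnth c j | i < k].

Lemma tnth_lact k m (W : 'M[R]_(k, m)) c i :
  tnth (lact W c) i = \sum_(j < m) W i j * tnth c j.
Proof. by rewrite tnth_mktuple. Qed.

Lemma measurable_dot (m : nat) (u : 'I_m -> R) :
  measurable_fun setT (fun c : m.-tuple R => \sum_(j < m) u j * tnth c j).
Proof.
by apply: measurable_sum => j; apply: measurable_funM => //; exact: measurable_tnth.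
Qed.

Lemma measurable_lact k m (W : 'M[R]_(k, m)) : measurable_fun setT (lact W).
Proof.
apply/measurable_fun_tnthP => i.
rewrite (_ : _ \o _ = fun c => \sum_(j < m) W i j * tnth c j); last first.
  by apply/funext => c /=; rewrite tnth_lact.
exact: measurable_dot.
Qed.

Lemma lact_mul k l m (W : 'M[R]_(k, l)) (G : 'M[R]_(l, m)) c :
  lact (W *m G) c = lact W (lact G c).
Proof.
apply: eq_from_tnth => i; rewrite !tnth_lact.
under [RHS]eq_bigr do rewrite tnth_lact mulr_sumr.
rewrite exchange_big /=; apply: eq_bigr => j _.
by rewrite !mxE mulr_suml; apply: eq_bigr => l' _; rewrite mulrA.
Qed.

Lemma lact1 m (c : m.-tuple R) : lact 1%:M c = c.
Proof.
apply: eq_from_tnth => i; rewrite tnth_lact (bigD1 i) //= !mxE eqxx mul1r.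
by rewrite big1 ?addr0 // => j ji; rewrite !mxE eq_sym (negbTE ji) mul0r.
Qed.

Definition gauss_stable k m (W : 'M[R]_(k, m)) := std_gaussian (gauss R m) (lact W).

Lemma gauss_stableE k m (W : 'M[R]_(k, m)) (A : set (k.-tuple R)) :
  gauss_stable W -> measurable A -> gauss R m (lact W @^-1` A) = gauss R k A.
Proof. by move=> gW mA; exact: gauss_law. Qed.

Lemma gauss_stable_mul k l m (W : 'M[R]_(k, l)) (G : 'M[R]_(l, m)) :
  gauss_stable W -> gauss_stable G -> gauss_stable (W *m G).
Proof.
move=> gW gG; split; first exact: measurable_lact.
move=> B mB; have [_ <-] := gW; last exact: mB.
rewrite -[RHS](gauss_stableE gG); last first.
  by apply: measurable_preimage; [exact: measurable_lact|exact: measurable_box].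
congr (gauss R m _); apply/seteqP.
by split => c; rewrite /preimage /= lact_mul.
Qed.

Lemma gauss_stable1 m : gauss_stable (1%:M : 'M[R]_m).
Proof.
have [h1 h2] := gaussP R m; split => [|B mB]; first exact: measurable_lact.
rewrite -h2 //; congr (gauss R m _); apply/seteqP.
by split => c; rewrite /preimage /= lact1.
Qed.

Definition cons_mx k m (W : 'M[R]_(k, m)) : 'M[R]_(k.+1, m.+1) :=
  \matrix_(i, j) match unlift ord0 i, unlift ord0 j with
    | Some i', Some j' => W i' j' | None, None => 1 | _, _ => 0 end.

Lemma cons_mx00 k m (W : 'M[R]_(k, m)) : cons_mx W ord0 ord0 = 1.
Proof. by rewrite mxE !unlift_none. Qed.

Lemma cons_mx0S k m (W : 'M[R]_(k, m)) j : cons_mx W ord0 (lift ord0 j) = 0.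
Proof. by rewrite mxE unlift_none liftK. Qed.

Lemma cons_mxS0 k m (W : 'M[R]_(k, m)) i : cons_mx W (lift ord0 i) ord0 = 0.
Proof. by rewrite mxE unlift_none liftK. Qed.

Lemma cons_mxSS k m (W : 'M[R]_(k, m)) i j :
  cons_mx W (lift ord0 i) (lift ord0 j) = W i j.
Proof. by rewrite mxE !liftK. Qed.

Definition cons_mxE := (cons_mx00, cons_mx0S, cons_mxS0, cons_mxSS).

Lemma cons_mx_tr k m (W : 'M[R]_(k, m)) : (cons_mx W)^T = cons_mx W^T.
Proof.
apply/matrixP => i j; rewrite mxE.
have [i'|] := unliftP ord0 i => ->; have [j'|] := unliftP ord0 j => ->;
by rewrite !cons_mxE ?mxE.
Qed.

Lemma cons_mx_mul k l m (W : 'M[R]_(k, l)) (G : 'M[R]_(l, m)) :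
  cons_mx W *m cons_mx G = cons_mx (W *m G).
Proof.
apply/matrixP => i j; rewrite mxE big_ord_recl.
have [i'|] := unliftP ord0 i => ->; have [j'|] := unliftP ord0 j => ->.
- by rewrite !cons_mxE mul0r add0r mxE; apply: eq_bigr => a _; rewrite !cons_mxE.
- by rewrite !cons_mxE mul0r add0r big1 // => a _; rewrite !cons_mxE mulr0.
- by rewrite !cons_mxE mulr0 add0r big1 // => a _; rewrite !cons_mxE mul0r.
- by rewrite !cons_mxE mulr1 big1 ?addr0 // => a _; rewrite !cons_mxE mul0r.
Qed.

Lemma cons_mx1 m : cons_mx (1%:M : 'M[R]_m) = 1%:M.
Proof.
apply/matrixP => i j; rewrite [RHS]mxE.
have [i'|] := unliftP ord0 i => ->; have [j'|] := unliftP ord0 j => ->;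
by rewrite !cons_mxE ?mxE ?(inj_eq lift_inj).
Qed.

Lemma cons_mx_unitary k m (W : 'M[R]_(k, m)) :
  W *m W^T = 1%:M -> cons_mx W *m (cons_mx W)^T = 1%:M.
Proof. by move=> WW; rewrite cons_mx_tr cons_mx_mul WW cons_mx1. Qed.

Lemma lact_cons k m (W : 'M[R]_(k, m)) x c :
  lact (cons_mx W) (tcons (x, c)) = tcons (x, lact W c).
Proof.
apply: eq_from_tnth => i; rewrite tnth_lact big_ord_recl.
have [i'|] := unliftP ord0 i => ->.
  rewrite cons_mxE mul0r add0r tnthS tnth_lact.
  by apply: eq_bigr => j _; rewrite cons_mxE tnthS.
rewrite cons_mxE mul1r tnth0 big1 ?addr0 // => j _.
by rewrite cons_mxE mul0r.
Qed.

Lemma preimage_tcons_box m (B : 'I_m.+1 -> set R) :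
  @tcons R m @^-1` box B = B ord0 `*` box (fun i => B (lift ord0 i)).
Proof.
apply/seteqP; split => [[x c] /= h|[x c] /= [h0 h] i].
  split; first exact: (h ord0).
  by move=> i /=; have := h (lift ord0 i); rewrite tnthS.
by case: (unliftP ord0 i) => [j|] ->; rewrite ?tnthS //.
Qed.

Lemma gauss_stable_cons k m (W : 'M[R]_(k, m)) :
  gauss_stable W -> gauss_stable (cons_mx W).
Proof.
move=> [mW gW]; split; first exact: measurable_lact.
move=> B mB.
have mb : measurable (box (fun i : 'I_k => B (lift ord0 i))) by exact: measurable_box.
rewrite gauss_consE; last first.
  by apply: measurable_preimage; [exact: measurable_lact|exact: measurable_box].
have -> : @tcons R m @^-1` (lact (cons_mx W) @^-1` box B) =
    B ord0 `*` (lact W @^-1` box (fun i => B (lift ord0 i))).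
  apply/seteqP; split => -[x c]; rewrite /preimage /= lact_cons.
    by have /seteqP[+ _] := preimage_tcons_box B => /(_ (x, lact W c)) h /h[].
  by have /seteqP[_] := preimage_tcons_box B => /(_ (x, lact W c)) h /h.
rewrite (@prodPE _ _ _ _ R (normal01 R) (gauss R m) (B ord0)); first last.
- exact: measurable_preimage.
- exact: mB.
by rewrite big_ord_recl gW.
Qed.

Definition rot_mx m (c s : R) : 'M[R]_(m.+2) :=
  \matrix_(i, j) match val i, val j with
    | 0%N, 0%N => c | 0%N, 1%N => s | 1%N, 0%N => - s | 1%N, 1%N => c
    | i', j' => (i' == j')%:R end.

Lemma lact_rot m c s x y (r : m.-tuple R) :
  lact (rot_mx m c s) (tcons (x, tcons (y, r))) =
  tcons ((rot2 c s (x, y)).1, tcons ((rot2 c s (x, y)).2, r)).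
Proof.
apply: eq_from_tnth => i; rewrite tnth_lact 2!big_ord_recl tnth0 tnthS tnth0.
have [i'|] := unliftP ord0 i => ->.
  rewrite tnthS; have [i''|] := unliftP ord0 i' => ->.
    rewrite !mxE /= !mul0r !add0r tnthS (bigD1 i'') //= !mxE /= eqxx mul1r !tnthS.
    rewrite big1 ?addr0 // => j ji; rewrite !mxE /= !/bump /= !add1n !eqSS.
    by rewrite eq_sym (negbTE ji : (j == i'' :> nat) = false) mul0r.
  rewrite !mxE /= tnth0 big1 => [|j _]; first by rewrite /rot2 /=; ring.
  by rewrite !mxE /= mul0r.
rewrite !mxE /= tnth0 big1 => [|j _]; first by rewrite /rot2 /= addr0.
by rewrite !mxE /= mul0r.
Qed.

Definition tcons2 m (z : (R * R) * m.-tuple R) : m.+2.-tuple R :=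
  tcons (z.1.1, tcons (z.1.2, z.2)).

Lemma measurable_tcons2 m : measurable_fun setT (@tcons2 m).
Proof.
apply: measurable_cons; first exact: (measurableT_comp measurable_fst measurable_fst).
apply: measurable_cons; first exact: (measurableT_comp measurable_snd measurable_fst).
exact: measurable_snd.
Qed.

Lemma preimage_tcons2_box m (B : 'I_m.+2 -> set R) :
  @tcons2 m @^-1` box B =
  (B ord0 `*` B (lift ord0 ord0)) `*` box (fun i => B (lift ord0 (lift ord0 i))).
Proof.
apply/seteqP; split => -[[x y] r] /=.
  move=> h; split; first split => /=.
  - by have := h ord0.
  - by have := h (lift ord0 ord0); rewrite tnthS.
  - by move=> i; have := h (lift ord0 (lift ord0 i)); rewrite !tnthS.
move=> [[/= h0 h1] h] i.
have [i'|] := unliftP ord0 i => -> //; rewrite tnthS.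
by have [i''|] := unliftP ord0 i' => -> //; rewrite tnthS.
Qed.

Lemma std_gaussian_cons2 m :
  std_gaussian (prodP (prodP (normal01 R) (normal01 R)) (gauss R m)) (@tcons2 m).
Proof.
have [_ h2] := gaussP R m.
split; first exact: measurable_tcons2.
move=> B mB; rewrite preimage_tcons2_box.
have mb : measurable (box (fun i => B (lift ord0 (lift ord0 i)))).
  exact: measurable_box.
rewrite (@prodPE _ _ _ _ R _ (gauss R m) _ _ (measurableX (mB _) (mB _)) mb).
rewrite (@prodPE _ _ _ _ R (normal01 R) (normal01 R)) //.
by rewrite 2!big_ord_recl muleA; congr (_ * _)%E; rewrite -h2.
Qed.

Lemma gauss_stable_rot m c s : c ^+ 2 + s ^+ 2 = 1 -> gauss_stable (rot_mx m c s).
Proof.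
move=> cs; split; first exact: measurable_lact.
have [_ h2] := @std_gaussian_cons2 m.
move=> B mB; rewrite -(gauss_law (@std_gaussian_cons2 m)); last first.
  by apply: measurable_preimage; [exact: measurable_lact|exact: measurable_box].
rewrite -h2 // preimage_tcons2_box.
have -> : @tcons2 m @^-1` (lact (rot_mx m c s) @^-1` box B) =
    (rot2 c s @^-1` (B ord0 `*` B (lift ord0 ord0))) `*`
    box (fun i => B (lift ord0 (lift ord0 i))).
  apply/seteqP; split => -[[x y] r]; rewrite /preimage /= lact_rot => h.
    have /seteqP[+ _] := preimage_tcons2_box B.
    by move=> /(_ (rot2 c s (x, y), r)) h'; have [h0 h1] := h' h; split.
  have /seteqP[_] := preimage_tcons2_box B.
  by move=> /(_ (rot2 c s (x, y), r)); apply; case: h => h0 h1; split.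
have mb : measurable (box (fun i => B (lift ord0 (lift ord0 i)))).
  exact: measurable_box.
have mX : measurable (B ord0 `*` B (lift ord0 ord0)) by exact: measurableX.
have mrX := measurable_preimage (@measurable_rot2 R c s) mX.
rewrite (@prodPE _ _ _ _ R _ (gauss R m) _ _ mrX mb).
rewrite (@prodPE _ _ _ _ R _ (gauss R m) _ _ mX mb).
by rewrite prod_normal01_rot.
Qed.

Lemma rot_mx_unitary m c s : c ^+ 2 + s ^+ 2 = 1 ->
  rot_mx m c s *m (rot_mx m c s)^T = 1%:M.
Proof.
move=> cs; apply/matrixP => i j; rewrite !mxE 2!big_ord_recl.
have [i'|] := unliftP ord0 i => ->; have [j'|] := unliftP ord0 j => ->.
- have [i2|] := unliftP ord0 i' => ->; have [j2|] := unliftP ord0 j' => ->.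
  + rewrite !mxE /= !mul0r !add0r (bigD1 i2) //= !mxE /= eqxx mul1r big1 ?addr0.
      by rewrite !(inj_eq lift_inj) /bump /= !add1n !eqSS eq_sym.
    move=> a ai; rewrite !mxE /= /bump /= !add1n !eqSS.
    by rewrite eq_sym (negbTE ai : (a == i2 :> nat) = false) mul0r.
  + by rewrite !mxE /= !mul0r !add0r big1 // => a _; rewrite !mxE /= mulr0.
  + by rewrite !mxE /= !mulr0 !add0r big1 // => a _; rewrite !mxE /= mul0r.
  + rewrite !mxE /= big1 ?addr0; last by move=> a _; rewrite !mxE /= mul0r.
    by rewrite -cs; ring.
- have [i2|] := unliftP ord0 i' => ->.
  + by rewrite !mxE /= !mul0r !add0r big1 // => a _; rewrite !mxE /= mulr0.
  + rewrite !mxE /= big1 ?addr0; last by move=> a _; rewrite !mxE /= mul0r.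
    by ring.
- have [j2|] := unliftP ord0 j' => ->.
  + by rewrite !mxE /= !mulr0 !add0r big1 // => a _; rewrite !mxE /= mul0r.
  + rewrite !mxE /= big1 ?addr0; last by move=> a _; rewrite !mxE /= mul0r.
    by ring.
- rewrite !mxE /= big1 ?addr0; last by move=> a _; rewrite !mxE /= mul0r.
  by rewrite -cs; ring.
Qed.

Lemma gauss_stableN1 : gauss_stable ((-1)%:M : 'M[R]_1).
Proof.
split; first exact: measurable_lact.
move=> B mB; have [_ h] := gaussP R 1.
have mNB i : measurable ((fun x : R => - x) @^-1` B i).
  by apply: (measurable_preimage (f := fun x : R => - x)) => //; exact: measurable_funN.
transitivity (gauss R 1 (box (fun i => (fun x : R => - x) @^-1` B i))).
  congr (gauss R 1 _); apply/seteqP; split => c /= h' i; have := h' i.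
    by rewrite tnth_lact big_ord1 [i]ord1 !mxE eqxx mulN1r.
  by rewrite tnth_lact big_ord1 [i]ord1 !mxE eqxx mulN1r.
rewrite [LHS](h _ mNB); apply: eq_bigr => i _; exact: normal01N.
Qed.

(* Plane rotations bring any vector onto the first axis. *)
Lemma gauss_stable_axis m (u : 'rV[R]_m.+1) :
  exists (G : 'M[R]_m.+1) (rho : R),
    [/\ 0 <= rho, G *m G^T = 1%:M, gauss_stable G & u = rho *: row ord0 G].
Proof.
elim: m u => [|m IH] u.
  have [u0|u0] := leP 0 (u ord0 ord0).
    exists 1%:M, (u ord0 ord0); split => //; first by rewrite trmx1 mulmx1.
      exact: gauss_stable1.
    by apply/rowP => j; rewrite !mxE [j]ord1 eqxx mulr1.
  exists (-1)%:M, (- u ord0 ord0); split => //; first by rewrite oppr_ge0 ltW.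
  - by rewrite tr_scalar_mx -scalar_mxM mulrNN mulr1.
  - exact: gauss_stableN1.
  - by apply/rowP => j; rewrite !mxE [j]ord1 eqxx mulrN1 opprK.
pose u' : 'rV[R]_m.+1 := \row_j u ord0 (lift ord0 j).
have [G [r [r0 GG gG uG]]] := IH u'.
pose rho := Num.sqrt (u ord0 ord0 ^+ 2 + r ^+ 2).
have rho0 : 0 <= rho by exact: sqrtr_ge0.
have rho2 : rho ^+ 2 = u ord0 ord0 ^+ 2 + r ^+ 2.
  by rewrite sqr_sqrtr // addr_ge0 ?sqr_ge0.
have [c [s [cs hc hs]]] : exists c s : R,
    [/\ c ^+ 2 + s ^+ 2 = 1, u ord0 ord0 = rho * c & r = rho * s].
  have [z|nz] := eqVneq rho 0.
    exists 1, 0; rewrite expr1n expr0n addr0 z !mul0r; split => //.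
      by apply/eqP; move: rho2; rewrite z expr0n /= => /esym/eqP;
         rewrite paddr_eq0 ?sqr_ge0 // !sqrf_eq0 => /andP[].
    by apply/eqP; move: rho2; rewrite z expr0n /= => /esym/eqP;
         rewrite paddr_eq0 ?sqr_ge0 // !sqrf_eq0 => /andP[].
  exists (u ord0 ord0 / rho), (r / rho); split; last 2 first.
  - by rewrite mulrCA divff ?mulr1.
  - by rewrite mulrCA divff ?mulr1.
  by rewrite !expr_div_n -mulrDl -rho2 divff // expf_neq0.
exists (rot_mx m c s *m cons_mx G), rho; split => //.
- by rewrite trmx_mul mulmxA -[_ *m _ *m (cons_mx G)^T]mulmxA cons_mx_unitary // mulmx1 rot_mx_unitary.
- by apply: gauss_stable_mul; [exact: gauss_stable_rot|exact: gauss_stable_cons].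
apply/rowP => j; rewrite !mxE 2!big_ord_recl /= big1 => [|a _]; last first.
  by rewrite !mxE /= mul0r.
rewrite !mxE addr0 /=.
have [j'|] := unliftP ord0 j => ->.
  rewrite unlift_none liftK !mulr0 add0r.
  have /rowP/(_ j') := uG; rewrite !mxE => ->.
  by rewrite mulrA -hs; congr (r * G _ _); apply/val_inj.
by rewrite !unlift_none liftK mulr1 mulr0 addr0.
Qed.

(** Induction on the rows. Composition with an orthogonal map that preserves the Gaussian law turns
    the first row into the first basis vector; orthonormality then clears the first column below it,
    and the matrix is [cons_mx] of a smaller one. *)
Lemma gauss_stable_orthonormal k m (W : 'M[R]_(k, m)) :
  W *m W^T = 1%:M -> gauss_stable W.
Proof.
elim: k m W => [|k IH] m W WW.
  split; first exact: measurable_lact.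
  move=> B mB; rewrite big_ord0 -(probability_setT (gauss R m)).
  by congr (gauss R m _); apply/seteqP; split => // c _ [].
case: m W WW => [|m] W WW.
  have /matrixP/(_ ord0 ord0) := WW; rewrite !mxE big_ord0 eqxx => /eqP.
  by rewrite eq_sym oner_eq0.
have [G [r [r0 GG gG rG]]] := gauss_stable_axis (row ord0 W).
have GG' : G^T *m G = 1%:M by exact: mulmx1C.
pose V := W *m G^T.
have VV : V *m V^T = 1%:M by rewrite trmx_mul trmxK mulmxA -[W *m _ *m _]mulmxA GG' mulmx1.
have V0 j : V ord0 j = r * (j == ord0)%:R.
  have := congr1 (fun A : 'rV_m.+1 => (A *m G^T) ord0 j) rG.
  rewrite -row_mul -scalemxAl -row_mul GG !mxE => ->.
  by rewrite eq_sym.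
have WV : W = V *m G by rewrite /V -mulmxA GG' mulmx1.
clearbody V.
have r1 : r = 1.
  have /matrixP/(_ ord0 ord0) := VV; rewrite !mxE eqxx big_ord_recl !mxE V0 eqxx mulr1.
  rewrite big1 => [|a _]; last by rewrite V0 /= mulr0 mul0r.
  rewrite addr0 => /eqP; rewrite -expr2 sqrf_eq1 => /orP[]/eqP // rN.
  by move: r0; rewrite rN lerNr oppr0 ler10.
have V0' i : V (lift ord0 i) ord0 = 0.
  have /matrixP/(_ (lift ord0 i) ord0) := VV; rewrite !mxE big_ord_recl mxE V0 eqxx r1 !mulr1.
  by rewrite big1 ?addr0 // => a _; rewrite mxE V0 /= mulr0 mulr0.
pose V1 : 'M[R]_(k, m) := \matrix_(i, j) V (lift ord0 i) (lift ord0 j).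
have VE : V = cons_mx V1.
  apply/matrixP => i j.
  have [i'|] := unliftP ord0 i => ->; have [j'|] := unliftP ord0 j => ->;
  by rewrite cons_mxE ?mxE ?V0 ?V0' ?eqxx ?r1 ?mulr1 //= mulr0.
have V1V1 : V1 *m V1^T = 1%:M.
  apply/matrixP => i j; have /matrixP/(_ (lift ord0 i) (lift ord0 j)) := VV.
  rewrite !mxE big_ord_recl V0' mul0r add0r (inj_eq lift_inj) => <-.
  by apply: eq_bigr => a _; rewrite !mxE.
rewrite WV; apply: gauss_stable_mul => //; rewrite VE; exact/gauss_stable_cons/IH.
Qed.

End linear_images.

(** * Elementary real inequalities *)

Section real_inequalities.
Variable R : realType.
Implicit Types x y : R.

Lemma ge0_of_derive_ge0 (f df : R -> R) x :
  (forall y, is_derive y 1 f (df y)) -> f 0 = 0 ->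
  (forall y, 0 <= y <= x -> 0 <= df y) -> 0 <= x -> 0 <= f x.
Proof.
move=> fd f0 df0 x0.
have cf : {within `[0, x], continuous f}.
  apply: derivable_within_continuous => y _; by have /@ex_derive := fd y.
have [c cI] := MVT_segment x0 (fun y _ => fd y) cf.
rewrite f0 !subr0 => ->; rewrite mulr_ge0 // df0 //.
Qed.

Lemma sin_le_id x : 0 <= x -> sin x <= x.
Proof.
move=> x0; rewrite -subr_ge0.
apply: (@ge0_of_derive_ge0 (fun y => y - sin y) (fun y => 1 - cos y)) => //.
  by rewrite sin0 subrr.
Qed.

Lemma cos_ge_quadratic x : 0 <= x -> 1 - x ^+ 2 / 2 <= cos x.
Proof.
move=> x0; rewrite -subr_ge0.
apply: (@ge0_of_derive_ge0 (fun y => cos y - (1 - y ^+ 2 / 2)) (fun y => y - sin y)) => //.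
- by move=> y; apply: is_derive_eq; rewrite /= !scaler0 /GRing.scale /=; field.
- by rewrite cos0 expr0n /= mul0r subr0 subrr.
- by move=> y /andP[y0 _]; rewrite subr_ge0 sin_le_id.
Qed.

Lemma sin_ge_cubic x : 0 <= x -> x - x ^+ 3 / 6 <= sin x.
Proof.
move=> x0; rewrite -subr_ge0.
apply: (@ge0_of_derive_ge0 (fun y => sin y - (y - y ^+ 3 / 6))
  (fun y => cos y - (1 - y ^+ 2 / 2))) => //.
- by move=> y; apply: is_derive_eq; rewrite /= !scaler0 /GRing.scale /=; field.
- by rewrite sin0 expr0n /= mul0r !subr0.
- by move=> y /andP[y0 _]; rewrite subr_ge0 cos_ge_quadratic.
Qed.

Lemma cos_le_quartic x : 0 <= x -> cos x <= 1 - x ^+ 2 / 2 + x ^+ 4 / 24.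
Proof.
move=> x0; rewrite -subr_ge0.
apply: (@ge0_of_derive_ge0 (fun y => 1 - y ^+ 2 / 2 + y ^+ 4 / 24 - cos y)
  (fun y => sin y - (y - y ^+ 3 / 6))) => //.
- by move=> y; apply: is_derive_eq; rewrite /= !scaler0 /GRing.scale /=; field.
- by rewrite cos0 !expr0n /= !mul0r subr0 addr0 subrr.
- by move=> y /andP[y0 _]; rewrite subr_ge0 sin_ge_cubic.
Qed.

(** The function [1 - expR (x ^+ 2 / 2) * cos x] vanishes at 0 and has derivative
    [expR (x ^+ 2 / 2) * (sin x - x * cos x)]; the last factor is nonnegative because its own
    derivative is [x * sin x]. *)
Lemma cos_le_gauss x : 0 <= x -> x <= pi / 2 -> cos x <= expR (- (x ^+ 2) / 2).
Proof.
move=> x0 xpi.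
have key : forall y, 0 <= y <= x -> 0 <= sin y - y * cos y.
  move=> y /andP[y0 yx].
  apply: (@ge0_of_derive_ge0 (fun y => sin y - y * cos y) (fun y => y * sin y)) => //.
  - by move=> z; apply: is_derive_eq; rewrite /GRing.scale /=; ring.
  - by rewrite sin0 mul0r subrr.
  - move=> z /andP[z0 zy]; apply: mulr_ge0 => //; apply: sin_ge0_pi; rewrite z0 /=.
    apply: (le_trans zy); apply: (le_trans yx); apply: (le_trans xpi).
    by rewrite ler_pdivrMr // mulr_natr mulr2n lerDl pi_ge0.
have : 0 <= 1 - expR (x ^+ 2 / 2) * cos x.
  apply: (@ge0_of_derive_ge0 (fun y => 1 - expR (y ^+ 2 / 2) * cos y)
     (fun y => expR (y ^+ 2 / 2) * (sin y - y * cos y))) => //.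
  - by move=> y; apply: is_derive_eq; rewrite /= !scaler0 /GRing.scale /=; field.
  - by rewrite cos0 expr0n /= mul0r expR0 mulr1 subrr.
  - by move=> y yx; rewrite mulr_ge0 ?expR_ge0 // key.
rewrite subr_ge0 mulNr expRN => h.
by rewrite -[leRHS]mul1r ler_pdivlMr ?expR_gt0 // mulrC.
Qed.

(** Cauchy's functional equation with nonnegativity in the role of continuity: it makes [f]
    monotone, and [f] is then squeezed between consecutive multiples of [f (L / n)]. *)
Lemma ge0_additive_linear (f : R -> R) (L : R) : 0 < L ->
  (forall x, 0 <= x <= L -> 0 <= f x) ->
  (forall x y, 0 <= x -> 0 <= y -> x + y <= L -> f (x + y) = f x + f y) ->
  forall x, 0 <= x <= L -> f x = x / L * f L.
Proof.
move=> L0 f0 fD.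
have mono x y : 0 <= x -> x <= y -> y <= L -> f x <= f y.
  move=> x0 xy yL; rewrite -[y](subrK x) addrC fD ?subrKC ?subr_ge0 // lerDl.
  by rewrite f0 // subr_ge0 xy /= lerBlDr (le_trans yL) // lerDl.
have f00 : f 0 = 0.
  have := fD 0 0 (lexx 0) (lexx 0); rewrite addr0 => /(_ (ltW L0)) h; lra.
have fk x n : 0 <= x -> n%:R * x <= L -> f (n%:R * x) = n%:R * f x.
  move=> x0; elim: n => [|n IH] nL; first by rewrite !mul0r.
  have nL' : n%:R * x <= L.
    by apply: le_trans nL; rewrite ler_wpM2r // ler_nat.
  by rewrite -natr1 !mulrDl !mul1r fD ?IH ?mulr_ge0 ?ler0n //; rewrite -natr1 mulrDl mul1r in nL.
move=> x /andP[x0 xL].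
have fL0 : 0 <= f L by rewrite f0 // ltW //= lexx.
have key (n : nat) : (0 < n)%N -> `|f x - x / L * f L| <= f L / n%:R.
  move=> n0; have n0' : 0 < n%:R :> R by rewrite ltr0n.
  pose h := L / n%:R.
  have h0 : 0 < h by rewrite divr_gt0.
  have nh : n%:R * h = L by rewrite /h mulrC divfK ?gt_eqF.
  have fh : f h = f L / n%:R.
    have -> : f L = n%:R * f h by rewrite -fk ?nh // ltW.
    by rewrite mulrC mulKf ?gt_eqF.
  pose k := Num.truncn (x / h).
  have /andP[k1 k2] : k%:R <= x / h < k.+1%:R by apply: truncn_itv; rewrite divr_ge0 // ltW.
  have kx : k%:R * h <= x by rewrite -ler_pdivlMr.
  have xk : x <= k.+1%:R * h by rewrite -ler_pdivrMr // ltW.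
  have fh0 : 0 <= f h by rewrite fh divr_ge0 // ltW.
  have e1 : k%:R * f h <= f x.
    by rewrite -(fk _ _ (ltW h0) (le_trans kx xL)) mono ?mulr_ge0 ?ler0n // ltW.
  have e2 : f x <= k.+1%:R * f h.
    have [le|/ltW ge] := leP (k.+1%:R * h) L.
      by rewrite -(fk _ _ (ltW h0) le) mono.
    apply: (@le_trans _ _ (f L)); first exact: mono.
    have -> : f L = n%:R * f h by rewrite -fk ?nh // ltW.
    rewrite ler_wpM2r //.
    have : n%:R * h <= k.+1%:R * h by rewrite nh.
    by rewrite ler_pM2r.
  have -> : x / L * f L = x / h * f h.
    by rewrite fh /h; field; rewrite !gt_eqF.
  rewrite -fh ler_distlC; apply/andP; split.
    have : k%:R * f h <= x / h * f h by rewrite ler_wpM2r.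
    move: e2; rewrite -natr1 mulrDl mul1r; lra.
  have : x / h * f h <= k.+1%:R * f h by rewrite ler_wpM2r // ltW.
  rewrite -natr1 mulrDl mul1r; lra.
apply/eqP; rewrite -subr_eq0 -normr_le0; apply/ler_addgt0Pr => e e0; rewrite add0r.
pose n := (Num.truncn (f L / e)).+1.
apply: (le_trans (key n isT)); rewrite ler_pdivrMr ?ltr0n // mulrC -ler_pdivrMr //.
by apply/ltW; rewrite /n truncnS_gt.
Qed.

End real_inequalities.

(** * Expectations of bounded functions *)

Section bounded_expectation.
Context d (T : measurableType d) (R : realType) (P : probability T R).

(** For a fixed degree every variable of the proof is bounded, so boundedness stands in for
    integrability throughout; bounds uniform in the degree are a separate matter. *)
Definition bmfun (f : T -> R) :=
  measurable_fun setT f /\ exists C : R, forall x, `|f x| <= C.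

Definition Ex (f : T -> R) : R := (\int[P]_x f x)%R.

Lemma bmfun_integrable f : bmfun f -> P.-integrable setT (EFin \o f).
Proof.
move=> [mf [C fC]]; apply: measurable_bounded_integrable => //.
  by apply: le_lt_trans (ltry 1); exact: (probability_le1 P measurableT).
exists C; split; first by rewrite num_real.
by move=> M CM x _; apply: (le_trans (fC x)); exact: ltW.
Qed.

Lemma bmfun_cst (a : R) : bmfun (fun=> a).
Proof. by split; [exact: measurable_cst|exists `|a|]. Qed.

Lemma bmfunD f g : bmfun f -> bmfun g -> bmfun (fun x => f x + g x).
Proof.
move=> [mf [C fC]] [mg [D gD]]; split; first exact: measurable_funD.
by exists (C + D) => x; apply: (le_trans (ler_normD _ _)); exact: lerD.
Qed.

Lemma bmfunN f : bmfun f -> bmfun (fun x => - f x).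
Proof.
move=> [mf [C fC]]; split; first exact: measurable_funN.
by exists C => x; rewrite normrN.
Qed.

Lemma bmfunB f g : bmfun f -> bmfun g -> bmfun (fun x => f x - g x).
Proof. by move=> bf bg; apply: bmfunD => //; exact: bmfunN. Qed.

Lemma bmfunM f g : bmfun f -> bmfun g -> bmfun (fun x => f x * g x).
Proof.
move=> [mf [C fC]] [mg [D gD]]; split; first exact: measurable_funM.
by exists (C * D) => x; rewrite normrM ler_pM.
Qed.

Lemma bmfun_sum (I : Type) (s : seq I) (f : I -> T -> R) :
  (forall i, bmfun (f i)) -> bmfun (fun x => \sum_(i <- s) f i x).
Proof.
move=> bf; elim: s => [|i s IH].
  rewrite (_ : (fun x => _) = fun=> 0); first exact: bmfun_cst.
  by apply/funext => x; rewrite big_nil.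
rewrite (_ : (fun x => _) = fun x => f i x + \sum_(j <- s) f j x).
  exact: bmfunD.
by apply/funext => x; rewrite big_cons.
Qed.

Lemma bmfun_prod (I : Type) (s : seq I) (f : I -> T -> R) :
  (forall i, bmfun (f i)) -> bmfun (fun x => \prod_(i <- s) f i x).
Proof.
move=> bf; elim: s => [|i s IH].
  rewrite (_ : (fun x => _) = fun=> 1); first exact: bmfun_cst.
  by apply/funext => x; rewrite big_nil.
rewrite (_ : (fun x => _) = fun x => f i x * \prod_(j <- s) f j x).
  exact: bmfunM.
by apply/funext => x; rewrite big_cons.
Qed.

Lemma bmfunX n f : bmfun f -> bmfun (fun x => f x ^+ n).
Proof.
move=> bf; elim: n => [|n IH].
  by rewrite (_ : (fun x => _) = fun=> 1); [exact: bmfun_cst|apply/funext => x; rewrite expr0].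
rewrite (_ : (fun x => _) = fun x => f x * f x ^+ n); first exact: bmfunM.
by apply/funext => x; rewrite exprS.
Qed.

Lemma bmfun_bool (b : T -> bool) : measurable_fun setT b -> bmfun (fun x => (b x)%:R).
Proof.
move=> mb; split.
  rewrite (_ : (fun x => _) = (fun x => if b x then 1 else 0)).
    by apply: measurable_fun_ifT => //; exact: measurable_cst.
  by apply/funext => x; case: (b x).
by exists 1 => x; case: (b x); rewrite ?normr1 ?normr0.
Qed.

Lemma Ex_cst (a : R) : Ex (fun=> a) = a.
Proof.
rewrite /Ex Rintegral_cst // -[RHS]mulr1; congr (a * _).
exact: (congr1 fine (probability_setT P)).
Qed.

Lemma ExD f g : bmfun f -> bmfun g -> Ex (fun x => f x + g x) = Ex f + Ex g.
Proof. by move=> bf bg; rewrite /Ex RintegralD //; exact: bmfun_integrable. Qed.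

Lemma ExB f g : bmfun f -> bmfun g -> Ex (fun x => f x - g x) = Ex f - Ex g.
Proof. by move=> bf bg; rewrite /Ex RintegralB //; exact: bmfun_integrable. Qed.

Lemma ExZ (a : R) f : bmfun f -> Ex (fun x => a * f x) = a * Ex f.
Proof. by move=> bf; rewrite /Ex RintegralZl //; exact: bmfun_integrable. Qed.

Lemma Ex_sum (I : Type) (s : seq I) (f : I -> T -> R) :
  (forall i, bmfun (f i)) -> Ex (fun x => \sum_(i <- s) f i x) = \sum_(i <- s) Ex (f i).
Proof.
move=> bf; elim: s => [|i s IH].
  rewrite big_nil -[RHS](Ex_cst 0); congr Ex; apply/funext => x; exact: big_nil.
rewrite big_cons -IH -ExD //; last exact: bmfun_sum.
by congr Ex; apply/funext => x; rewrite big_cons.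
Qed.

Lemma Ex_le f g : bmfun f -> bmfun g -> (forall x, f x <= g x) -> Ex f <= Ex g.
Proof.
move=> bf bg fg; apply: le_Rintegral => //; exact: bmfun_integrable.
Qed.

Lemma Ex_ge0 f : (forall x, 0 <= f x) -> 0 <= Ex f.
Proof. by move=> f0; apply: Rintegral_ge0. Qed.

Lemma bmfun_norm f : bmfun f -> bmfun (fun x => `|f x|).
Proof.
move=> [mf [C fC]]; split; first exact: measurableT_comp.
by exists C => x; rewrite normr_id.
Qed.

Lemma Ex_norm f : bmfun f -> `|Ex f| <= Ex (fun x => `|f x|).
Proof. by move=> bf; apply: le_normr_Rintegral => //; exact: bmfun_integrable. Qed.

Lemma EFin_Ex f : bmfun f -> (Ex f)%:E = (\int[P]_x (f x)%:E)%E.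
Proof.
move=> bf; rewrite /Ex /Rintegral fineK //; exact/integrable_fin_num/bmfun_integrable.
Qed.

Definition Pr (b : T -> bool) : R := Ex (fun x => (b x)%:R).

Lemma PrE (b : T -> bool) : measurable_fun setT b -> (Pr b)%:E = P [set x | b x].
Proof.
move=> mb; rewrite EFin_Ex; last exact: bmfun_bool.
have mb' : measurable [set x | b x].
  rewrite (_ : [set x | b x] = b @^-1` [set true]); last by apply/seteqP; split.
  exact: measurable_preimage.
rewrite -[in RHS](setIT [set x | b x]) -integral_indic //.
apply: eq_integral => x _; rewrite indicE.
suff -> : (x \in [set x | b x]) = b x by [].
by apply/idP/idP; rewrite inE.
Qed.

Lemma Pr_ge0 b : 0 <= Pr b.
Proof. by apply: Ex_ge0 => x; rewrite ler0n. Qed.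

Lemma Pr_le1 (b : T -> bool) : measurable_fun setT b -> Pr b <= 1.
Proof.
move=> mb; rewrite -[leRHS]Ex_cst; apply: Ex_le; last by move=> x; case: (b x).
  exact: bmfun_bool.
exact: bmfun_cst.
Qed.

Lemma Pr_le (b c : T -> bool) : measurable_fun setT b -> measurable_fun setT c ->
  (forall x, b x -> c x) -> Pr b <= Pr c.
Proof.
move=> mb mc bc; apply: Ex_le => [||x]; [exact: bmfun_bool|exact: bmfun_bool|].
by move: (bc x); case: (b x); case: (c x) => // /(_ isT).
Qed.

Lemma Pr_or (b c : T -> bool) : measurable_fun setT b -> measurable_fun setT c ->
  Pr (fun x => b x || c x) <= Pr b + Pr c.
Proof.
move=> mb mc; rewrite -ExD; [|exact: bmfun_bool|exact: bmfun_bool].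
apply: Ex_le => [||x].
- by apply: bmfun_bool; exact: measurable_or.
- by apply: bmfunD; exact: bmfun_bool.
- by case: (b x); case: (c x); rewrite /= ?addr0 ?add0r ?ler0n // lerDl ler01.
Qed.

(* Substitute for Hoelder's inequality: [Z <= lam] or [Z ^+ r.+1 >= Z * lam ^+ r]. *)
Lemma Ex_mul_le D Z (lam : R) r : bmfun D -> bmfun Z -> 0 < lam ->
  (forall x, 0 <= D x) -> (forall x, 0 <= Z x) ->
  Ex (fun x => D x * Z x) <= lam * Ex D + Ex (fun x => D x * Z x ^+ r.+1) / lam ^+ r.
Proof.
move=> bD bZ lam0 D0 Z0; rewrite [X in _ + X]mulrC -ExZ // -ExZ; last first.
  by apply: bmfunM => //; exact: bmfunX.
rewrite -ExD; first last.
- by apply: bmfunM; [exact: bmfun_cst|apply: bmfunM => //; exact: bmfunX].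
- by apply: bmfunM => //; exact: bmfun_cst.
apply: Ex_le => [||x]; first exact: bmfunM.
  apply: bmfunD; first by apply: bmfunM => //; exact: bmfun_cst.
  by apply: bmfunM; [exact: bmfun_cst|apply: bmfunM => //; exact: bmfunX].
have [Zl|/ltW lZ] := leP (Z x) lam.
  apply: (@le_trans _ _ (D x * lam)); first exact: ler_wpM2l.
  rewrite mulrC lerDl mulr_ge0 ?invr_ge0 ?exprn_ge0 ?(ltW lam0) //.
  by rewrite mulr_ge0 ?exprn_ge0.
apply: (@le_trans _ _ ((lam ^+ r)^-1 * (D x * Z x ^+ r.+1))); last first.
  by rewrite lerDr mulr_ge0 // ltW.
rewrite [leRHS]mulrC ler_pdivlMr ?exprn_gt0 // exprS -mulrA ler_wpM2l // ler_wpM2l //.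
by apply: lerXn2r; rewrite ?nnegrE // ltW.
Qed.

Lemma Ex_eq_ae f g (b : T -> bool) : bmfun f -> bmfun g -> measurable_fun setT b ->
  Pr b = 0 -> (forall x, ~~ b x -> f x = g x) -> Ex f = Ex g.
Proof.
move=> bf bg mb b0 fg; apply/eqP; rewrite -subr_eq0 -normr_le0 -ExB //.
have bfg := bmfunB bf bg.
have [_ [C fC]] := bfg.
apply: le_trans (Ex_norm bfg) _.
have <- : C * Pr b = 0 by rewrite b0 mulr0.
rewrite -ExZ; last exact: bmfun_bool.
apply: Ex_le => [||x]; first exact: bmfun_norm.
  by apply: bmfunM; [exact: bmfun_cst|exact: bmfun_bool].
have [bx|/fg ->] := boolP (b x); first by rewrite mulr1.
by rewrite subrr normr0 mulr0.
Qed.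

End bounded_expectation.

Section gaussian_expectation.
Variable R : realType.

Lemma Ex_law m d (T : measurableType d) (P : probability T R) (X : T -> m.-tuple R) f :
  std_gaussian P X -> bmfun f -> Ex P (f \o X) = Ex (gauss R m) f.
Proof.
move=> PX bf; have mX := PX.1.
have bfX : bmfun (f \o X).
  have [mf [C fC]] := bf; split; first exact: measurableT_comp.
  by exists C => x; exact: fC.
apply: EFin_inj; rewrite !EFin_Ex //.
have := @integral_distribution _ _ _ _ _ P (mkRV P mX) (EFin \o f).
move=> <-; last 2 first.
- by apply/measurable_EFinP; exact: bf.1.
- exact: (bmfun_integrable P bfX).
apply: eq_measure_integral => A mA _; exact: (gauss_law PX mA).
Qed.

Lemma bmfun_comp d (T : measurableType d) d' (T' : measurableType d') (X : T -> T') (f : T' -> R) :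
  measurable_fun setT X -> bmfun f -> bmfun (fun x => f (X x)).
Proof.
move=> mX [mf [C fC]]; split; first exact: (measurableT_comp mf mX).
by exists C => x; exact: fC.
Qed.

Lemma Ex_lact k m (W : 'M[R]_(k, m)) f : W *m W^T = 1%:M -> bmfun f ->
  Ex (gauss R m) (fun c => f (lact W c)) = Ex (gauss R k) f.
Proof. by move=> WW bf; apply: (Ex_law (gauss_stable_orthonormal WW)). Qed.

Lemma Ex_prodP d1 (T1 : measurableType d1) d2 (T2 : measurableType d2)
    (P1 : probability T1 R) (P2 : probability T2 R) (f : T1 -> R) (g : T2 -> R) :
  bmfun f -> bmfun g -> Ex (prodP P1 P2) (fun z => f z.1 * g z.2) = Ex P1 f * Ex P2 g.
Proof.
move=> bf bg.
have bfg : bmfun (fun z : T1 * T2 => f z.1 * g z.2).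
  by apply: bmfunM; apply: bmfun_comp.
have ifg : (P1 \x P2)%E.-integrable setT (EFin \o (fun z : T1 * T2 => f z.1 * g z.2)).
  by apply: bmfun_integrable.
apply: EFin_inj; rewrite EFin_Ex //.
have -> : (\int[prodP P1 P2]_x (f x.1 * g x.2)%:E =
    \int[(P1 \x P2)%E]_x (f x.1 * g x.2)%:E)%E.
  by apply: eq_measure_integral => A mA _; exact: prodP_prod.
rewrite -[LHS](integral12_prod_meas1 ifg) /fubini_F /=.
transitivity (\int[P1]_x ((f x)%:E * (Ex P2 g)%:E))%E.
  apply: eq_integral => x _; under eq_integral do rewrite EFinM.
  rewrite integralZl //; last exact: (bmfun_integrable P2 bg).
  by rewrite EFin_Ex.
rewrite integralZr //; last exact: (bmfun_integrable P1 bf).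
by rewrite -EFin_Ex // EFinM.
Qed.

Definition low (m j0 : nat) (c : m.-tuple R) : m.-tuple R :=
  [tuple if (i < j0)%N then tnth c i else 0 | i < m].
Definition high (m j0 : nat) (c : m.-tuple R) : m.-tuple R :=
  [tuple if (i < j0)%N then 0 else tnth c i | i < m].

Lemma measurable_low m j0 : measurable_fun setT (@low m j0).
Proof.
apply/measurable_fun_tnthP => i; rewrite (_ : _ \o _ =
  fun c : m.-tuple R => if (i < j0)%N then tnth c i else 0); last first.
  by apply/funext => c /=; rewrite tnth_mktuple.
by case: (i < j0)%N; [exact: measurable_tnth|exact: measurable_cst].
Qed.

Lemma measurable_high m j0 : measurable_fun setT (@high m j0).
Proof.
apply/measurable_fun_tnthP => i; rewrite (_ : _ \o _ =
  fun c : m.-tuple R => if (i < j0)%N then 0 else tnth c i); last first.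
  by apply/funext => c /=; rewrite tnth_mktuple.
by case: (i < j0)%N; [exact: measurable_cst|exact: measurable_tnth].
Qed.

(* Two independent copies, the first one read below [j0] and the second one above. *)
Lemma Ex_low_high m j0 (f g : m.-tuple R -> R) : bmfun f -> bmfun g ->
  Ex (gauss R m) (fun c => f (low j0 c) * g (high j0 c)) =
  Ex (gauss R m) (fun c => f (low j0 c)) * Ex (gauss R m) (fun c => g (high j0 c)).
Proof.
move=> bf bg.
pose mix (z : m.-tuple R * m.-tuple R) : m.-tuple R :=
  [tuple if (i < j0)%N then tnth z.1 i else tnth z.2 i | i < m].
have mmix : measurable_fun setT mix.
  apply/measurable_fun_tnthP => i; rewrite (_ : _ \o _ =
    fun z => if (i < j0)%N then tnth z.1 i else tnth z.2 i); last first.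
    by apply/funext => c /=; rewrite tnth_mktuple.
  by case: (i < j0)%N; [exact: (measurableT_comp (measurable_tnth i) measurable_fst)|
                      exact: (measurableT_comp (measurable_tnth i) measurable_snd)].
have smix : std_gaussian (prodP (gauss R m) (gauss R m)) mix.
  split=> // B mB; have [_ h] := gaussP R m.
  have mB1 (i : 'I_m) : measurable (if (i < j0)%N then B i else setT) by case: ifP.
  have mB2 (i : 'I_m) : measurable (if (i < j0)%N then setT else B i) by case: ifP.
  have -> : mix @^-1` box B =
      box (fun i : 'I_m => if (i < j0)%N then B i else setT) `*`
      box (fun i : 'I_m => if (i < j0)%N then setT else B i).
    apply/seteqP; split => -[x y] /=.
      move=> hB; split => i /=; have := hB i; rewrite tnth_mktuple;
      by case: ifP.
    move=> [hx hy] i; have := hx i; have := hy i; rewrite tnth_mktuple /=.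
    by case: ifP.
  rewrite (@prodPE _ _ _ _ R (gauss R m) (gauss R m) _ _ (measurable_box mB1) (measurable_box mB2)).
  rewrite [X in (X * _)%E]h // [X in (_ * X)%E]h // -big_split /=.
  apply: eq_bigr => i _; case: ifP => _; rewrite probability_setT ?mule1 ?mul1e //.
have blo : bmfun (fun c => f (low j0 c)) by apply: bmfun_comp => //; exact: measurable_low.
have bhi : bmfun (fun c => g (high j0 c)) by apply: bmfun_comp => //; exact: measurable_high.
rewrite -(Ex_law smix); last exact: bmfunM.
rewrite -Ex_prodP //; congr Ex; apply/funext => -[x y] /=.
by congr (f _ * g _); apply: eq_from_tnth => i; rewrite !tnth_mktuple; case: ifP => // ->.
Qed.

End gaussian_expectation.

(** * Sign changes of Gaussian linear forms *)

Section sign_changes.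
Variable R : realType.

Definition dot (m : nat) (u : 'I_m -> R) (c : m.-tuple R) : R :=
  \sum_(j < m) u j * tnth c j.

Definition opposite (m : nat) (u v : 'I_m -> R) (c : m.-tuple R) : bool :=
  dot u c * dot v c < 0.

Lemma measurable_opposite m (u v : 'I_m -> R) : measurable_fun setT (opposite u v).
Proof.
apply: measurable_fun_ltr; last exact: measurable_cst.
by apply: measurable_funM; exact: measurable_dot.
Qed.

Lemma dotD m (u v : 'I_m -> R) c : dot (fun j => u j + v j) c = dot u c + dot v c.
Proof. by rewrite /dot -big_split; apply: eq_bigr => j _; rewrite mulrDl. Qed.

Lemma dotZ m a (u : 'I_m -> R) c : dot (fun j => a * u j) c = a * dot u c.
Proof. by rewrite /dot mulr_sumr; apply: eq_bigr => j _; rewrite mulrA. Qed.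

Lemma normal01_set1 (a : R) : normal01 R [set a] = 0%E.
Proof.
rewrite normal01E.
have /null_content_dominatesP h := @normal_prob_dominates R 0 1.
by apply: h; [exact: measurable_set1|exact: lebesgue_measure_set1].
Qed.

Lemma Pr_tnth_eq m (i : 'I_m) (a : R) :
  Pr (gauss R m) (fun c => tnth c i == a) = 0.
Proof.
apply: EFin_inj; rewrite PrE; last first.
  apply: measurable_fun_eqr; [exact: measurable_tnth|exact: measurable_cst].
have [_ h] := gaussP R m.
rewrite (_ : [set c | _] = box (fun j : 'I_m => if j == i then [set a] else setT)).
  rewrite [LHS]h.
    by rewrite (bigD1 i) //= eqxx normal01_set1 mul0e.
  by move=> j; case: ifP.
apply/seteqP; split => c /=.
  by move/eqP => ca j; case: eqP => // ->.
by move/(_ i); rewrite eqxx => ->.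
Qed.

Lemma Pr_dot_eq0 m (u : 'I_m -> R) : \sum_j u j ^+ 2 = 1 ->
  Pr (gauss R m) (fun c => dot u c == 0) = 0.
Proof.
move=> u1; pose W : 'M[R]_(1, m) := \matrix_(i, j) u j.
have WW : W *m W^T = 1%:M.
  apply/matrixP => i j; rewrite [i]ord1 [j]ord1 !mxE eqxx -[RHS]u1.
  by apply: eq_bigr => a _; rewrite !mxE expr2.
rewrite -[RHS](@Pr_tnth_eq 1 ord0 0) /Pr -[RHS](Ex_lact WW).
  congr Ex; apply/funext => c; rewrite tnth_lact; congr ((_ == _)%:R).
  by apply: eq_bigr => j _; rewrite mxE.
apply: bmfun_bool.
apply: measurable_fun_eqr; [exact: measurable_tnth|exact: measurable_cst].
Qed.

Definition plane (a : R) (i : 'I_2) : R := if i == ord0 then cos a else sin a.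

Lemma dot_plane a (c : 2.-tuple R) :
  dot (plane a) c = cos a * tnth c ord0 + sin a * tnth c ord_max.
Proof.
by rewrite /dot 2!big_ord_recl big_ord0 addr0; congr (_ + _ * tnth c _); apply/val_inj.
Qed.

Lemma plane_norm a : \sum_j plane a j ^+ 2 = 1.
Proof. by rewrite 2!big_ord_recl big_ord0 addr0 /plane /= cos2Dsin2. Qed.

Definition angle_prob (a : R) := Pr (gauss R 2) (opposite (plane 0) (plane a)).

(** The unit vectors at angles [a] and [a + pi / 2] form an orthonormal frame, in which the pair
    becomes the one at angles 0 and [b]. *)
Lemma angle_prob_rot a b :
  Pr (gauss R 2) (opposite (plane a) (plane (a + b))) = angle_prob b.
Proof.
pose W : 'M[R]_2 := \matrix_(i, j)
  if i == ord0 then plane a j else plane (a + pi / 2) j.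
have WW : W *m W^T = 1%:M.
  apply/matrixP => i j; rewrite !mxE 2!big_ord_recl big_ord0 addr0 !mxE /plane /=.
  rewrite cosDpihalf sinDpihalf.
  have := cos2Dsin2 a.
  case: (unliftP ord0 i) => [i'|] ->; case: (unliftP ord0 j) => [j'|] -> /= cs.
  - have -> : i' = j' by rewrite [LHS]ord1 [RHS]ord1.
    by transitivity (cos a ^+ 2 + sin a ^+ 2); [ring|rewrite cs eqxx].
  - by ring.
  - by ring.
  - by transitivity (cos a ^+ 2 + sin a ^+ 2); [ring|rewrite cs].
rewrite /angle_prob /Pr -[RHS](Ex_lact WW); last first.
  by apply: bmfun_bool; exact: measurable_opposite.
congr Ex; apply/funext => c; rewrite /opposite !dot_plane !tnth_lact.
rewrite !big_ord_recl !big_ord0 !addr0 !mxE /plane /= cosDpihalf sinDpihalf cos0 sin0.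
rewrite cosD sinD.
have -> : tnth c (lift ord0 ord0) = tnth c ord_max by congr (tnth c _); apply/val_inj.
set x := tnth c ord0; set y := tnth c ord_max.
by congr (nat_of_bool (_ < 0))%:R; ring.
Qed.

Lemma angle_prob_ge0 a : 0 <= angle_prob a. Proof. exact: Pr_ge0. Qed.

Lemma angle_prob0 : angle_prob 0 = 0.
Proof.
rewrite /angle_prob /Pr -[RHS](Ex_cst (gauss R 2) 0); congr Ex; apply/funext => c.
by rewrite /opposite -expr2 ltNge sqr_ge0.
Qed.

Lemma measurable_dot_eq0 m (u : 'I_m -> R) : measurable_fun setT (fun c => dot u c == 0).
Proof. by apply: measurable_fun_eqr; [exact: measurable_dot|exact: measurable_cst]. Qed.

Lemma angle_prob_pi : angle_prob pi = 1.
Proof.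
apply/eqP; rewrite eq_le Pr_le1 /=; last exact: measurable_opposite.
rewrite -[leLHS]subr0 -(Pr_dot_eq0 (plane_norm 0)) lerBlDr.
rewrite -[leLHS](Ex_cst (gauss R 2) 1).
apply: le_trans (Pr_or _ (measurable_opposite _ _) (measurable_dot_eq0 _)).
apply: Ex_le => [||c]; first exact: bmfun_cst.
  apply: bmfun_bool; apply: measurable_or; first exact: measurable_opposite.
  exact: measurable_dot_eq0.
have -> : opposite (plane 0) (plane pi) c = (dot (plane 0) c != 0).
  rewrite /opposite !dot_plane cospi sinpi cos0 sin0 !mul0r !addr0 mul1r mulN1r.
  by rewrite mulrN oppr_lt0 lt_def sqr_ge0 andbT -expr2 sqrf_eq0.
by rewrite orNb.
Qed.

(** Since [u * B] is a positive combination of [A] and [C], the sign of [B] cannot differ from a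
    common sign of [A] and [C]. So the two partial sign changes never both occur. *)
Lemma opposite_chain (A B C s t u : R) : 0 < s -> 0 < t -> 0 <= u ->
  u * B = t * A + s * C -> A != 0 -> B != 0 -> C != 0 ->
  (A * C < 0)%R = (A * B < 0)%R || (B * C < 0)%R /\ ~~ ((A * B < 0)%R && (B * C < 0)%R).
Proof.
move=> s0 t0 u0 e A0 B0 C0.
have [a|a|/eqP] := ltgtP A 0; last by rewrite (negbTE A0).
all: have [b|b|/eqP] := ltgtP B 0; last by rewrite (negbTE B0).
all: have [c|c|/eqP] := ltgtP C 0; last by rewrite (negbTE C0).
all: rewrite ?(nmulr_rlt0 _ a) ?(pmulr_rlt0 _ a) ?(nmulr_rlt0 _ b) ?(pmulr_rlt0 _ b).
all: rewrite ?a ?b ?c ?(lt_gtF a) ?(lt_gtF b) ?(lt_gtF c) //=.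
- have : t * A + s * C < 0.
    by rewrite -[ltRHS]addr0 ltrD // pmulr_rlt0.
  by rewrite -e ltNge mulr_ge0 // ltW.
- have : 0 < t * A + s * C by rewrite addr_gt0 // mulr_gt0.
  by rewrite -e ltNge mulr_ge0_le0 // ltW.
Qed.

(** As the angles sum to at most [pi], the middle vector times [sin (a + b)] is a combination of the
    outer ones with positive weights [sin b] and [sin a]; [opposite_chain] applies off the null
    event that some form vanishes. *)
Lemma angle_prob_add a b : 0 <= a -> 0 <= b -> a + b <= pi ->
  angle_prob (a + b) = angle_prob a + angle_prob b.
Proof.
move=> a0 b0 abpi.
have [->|an0] := eqVneq a 0; first by rewrite add0r angle_prob0 add0r.
have [->|bn0] := eqVneq b 0; first by rewrite addr0 angle_prob0 addr0.
have {an0}a0' : 0 < a by rewrite lt_def an0.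
have {bn0}b0' : 0 < b by rewrite lt_def bn0.
rewrite -(angle_prob_rot a b) /angle_prob /Pr -ExD; last 2 first.
- by apply: bmfun_bool; exact: measurable_opposite.
- by apply: bmfun_bool; exact: measurable_opposite.
pose z c := (dot (plane 0) c == 0) || ((dot (plane a) c == 0) || (dot (plane (a + b)) c == 0)).
have mz : measurable_fun setT z.
  by apply: measurable_or; last apply: measurable_or; exact: measurable_dot_eq0.
have z0 : Pr (gauss R 2) z = 0.
  apply/eqP; rewrite eq_le Pr_ge0 andbT.
  apply: le_trans (Pr_or _ (measurable_dot_eq0 _) _) _.
    by apply: measurable_or; exact: measurable_dot_eq0.
  rewrite (Pr_dot_eq0 (plane_norm 0)) add0r.
  apply: le_trans (Pr_or _ (measurable_dot_eq0 _) (measurable_dot_eq0 _)) _.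
  by rewrite !(Pr_dot_eq0 (plane_norm _)) addr0.
apply: (Ex_eq_ae _ _ mz z0) => [||c].
- by apply: bmfun_bool; exact: measurable_opposite.
- by apply: bmfunD; apply: bmfun_bool; exact: measurable_opposite.
rewrite !negb_or => /and3P[A0 B0 C0].
have s0 : 0 < sin a by apply: sin_gt0_pi; rewrite a0' /=; apply: lt_le_trans abpi; rewrite ltrDl.
have t0 : 0 < sin b by apply: sin_gt0_pi; rewrite b0' /=; apply: lt_le_trans abpi; rewrite ltrDr.
have u0 : 0 <= sin (a + b) by apply: sin_ge0_pi; rewrite abpi addr_ge0.
have e : sin (a + b) * dot (plane a) c =
    sin b * dot (plane 0) c + sin a * dot (plane (a + b)) c.
  rewrite !dot_plane cos0 sin0 cosD sinD.
  have := cos2Dsin2 a; have := cos2Dsin2 b => cb ca.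
  have {}ca : sin a ^+ 2 = 1 - cos a ^+ 2 by rewrite -ca; ring.
  rewrite -[RHS]addr0 -(subrr (sin b * tnth c ord0 * sin a ^+ 2)).
  by rewrite [in X in _ + (_ - X)]ca; ring.
rewrite /opposite.
have [-> ] := opposite_chain s0 t0 u0 e A0 B0 C0.
by case: (_ < 0); case: (_ < 0) => //= _; rewrite ?addr0 ?add0r.
Qed.

Lemma angle_probE a : 0 <= a <= pi -> angle_prob a = a / pi.
Proof.
move=> api; rewrite (ge0_additive_linear (f := angle_prob) (pi_gt0 R)) //.
- by rewrite angle_prob_pi mulr1.
- by move=> x _; exact: angle_prob_ge0.
- exact: angle_prob_add.
Qed.

(** Gram-Schmidt reduces the sign law to the plane: [v = cos a * u + sin a * w] with [u] and [w]
    orthonormal. The division by [sin a] excludes [a = 0], where [v = u] is forced. *)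
Lemma Pr_oppositeE m (u v : 'I_m -> R) a : \sum_j u j ^+ 2 = 1 -> \sum_j v j ^+ 2 = 1 ->
  \sum_j u j * v j = cos a -> 0 <= a -> a < pi ->
  Pr (gauss R m) (opposite u v) = a / pi.
Proof.
move=> u1 v1 uv a0 api; rewrite -angle_probE ?a0 ?ltW //.
have [a_0|an0] := eqVneq a 0.
  rewrite a_0 angle_prob0 /Pr -[RHS](Ex_cst (gauss R m) 0); congr Ex; apply/funext => c.
  suff -> : v = u by rewrite /opposite -expr2 ltNge sqr_ge0.
  apply/funext => j; apply/eqP; rewrite eq_sym -subr_eq0 -sqrf_eq0; apply/eqP.
  have : \sum_j (u j - v j) ^+ 2 = 0.
    transitivity (\sum_j u j ^+ 2 + \sum_j v j ^+ 2 - 2 * \sum_j u j * v j).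
      rewrite mulr_sumr -big_split -sumrB /=; apply: eq_bigr => i _; ring.
    by rewrite u1 v1 uv a_0 cos0; ring.
  by move/eqP; rewrite psumr_eq0 => [/allP/(_ j (mem_index_enum j))/eqP|i _]; rewrite ?sqr_ge0.
have s0 : sin a != 0 by rewrite gt_eqF // sin_gt0_pi // api lt_def an0 a0.
pose w j := (v j - cos a * u j) / sin a.
have vw j : v j = cos a * u j + sin a * w j by rewrite /w; field.
pose W : 'M[R]_(2, m) := \matrix_(i, j) if i == ord0 then u j else w j.
have uw : \sum_j u j * w j = 0.
  transitivity ((\sum_j u j * v j - cos a * \sum_j u j ^+ 2) / sin a).
    rewrite mulr_sumr -sumrB mulr_suml; apply: eq_bigr => j _; rewrite /w; ring.
  by rewrite uv u1 mulr1 subrr mul0r.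
have w1 : \sum_j w j ^+ 2 = 1.
  have : sin a ^+ 2 * \sum_j w j ^+ 2 = sin a ^+ 2 * 1.
    transitivity (\sum_j v j ^+ 2 - 2 * cos a * (\sum_j u j * v j) + cos a ^+ 2 * \sum_j u j ^+ 2).
      rewrite !mulr_sumr -sumrB -big_split /=; apply: eq_bigr => j _.
      by rewrite /w; field.
    by rewrite v1 uv u1 sin2cos2; ring.
  by apply: mulfI; rewrite expf_neq0.
have WW : W *m W^T = 1%:M.
  apply/matrixP => i j; rewrite !mxE.
  under eq_bigr do rewrite !mxE.
  case: (unliftP ord0 i) => [i'|] ->; case: (unliftP ord0 j) => [j'|] -> /=.
  - have -> : i' = j' by rewrite [LHS]ord1 [RHS]ord1.
    by rewrite eqxx -[RHS]w1; apply: eq_bigr => l _; rewrite expr2.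
  - by rewrite -[RHS]uw; apply: eq_bigr => l _; rewrite mulrC.
  - by rewrite -[RHS]uw.
  - by rewrite -[RHS]u1; apply: eq_bigr => l _; rewrite expr2.
rewrite /angle_prob /Pr -[RHS](Ex_lact WW); last first.
  by apply: bmfun_bool; exact: measurable_opposite.
congr Ex; apply/funext => c.
have Wu : tnth (lact W c) ord0 = dot u c.
  by rewrite tnth_lact; apply: eq_bigr => j _; rewrite mxE.
have Ww : tnth (lact W c) ord_max = dot w c.
  by rewrite tnth_lact; apply: eq_bigr => j _; rewrite mxE.
rewrite /opposite !dot_plane Wu Ww cos0 sin0 mul1r mul0r addr0.
suff -> : dot v c = cos a * dot u c + sin a * dot w c by [].
by rewrite -!dotZ -dotD; congr dot; apply/funext => j; rewrite vw.
Qed.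

(** The cubic lower bound on [sin] leaves enough slack with [pi >= 2] as long as [a <= 3 / 2];
    beyond that, [a <= pi / 2] itself yields [pi >= 3]. *)
Lemma angle_le_sin (a : R) : 0 <= a -> a <= pi / 2 -> a / pi <= sin a.
Proof.
move=> a0 api; have p2 := pi_ge2 R.
have a2 : a <= 2 by apply: le_trans api _; exact: ltW (pihalf_lt2 R).
apply: le_trans (sin_ge_cubic a0).
rewrite ler_pdivrMr ?pi_gt0 //.
have h : 0 <= a * (4 - a ^+ 2).
  by rewrite mulr_ge0 // subr_ge0; nra.
have [a1|a1] := leP a (3 / 2).
  have : 0 <= a * (9 / 4 - a ^+ 2) by rewrite mulr_ge0 // subr_ge0; nra.
  have : 0 <= a - a ^+ 3 / 6 by nra.
  nra.
have pi3 : 3 <= pi :> R by lra.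
have : 0 <= a - a ^+ 3 / 6 by nra.
nra.
Qed.

(** The probability is angle over [pi], at most the sine of the angle, and [|u|] times this sine is
    the distance from [u] to the line of [v], hence at most [|u - v|]. For a nonpositive scalar
    product, [|u| <= |u - v|] suffices. *)
Lemma Pr_opposite_le m (u v : 'I_m -> R) : 0 < \sum_j u j ^+ 2 ->
  Pr (gauss R m) (opposite u v) ^+ 2 * \sum_j u j ^+ 2 <= \sum_j (u j - v j) ^+ 2.
Proof.
move=> u0; set U := \sum_j u j ^+ 2 in u0 *; pose V := \sum_j v j ^+ 2.
pose S := \sum_j u j * v j; have p01 := Pr_ge0 (gauss R m) (opposite u v).
have p1 : Pr (gauss R m) (opposite u v) <= 1 by apply: Pr_le1; exact: measurable_opposite.
have -> : \sum_j (u j - v j) ^+ 2 = U + V - 2 * S.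
  by rewrite mulr_sumr -big_split -sumrB /=; apply: eq_bigr => i _; ring.
have V0 : 0 <= V by apply: sumr_ge0 => j _; exact: sqr_ge0.
have CS (t : R) : 0 <= U * t ^+ 2 - 2 * S * t + V.
  have -> : U * t ^+ 2 - 2 * S * t + V = \sum_j (t * u j - v j) ^+ 2.
    rewrite mulrAC !mulr_sumr !mulr_suml -sumrB -big_split /=.
    by apply: eq_bigr => i _; ring.
  by apply: sumr_ge0 => j _; exact: sqr_ge0.
have [S0|S0] := leP S 0.
  have : Pr (gauss R m) (opposite u v) ^+ 2 * U <= U.
    by rewrite ler_piMl ?exprn_ile1 // ltW.
  lra.
have SS : S ^+ 2 <= U * V.
  have := CS (S / U); set t := S / U.
  have St : S = U * t by rewrite /t mulrC divfK // gt_eqF.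
  rewrite St; nra.
have V0' : 0 < V by nra.
pose ru := Num.sqrt U; pose rv := Num.sqrt V.
have ru0 : 0 < ru by rewrite sqrtr_gt0.
have rv0 : 0 < rv by rewrite sqrtr_gt0.
have ruE : ru ^+ 2 = U by rewrite sqr_sqrtr // ltW.
have rvE : rv ^+ 2 = V by rewrite sqr_sqrtr // ltW.
pose q := S / (ru * rv).
have q0 : 0 < q by rewrite divr_gt0 // mulr_gt0.
have qE : S = q * ru * rv by rewrite /q -mulrA divfK // mulf_neq0 ?gt_eqF.
have q1 : q <= 1.
  rewrite /q ler_pdivrMr ?mulr_gt0 // mul1r.
  have r0 : 0 <= ru * rv by rewrite mulr_ge0 // ltW.
  by rewrite -(ler_pXn2r (n := 2)) ?nnegrE ?(ltW S0) // exprMn ruE rvE.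
have qI : -1 <= q <= 1 by rewrite q1 andbT; lra.
pose a := acos q.
have ca : cos a = q by rewrite acosK // in_itv.
have a0 : 0 <= a by exact: acos_ge0.
have api : a <= pi / 2.
  rewrite leNgt; apply/negP => h.
  have : cos a <= cos (pi / 2).
    rewrite leNgt ltr_cos ?in_itv /= ?a0 ?acos_lepi //; first by rewrite -leNgt ltW.
    rewrite divr_ge0 ?pi_ge0 //= ler_pdivrMr // mulr_natr mulr2n lerDl pi_ge0 //.
  by rewrite cos_pihalf ca leNgt q0.
have ltpi : a < pi.
  apply: le_lt_trans api _; rewrite ltr_pdivrMr // mulr_natr mulr2n ltrDl; exact: pi_gt0.
pose u' j := ru^-1 * u j; pose v' j := rv^-1 * v j.
have oE : opposite u v = opposite u' v'.
  apply/funext => c; rewrite /opposite /u' /v' !dotZ mulrACA.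
  have r0 : 0 < ru^-1 * rv^-1 by rewrite mulr_gt0 // invr_gt0.
  by rewrite (pmulr_rlt0 _ r0).
have pE : Pr (gauss R m) (opposite u v) = a / pi.
  rewrite oE; apply: Pr_oppositeE => //.
  - rewrite -[RHS](@divff _ U) ?gt_eqF // mulr_suml; apply: eq_bigr => j _.
    by rewrite /u' exprMn exprVn ruE mulrC.
  - rewrite -[RHS](@divff _ V) ?gt_eqF // mulr_suml; apply: eq_bigr => j _.
    by rewrite /v' exprMn exprVn rvE mulrC.
  - rewrite ca /q mulr_suml; apply: eq_bigr => j _.
    by rewrite /u' /v' invfM; ring.
have := angle_le_sin a0 api; rewrite -pE => ps.
have : Pr (gauss R m) (opposite u v) ^+ 2 <= 1 - q ^+ 2.
  rewrite -ca -sin2cos2; apply: lerXn2r; rewrite ?nnegrE //.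
  exact: le_trans ps.
rewrite -ruE -rvE qE => h.
have : Pr (gauss R m) (opposite u v) ^+ 2 * ru ^+ 2 <= (1 - q ^+ 2) * ru ^+ 2.
  by rewrite ler_wpM2r // sqr_ge0.
move/le_trans; apply.
have : 0 <= (rv - q * ru) ^+ 2 by exact: sqr_ge0.
nra.
Qed.

End sign_changes.

(** * The homogenized elliptic process *)

Section elliptic_process.
Variable R : realType.
Implicit Types (n : nat) (x y a : R).

(* The coordinates of the elliptic polynomial at [x = tan a], multiplied by [cos a ^+ n]. *)
Definition vv n a (j : 'I_n.+1) : R :=
  Num.sqrt ('C(n, j)%:R) * cos a ^+ (n - j) * sin a ^+ j.

Definition FF n (c : n.+1.-tuple R) a : R := dot (vv a) c.

(** The binomial theorem for [cos a * cos b + sin a * sin b]. *)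
Lemma vv_gram n a b : \sum_(j < n.+1) vv a j * vv b j = cos (a - b) ^+ n.
Proof.
rewrite cosB exprDn; apply: eq_bigr => j _; rewrite /vv.
rewrite -[RHS]mulr_natl; set q := Num.sqrt _.
have -> : 'C(n, j)%:R = q * q by rewrite -expr2 sqr_sqrtr ?ler0n.
by rewrite !exprMn; ring.
Qed.

Lemma vv_norm n a : \sum_(j < n.+1) vv a j ^+ 2 = 1.
Proof.
have := vv_gram n a a; rewrite subrr cos0 expr1n => <-.
by apply: eq_bigr => j _; rewrite expr2.
Qed.

(** The angles [atan i] have distinct tangents [i], which makes [vv_mx n 0] a Vandermonde matrix up
    to diagonal factors. *)
Definition vv_mx n a : 'M[R]_n.+1 := \matrix_(i, j) vv (atan i%:R + a) j.

Lemma vv_mx_gram n a : vv_mx n a *m (vv_mx n a)^T = vv_mx n 0 *m (vv_mx n 0)^T.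
Proof.
apply/matrixP => i j; rewrite !mxE.
under eq_bigr do rewrite !mxE.
under [RHS]eq_bigr do rewrite !mxE.
by rewrite !vv_gram; congr (cos _ ^+ _); ring.
Qed.

Lemma vv_mx_unit n : vv_mx n 0 \in unitmx.
Proof.
have c0 (i : 'I_n.+1) : cos (atan i%:R) != 0 :> R.
  by rewrite gt_eqF // cos_gt0_pihalf // atan_gtNpi2 atan_ltpi2.
pose d1 : 'rV[R]_n.+1 := \row_i cos (atan i%:R) ^+ n.
pose d2 : 'rV[R]_n.+1 := \row_j Num.sqrt ('C(n, j)%:R).
pose V := Vandermonde n.+1 (\row_(i < n.+1) i%:R : 'rV[R]_n.+1).
have -> : vv_mx n 0 = diag_mx d1 *m V^T *m diag_mx d2.
  rewrite mul_mx_diag mul_diag_mx; apply/matrixP => i j; rewrite !mxE addr0 /vv.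
  have -> : sin (atan i%:R) = i%:R * cos (atan i%:R) :> R.
    by have := atanK (i%:R : R); rewrite /tan => {2}<-; rewrite divfK.
  have jn : (j <= n)%N by rewrite -ltnS.
  rewrite exprMn.
  have -> : cos (atan i%:R) ^+ n = cos (atan i%:R) ^+ (n - j) * cos (atan i%:R) ^+ j :> R.
    by rewrite -exprD subnK.
  by ring.
rewrite !unitmx_mul unitmx_tr !unitmxE !det_diag det_Vandermonde !unitfE.
apply/andP; split; first apply/andP; [split|].
- by rewrite prodf_seq_neq0; apply/allP => i _; rewrite mxE expf_neq0.
- rewrite prodf_seq_neq0; apply/allP => i _ /=.
  rewrite prodf_seq_neq0; apply/allP => j _; apply/implyP => ij.
  by rewrite !mxE subr_eq0 eqr_nat gtn_eqF.
- rewrite prodf_seq_neq0; apply/allP => j _; rewrite mxE /=.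
  by rewrite gt_eqF // sqrtr_gt0 ltr0n bin_gt0 -ltnS.
Qed.

(** Two bases with equal Gram matrices differ by an orthogonal map. This one realizes the shift by
    [a] on the coefficients, so that stationarity holds outcome by outcome and not merely in law. *)
Definition vv_rot n a : 'M[R]_n.+1 := invmx (vv_mx n 0) *m vv_mx n a.

Lemma vv_rot_unitary n a : vv_rot n a *m (vv_rot n a)^T = 1%:M.
Proof.
rewrite /vv_rot trmx_mul trmx_inv !mulmxA -[_ *m vv_mx n a *m _]mulmxA vv_mx_gram.
by rewrite mulmxA mulVmx ?vv_mx_unit // mul1mx mulmxV // unitmx_tr vv_mx_unit.
Qed.

(** Both sides have the same scalar products with the basis formed by the rows of [vv_mx n a],
    because these depend on differences of angles only. *)
Lemma vv_rotE n a b : (\row_j vv b j) *m vv_rot n a = \row_j vv (b + a) j.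
Proof.
have au : vv_mx n a \in unitmx.
  have : vv_rot n a \in unitmx by have /mulmx1_unit[] := vv_rot_unitary n a.
  by rewrite /vv_rot unitmx_mul => /andP[].
have atu : (vv_mx n a)^T \in unitmx by rewrite unitmx_tr.
apply: (can_inj (mulmxK atu)).
have -> : (vv_mx n a)^T = (vv_rot n a)^T *m (vv_mx n 0)^T.
  by rewrite -trmx_mul /vv_rot mulmxA mulmxV ?vv_mx_unit // mul1mx.
rewrite mulmxA -[_ *m vv_rot n a *m _]mulmxA vv_rot_unitary mulmx1.
have -> : (vv_rot n a)^T *m (vv_mx n 0)^T = (vv_mx n a)^T.
  by rewrite -trmx_mul /vv_rot mulmxA mulmxV ?vv_mx_unit // mul1mx.
apply/rowP => j; rewrite !mxE.
under eq_bigr do rewrite !mxE.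
under [RHS]eq_bigr do rewrite !mxE.
by rewrite !vv_gram; congr (cos _ ^+ _); ring.
Qed.

Lemma FF_rot n a b (c : n.+1.-tuple R) : FF c (b + a) = FF (lact (vv_rot n a) c) b.
Proof.
rewrite /FF /dot.
under [RHS]eq_bigr do rewrite tnth_lact mulr_sumr.
rewrite exchange_big /=; apply: eq_bigr => j _.
have /rowP/(_ j) := vv_rotE n a b; rewrite !mxE => <-.
by rewrite mulr_suml; apply: eq_bigr => i _; rewrite mxE mulrA.
Qed.

Lemma FF_periodic n (c : n.+1.-tuple R) a : FF c (a + pi) = (-1) ^+ n * FF c a.
Proof.
rewrite /FF /dot mulr_sumr; apply: eq_bigr => j _; rewrite /vv cosDpi sinDpi.
have jn : (j <= n)%N by rewrite -ltnS.
rewrite (exprNn (cos a)) (exprNn (sin a)).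
have -> : (-1) ^+ n = (-1) ^+ (n - j) * (-1) ^+ j :> R by rewrite -exprD subnK.
by ring.
Qed.

Definition ppoly n (c : n.+1.-tuple R) : {poly R} :=
  \poly_(j < n.+1) (nth 0 c j * Num.sqrt ('C(n, j)%:R)).

Lemma FF_ppoly n (c : n.+1.-tuple R) a : cos a != 0 ->
  FF c a = cos a ^+ n * (ppoly c).[tan a].
Proof.
move=> c0; rewrite horner_poly mulr_sumr; apply: eq_bigr => j _.
have jn : (j <= n)%N by rewrite -ltnS.
rewrite /vv (tnth_nth 0) /tan expr_div_n.
have -> : cos a ^+ n = cos a ^+ (n - j) * cos a ^+ j :> R by rewrite -exprD subnK.
by field; rewrite expf_neq0.
Qed.

Lemma measurable_FF n a : measurable_fun setT (fun c : n.+1.-tuple R => FF c a).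
Proof. exact: measurable_dot. Qed.

End elliptic_process.

(** * Counting and measurability of zeros *)

Section finite_cardinality.
Variable R : realType.
Implicit Types (A B : set R).

(** Inherits from [fset_set] the value 0 on infinite sets, in agreement with [num_real_zeros]. *)
Definition crd A : nat := #|` fset_set A|.

Lemma crd0 : crd set0 = 0%N.
Proof. by rewrite /crd fset_set0 cardfs0. Qed.

Lemma crd_infinite A : ~ finite_set A -> crd A = 0%N.
Proof. by move=> iA; rewrite /crd /fset_set; case: pselect => // _; rewrite cardfs0. Qed.

Lemma crd_le A B : finite_set B -> A `<=` B -> (crd A <= crd B)%N.
Proof.
move=> fB AB; apply: fsubset_leq_card; rewrite -fset_set_sub //.
exact: sub_finite_set AB fB.
Qed.

Lemma crdU A B : finite_set A -> finite_set B -> A `&` B = set0 ->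
  crd (A `|` B) = (crd A + crd B)%N.
Proof.
move=> fA fB AB; rewrite /crd fset_setU // cardfsU.
by rewrite -fset_setI // AB fset_set0 cardfs0 subn0.
Qed.

Lemma crd_image (f : R -> R) A : finite_set A -> {in A &, injective f} ->
  crd (f @` A) = crd A.
Proof.
move=> fA fi; rewrite /crd fset_set_image // card_in_imfset //=.
by move=> x y /= xA yA; apply: fi; rewrite -(@in_fset_set _ A).
Qed.

Lemma crd1_gt0 A x : finite_set A -> A x -> (0 < crd A)%N.
Proof.
move=> fA Ax; rewrite /crd cardfs_gt0; apply/fset0Pn; exists x.
by rewrite in_fset_set // inE.
Qed.

Lemma crd_le_size A N : (forall s : seq R, uniq s -> (forall x, x \in s -> A x) -> (size s <= N)%N) ->
  finite_set A /\ (crd A <= N)%N.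
Proof.
move=> h; have fA : finite_set A.
  apply: contrapT => /(@infinite_set_fset _ _ N.+1) [B BA NB].
  have := h (enum_fset B) (fset_uniq B) (fun x xB => BA x xB).
  by rewrite leqNgt => /negP; apply.
split=> //; apply: h; first exact: fset_uniq.
by move=> x; rewrite in_fset_set // inE.
Qed.

Lemma crd_le1 A : (forall x y, A x -> A y -> x = y) -> (crd A <= 1)%N.
Proof.
move=> h; apply: (crd_le_size _).2 => -[|x [|y s]] //= /andP[xs _] hA.
have xy : x = y by apply: h; apply: hA; rewrite !inE eqxx ?orbT.
by rewrite xy inE eqxx in xs.
Qed.

Lemma finite_separated A : finite_set A ->
  exists2 e : R, 0 < e & forall x y, A x -> A y -> x != y -> e <= `|x - y|.
Proof.
move=> fA.
have key1 (x : R) (s : seq R) :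
    exists2 e : R, 0 < e & forall y, y \in s -> x != y -> e <= `|x - y|.
  elim: s => [|y s [e e0 he]]; first by exists 1.
  have [<-|xy] := eqVneq x y.
    by exists e => // z; rewrite inE => /orP[/eqP ->|]; [rewrite eqxx|exact: he].
  exists (Num.min e `|x - y|); first by rewrite lt_min e0 normr_gt0 subr_eq0.
  move=> z; rewrite inE => /orP[/eqP -> _|zs xz]; first by rewrite ge_min lexx orbT.
  by rewrite ge_min he.
have key2 (s : seq R) :
    exists2 e : R, 0 < e & forall x y, x \in s -> y \in s -> x != y -> e <= `|x - y|.
  elim: s => [|z s [e e0 he]]; first by exists 1.
  have [e' e'0 he'] := key1 z s.
  exists (Num.min e e'); first by rewrite lt_min e0.
  move=> x y; rewrite !inE => /orP[/eqP ->|xs] /orP[/eqP ->|ys] xy.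
  - by rewrite eqxx in xy.
  - by rewrite ge_min (he' y) ?orbT.
  - by rewrite ge_min distrC (he' x) ?orbT // eq_sym.
  - by rewrite ge_min he.
have [e e0 he] := key2 (fset_set A).
by exists e => // x y Ax Ay; apply: he; rewrite in_fset_set // inE.
Qed.

End finite_cardinality.

Section measurable_zeros.
Variable R : realType.

(** By compactness a continuous function vanishes somewhere on the closed interval iff its absolute
    value gets arbitrarily small on grid points, a condition on countably many points. *)
Lemma measurable_closed_zero d (T : measurableType d) (G : T -> R -> R) (a b : R) :
  a <= b -> (forall t, measurable_fun setT (fun c => G c t)) ->
  (forall c, continuous (G c)) ->
  measurable [set c | exists t, a <= t <= b /\ G c t = 0].
Proof.
move=> ab mG cG.
(* Capping the index by [N.+1] keeps every [pt N i] inside the interval, so the union can run over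
   all [i]. *)
pose pt (N i : nat) : R := a + (b - a) * ((minn i N.+1)%:R / N.+1%:R).
have pt_ab N i : a <= pt N i <= b.
  have h0 : 0 <= (minn i N.+1)%:R / N.+1%:R :> R by rewrite divr_ge0 ?ler0n.
  have h1 : (minn i N.+1)%:R / N.+1%:R <= 1 :> R.
    by rewrite ler_pdivrMr ?ltr0n // mul1r ler_nat geq_minr.
  rewrite /pt lerDl mulr_ge0 ?subr_ge0 //= -lerBrDl.
  by rewrite ler_piMr // subr_ge0.
have -> : [set c | exists t, a <= t <= b /\ G c t = 0] =
    \bigcap_m \bigcup_N \bigcup_i [set c | `|G c (pt N i)| < m.+1%:R^-1].
  apply/seteqP; split => c /=.
    move=> [t [/andP[at_ tb] Gt]] m _.
    have [e /= e0 he] : nbhs_ball t [set s | `|G c s| < m.+1%:R^-1].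
      have m0 : 0 < m.+1%:R^-1 :> R by rewrite invr_gt0 ltr0n.
      have /cvgrPdist_lt/(_ _ m0)/nbhs_ballP := cG c t.
      by rewrite Gt; under [X in nbhs_ball _ X]funext do rewrite sub0r normrN.
    have [ab0|ba] := eqVneq (b - a) 0.
      exists 0%N => //; exists 0%N => //=.
      have -> : pt 0%N 0%N = t by rewrite /pt ab0 mul0r addr0; lra.
      by rewrite Gt normr0 invr_gt0 ltr0n.
    have {}ba : 0 < b - a by rewrite lt_def ba subr_ge0.
    pose N := Num.truncn ((b - a) / e).
    have Ne : (b - a) / N.+1%:R < e.
      rewrite ltr_pdivrMr ?ltr0n // mulrC -ltr_pdivrMr //; exact: truncnS_gt.
    have h0 : 0 <= (t - a) / (b - a) * N.+1%:R.
      by rewrite mulr_ge0 ?ler0n // divr_ge0 ?subr_ge0 // ltW.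
    pose i := Num.truncn ((t - a) / (b - a) * N.+1%:R).
    have /andP[i1 i2] : i%:R <= (t - a) / (b - a) * N.+1%:R < i.+1%:R by exact: truncn_itv.
    have iN : (i <= N.+1)%N.
      rewrite -(ler_nat R); apply: (le_trans i1).
      by rewrite ler_piMl ?ler0n // ler_pdivrMr // mul1r lerD2r.
    exists N => //; exists i => //=; apply: he => /=; rewrite /ball /= /pt (minn_idPl iN).
    have N0 : 0 < N.+1%:R :> R by rewrite ltr0n.
    have f1 : (b - a) * (i%:R / N.+1%:R) <= t - a.
      by rewrite mulrA ler_pdivrMr // mulrC -ler_pdivlMr // mulrAC.
    have f2 : t - a < (b - a) * (i%:R / N.+1%:R) + (b - a) / N.+1%:R.
      rewrite mulrA -mulrDl -[X in _ < (_ + X) / _]mulr1 -mulrDr natr1.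
      by rewrite ltr_pdivlMr // [ltRHS]mulrC -ltr_pdivrMr // mulrAC.
    set q := (b - a) * (i%:R / N.+1%:R) in f1 f2 *.
    set w := (b - a) / N.+1%:R in Ne f2 *.
    rewrite ger0_norm; lra.
  move=> h; apply: contrapT => nz.
  have [x xab xmin] : exists2 x, x \in `[a, b]%R & forall t, t \in `[a, b]%R -> `|G c x| <= `|G c t|.
    apply: EVT_min => //; apply: continuous_subspaceT => x.
    by apply: continuous_comp; [exact: cG|exact: norm_continuous].
  have Gx : 0 < `|G c x|.
    rewrite normr_gt0; apply/eqP => Gx; apply: nz; exists x; split => //.
  have [N _ [i _ /=]] := h (Num.truncn (`|G c x|^-1)) I.
  apply/negP; rewrite -leNgt.
  apply: (@le_trans _ _ `|G c x|); last by apply: xmin; rewrite in_itv /= pt_ab.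
  rewrite invf_ple ?posrE ?ltr0n //; exact/ltW/truncnS_gt.
apply: bigcapT_measurable => m; apply: bigcupT_measurable => N.
apply: bigcupT_measurable => i.
have mlt : measurable_fun setT (fun c => `|G c (pt N i)| < m.+1%:R^-1).
  by apply: measurable_fun_ltr; [exact: measurableT_comp|exact: measurable_cst].
rewrite (_ : [set c | _] = (fun c => `|G c (pt N i)| < m.+1%:R^-1) @^-1` [set true]).
  exact: measurable_preimage.
by apply/seteqP; split.
Qed.

End measurable_zeros.

Section zero_counts.
Variable R : realType.
Implicit Types (n : nat) (a b e : R).

Lemma continuous_FF n (c : n.+1.-tuple R) : continuous (FF c).
Proof.
have -> : FF c = fun t => \sum_(j < n.+1) vv t j * tnth c j by [].
apply: continuous_big => [|j _ t]; first exact: add_continuous.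
apply: cvgM; last exact: cvg_cst.
apply: cvgM; first (apply: cvgM; first exact: cvg_cst).
  apply: (@cvg_comp _ _ _ (@cos R) (fun x => x ^+ (n - j)) _ (nbhs (cos t))); [exact: continuous_cos|exact: exprn_continuous].
apply: (@cvg_comp _ _ _ (@sin R) (fun x => x ^+ j) _ (nbhs (sin t))); [exact: continuous_sin|exact: exprn_continuous].
Qed.

Definition nonzero n (c : n.-tuple R) : bool := [exists j, tnth c j != 0].

(** The right end is left out so that counts over adjacent arcs add up exactly. *)
Definition zeros n (c : n.+1.-tuple R) a b : set R := [set t | a <= t < b /\ FF c t = 0].

Definition ZZ n a b (c : n.+1.-tuple R) : nat := if nonzero c then crd (zeros c a b) else 0%N.

Lemma nonzero_lact n (W : 'M[R]_n) (c : n.-tuple R) : W *m W^T = 1%:M ->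
  nonzero (lact W c) = nonzero c.
Proof.
move=> WW; have WW' := mulmx1C WW.
have lact0 (V : 'M[R]_n) d : ~~ nonzero d -> ~~ nonzero (lact V d).
  rewrite !negb_exists => /forallP d0; apply/forallP => i.
  rewrite negbK tnth_lact big1 // => j _.
  by move: (d0 j); rewrite negbK => /eqP ->; rewrite mulr0.
apply/idP/idP => h; apply: contraLR h => h.
  exact: lact0.
by rewrite -[c]lact1 -WW' lact_mul lact0.
Qed.

Lemma ppoly_neq0 n (c : n.+1.-tuple R) : nonzero c -> ppoly c != 0.
Proof.
move=> /existsP[j cj]; apply/eqP => /polyP/(_ j).
rewrite coef_poly ltn_ord coef0 => /eqP; rewrite mulf_eq0 => /orP[|].
  by rewrite -tnth_nth (negbTE cj).
by rewrite gt_eqF // sqrtr_gt0 ltr0n bin_gt0 -ltnS.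
Qed.

(** Rotating the middle [a + pi / 2] of the arc to 0 puts its interior where [tan] is injective, so
    the zeros there are distinct roots of a polynomial of degree at most [n]. The end [a] goes to
    infinity and is counted apart, whence [n.+1]. *)
Lemma zeros_finite_pi n (c : n.+1.-tuple R) a : nonzero c ->
  finite_set (zeros c a (a + pi)) /\ (crd (zeros c a (a + pi)) <= n.+1)%N.
Proof.
move=> c0; apply: crd_le_size => s us sz.
pose s0 := a + pi / 2; pose c' := lact (vv_rot n s0) c.
have c'0 : nonzero c' by rewrite nonzero_lact //; exact: vv_rot_unitary.
have cI t : t \in rem a s -> - (pi / 2) < t - s0 < pi / 2.
  rewrite mem_rem_uniq // !inE => /andP[ta ts].
  have [/andP[at_ tb] _] := sz t ts.
  have at' : a < t by rewrite lt_def ta.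
  by rewrite /s0; apply/andP; split; lra.
have ct t : t \in rem a s -> cos (t - s0) != 0.
  by move=> /cI/cos_gt0_pihalf h; rewrite gt_eqF.
pose r := [seq tan (t - s0) | t <- rem a s].
have ur : uniq r.
  rewrite map_inj_in_uniq ?rem_uniq // => x y xs ys /tan_inj.
  by rewrite !in_itv /= !cI // => /(_ isT isT) h; lra.
have rr : all (root (ppoly c')) r.
  apply/allP => _ /mapP[t ts ->]; apply/eqP.
  have : FF c t = 0.
    by have [] := sz t (mem_rem ts).
  rewrite -[t in FF c t](subrK s0) FF_rot FF_ppoly ?ct // => /eqP.
  by rewrite mulf_eq0 expf_eq0 (negbTE (ct t ts)) andbF /= => /eqP.
have sr : (size r <= n)%N.
  have := max_poly_roots (ppoly_neq0 c'0) rr ur.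
  by move=> /leq_trans h; rewrite -ltnS; apply: h; exact: size_poly.
move: sr; rewrite size_map.
have [as_|/rem_id ->] := boolP (a \in s); last by move/leq_trans; apply.
by rewrite size_rem // => h; rewrite -(ltn_predK (n := size s) (m := 0)) //; case: (s) as_.
Qed.

Lemma zeros_finite n (c : n.+1.-tuple R) a b : nonzero c -> b <= a + pi ->
  finite_set (zeros c a b) /\ (crd (zeros c a b) <= n.+1)%N.
Proof.
move=> c0 ab; have [f1 f2] := zeros_finite_pi a c0.
have sub : zeros c a b `<=` zeros c a (a + pi).
  by move=> t [/andP[h1 h2] h3]; split => //; rewrite h1 (lt_le_trans h2).
split; first exact: sub_finite_set sub f1.
exact: leq_trans (crd_le f1 sub) f2.
Qed.

Lemma ZZ_le n (c : n.+1.-tuple R) a b : b <= a + pi -> (ZZ a b c <= n.+1)%N.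
Proof. by move=> ab; rewrite /ZZ; case: ifP => // c0; exact: (zeros_finite c0 ab).2. Qed.

Lemma ZZ_add n (c : n.+1.-tuple R) a b e : a <= b -> b <= e -> e <= a + pi ->
  ZZ a e c = (ZZ a b c + ZZ b e c)%N.
Proof.
move=> ab be ea; rewrite /ZZ; case: ifP => // c0.
have h1 : b <= a + pi by exact: le_trans ea.
have h2 : e <= b + pi by apply: (le_trans ea); rewrite lerD2r.
rewrite -crdU; last 3 first.
- exact: (zeros_finite c0 h1).1.
- exact: (zeros_finite c0 h2).1.
- by apply/seteqP; split => // t [[/andP[_ +] _] [/andP[+ _] _]]; case: ltP.
congr crd; apply/seteqP; split => t.
  by move=> [/andP[t1 t2] t3]; have [tb|tb] := ltP t b; [left|right]; split; rewrite ?t1 ?t2 ?tb.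
move=> [|] [/andP[t1 t2] t3]; split; rewrite ?t3 ?t1 ?t2 //=.
  exact: lt_le_trans be.
by rewrite (le_trans ab).
Qed.

Lemma ZZ_empty n (c : n.+1.-tuple R) a : ZZ a a c = 0%N.
Proof.
rewrite /ZZ; case: ifP => // _; rewrite -[RHS](@crd0 R); congr crd.
by apply/seteqP; split => // t [/andP[h1 h2] _]; move: (le_lt_trans h1 h2); rewrite ltxx.
Qed.

Lemma ZZ_rot n (c : n.+1.-tuple R) a b s : b <= a + pi ->
  ZZ (a + s) (b + s) c = ZZ a b (lact (vv_rot n s) c).
Proof.
move=> ab; rewrite /ZZ nonzero_lact; last exact: vv_rot_unitary.
case: ifP => // c0.
have c'0 : nonzero (lact (vv_rot n s) c) by rewrite nonzero_lact //; exact: vv_rot_unitary.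
rewrite -[RHS](@crd_image R (fun t => t + s)); last by move=> x y _ _ /addIr.
  congr crd; apply/seteqP; split => t.
    move=> [/andP[t1 t2] t3]; exists (t - s); last by rewrite subrK.
    by split; [rewrite lerBrDr t1 ltrBlDr t2|rewrite -FF_rot subrK].
  move=> [u [/andP[u1 u2] u3] <-]; split; first by rewrite lerD2r u1 ltrD2r.
  by rewrite FF_rot.
exact: (zeros_finite c'0 ab).1.
Qed.

Lemma sign_change_zero n (c : n.+1.-tuple R) a b : a < b -> FF c a * FF c b < 0 ->
  exists2 t, a < t < b & FF c t = 0.
Proof.
move=> ab h.
have [t tab t0] : exists2 t, t \in `[a, b]%R & FF c t = 0.
  apply: IVT; [exact: ltW|exact/continuous_subspaceT/continuous_FF|].
  rewrite ge_min le_max; move: h; rewrite mulr_lt0 => /andP[_ /andP[_]].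
  have [fa|fa] := ltP (FF c a) 0.
    by rewrite addTb -leNgt => ->; rewrite (ltW fa) orbT.
  by rewrite addFb => fb; rewrite (ltW fb) orbT.
exists t => //; move: tab; rewrite in_itv /= => /andP[at_ tb].
rewrite !lt_def at_ tb !andbT; apply/andP; split; apply/eqP => e.
  by move: h; rewrite -e t0 mul0r ltxx.
by move: h; rewrite e t0 mulr0 ltxx.
Qed.

Lemma sign_change_ZZ n (c : n.+1.-tuple R) a b : a < b -> b <= a + pi ->
  FF c a * FF c b < 0 -> (0 < ZZ a b c)%N.
Proof.
move=> ab bpi h; have [t /andP[t1 t2] t0] := sign_change_zero ab h.
have c0 : nonzero c.
  apply: contraLR h; rewrite negb_exists => /forallP h.
  rewrite {1}/FF /dot big1 ?mul0r ?ltxx // => j _.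
  by move: (h j); rewrite negbK => /eqP ->; rewrite mulr0.
rewrite /ZZ c0; apply: (@crd1_gt0 _ _ t); first exact: (zeros_finite c0 bpi).1.
by split => //; rewrite (ltW t1).
Qed.

Definition has_zero n a b (c : n.+1.-tuple R) : bool := `[< exists t, a <= t < b /\ FF c t = 0 >].

Lemma measurable_asbool d (T : measurableType d) (P : T -> Prop) :
  measurable [set x | P x] -> measurable_fun setT (fun x => `[< P x >]).
Proof.
move=> mP; apply: (@measurable_fun_bool _ _ _ _ true).
rewrite setTI (_ : _ @^-1` _ = [set x | P x]) //.
by apply/seteqP; split => x /= /asboolP.
Qed.

Lemma measurable_has_zero n a b : measurable_fun setT (@has_zero n a b).
Proof.
apply: measurable_asbool.
have [ab|ba] := ltP a b; last first.
  rewrite (_ : [set c | _] = set0) //; apply/seteqP; split => // c [t [/andP[t1 t2] _]].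
  by move: (lt_le_trans (le_lt_trans t1 t2) ba); rewrite ltxx.
have -> : [set c | exists t, a <= t < b /\ FF c t = 0] =
    \bigcup_k [set c : n.+1.-tuple R | exists t, a <= t <= b - (b - a) / k.+1%:R /\ FF c t = 0].
  apply/seteqP; split => c /=.
    move=> [t [/andP[t1 t2] t3]]; exists (Num.truncn ((b - a) / (b - t))) => //=.
    exists t; split => //; rewrite t1 /= lerBrDr -lerBrDl ler_pdivrMr ?ltr0n //.
    rewrite mulrC -ler_pdivrMr ?subr_gt0 //; exact/ltW/truncnS_gt.
  move=> [k _ [t [/andP[t1 t2] t3]]]; exists t; split => //; rewrite t1 /=.
  by apply: (le_lt_trans t2); rewrite gtrBl divr_gt0 ?ltr0n // subr_gt0.
apply: bigcupT_measurable => k.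
apply: measurable_closed_zero => [|t|c]; last exact: continuous_FF.
  rewrite lerBrDr -lerBrDl ler_pdivrMr ?ltr0n // ler_peMr ?subr_ge0 ?(ltW ab) ?ler1n //.
exact: measurable_FF.
Qed.

Definition cell a b (N i : nat) : R := a + (b - a) * (i%:R / N%:R).

Lemma cell0 a b N : cell a b N 0 = a.
Proof. by rewrite /cell mul0r mulr0 addr0. Qed.

Lemma cellN a b N : (0 < N)%N -> cell a b N N = b.
Proof. by move=> N0; rewrite /cell divff ?pnatr_eq0 -?lt0n // mulr1 subrKC. Qed.

Lemma cellS a b N i : cell a b N i.+1 = cell a b N i + (b - a) / N%:R.
Proof.
have e : i.+1%:R / N%:R = i%:R / N%:R + N%:R^-1 :> R by rewrite -natr1 mulrDl mul1r.
by rewrite /cell e mulrDr addrA.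
Qed.

Lemma cell_le a b N i : a <= b -> cell a b N i <= cell a b N i.+1.
Proof. by move=> ab; rewrite cellS lerDl divr_ge0 ?ler0n // subr_ge0. Qed.

Lemma cell_lt a b N i : a < b -> (0 < N)%N -> cell a b N i < cell a b N i.+1.
Proof. by move=> ab N0; rewrite cellS ltrDl divr_gt0 ?ltr0n // subr_gt0. Qed.

Lemma cell_ge a b N i : a <= b -> a <= cell a b N i.
Proof. by move=> ab; rewrite /cell lerDl mulr_ge0 ?subr_ge0 // divr_ge0 ?ler0n. Qed.

Lemma cell_le_end a b N i : a <= b -> (i <= N)%N -> cell a b N i <= b.
Proof.
move=> ab iN; case: N iN => [|N] iN.
  by rewrite leqn0 in iN; rewrite (eqP iN) cell0.
rewrite /cell -lerBrDl ler_piMr ?subr_ge0 //.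
by rewrite ler_pdivrMr ?ltr0n // mul1r ler_nat.
Qed.

Lemma ZZ_grid n (c : n.+1.-tuple R) (t : nat -> R) N :
  (forall i, (i < N)%N -> t i <= t i.+1) -> t N <= t 0%N + pi ->
  ZZ (t 0%N) (t N) c = (\sum_(i < N) ZZ (t i) (t i.+1) c)%N.
Proof.
elim: N => [|N IH] ht tpi; first by rewrite big_ord0 ZZ_empty.
have tN : t N <= t N.+1 by exact: ht.
have t0N : forall k, (k <= N)%N -> t 0%N <= t k.
  elim=> [|k IHk] kN //; apply: (le_trans (IHk (ltnW kN))).
  by apply: ht; rewrite ltnW.
rewrite big_ord_recr /= -IH; last 2 first.
- by move=> i iN; apply: ht; rewrite ltnW.
- exact: le_trans tpi.
by apply: ZZ_add => //; exact: t0N.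
Qed.

Lemma ZZ_cells n (c : n.+1.-tuple R) a b N : a <= b -> b <= a + pi -> (0 < N)%N ->
  ZZ a b c = (\sum_(i < N) ZZ (cell a b N i) (cell a b N i.+1) c)%N.
Proof.
move=> ab bpi N0; have := @ZZ_grid n c (cell a b N) N; rewrite cell0 cellN //; apply => // i _.
exact: cell_le.
Qed.

Lemma has_zero_le_ZZ n (c : n.+1.-tuple R) a b : nonzero c -> b <= a + pi ->
  (has_zero a b c <= ZZ a b c)%N.
Proof.
move=> c0 ab; rewrite /has_zero; case: asboolP => //= -[t [tab t0]].
by rewrite /ZZ c0; apply: (@crd1_gt0 _ _ t) => //; exact: (zeros_finite c0 ab).1.
Qed.

Lemma ZZ_has_zero n (c : n.+1.-tuple R) a b : (0 < ZZ a b c)%N -> has_zero a b c.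
Proof.
move=> h; apply/asboolP; apply: contrapT => nz; move: h; rewrite /ZZ; case: ifP => // _.
rewrite (_ : zeros c a b = set0) ?crd0 //.
by apply/seteqP; split => // t [t1 t2]; case: nz; exists t.
Qed.

(** A count that is visibly measurable for fixed [N] and converges to [ZZ]; it carries both the
    measurability of [ZZ] and the computation of its mean. *)
Definition occupied n a b N (c : n.+1.-tuple R) : nat :=
  (nonzero c * \sum_(i < N) has_zero (cell a b N i) (cell a b N i.+1) c)%N.

Lemma occupied_ZZ n (c : n.+1.-tuple R) a b : a <= b -> b <= a + pi ->
  exists N0, forall N, (N0 <= N)%N -> (0 < N)%N -> occupied a b N c = ZZ a b c.
Proof.
move=> ab bpi; rewrite /occupied; have [c0|c0] := boolP (nonzero c); last first.
  by exists 0%N => N _ _; rewrite mul0n /ZZ (negbTE c0).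
have [e e0 he] := finite_separated (zeros_finite c0 bpi).1.
exists (Num.truncn ((b - a) / e)).+1 => N hN N0; rewrite mul1n (ZZ_cells c ab bpi N0).
apply: eq_bigr => -[i iN] _ /=.
have sub1 : cell a b N i.+1 <= cell a b N i + pi.
  by apply: (le_trans (cell_le_end ab iN)); rewrite (le_trans bpi) // lerD2r cell_ge.
apply/eqP; rewrite eqn_leq has_zero_le_ZZ //=.
have [->//|Z0] := posnP (ZZ (cell a b N i) (cell a b N i.+1) c).
rewrite (ZZ_has_zero Z0) /ZZ c0; apply: crd_le1 => x y [/andP[x1 x2] x3] [/andP[y1 y2] y3].
apply/eqP; apply: contraT => xy.
have zab u : cell a b N i <= u -> u < cell a b N i.+1 -> FF c u = 0 -> zeros c a b u.
  move=> u1 u2 u3; split => //; rewrite (le_trans (cell_ge N i ab) u1) /=.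
  exact: lt_le_trans u2 (cell_le_end ab iN).
have := he x y (zab _ x1 x2 x3) (zab _ y1 y2 y3) xy; rewrite leNgt => /negP; case.
have cN : (b - a) / N%:R < e.
  rewrite ltr_pdivrMr ?ltr0n // mulrC -ltr_pdivrMr //.
  by apply: (lt_le_trans (truncnS_gt _)); rewrite ler_nat.
move: x2 y2; rewrite cellS => x2 y2.
by rewrite ltr_norml; apply/andP; split; lra.
Qed.

Lemma measurable_nonzero n : measurable_fun setT (@nonzero n).
Proof.
apply: (@measurable_fun_bool _ _ _ _ true); rewrite setTI.
have -> : @nonzero n @^-1` [set true] =
    \bigcup_(j in [set: 'I_n]) ((fun c : n.-tuple R => tnth c j) @^-1` [set~ 0]).
  apply/seteqP; split => c /=.
    by move=> /existsP[j cj]; exists j => //=; exact/eqP.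
  by move=> [j _ /eqP cj]; apply/existsP; exists j.
apply: fin_bigcup_measurable => [|j _]; first exact: finite_finset.
by apply: measurable_preimage; [exact: measurable_tnth|exact: measurableC].
Qed.

Lemma measurable_occupied n a b N :
  measurable_fun setT (fun c : n.+1.-tuple R => (occupied a b N c)%:R : R).
Proof.
rewrite (_ : (fun c => _) = fun c : n.+1.-tuple R => (nonzero c)%:R *
   \sum_(i < N) (has_zero (cell a b N i) (cell a b N i.+1) c)%:R); last first.
  by apply/funext => c; rewrite /occupied natrM natr_sum.
apply: measurable_funM.
  exact: (@bmfun_bool _ _ R _ (@measurable_nonzero n.+1)).1.
apply: measurable_sum => i; exact: (@bmfun_bool _ _ R _ (@measurable_has_zero n _ _)).1.
Qed.

Lemma measurable_ZZ n a b : a <= b -> b <= a + pi ->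
  measurable_fun setT (fun c : n.+1.-tuple R => (ZZ a b c)%:R : R).
Proof.
move=> ab bpi.
apply: (@measurable_fun_cvg _ _ _ _ (fun N c => (occupied a b N c)%:R)).
  by move=> N; exact: measurable_occupied.
move=> c _; have [N0 h] := occupied_ZZ c ab bpi.
apply: cvg_near_cst; exists N0.+1 => // N /= hN; rewrite h //; first exact: ltnW.
exact: leq_trans hN.
Qed.

Lemma bmfun_ZZ n a b : a <= b -> b <= a + pi ->
  bmfun (fun c : n.+1.-tuple R => (ZZ a b c)%:R : R).
Proof.
move=> ab bpi; split; first exact: measurable_ZZ.
by exists n.+1%:R => c; rewrite ger0_norm ?ler0n // ler_nat ZZ_le.
Qed.

End zero_counts.

(** * Mean number of zeros *)

Section crossing_angle.
Variable R : realType.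

Lemma expRN_le (y : R) : 0 <= y -> expR (- y) <= 1 - y + y ^+ 2 / 2.
Proof.
move=> y0; rewrite -subr_ge0.
apply: (@ge0_of_derive_ge0 _ (fun y => 1 - y + y ^+ 2 / 2 - expR (- y))
  (fun y => expR (- y) - (1 - y))) => //.
- by move=> z; apply: is_derive_eq; rewrite /= !scaler0 /GRing.scale /=; field.
- by rewrite subr0 expr0n /= mul0r addr0 oppr0 expR0 subrr.
- by move=> z _; rewrite subr_ge0 expR_ge1Dx.
Qed.

Lemma bernoulli_le (x : R) n : 0 <= x <= 1 -> 1 - n%:R * x <= (1 - x) ^+ n.
Proof.
move=> /andP[x0 x1]; elim: n => [|n IH]; first by rewrite mul0r subr0 expr0.
rewrite exprS; apply: (@le_trans _ _ ((1 - x) * (1 - n%:R * x))).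
  have : 0 <= n%:R * x * x by rewrite !mulr_ge0 ?ler0n.
  rewrite -natr1; nra.
by rewrite ler_wpM2l // subr_ge0.
Qed.

Definition phi (n : nat) (h : R) : R := acos (cos h ^+ n).

Lemma cosX_itv (n : nat) (h : R) : 0 <= h -> h <= 1 -> 0 <= cos h ^+ n <= 1.
Proof.
move=> h0 h1; have p2 := pihalf_ge1 R.
have c0 : 0 <= cos h by apply: cos_ge0_pihalf; apply/andP; split; lra.
by rewrite exprn_ge0 //= exprn_ile1 // cos_le1.
Qed.

Lemma cos_phi (n : nat) (h : R) : 0 <= h -> h <= 1 -> cos (phi n h) = cos h ^+ n.
Proof.
move=> h0 h1; have /andP[c0 c1] := cosX_itv n h0 h1.
by rewrite /phi acosK // in_itv /= c1 andbT; lra.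
Qed.

Lemma phi_itv (n : nat) (h : R) : 0 <= h -> h <= 1 -> 0 <= phi n h <= pi.
Proof.
move=> h0 h1; have /andP[c0 c1] := cosX_itv n h0 h1.
have q : -1 <= cos h ^+ n <= 1 by rewrite c1 andbT; lra.
by rewrite acos_ge0 // acos_lepi.
Qed.

Lemma phi_ltpi (n : nat) (h : R) : 0 <= h -> h <= 1 -> phi n h < pi.
Proof.
move=> h0 h1; have /andP[c0 c1] := cosX_itv n h0 h1.
by rewrite acos_ltpi // c1 andbT; lra.
Qed.

(** With [s = sqrt n * h], the value [cos h ^+ n] lies between [1 - s ^+ 2 / 2] (Bernoulli) and
    [expR (- s ^+ 2 / 2)]; these are compared with the Taylor bounds of cosine at [s + s ^+ 3] and
    [s - s ^+ 3]. Summed over [N] cells of size [s / N], a cubic error leaves only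
    [s ^+ 3 / N ^+ 2]. *)
Lemma phi_close (n : nat) (h : R) : (0 < n)%N -> 0 <= h -> Num.sqrt n%:R * h <= 1 ->
  `|phi n h - Num.sqrt n%:R * h| <= (Num.sqrt n%:R * h) ^+ 3.
Proof.
move=> n0 h0; set s := Num.sqrt n%:R * h => s1.
have sn : 1 <= Num.sqrt n%:R :> R by rewrite -[leLHS]sqrtr1 ler_wsqrtr // ler1n.
have hs : h <= s by rewrite /s ler_peMl.
have h1 : h <= 1 by exact: le_trans s1.
have s0 : 0 <= s by exact: le_trans hs.
have s2 : s ^+ 2 = n%:R * h ^+ 2 by rewrite /s exprMn sqr_sqrtr ?ler0n.
have p2 := pihalf_ge1 R.
have s3 : 0 <= s ^+ 3 <= s by rewrite exprn_ge0 //= exprS ler_piMr // exprn_ile1.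
have hp := phi_itv n h0 h1.
have cmono x y : 0 <= x <= pi -> 0 <= y <= pi -> cos x <= cos y -> y <= x.
  move=> xI yI; apply: contraTT; rewrite -!ltNge => xy.
  by rewrite ltr_cos // in_itv.
have s6 : s ^+ 4 <= 1 /\ 0 <= s ^+ 4 /\ s ^+ 6 <= s ^+ 4 /\ 0 <= s ^+ 6.
  split; first by rewrite exprn_ile1.
  split; first exact: exprn_ge0.
  split; last exact: exprn_ge0.
  by apply: ler_wiXn2l.
have [q4 [q40 [q64 q60]]] := s6.
rewrite ler_distl; apply/andP; split.
  apply: cmono => //; first by apply/andP; split; lra.
  rewrite cos_phi //.
  apply: (@le_trans _ _ (expR (- (s ^+ 2 / 2)))).
    have -> : expR (- (s ^+ 2 / 2)) = expR (- h ^+ 2 / 2) ^+ n.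
      by rewrite -expRM_natl s2; congr expR; field.
    apply: lerXn2r; rewrite ?nnegrE ?expR_ge0 //.
      by apply: cos_ge0_pihalf; apply/andP; split; lra.
    by apply: cos_le_gauss => //; lra.
  apply: (@le_trans _ _ (1 - s ^+ 2 / 2 + (s ^+ 2 / 2) ^+ 2 / 2)).
    by apply: expRN_le; rewrite divr_ge0 // sqr_ge0.
  have ss3 : 0 <= s - s ^+ 3 by lra.
  apply: le_trans (cos_ge_quadratic ss3).
  have -> : (s - s ^+ 3) ^+ 2 = s ^+ 2 - 2 * s ^+ 4 + s ^+ 6 by ring.
  have -> : (s ^+ 2 / 2) ^+ 2 = s ^+ 4 / 4 by field.
  lra.
apply: cmono => //; first by apply/andP; split; lra.
rewrite cos_phi //.
have ss3 : 0 <= s + s ^+ 3 by lra.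
apply: (le_trans (cos_le_quartic ss3)).
apply: (@le_trans _ _ (1 - n%:R * (h ^+ 2 / 2))).
  have -> : n%:R * (h ^+ 2 / 2) = s ^+ 2 / 2 by rewrite s2 mulrA.
  have -> : (s + s ^+ 3) ^+ 2 = s ^+ 2 + 2 * s ^+ 4 + s ^+ 6 by ring.
  have : (s + s ^+ 3) ^+ 4 <= 16 * s ^+ 4.
    have -> : 16 * s ^+ 4 = (2 * s) ^+ 4 by ring.
    by apply: lerXn2r; rewrite ?nnegrE //; lra.
  lra.
apply: le_trans (bernoulli_le n _) _.
  have : 0 <= h ^+ 2 <= 1 by rewrite sqr_ge0 exprn_ile1.
  by move=> /andP[a1 a2]; apply/andP; split; lra.
apply: lerXn2r; rewrite ?nnegrE.
- have : h ^+ 2 <= 1 by rewrite exprn_ile1.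
  lra.
- by apply: cos_ge0_pihalf; apply/andP; split; lra.
exact: cos_ge_quadratic.
Qed.

Definition cross n (a b : R) (c : n.+1.-tuple R) : bool := FF c a * FF c b < 0.

Lemma measurable_cross n a b : measurable_fun setT (@cross n a b).
Proof. exact: measurable_opposite. Qed.

Lemma Pr_cross n a b : a <= b -> b - a <= 1 ->
  Pr (gauss R n.+1) (@cross n a b) = phi n (b - a) / pi.
Proof.
move=> ab ba1; have ba0 : 0 <= b - a by rewrite subr_ge0.
apply: Pr_oppositeE.
- exact: vv_norm.
- exact: vv_norm.
- by rewrite cos_phi // vv_gram -cosN opprB.
- by have /andP[] := phi_itv n ba0 ba1.
- exact: phi_ltpi.
Qed.

End crossing_angle.

Lemma prodP_null_sections d1 (T1 : measurableType d1) d2 (T2 : measurableType d2)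
    (R : realType) (P1 : probability T1 R) (P2 : probability T2 R) (A : set (T1 * T2)) :
  measurable A -> (forall y, P1 [set x | A (x, y)] = 0%E) -> prodP P1 P2 A = 0%E.
Proof.
move=> mA h; rewrite prodP_prod.
have -> : (P1 \x P2)%E A = (P1 \x^ P2)%E A.
  by apply: product_measure_unique => // B C mB mC; exact: product_measure2E.
rewrite /product_measure2 integral0_eq // => y _ /=.
rewrite -[RHS](h y); congr (P1 _).
by apply/seteqP; split => x /=; rewrite /ysection /= inE.
Qed.

(** * Almost sure absence of multiple roots *)

Section simple_roots.
Variable R : realType.

(** Dividing by [X - z] leaves a cofactor without roots on the interval, hence of constant sign
    there. *)
Lemma simple_root_sign (p : {poly R}) (a b z : R) : a < z -> z < b ->
  root p z -> p^`().[z] != 0 -> (forall x, a <= x <= b -> root p x -> x = z) ->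
  p.[a] * p.[b] < 0.
Proof.
move=> az zb pz dpz uz.
have [r pr] := factor_theorem p z pz.
have dr : p^`().[z] = r.[z].
  by rewrite pr derivM derivXsubC !hornerE subrr mulr0 add0r.
have rz : r.[z] != 0 by rewrite -dr.
have rn x : a <= x <= b -> r.[x] != 0.
  move=> xab; apply/negP => rx.
  have xz : x = z by apply: uz => //; rewrite pr rootM /root rx.
  by move: rz; rewrite -xz rx.
have rr : 0 < r.[a] * r.[b].
  have ab : a <= b by apply: ltW; exact: lt_trans zb.
  have ra : r.[a] != 0 by apply: rn; rewrite lexx ab.
  have rb : r.[b] != 0 by apply: rn; rewrite lexx ab.
  rewrite lt_def mulf_neq0 //= leNgt; apply/negP => h.
  have [ra0|ra0] := ltP r.[a] 0.
    have rb0 : 0 <= r.[b] by rewrite -(nmulr_rle0 _ ra0) ltW.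
    have hI : r.[a] <= 0 <= r.[b] by rewrite (ltW ra0).
    have [x xab] := poly_ivt ab hI.
    by rewrite /root (negbTE (rn x xab)).
  have ra1 : 0 < r.[a] by rewrite lt_def ra.
  have rb0 : r.[b] <= 0 by rewrite -(pmulr_rle0 _ ra1) ltW.
  have hI : (- r).[a] <= 0 <= (- r).[b].
    by rewrite !hornerN oppr_le0 oppr_ge0 rb0 ltW.
  have [x xab] := poly_ivt ab hI.
  by rewrite /root hornerN oppr_eq0 (negbTE (rn x xab)).
rewrite pr !hornerM !hornerXsubC.
have -> : r.[a] * (a - z) * (r.[b] * (b - z)) = (r.[a] * r.[b]) * ((a - z) * (b - z)) by ring.
by rewrite pmulr_rlt0 // nmulr_rlt0 ?subr_gt0 // subr_lt0.
Qed.

(** Coded as a zero of one continuous function, a sum of two squares, so that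
    [measurable_closed_zero] applies. *)
Definition double_root n (b : R) (c : n.+1.-tuple R) : bool :=
  `[< exists x, 0 <= x <= b /\ ((ppoly c).[x] ^+ 2 + (ppoly c)^`().[x] ^+ 2 = 0) >].

Lemma deriv_ppolyE n (c : n.+1.-tuple R) x : (ppoly c)^`().[x] =
  dot (fun j : 'I_n.+1 => Num.sqrt ('C(n, j)%:R) * (j%:R * x ^+ j.-1)) c.
Proof.
rewrite /ppoly poly_def raddf_sum /dot horner_sum; apply: eq_bigr => j _.
by rewrite /= derivZ derivXn hornerZ hornerMn hornerXn (tnth_nth 0) -mulr_natl; ring.
Qed.

Lemma ppolyE n (c : n.+1.-tuple R) x : (ppoly c).[x] =
  dot (fun j : 'I_n.+1 => Num.sqrt ('C(n, j)%:R) * x ^+ j) c.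
Proof.
rewrite horner_poly /dot; apply: eq_bigr => j _.
by rewrite (tnth_nth 0); ring.
Qed.

Lemma measurable_double_root n b : 0 <= b -> measurable_fun setT (@double_root n b).
Proof.
move=> b0; apply: measurable_asbool.
apply: (measurable_closed_zero (G := fun c x => (ppoly c).[x] ^+ 2 + (ppoly c)^`().[x] ^+ 2)) => //.
  move=> x; apply: measurable_funD; apply: measurable_funX.
    by under eq_fun do rewrite ppolyE; exact: measurable_dot.
  by under eq_fun do rewrite deriv_ppolyE; exact: measurable_dot.
move=> c x; apply: cvgD.
  apply: (@cvg_comp _ _ _ (horner (ppoly c)) (fun y => y ^+ 2) _ (nbhs (ppoly c).[x])).
    exact: continuous_horner.
  exact: exprn_continuous.
apply: (@cvg_comp _ _ _ (horner (ppoly c)^`()) (fun y => y ^+ 2) _ (nbhs (ppoly c)^`().[x])).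
  exact: continuous_horner.
exact: exprn_continuous.
Qed.

(* With the other coefficients fixed, a double root forces the constant one into the
   finite set of critical values. *)
Lemma double_root_section n b (y : n.+1.-tuple R) : tnth y ord0 != 0 ->
  normal01 R [set x | double_root b (tcons (x, y))] = 0%E.
Proof.
move=> y0.
pose q := ppoly (tcons (0, y)); pose A := [set x : R | double_root b (tcons (x, y))].
have q0 : q^`() != 0.
  apply/eqP => /polyP/(_ 0%N); rewrite coef_deriv coef_poly /= mulr1n coef0.
  rewrite -(tnth_nth 0 y ord0) => /eqP; rewrite mulf_eq0 (negbTE y0) /=.
  by rewrite gt_eqF // sqrtr_gt0 bin1 ltr0n.
have pE x : ppoly (tcons (x, y)) = x%:P + q.
  apply/polyP => j; rewrite coefD coefC !coef_poly.
  case: j => [|j] /=; last by rewrite add0r.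
  by rewrite bin0 sqrtr1 !mulr1 addr0.
have Asub : A `<=` [set - q.[t] | t in [set t | root q^`() t]].
  move=> x /asboolP[t [_]] /eqP; rewrite paddr_eq0 ?sqr_ge0 // !sqrf_eq0.
  rewrite pE derivD derivC add0r hornerD hornerC => /andP[/eqP e dq].
  by exists t => //; apply/eqP; rewrite eq_sym -addr_eq0; apply/eqP.
have fr : finite_set [set t | root q^`() t].
  suff h (s : seq R) : uniq s -> (forall x, x \in s -> [set t | root q^`() t] x) ->
      (size s <= size q^`())%N by exact: (crd_le_size h).1.
  by move=> us sr; apply/ltnW/max_poly_roots => //; apply/allP => t /sr.
have cA : countable A.
  apply/finite_set_countable/(sub_finite_set Asub)/finite_image/fr.
have mA : measurable A by exact: countable_measurable.
rewrite normal01E.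
have /null_content_dominatesP h := @normal_prob_dominates R 0 1.
by apply: h => //; exact: countable_lebesgue_measure0.
Qed.

(** The linear coefficient, present because [0 < n], is almost surely nonzero; on that event the
    sections in the constant coefficient are null by [double_root_section]. *)
Lemma Pr_double_root n b : 0 <= b -> (0 < n)%N -> Pr (gauss R n.+1) (@double_root n b) = 0.
Proof.
move=> b0; case: n => // n _.
have md := @measurable_double_root n.+1 b b0.
pose e (c : n.+2.-tuple R) := double_root b c && (tnth c (lift ord0 ord0) != 0).
have me1 : measurable_fun setT (fun c : n.+2.-tuple R => tnth c (lift ord0 ord0) == 0).
  by apply: measurable_fun_eqr; [exact: measurable_tnth|exact: measurable_cst].
have me : measurable_fun setT e.
  by apply: measurable_and => //; exact: measurable_neg.
apply/eqP; rewrite eq_le Pr_ge0 andbT.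
apply: (@le_trans _ _ (Pr (gauss R n.+2)
  (fun c => e c || (tnth c (lift ord0 ord0) == 0)))).
  apply: Pr_le => //; first exact: measurable_or.
  by move=> c cd; rewrite /e cd /=; case: eqP.
apply: le_trans (Pr_or _ me me1) _.
rewrite (Pr_tnth_eq (lift ord0 ord0) 0) addr0 le_eqVlt; apply/orP; left; apply/eqP.
apply: EFin_inj; rewrite PrE //.
have mE : measurable [set c | e c].
  rewrite (_ : [set c | e c] = e @^-1` [set true]); first exact: measurable_preimage.
  by apply/seteqP; split.
rewrite gauss_consE //; set A := _ @^-1` _.
have mA : measurable A by apply: measurable_preimage => //; exact: measurable_tcons.
apply: prodP_null_sections => // y.
have [y0|y0] := eqVneq (tnth y ord0) 0.
  rewrite (_ : [set x | _] = set0) ?measure0 //; apply/seteqP; split => // x /=.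
  by rewrite /A /preimage /e /= tnthS y0 eqxx andbF.
rewrite -(double_root_section b y0); congr (normal01 R _); apply/seteqP; split => x /=.
  by rewrite /A /preimage /e /= => /andP[].
by rewrite /A /preimage /e /= tnthS y0 andbT.
Qed.

End simple_roots.

Section union_bound.
Context d (T : measurableType d) (R : realType) (P : probability T R).

Lemma measurable_has (I : Type) (s : seq I) (b : I -> T -> bool) :
  (forall i, measurable_fun setT (b i)) -> measurable_fun setT (fun x => has (b^~ x) s).
Proof.
move=> mb; elim: s => [|i s IH] /=; first exact: measurable_cst.
exact: measurable_or.
Qed.

Lemma Pr_has (I : Type) (s : seq I) (b : I -> T -> bool) :
  (forall i, measurable_fun setT (b i)) ->
  Pr P (fun x => has (b^~ x) s) <= \sum_(i <- s) Pr P (b i).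
Proof.
move=> mb; elim: s => [|i s IH] /=.
  by rewrite big_nil /Pr Ex_cst.
rewrite big_cons; apply: (le_trans (Pr_or _ (mb i) (measurable_has s mb))).
by rewrite lerD2l.
Qed.

Lemma Ex_eventually0 (f : nat -> T -> R) :
  (forall N, bmfun (f N)) -> (forall N x, `|f N x| <= 1) ->
  (forall x, exists N0, forall N, (N0 <= N)%N -> f N x = 0) ->
  forall e : R, 0 < e -> exists N0, forall N, (N0 <= N)%N -> `|Ex P (f N)| <= e.
Proof.
move=> bf f1 f0 e e0.
have h : (\int[P]_(x in setT) (f N x)%:E @[N --> \oo] --> \int[P]_(x in setT) (0 : \bar R))%E.
  apply: (@dominated_cvg _ _ _ _ _ _ _ _ (fun=> 1%E)) => //.
  - by move=> N; apply/measurable_EFinP; exact: (bf N).1.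
  - move=> x _; have [N0 h] := f0 x; apply: cvg_near_cst; exists N0 => // N hN.
    by rewrite h.
  - exact: (bmfun_integrable P (@bmfun_cst _ T R 1)).
  - by move=> N x _; rewrite lee_fin f1.
rewrite integral0 in h.
have {}h : Ex P (f N) @[N --> \oo] --> (0 : R).
  have h' : (\int[P]_(x in setT) (f N x)%:E @[N --> \oo] --> (0 : R)%:E)%E by [].
  exact: (fine_cvg h').
have /cvgrPdist_le/(_ e e0)[N0 _ hN0] := h.
exists N0 => N hN; have := hN0 N hN; by rewrite sub0r normrN.
Qed.

End union_bound.

Section expected_zeros.
Variable R : realType.
Implicit Types (n N : nat).

(** Once double roots, zeros at grid points and cells with several zeros are excluded, each occupied
    cell contains a single simple zero in its interior, and there the sign changes. The bound
    [tan 1] covers the arc because it lies in [[0, 1]]. *)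
Lemma ZZ_crossE n (c : n.+1.-tuple R) (b : R) N : 0 < b -> b <= 1 -> (0 < N)%N ->
  ~~ double_root (tan 1) c ->
  ~~ has (fun i => FF c (cell 0 b N i) == 0) (iota 0 N.+1) ->
  occupied 0 b N c = ZZ 0 b c ->
  ZZ 0 b c = (\sum_(i < N) cross (cell 0 b N i) (cell 0 b N i.+1) c)%N.
Proof.
move=> b0 b1 N0 nd /hasPn nF occ.
have p2 := pihalf_ge1 R; have b0' := ltW b0.
have bpi : b <= 0 + pi by rewrite add0r; lra.
have nz : nonzero c.
  have : FF c (cell 0 b N 0) != 0 by apply: nF; rewrite mem_iota.
  apply: contraR; rewrite negb_exists => /forallP h.
  rewrite /FF /dot big1 // => j _.
  by move: (h j); rewrite negbK => /eqP ->; rewrite mulr0.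
have sub1 i : (i < N)%N -> cell 0 b N i.+1 <= cell 0 b N i + pi.
  by move=> iN; apply: (le_trans (cell_le_end b0' iN)); rewrite (le_trans bpi) // lerD2r cell_ge.
(* Termwise [has_zero <= ZZ] together with equal sums forces equality in every cell. *)
have hz (i : 'I_N) : has_zero (cell 0 b N i) (cell 0 b N i.+1) c = ZZ (cell 0 b N i) (cell 0 b N i.+1) c :> nat.
  have lei : forall i : 'I_N, true -> (has_zero (cell 0 b N i) (cell 0 b N i.+1) c <= ZZ (cell 0 b N i) (cell 0 b N i.+1) c
     ?= iff (has_zero (cell 0 b N i) (cell 0 b N i.+1) c == ZZ (cell 0 b N i) (cell 0 b N i.+1) c :> nat))%N.
    by move=> j _; apply/leqifP; case: eqP => [//|/eqP ne]; rewrite ltn_neqAle ne has_zero_le_ZZ // sub1.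
  have [_] := leqif_sum lei.
  move: occ; rewrite /occupied nz mul1n (ZZ_cells c b0' bpi N0) => ->; rewrite eqxx => /esym/forallP/(_ i)/implyP/(_ isT)/eqP.
  by [].
rewrite (ZZ_cells c b0' bpi N0); apply: eq_bigr => -[i iN] _ /=.
have clt := cell_lt i b0 N0.
have [Z0|Z0] := posnP (ZZ (cell 0 b N i) (cell 0 b N i.+1) c).
  rewrite Z0; case cr : (cross _ _ _) => //.
  by have := sign_change_ZZ clt (sub1 i iN) cr; rewrite Z0.
have Z1 : ZZ (cell 0 b N i) (cell 0 b N i.+1) c = 1%N.
  by have := hz (Ordinal iN) => /=; rewrite (ZZ_has_zero Z0).
rewrite Z1; suff -> : cross (cell 0 b N i) (cell 0 b N i.+1) c by [].
have [z [/andP[z1 z2] z0]] : exists z, cell 0 b N i <= z < cell 0 b N i.+1 /\ FF c z = 0.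
  exact/asboolP/(ZZ_has_zero Z0).
have i0 : 0 <= cell 0 b N i := cell_ge N i b0'.
have i1 : cell 0 b N i.+1 <= 1 by apply: (le_trans (cell_le_end b0' iN)).
have tI' (t : R) : 0 <= t -> t <= 1 -> - (pi / 2) < t < pi / 2.
  move=> t0 t1; apply/andP; split; first lra.
  rewrite ltNge; apply/negP => tp; have e1 : pi / 2 = 1 :> R by lra.
  by have := cos1_gt0 R; rewrite -e1 cos_pihalf ltxx.
have cI (t : R) : 0 <= t -> t <= 1 -> 0 < cos t by move=> t0 t1; apply/cos_gt0_pihalf/tI'.
have tI (t : R) : 0 <= t -> t <= 1 -> t \in `](- (pi / 2)), (pi / 2)[%R.
  by move=> t0 t1; rewrite in_itv /= tI'.
have az : cell 0 b N i < z.
  rewrite lt_def z1 andbT; apply/eqP => e.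
  have := nF i; rewrite mem_iota /= add0n ltnS (ltnW iN) => /(_ isT).
  by rewrite -e z0 eqxx.
have zi : 0 <= z by exact: le_trans z1.
have zi' : z <= 1 by apply: ltW; exact: lt_le_trans i1.
have ai1 : cell 0 b N i <= 1 by exact: le_trans zi'.
have bi0 : 0 <= cell 0 b N i.+1 by apply: le_trans zi _; exact: ltW.
have FFp (t : R) : 0 <= t -> t <= 1 -> (FF c t == 0) = root (ppoly c) (tan t).
  move=> t0 t1; have ct : cos t != 0 by rewrite gt_eqF // cI.
  by rewrite FF_ppoly // mulf_eq0 expf_eq0 (negbTE ct) andbF.
have rz : root (ppoly c) (tan z) by rewrite -FFp // z0.
have tz0 : 0 <= tan z.
  by rewrite -(@tan0 R) leNgt ltr_tan ?tI // -leNgt.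
have ci : cos (cell 0 b N i) != 0 by rewrite gt_eqF // cI.
have ci1 : cos (cell 0 b N i.+1) != 0 by rewrite gt_eqF // cI.
rewrite /cross (FF_ppoly _ ci) (FF_ppoly _ ci1).
have cc : 0 < cos (cell 0 b N i) ^+ n * cos (cell 0 b N i.+1) ^+ n.
  by rewrite mulr_gt0 // exprn_gt0 // cI.
rewrite mulrACA pmulr_rlt0 //.
apply: (@simple_root_sign R _ _ _ (tan z)) => //.
- by rewrite ltr_tan ?tI.
- by rewrite ltr_tan ?tI.
- apply/eqP => dz; move: nd; rewrite /double_root; case: asboolP => // nd _; apply: nd.
  exists (tan z); split.
    by rewrite tz0 leNgt ltr_tan ?tI // -leNgt.
  by rewrite dz (rootP rz) expr0n addr0.
move=> x /andP[x1 x2] rx.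
pose t := atan x.
have xt : x = tan t by rewrite /t atanK.
have tJ : t \in `](- (pi / 2)), (pi / 2)[%R by rewrite in_itv /= atan_gtNpi2 atan_ltpi2.
have t1 : cell 0 b N i <= t by rewrite leNgt -(ltr_tan tJ (tI _ i0 ai1)) -xt -leNgt.
have t2 : t <= cell 0 b N i.+1 by rewrite leNgt -(ltr_tan (tI _ bi0 i1) tJ) -xt -leNgt.
have t0 : FF c t = 0.
  apply/eqP; rewrite FFp -?xt //; first exact: le_trans t1.
  exact: le_trans i1.
have tlt : t < cell 0 b N i.+1.
  rewrite lt_def t2 andbT; apply/eqP => e.
  have := nF i.+1; rewrite mem_iota /= add0n ltnS iN => /(_ isT).
  by rewrite e t0 eqxx.
rewrite xt; congr tan; apply: contrapT => /eqP tz.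
have fz := (zeros_finite nz (sub1 i iN)).1.
have : (crd [set t; z] <= 1)%N.
  rewrite -Z1 /ZZ nz; apply: crd_le => // u [|] -> ; split => //; first by rewrite t1 tlt.
  by rewrite z1 z2.
rewrite /crd fset_setU1 // fset_set1 cardfsU1 inE tz /=.
by rewrite cardfs1.
Qed.

Lemma cross_le_ZZ n (c : n.+1.-tuple R) (t : nat -> R) N :
  (forall i, (i < N)%N -> t i < t i.+1) -> t N <= t 0%N + pi ->
  (\sum_(i < N) cross (t i) (t i.+1) c <= ZZ (t 0%N) (t N) c)%N.
Proof.
move=> ht tpi; rewrite ZZ_grid //; last by move=> i iN; exact/ltW/ht.
have mono i j : (i <= j)%N -> (j <= N)%N -> t i <= t j.
  elim: j => [|j IH]; first by rewrite leqn0 => /eqP ->.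
  rewrite leq_eqVlt => /predU1P[-> //|ij jN]; apply: (le_trans (IH ij (ltnW jN))).
  exact/ltW/ht.
apply: leq_sum => -[i iN] _ /=; case cr : (cross _ _ _) => //.
apply: sign_change_ZZ => //; first exact: ht.
apply: (le_trans (mono i.+1 N iN (leqnn N))); apply: (le_trans tpi).
by rewrite lerD2r mono // ltnW.
Qed.

Lemma Pr_FF_eq0 n a : Pr (gauss R n.+1) (fun c => FF c a == 0) = 0.
Proof. by apply: Pr_dot_eq0; exact: vv_norm. Qed.

Lemma bmfun_crosses n (t : nat -> R) N :
  bmfun (fun c : n.+1.-tuple R => (\sum_(i < N) cross (t i) (t i.+1) c)%N%:R : R).
Proof.
rewrite (_ : (fun c => _) = fun c : n.+1.-tuple R => \sum_(i < N) (cross (t i) (t i.+1) c)%:R).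
  by apply: bmfun_sum => i; apply: bmfun_bool; exact: measurable_cross.
by apply/funext => c; rewrite natr_sum.
Qed.

Lemma Ex_crosses n (t : nat -> R) N : (forall i, (i < N)%N -> t i <= t i.+1) ->
  (forall i, (i < N)%N -> t i.+1 - t i <= 1) ->
  Ex (gauss R n.+1) (fun c => (\sum_(i < N) cross (t i) (t i.+1) c)%N%:R) =
  \sum_(i < N) phi n (t i.+1 - t i) / pi.
Proof.
move=> ht ht1; transitivity (Ex (gauss R n.+1)
    (fun c => \sum_(i < N) (cross (t i) (t i.+1) c)%:R)).
  by congr Ex; apply/funext => c; rewrite natr_sum.
rewrite Ex_sum => [|i]; last by apply: bmfun_bool; exact: measurable_cross.
by apply: eq_bigr => i _; rewrite -Pr_cross ?ht ?ht1.
Qed.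

(** Grid sign changes never exceed the zeros, and their mean tends to the claimed value by
    [phi_close]. The deficit is at most [n.+1] times the probability that some cell holds several
    zeros, which tends to 0 by dominated convergence. *)
Lemma Ex_ZZ_near0 n (b : R) : (0 < n)%N -> 0 < b -> b <= 1 ->
  Ex (gauss R n.+1) (fun c => (ZZ 0 b c)%:R) = Num.sqrt n%:R * b / pi.
Proof.
move=> n0 b0 b1; have b0' := ltW b0; have p2 := pi_ge2 R; have pi0 := pi_gt0 R.
have bpi : b <= 0 + pi by rewrite add0r; lra.
set s := Num.sqrt n%:R * b.
have s0 : 0 <= s by rewrite mulr_ge0 ?sqrtr_ge0.
pose D N (c : n.+1.-tuple R) := occupied 0 b N.+1 c != ZZ 0 b c.
have mD N : measurable_fun setT (D N).
  apply: measurable_neg.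
  rewrite (_ : (fun c => _) = fun c : n.+1.-tuple R =>
     ((occupied 0 b N.+1 c)%:R : R) == (ZZ 0 b c)%:R); last first.
    by apply/funext => c; rewrite eqr_nat.
  by apply: measurable_fun_eqr; [exact: measurable_occupied|exact: measurable_ZZ].
have bD N : bmfun (fun c => (D N c)%:R : R) by apply: bmfun_bool.
pose S N (c : n.+1.-tuple R) := (\sum_(i < N.+1) cross (cell 0 b N.+1 i) (cell 0 b N.+1 i.+1) c)%N.
have bS N : bmfun (fun c => (S N c)%:R : R) by exact: bmfun_crosses.
have bZ := bmfun_ZZ n b0' bpi.
have SZ N c : (S N c <= ZZ 0 b c)%N.
  have := @cross_le_ZZ n c (cell 0 b N.+1) N.+1; rewrite cell0 cellN //; apply => // i _.
  exact: cell_lt.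
have step1 N : Ex (gauss R n.+1) (fun c => (ZZ 0 b c)%:R - (S N c)%:R) <=
    n.+1%:R * Pr (gauss R n.+1) (D N).
  pose z (c : n.+1.-tuple R) := double_root (tan 1) c || has (fun i => FF c (cell 0 b N.+1 i) == 0) (iota 0 N.+2).
  have mF i : measurable_fun setT (fun c : n.+1.-tuple R => FF c (cell 0 b N.+1 i) == 0).
    exact: measurable_dot_eq0.
  have tan1 : 0 <= tan 1 :> R.
    rewrite /tan divr_ge0 //; last exact/ltW/cos1_gt0.
    by apply: sin_ge0_pi; apply/andP; split; lra.
  have mz : measurable_fun setT z.
    apply: measurable_or; first exact: measurable_double_root.
    exact: measurable_has.
  have z0 : Pr (gauss R n.+1) z = 0.
    apply/eqP; rewrite eq_le Pr_ge0 andbT.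
    pose w (c : n.+1.-tuple R) := has (fun i => FF c (cell 0 b N.+1 i) == 0) (iota 0 N.+2).
    have mw : measurable_fun setT w by exact: (measurable_has (iota 0 N.+2) mF).
    apply: (@le_trans _ _ (Pr (gauss R n.+1) (@double_root _ n (tan 1)) + Pr (gauss R n.+1) w)).
      by apply: Pr_or => //; exact: measurable_double_root.
    rewrite Pr_double_root // add0r.
    apply: (le_trans (Pr_has (gauss R n.+1) (iota 0 N.+2) mF)).
    by rewrite big1 // => i _; exact: Pr_FF_eq0.
  have bZS : bmfun (fun c => (ZZ 0 b c)%:R - (S N c)%:R : R) by exact: bmfunB.
  rewrite -[leRHS]ExZ //.
  rewrite (@Ex_eq_ae _ _ _ _ _ (fun c => ((ZZ 0 b c)%:R - (S N c)%:R) * (D N c)%:R) z) //.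
  - apply: Ex_le => [||c]; first exact: bmfunM.
      by apply: bmfunM => //; exact: bmfun_cst.
    rewrite ler_wpM2r ?ler0n //; apply: (@le_trans _ _ (ZZ 0 b c)%:R).
      by rewrite gerBl ler0n.
    by rewrite ler_nat ZZ_le.
  - exact: bmfunM.
  - move=> c; rewrite negb_or => /andP[c1 c2]; rewrite /D; case: eqP => [e|_] /=.
      by rewrite mulr0 /S -(ZZ_crossE b0 b1 _ c1 c2 e) // subrr.
    by rewrite mulr1.
have step2 N : s <= N.+1%:R ->
    `|Ex (gauss R n.+1) (fun c => (S N c)%:R) - s / pi| <= s ^+ 3 / N.+1%:R.
  move=> sN; have N0 : 0 < N.+1%:R :> R by rewrite ltr0n.
  have stepE i : cell 0 b N.+1 i.+1 - cell 0 b N.+1 i = b / N.+1%:R.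
    by rewrite cellS subr0 addrC addKr.
  have bN1 : b / N.+1%:R <= 1.
    by rewrite ler_pdivrMr // mul1r (le_trans b1) // ler1n.
  have bN0 : 0 <= b / N.+1%:R by rewrite divr_ge0 // ltW.
  rewrite Ex_crosses; last 2 first.
  - by move=> i _; exact: cell_le.
  - by move=> i _; rewrite stepE.
  under eq_bigr do rewrite stepE.
  rewrite sumr_const card_ord -[X in `|X - _|]mulr_natl.
  set f := phi n _; pose g := s / N.+1%:R.
  have gE : Num.sqrt n%:R * (b / N.+1%:R) = g by rewrite mulrA.
  have sE : s = g * N.+1%:R by rewrite /g divfK // gt_eqF.
  have g1 : g <= 1 by rewrite ler_pdivrMr // mul1r.
  have := phi_close n0 bN0; rewrite gE => /(_ g1); rewrite -/f => fg.
  have -> : N.+1%:R * (f / pi) - s / pi = N.+1%:R / pi * (f - g) by rewrite [in LHS]sE; ring.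
  rewrite normrM (@ger0_norm _ (_ / pi)); last by rewrite divr_ge0 // ltW.
  apply: (@le_trans _ _ (N.+1%:R / pi * g ^+ 3)).
    by apply: ler_wpM2l => //; rewrite divr_ge0 // ltW.
  have g30 : 0 <= N.+1%:R * g ^+ 3.
    by rewrite mulr_ge0 ?ler0n // exprn_ge0 // divr_ge0 ?ler0n.
  apply: (@le_trans _ _ (N.+1%:R * g ^+ 3)).
    rewrite mulrAC ler_pdivrMr // ler_peMr //; lra.
  have -> : N.+1%:R * g ^+ 3 = s ^+ 3 / N.+1%:R / N.+1%:R by rewrite /g; field; rewrite gt_eqF.
  by rewrite ler_pdivrMr // ler_peMr ?ler1n // divr_ge0 ?exprn_ge0 ?ler0n.
apply/eqP; rewrite -subr_eq0 -normr_le0; apply/ler_addgt0Pr => e e0; rewrite add0r.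
have e2 : 0 < e / 2 / n.+1%:R by rewrite !divr_gt0 ?ltr0n.
have D1 N c : `|(D N c)%:R : R| <= 1 by case: (D N c); rewrite ?normr1 ?normr0.
have Dev c : exists N0, forall N, (N0 <= N)%N -> (D N c)%:R = 0 :> R.
  have [N0 h] := occupied_ZZ c b0' bpi; exists N0 => N hN.
  by rewrite /D h ?eqxx // (leq_trans hN).
have [N0 hN0] := Ex_eventually0 (gauss R n.+1) bD D1 Dev e2.
pose M := maxn N0 (maxn (Num.truncn s) (Num.truncn (s ^+ 3 / (e / 2)))).
have M0 : (N0 <= M)%N by exact: leq_maxl.
have M1 : s <= M.+1%:R.
  apply/ltW/(lt_le_trans (truncnS_gt s)); rewrite ler_nat ltnS.
  by rewrite /M leq_max leq_maxl orbT.
have M2 : s ^+ 3 / M.+1%:R <= e / 2.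
  rewrite ler_pdivrMr ?ltr0n // mulrC -ler_pdivrMr ?divr_gt0 //.
  apply/ltW/(lt_le_trans (truncnS_gt _)); rewrite ler_nat ltnS.
  by rewrite /M !leq_max leqnn !orbT.
have h1 := step1 M; have h2 := step2 M M1; have h3 := hN0 M M0.
have Sle : Ex (gauss R n.+1) (fun c => (S M c)%:R) <= Ex (gauss R n.+1) (fun c => (ZZ 0 b c)%:R).
  by apply: Ex_le => // c; rewrite ler_nat.
rewrite ExB // in h1.
have h4 : n.+1%:R * Pr (gauss R n.+1) (D M) <= e / 2.
  rewrite mulrC -ler_pdivlMr ?ltr0n //; apply: le_trans h3; exact: ler_norm.
move: h2 h1 h4 Sle M2; rewrite !ler_norml.
set EZ := Ex _ (fun c => (ZZ 0 b c)%:R); set ES := Ex _ (fun c => (S M c)%:R).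
set PD := _ * Pr _ _; set q := s ^+ 3 / _; set t := s / pi.
by move=> /andP[h5 h6] *; apply/andP; split; lra.
Qed.

End expected_zeros.

(** * Moments of the number of zeros *)

Section growth.

Lemma expn_le_fact (a : nat) : exists K, (0 < K)%N /\ forall j, (a ^ j <= K * j`!)%N.
Proof.
case: a => [|a].
  by exists 1%N; split => // j; rewrite mul1n; case: j => // j; rewrite exp0n.
exists (a.+1 ^ a.+1)%N; split=> [|j]; first by rewrite expn_gt0.
elim: j => [|j IH]; first by rewrite expn0 fact0 muln1 expn_gt0.
have [ja|aj] := ltnP j a.+1.
  by apply: (@leq_trans (a.+1 ^ a.+1)); [rewrite leq_pexp2l|rewrite leq_pmulr ?fact_gt0].
by rewrite expnS factS mulnCA leq_mul // leqW.
Qed.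

(** The inequality [q <= p * 2 ^ (q %/ p)] raised to the power [p]. *)
Lemma expn_le_2expn (p q : nat) : (q ^ p <= p ^ p * 2 ^ q)%N.
Proof.
case: p => [|p]; first by rewrite !expn0 mul1n expn_gt0.
have h : (q <= p.+1 * 2 ^ (q %/ p.+1))%N.
  apply: ltnW; apply: (@leq_trans ((q %/ p.+1).+1 * p.+1)); first exact: ltn_ceil.
  by rewrite mulnC leq_pmul2l // ltn_expl.
apply: (@leq_trans ((p.+1 * 2 ^ (q %/ p.+1)) ^ p.+1)); first by rewrite leq_exp2r.
by rewrite expnMn leq_mul2l -expnM leq_pexp2l ?orbT // leq_divM.
Qed.

End growth.

(** * Dividing out roots of modulus at most 1 *)

Section root_bound.
Variable R : realType.

(** A weighted coefficient norm adapted to removing [q] roots; it does the work of Jensen's formula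
    in bounding the number of roots. *)
Definition binom_norm (q N : nat) (Q : {poly R}) : R := \sum_(j < N) `|Q`_j| * 'C(j, q)%:R.

(** The relation [S_l = Q_(l+1) + y * S_(l+1)] gives [|S_l| <= |Q_(l+1)| + |S_(l+1)|]; summed
    against binomials it telescopes by Pascal's rule. *)
Lemma binom_norm_div (Q S : {poly R}) (y : R) q N : Q = S * ('X - y%:P) -> `|y| <= 1 ->
  (size S <= N)%N -> binom_norm q N S <= binom_norm q.+1 N.+1 Q.
Proof.
move=> QS y1 SN.
have S1 l : `|S`_l| <= `|Q`_l.+1| + `|S`_l.+1|.
  have -> : S`_l = Q`_l.+1 + y * S`_l.+1.
    by rewrite QS mulrBr coefB coefMX coefMC /=; ring.
  apply: (le_trans (ler_normD _ _)); rewrite lerD2l normrM.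
  by rewrite ler_piMl.
have key M : binom_norm q M S <=
    \sum_(l < M) `|Q`_l.+1| * 'C(l.+1, q.+1)%:R + `|S`_M| * 'C(M, q.+1)%:R.
  elim: M => [|M IH]; first by rewrite /binom_norm !big_ord0 add0r mulr_ge0 ?ler0n.
  rewrite /binom_norm !big_ord_recr /= -/(binom_norm q M S).
  have h : `|S`_M| * 'C(M.+1, q.+1)%:R <= (`|Q`_M.+1| + `|S`_M.+1|) * 'C(M.+1, q.+1)%:R.
    by rewrite ler_wpM2r ?ler0n.
  move: h; rewrite mulrDl [in X in X <= _]binS natrD mulrDr; lra.
have := key N; rewrite nth_default // normr0 mul0r addr0 => /le_trans; apply.
by rewrite /binom_norm big_ord_recl /= bin_small // mulr0 add0r.
Qed.

(** Dividing out a root [y] with [|y| <= 1] does not decrease the modulus of the constant term, and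
    each division is paid by one more binomial index in the norm of the original polynomial. The
    final bound sees only the coefficients of degree at least the number of roots. *)
Lemma coef0_le_binom_norm (Q : {poly R}) (ys : seq R) N : uniq ys -> all (root Q) ys ->
  (forall y, y \in ys -> `|y| <= 1) -> (size Q <= N)%N -> Q != 0 ->
  `|Q`_0| <= binom_norm (size ys) N Q.
Proof.
move=> uys rys y1 QN Q0.
have [S QS] : exists S, Q = S * \prod_(y <- ys) ('X - y%:P).
  by apply: uniq_roots_prod_XsubC; rewrite ?uniq_rootsE.
elim: ys Q {uys rys} y1 S N QN Q0 QS => [|y ys IH] Q y1 S N QN Q0 QS.
  rewrite /binom_norm /=.
  have N0 : (0 < N)%N by apply: leq_trans QN; rewrite lt0n size_poly_eq0.
  rewrite -(prednK N0) big_ord_recl /= bin0 mulr1 lerDl.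
  by apply: sumr_ge0 => j _; rewrite mulr_ge0 ?ler0n.
pose U := S * \prod_(z <- ys) ('X - z%:P).
have QU : Q = U * ('X - y%:P) by rewrite QS big_cons /U; ring.
have U0 : U != 0 by apply: contraNneq Q0; rewrite QU => ->; rewrite mul0r.
have sQ : size Q = (size U).+1 by rewrite QU size_Mmonic ?monicXsubC // size_XsubC addn2.
have N0 : (0 < N)%N by apply: leq_trans QN; rewrite lt0n size_poly_eq0.
have UN : (size U <= N.-1)%N by rewrite -ltnS prednK // -sQ.
have h : `|U`_0| <= binom_norm (size ys) N.-1 U.
  by apply: (IH U _ S) => // z zs; apply: y1; rewrite inE zs orbT.
have yy : `|y| <= 1 by apply: y1; rewrite inE eqxx.
rewrite -(prednK N0); apply: le_trans (binom_norm_div _ QU yy UN).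
apply: le_trans h; rewrite QU mulrBr coefB coefMX coefMC /= sub0r normrN normrM.
by rewrite ler_piMr.
Qed.

End root_bound.

Section gaussian_tails.
Variable R : realType.

Lemma normal01_small (e : R) : 0 <= e -> (normal01 R [set x | `|x| <= e]%R <= (2 * e)%:E)%E.
Proof.
move=> e0; rewrite normal01E /normal_prob.
have -> : [set x : R | `|x| <= e]%R = `[- e, e]%classic.
  by apply/seteqP; split => x /=; rewrite in_itv /= ler_norml.
apply: (@le_trans _ _ (\int[lebesgue_measure]_(x in `[(- e)%R, e]) (cst 1%:E x))%E).
  apply: ge0_le_integral => //.
  - by move=> x _; rewrite lee_fin normal_pdf_ge0.
  - apply/measurable_funTS/measurable_EFinP; exact: measurable_normal_pdf.
  - move=> x _; rewrite lee_fin; apply: (le_trans (normal_pdf_ub _ _ _)).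
      exact: oner_neq0.
    have p2 := pi_ge2 R; rewrite /normal_peak expr1n mul1r invf_le1; last first.
      by rewrite sqrtr_gt0 pmulrn_lgt0 ?pi_gt0.
    by rewrite -[leLHS]sqrtr1 ler_wsqrtr // mulr2n; lra.
rewrite integral_cst // mul1e.
rewrite -[X in (X <= _)%E]/(@lebesgue_measure R `[(- e)%R, e]%classic) lebesgue_measure_itv /= lte_fin; case: ifP => _.
  by rewrite -EFinB lee_fin; lra.
by rewrite lee_fin mulr_ge0.
Qed.

(** For [y >= 0] the density at [y + x] is at most [expR (- (x ^+ 2 / 2))] times the density at [y],
    and this factor is below [2 / x ^+ 2]. *)
Lemma normal01_tail (x : R) : 0 < x ->
  (normal01 R [set y | x <= y]%R <= (2 / x ^+ 2)%:E)%E.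
Proof.
move=> x0; rewrite normal01E /normal_prob integral_mkcond.
pose f (y : measurableTypeR R) : \bar R := ((fun y : R => (normal_pdf 0 1 y)%:E) \_ [set y | x <= y]%R) y.
have mA : measurable [set y : R | x <= y]%R.
  by rewrite (_ : [set _ | _] = `[x, +oo[%classic) //; apply/seteqP; split => y /=;
     rewrite in_itv /= andbT.
have mn : measurable_fun setT (fun y : R => (normal_pdf 0 1 y)%:E).
  by apply/measurable_EFinP; exact: measurable_normal_pdf.
have mf : measurable_fun setT f.
  by apply/(measurable_restrictT _ mA); exact: measurable_funTS.
have f0 y : (0 <= f y)%E.
  by rewrite /f patchE; case: ifP => // _; rewrite lee_fin normal_pdf_ge0.
rewrite -[leLHS]/(\int[lebesgue_measure]_y f y)%E -(ge0_integral_shift x mf f0).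
apply: (@le_trans _ _ (\int[lebesgue_measure]_y ((2 / x ^+ 2)%:E * (normal_pdf 0 1 y)%:E))%E).
  apply: ge0_le_integral => //.
  - apply: (measurableT_comp mf); exact: measurable_funD.
  - exact: measurable_funeM.
  move=> y _; rewrite /f patchE; case: ifPn => [|_]; last first.
    by rewrite mule_ge0 // lee_fin ?normal_pdf_ge0 // divr_ge0 // sqr_ge0.
  rewrite inE /= lerDr => y0.
  rewrite -EFinM lee_fin /normal_pdf (negbTE (oner_neq0 R)) mulrCA.
  apply: ler_wpM2l; first exact: normal_peak_ge0.
  rewrite /normal_fun !subr0 expr1n.
  apply: (@le_trans _ _ (expR (- (x ^+ 2 / 2)) * expR (- y ^+ 2 / (1 *+ 2)))).
    rewrite -expRD ler_expR.
    have : 0 <= y * x by rewrite mulr_ge0 // ltW.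
    have -> : (y + x) ^+ 2 = y ^+ 2 + 2 * (y * x) + x ^+ 2 by ring.
    have h (u v w : R) : 0 <= w -> - (u + 2 * w + v) / 2 <= - (v / 2) + - u / 2 by lra.
    exact: h.
  apply: ler_wpM2r; first exact: expR_ge0.
  have x2 : 0 < x ^+ 2 by rewrite exprn_gt0.
  rewrite expRN -[2 / x ^+ 2]invf_div lef_pV2 ?posrE ?expR_gt0 ?divr_gt0 //.
  have := expR_ge1Dx (x ^+ 2 / 2); lra.
rewrite ge0_integralZl //.
- by rewrite integral_normal_pdf mule1.
- by move=> y _; rewrite lee_fin normal_pdf_ge0.
- by rewrite lee_fin divr_ge0 // sqr_ge0.
Qed.

Lemma Pr_tnth m (i : 'I_m) (b : R -> bool) : measurable_fun setT b ->
  (Pr (gauss R m) (fun c => b (tnth c i)))%:E = normal01 R [set x | b x].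
Proof.
move=> mb; rewrite PrE; last first.
  exact: (measurableT_comp mb (measurable_tnth i)).
have mB : measurable [set x | b x].
  rewrite (_ : [set x | b x] = b @^-1` [set true]); first exact: measurable_preimage.
  by apply/seteqP; split.
have [_ h] := gaussP R m.
rewrite (_ : [set c | _] = box (fun j : 'I_m => if j == i then [set x | b x] else setT)).
  rewrite [LHS]h; last by move=> j; case: ifP.
  rewrite (bigD1 i) //= eqxx big1 ?mule1 // => j /negbTE ->.
  exact: probability_setT.
apply/seteqP; split => c /=.
  by move=> bc j; case: eqP => // ->.
by move/(_ i); rewrite eqxx.
Qed.

Lemma Pr_small m (i : 'I_m) (e : R) : 0 <= e ->
  Pr (gauss R m) (fun c => `|tnth c i| <= e) <= 2 * e.
Proof.
move=> e0; rewrite -lee_fin (@Pr_tnth m i (fun x => `|x| <= e)); first exact: normal01_small.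
by apply: measurable_fun_ler => //; exact: measurable_cst.
Qed.

Lemma Pr_large m (i : 'I_m) (x : R) : 0 < x ->
  Pr (gauss R m) (fun c => x <= `|tnth c i|) <= 4 / x ^+ 2.
Proof.
move=> x0.
have m1 : measurable_fun setT (fun y : R => x <= y).
  by apply: measurable_fun_ler; [exact: measurable_cst|exact: measurable_id].
have m2 : measurable_fun setT (fun y : R => x <= - y).
  apply: measurable_fun_ler; [exact: measurable_cst|exact: measurable_funN].
have e1 := Pr_tnth i m1; have e2 := Pr_tnth i m2.
have h1 : Pr (gauss R m) (fun c => x <= tnth c i) <= 2 / x ^+ 2.
  by rewrite -lee_fin e1; exact: normal01_tail.
have h2 : Pr (gauss R m) (fun c => x <= - tnth c i) <= 2 / x ^+ 2.
  rewrite -lee_fin e2.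
  have mA : measurable [set y : R | x <= y].
    by rewrite (_ : [set _ | _] = `[x, +oo[%classic) //; apply/seteqP; split => y /=;
     rewrite in_itv /= andbT.
  have := normal01N mA; rewrite /preimage /= => ->; exact: normal01_tail.
have mt := @measurable_tnth _ R m i.
have mm1 : measurable_fun setT (fun c : m.-tuple R => x <= tnth c i).
  exact: (measurableT_comp m1 mt).
have mm2 : measurable_fun setT (fun c : m.-tuple R => x <= - tnth c i).
  exact: (measurableT_comp m2 mt).
apply: (@le_trans _ _ (Pr (gauss R m) (fun c => (x <= tnth c i) || (x <= - tnth c i)))).
  apply: Pr_le; last by move=> c; rewrite ler_normr.
    apply: measurable_fun_ler; first exact: measurable_cst.
    exact: (measurableT_comp (@normr_measurable _ _) mt).
  exact: measurable_or.
by apply: (le_trans (Pr_or _ mm1 mm2)); lra.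
Qed.

End gaussian_tails.

Section block_moments.
Variable R : realType.
Implicit Types (n p q : nat) (a b : R).

(** Rotation brings an arc of length at most 1 to the origin, and since [pi <= 4] any arc is cut
    into four such arcs. *)
Lemma Ex_ZZ n a b : (0 < n)%N -> a <= b -> b <= a + pi ->
  Ex (gauss R n.+1) (fun c => (ZZ a b c)%:R) = Num.sqrt n%:R * (b - a) / pi.
Proof.
move=> n0.
have short a' b' : a' <= b' -> b' - a' <= 1 -> Ex (gauss R n.+1) (fun c => (ZZ a' b' c)%:R) =
    Num.sqrt n%:R * (b' - a') / pi.
  move=> ab; rewrite le_eqVlt in ab; have p2 := pi_ge2 R.
  case/orP: ab => [/eqP ->|ab] b1.
    rewrite subrr mulr0 mul0r -[RHS](Ex_cst (gauss R n.+1) 0); congr Ex.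
    by apply/funext => c; rewrite ZZ_empty.
  have e c : (ZZ a' b' c)%:R = (ZZ 0 (b' - a') (lact (vv_rot n a') c))%:R :> R.
    by rewrite -ZZ_rot ?add0r ?subrK //; lra.
  under [fun c : n.+1.-tuple R => _]eq_fun do rewrite e.
  have h : bmfun (fun c : n.+1.-tuple R => (ZZ 0 (b' - a') c)%:R : R) by apply: bmfun_ZZ; lra.
  by rewrite (Ex_lact (vv_rot_unitary n a') h) Ex_ZZ_near0 //; lra.
move=> ab bp; have p4 : pi <= 4 :> R by have [] := andP (pihalf_02 R); lra.
have e c : (ZZ a b c)%:R = \sum_(i < 4) (ZZ (cell a b 4 i) (cell a b 4 i.+1) c)%:R :> R.
  by rewrite (ZZ_cells c ab bp (isT : (0 < 4)%N)) natr_sum.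
under [fun c : n.+1.-tuple R => _]eq_fun do rewrite e.
have w i : cell a b 4 i.+1 - cell a b 4 i = (b - a) / 4 by rewrite cellS addrC addKr.
rewrite Ex_sum.
  rewrite (eq_bigr (fun=> Num.sqrt n%:R * ((b - a) / 4) / pi)); last first.
    by move=> i _; rewrite (short _ _ (cell_le 4 i ab)) w //; lra.
  by rewrite sumr_const card_ord -mulrnAl -mulrnAr -[((b - a) / 4) *+ 4]mulr_natr divfK.
move=> i; apply: bmfun_ZZ; first exact: cell_le.
have := w i; have := pi_ge2 R; lra.
Qed.

Lemma geometric_tail (r : R) q N : 0 <= r -> r <= 2^-1 ->
  \sum_(j < N) (q <= j)%N%:R * r ^+ j <= 2 * r ^+ q.
Proof.
move=> r0 r1; suff : \sum_(j < N) (q <= j)%N%:R * r ^+ j <= 2 * r ^+ q - 2 * r ^+ maxn q N.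
  by have : 0 <= r ^+ maxn q N by [rewrite exprn_ge0]; lra.
elim: N => [|N IH]; first by rewrite big_ord0 maxn0 subrr.
rewrite big_ord_recr /=; have [qN|Nq] := leqP q N.
  rewrite (maxn_idPr qN) in IH; rewrite (maxn_idPr (leqW qN)) mul1r exprS.
  have : r * r ^+ N <= 2^-1 * r ^+ N by rewrite ler_wpM2r ?exprn_ge0.
  lra.
by rewrite (maxn_idPl Nq); rewrite (maxn_idPl (ltnW Nq)) in IH; rewrite mul0r addr0.
Qed.

Lemma bin_le_exp2 j q : ('C(j, q) <= 2 ^ j)%N.
Proof.
elim: j q => [|j IH] [|q]; rewrite ?bin0 ?expn_gt0 //.
by rewrite binS expnS mul2n -addnn leq_add.
Qed.

Lemma bin_fact_le n j : ('C(n, j) * j`! <= n ^ j)%N.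
Proof.
rewrite bin_ffact; elim: j n => [|j IH] n; first by rewrite ffactn0.
case: n => [|n]; first by rewrite ffact0n.
rewrite ffactSS expnS leq_mul //; apply: (leq_trans (IH n)).
by case: j {IH} => // j; rewrite leq_exp2r.
Qed.

(** The coefficient in the variable [y = sqrt n * tan a]. Its square is at most the inverse of [j]
    factorial for every [n], which makes the estimates uniform in the degree. *)
Definition scaled_coef n j : R := Num.sqrt ('C(n, j)%:R) / Num.sqrt n%:R ^+ j.

Lemma scaled_coef_ge0 n j : 0 <= scaled_coef n j.
Proof. by rewrite divr_ge0 ?exprn_ge0 ?sqrtr_ge0. Qed.

Lemma scaled_coef_sqr n j : scaled_coef n j ^+ 2 = 'C(n, j)%:R / n%:R ^+ j.
Proof. by rewrite expr_div_n sqr_sqrtr // -exprM mulnC exprM sqr_sqrtr. Qed.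

Lemma scaled_coef_le n j : (0 < n)%N -> scaled_coef n j ^+ 2 <= (j`!%:R)^-1.
Proof.
move=> n0; rewrite scaled_coef_sqr ler_pdivrMr ?exprn_gt0 ?ltr0n //.
by rewrite ler_pdivlMl ?ltr0n ?fact_gt0 // -natrX -natrM ler_nat mulnC bin_fact_le.
Qed.

(* The polynomial of the rescaled variable [y = sqrt n * tan a]. *)
Definition qpoly n (c : n.+1.-tuple R) : {poly R} :=
  \poly_(j < n.+1) (nth 0 c j * scaled_coef n j).

Lemma coef_qpoly n (c : n.+1.-tuple R) (j : 'I_n.+1) : (qpoly c)`_j = tnth c j * scaled_coef n j.
Proof. by rewrite coef_poly ltn_ord -tnth_nth. Qed.

Lemma scaled_coef0 n : scaled_coef n 0 = 1.
Proof. by rewrite /scaled_coef bin0 sqrtr1 expr0 divr1. Qed.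

Lemma FF_qpoly n (c : n.+1.-tuple R) a : (0 < n)%N -> cos a != 0 ->
  FF c a = cos a ^+ n * (qpoly c).[Num.sqrt n%:R * tan a].
Proof.
move=> n0 ca; rewrite FF_ppoly //; congr (_ * _).
rewrite /ppoly /qpoly !horner_poly; apply: eq_bigr => j _.
have h : scaled_coef n j * Num.sqrt n%:R ^+ j = Num.sqrt 'C(n, j)%:R.
  by rewrite /scaled_coef divfK // expf_neq0 // gt_eqF // sqrtr_gt0 ltr0n.
by rewrite [(Num.sqrt _ * _) ^+ _]exprMn -h; move: (tan a) => t; ring.
Qed.

Lemma qpoly_neq0 n (c : n.+1.-tuple R) : (0 < n)%N -> nonzero c -> qpoly c != 0.
Proof.
move=> n0 /existsP[j cj]; apply: contraNneq cj => q0.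
have := congr1 (fun p : {poly R} => p`_j) q0; rewrite coef_poly ltn_ord coef0 => /eqP.
rewrite mulf_eq0 -tnth_nth => /orP[->//|/eqP s0].
have := scaled_coef_sqr n j; rewrite s0 expr0n /= => /esym/eqP.
rewrite mulf_eq0 pnatr_eq0 eqn0Ngt bin_gt0 -ltnS ltn_ord /= invr_eq0 expf_eq0.
by rewrite pnatr_eq0 (gtn_eqF n0) andbF.
Qed.

Lemma sqrtn_tan_le n a : (0 < n)%N -> Num.sqrt n%:R * `|a| <= 2^-1 -> `|Num.sqrt n%:R * tan a| <= 1.
Proof.
move=> n0 ha; have s1 : 1 <= Num.sqrt n%:R :> R by rewrite -[leLHS]sqrtr1 ler_wsqrtr // ler1n.
rewrite normrM ger0_norm ?sqrtr_ge0 //.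
suff : `|tan a| <= 2 * `|a|.
  move=> h; apply: (@le_trans _ _ (Num.sqrt n%:R * (2 * `|a|))); first by rewrite ler_wpM2l ?sqrtr_ge0.
  by rewrite mulrCA; lra.
have a1 : `|a| <= 2^-1.
  by apply: le_trans ha; rewrite ler_peMl.
have -> : `|tan a| = `|sin `|a| | / `|cos `|a| |.
  by rewrite {1}/tan normf_div; case: (ger0P a) => _; rewrite ?sinN ?cosN ?normrN.
have c0 : 2^-1 <= cos `|a|.
  apply: le_trans (cos_ge_quadratic (normr_ge0 a)).
  have : `|a| ^+ 2 <= 2^-1 * 2^-1 by rewrite expr2 ler_pM.
  lra.
have p2 := pi_ge2 R; move: (normr_ge0 a) a1 c0; move: `|a| => x x0 x1 c0.
have sx : 0 <= sin x by apply: sin_ge0_pi; lra.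
rewrite !ger0_norm //; last by lra.
rewrite ler_pdivrMr; last by lra.
have := sin_le_id x0.
have : x * 2^-1 <= x * cos x by rewrite ler_wpM2l.
lra.
Qed.

Lemma tan_injective a b : - (pi / 2) < a < pi / 2 -> - (pi / 2) < b < pi / 2 -> tan a = tan b -> a = b.
Proof.
move=> ha hb e; rewrite -[a]tanK ?e ?tanK //; rewrite in_itv /=; lra.
Qed.

Lemma ZZ_roots n (c : n.+1.-tuple R) a b q : (0 < n)%N -> (q <= ZZ a b c)%N ->
  Num.sqrt n%:R * `|a| <= 2^-1 -> Num.sqrt n%:R * `|b| <= 2^-1 ->
  nonzero c -> exists ys : seq R, [/\ uniq ys, all (root (qpoly c)) ys, size ys = q &
    forall y, y \in ys -> `|y| <= 1].
Proof.
move=> n0 qZ ha hb nz.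
have s1 : 1 <= Num.sqrt n%:R :> R by rewrite -[leLHS]sqrtr1 ler_wsqrtr // ler1n.
have a1 : `|a| <= 2^-1 by apply: le_trans ha; rewrite ler_peMl.
have b1 : `|b| <= 2^-1 by apply: le_trans hb; rewrite ler_peMl.
have p2 := pi_ge2 R.
have small t : a <= t < b -> `|t| <= 2^-1 /\ Num.sqrt n%:R * `|t| <= 2^-1.
  move=> /andP[at_ tb]; have tm : `|t| <= Num.max `|a| `|b|.
    rewrite le_max; apply/orP; have [t0|t0] := lerP 0 t; [right|left].
      by rewrite ger0_norm //; apply: le_trans (ler_norm b); exact: ltW.
    by rewrite ltr0_norm // -(normrN a); apply: le_trans (ler_norm _); rewrite lerN2.
  split; first by apply: (le_trans tm); rewrite ge_max a1 b1.
  apply: (@le_trans _ _ (Num.sqrt n%:R * Num.max `|a| `|b|)); first by rewrite ler_wpM2l ?sqrtr_ge0.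
  by rewrite maxr_pMr ?sqrtr_ge0 // ge_max ha hb.
have hab : b <= a + pi by move: a1 b1; rewrite !ler_norml; lra.
have [fz _] := zeros_finite nz hab.
rewrite /ZZ nz /crd in qZ.
pose ts := take q (enum_fset (fset_set (zeros c a b))).
have tz t : t \in ts -> zeros c a b t.
  by move=> /mem_take; rewrite -[_ \in _]/(t \in fset_set _) in_fset_set // inE.
have tsmall t : t \in ts -> - (pi / 2) < t < pi / 2.
  by move=> /tz[/small[]]; rewrite ler_norml; lra.
exists [seq Num.sqrt n%:R * tan t | t <- ts]; split.
- rewrite map_inj_in_uniq; first by rewrite take_uniq // fset_uniq.
  move=> t u tt uu /mulfI h; apply: tan_injective; [exact: tsmall|exact: tsmall|].
  by apply: h; rewrite gt_eqF //; lra.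
- apply/allP => _ /mapP[t tt ->]; have [_ F0] := tz _ tt.
  have ct : cos t != 0 by rewrite gt_eqF // cos_gt0_pihalf // tsmall.
  apply/rootP/eqP; move/eqP: F0; rewrite FF_qpoly // mulf_eq0 => /orP[|//].
  by rewrite expf_eq0 (negbTE ct) andbF.
- by rewrite size_map size_take; case: ltngtP qZ.
- move=> _ /mapP[t tt ->]; apply: sqrtn_tan_le => //.
  by have [/small[]] := tz _ tt.
Qed.

Lemma measurable_ZZ_ge n a b q : a <= b -> b <= a + pi ->
  measurable_fun setT (fun c : n.+1.-tuple R => (q <= ZZ a b c)%N).
Proof.
move=> ab bp; rewrite (_ : (fun c => _) = (fun c : n.+1.-tuple R => (q%:R <= (ZZ a b c)%:R :> R))).
  by apply: measurable_fun_ler; [exact: measurable_cst|exact: measurable_ZZ].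
by apply/funext => c; rewrite ler_nat.
Qed.

Lemma exprn_le_fact (a : nat) : exists K : nat, (0 < K)%N /\
  forall j, a%:R ^+ j <= K%:R * j`!%:R :> R.
Proof.
have [K [K0 h]] := expn_le_fact a; exists K; split=> // j.
by rewrite -natrX -natrM ler_nat.
Qed.

(** With [q] zeros, [coef0_le_binom_norm] bounds [|c_0|] by the coefficients of index at least [q].
    Unless some [|c_j|] with [q <= j] exceeds [2 ^ j], an event of probability [O(4 ^ -q)], this
    bound is of order [8 ^ -q], and a Gaussian is that small with probability of the same order. *)
Lemma Pr_block_near0 : exists C : R, 0 <= C /\ forall n a b q, (0 < n)%N -> a <= b ->
  Num.sqrt n%:R * `|a| <= 2^-1 -> Num.sqrt n%:R * `|b| <= 2^-1 ->
  Pr (gauss R n.+1) (fun c => (q <= ZZ a b c)%N) <= C / 4 ^+ q.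
Proof.
(* Squares of the quantities compared below: [16 ^ j] comes from [4 ^ j], the bound [2 ^ j] on
   [|c_j|] times the bound [2 ^ j] on the binomial, and [64 ^ j] from the wanted decay [8 ^ -j]. The
   factorial in [scaled_coef] absorbs both. *)
have [A [eA [K [K0 hK]]]] : exists A : R, 16 * 64 = A /\ exists K : nat, (0 < K)%N /\
    forall j, A ^+ j <= K%:R * j`!%:R.
  by exists 1024; split; [ring|exact: exprn_le_fact].
have sK : 1 <= Num.sqrt K%:R :> R by rewrite -[leLHS]sqrtr1 ler_wsqrtr // ler1n.
exists (4 * Num.sqrt K%:R + 8); split; first by lra.
move=> n a b q n0 ab ha hb.
have s1 : 1 <= Num.sqrt n%:R :> R by rewrite -[leLHS]sqrtr1 ler_wsqrtr // ler1n.
have a1 : `|a| <= 2^-1 by apply: le_trans ha; rewrite ler_peMl.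
have b1 : `|b| <= 2^-1 by apply: le_trans hb; rewrite ler_peMl.
have hab : b <= a + pi by have := pi_ge2 R; move: a1 b1; rewrite !ler_norml; lra.
have coefE j : 4 ^+ j * scaled_coef n j <= Num.sqrt K%:R * 8^-1 ^+ j.
  rewrite -(@ler_pXn2r _ 2) ?nnegrE ?mulr_ge0 ?exprn_ge0 ?scaled_coef_ge0 ?sqrtr_ge0 ?invr_ge0 //.
  have e16 : (4 ^+ j) ^+ 2 = 16 ^+ j :> R by rewrite -exprM mulnC exprM; congr (_ ^+ _); ring.
  have e64 : (8^-1 ^+ j) ^+ 2 = (64 ^+ j)^-1 :> R.
    by rewrite -exprM mulnC exprM -exprVn; congr (_ ^+ _); field.
  rewrite (exprMn 2 (4 ^+ j)) (exprMn 2 (Num.sqrt K%:R)) sqr_sqrtr // e16 e64.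
  rewrite ler_pdivlMr ?exprn_gt0 // mulrAC -exprMn.
  rewrite eA; apply: (@le_trans _ _ (A ^+ j * (j`!%:R)^-1)).
    by rewrite ler_wpM2l ?scaled_coef_le // exprn_ge0 // -eA mulr_ge0.
  by rewrite ler_pdivrMr ?ltr0n ?fact_gt0 //; exact: hK.
pose e : R := 2 * Num.sqrt K%:R * 8^-1 ^+ q.
have e0 : 0 <= e by rewrite mulr_ge0 ?exprn_ge0 ?invr_ge0 //; lra.
pose B1 (c : n.+1.-tuple R) := `|tnth c ord0| <= e.
pose B2 (c : n.+1.-tuple R) := has (fun j : 'I_n.+1 => (2 ^+ j <= `|tnth c j|)) [seq j : 'I_n.+1 <- enum 'I_n.+1 | (q <= j)%N].
have mB1 : measurable_fun setT B1.
  apply: measurable_fun_ler; last exact: measurable_cst.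
  exact: (measurableT_comp (@normr_measurable _ _) (@measurable_tnth _ R n.+1 ord0)).
have mj (j : 'I_n.+1) : measurable_fun setT (fun c : n.+1.-tuple R => 2 ^+ j <= `|tnth c j|).
  apply: measurable_fun_ler; first exact: measurable_cst.
  exact: (measurableT_comp (@normr_measurable _ _) (@measurable_tnth _ R n.+1 j)).
pose big (j : 'I_n.+1) (c : n.+1.-tuple R) := 2 ^+ j <= `|tnth c j|.
have mB2 : measurable_fun setT B2 by exact: (@measurable_has _ _ _ _ big).
have key c : (q <= ZZ a b c)%N -> B1 c || B2 c.
  move=> qZ; case: (boolP (B2 c)) => [|nB2]; rewrite ?orbT // orbF.
  have [nz|z] := boolP (nonzero c); last first.
    by move: z; rewrite negb_exists => /forallP/(_ ord0); rewrite negbK /B1 => /eqP ->; rewrite normr0.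
  have [ys [uys rys sys y1]] := ZZ_roots n0 qZ ha hb nz.
  have := coef0_le_binom_norm uys rys y1 (size_poly _ _) (qpoly_neq0 n0 nz).
  rewrite -[(qpoly c)`_0]/((qpoly c)`_(@ord0 n)) coef_qpoly scaled_coef0 mulr1 sys /B1.
  move/le_trans; apply; rewrite /binom_norm.
  apply: (@le_trans _ _ (\sum_(j < n.+1) Num.sqrt K%:R * ((q <= j)%N%:R * 8^-1 ^+ j))); last first.
    rewrite -mulr_sumr /e mulrAC -mulrA [leRHS]mulrC -[leRHS]mulrA.
    rewrite mulrCA ler_wpM2l ?sqrtr_ge0 //.
    apply: (le_trans (@geometric_tail 8^-1 q n.+1 _ _)); [lra|lra|].
    by rewrite mulrC.
  apply: ler_sum => j _; rewrite coef_qpoly.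
  have [qj|jq] := leqP q j; last by rewrite bin_small // mulr0 mul0r mulr0.
  rewrite mul1r; apply: le_trans (coefE j).
  rewrite normrM (ger0_norm (scaled_coef_ge0 _ _)).
  have cj : `|tnth c j| <= 2 ^+ j.
    move: nB2; rewrite -all_predC => /allP/(_ j); rewrite mem_filter qj mem_enum /= => /(_ isT).
    by rewrite -ltNge => /ltW.
  rewrite mulrAC ler_wpM2r ?scaled_coef_ge0 //.
  have -> : (4 ^+ j : R) = 2 ^+ j * (2 ^ j)%N%:R by rewrite natrX -exprMn; congr (_ ^+ _); ring.
  by rewrite ler_pM ?ler_nat ?bin_le_exp2.
apply: (le_trans (Pr_le _ (measurable_ZZ_ge q ab hab) (measurable_or mB1 mB2) key)).
apply: (le_trans (Pr_or _ mB1 mB2)).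
have h1 : Pr (gauss R n.+1) B1 <= 4 * Num.sqrt K%:R / 4 ^+ q.
  apply: (le_trans (Pr_small _ e0)).
  have -> : 2 * e = 4 * Num.sqrt K%:R * 8^-1 ^+ q by rewrite /e; ring.
  rewrite ler_wpM2l ?mulr_ge0 ?sqrtr_ge0 // exprVn lef_pV2 ?posrE ?exprn_gt0 //.
  by apply: lerXn2r; rewrite ?nnegrE //; lra.
have h2 : Pr (gauss R n.+1) B2 <= 8 / 4 ^+ q.
  apply: (le_trans (@Pr_has _ _ R (gauss R n.+1) _ _ big mj)).
  rewrite big_filter big_enum_cond /=.
  apply: (@le_trans _ _ (4 * \sum_(j < n.+1) (q <= j)%N%:R * 4^-1 ^+ j)); last first.
    rewrite (_ : 8 / 4 ^+ q = 4 * (2 * 4^-1 ^+ q)); last by rewrite exprVn; ring.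
    by rewrite ler_wpM2l // geometric_tail //; lra.
  rewrite mulr_sumr big_mkcond; apply: ler_sum => j _; case: ifP => _; last first.
    by rewrite mul0r mulr0.
  apply: (le_trans (Pr_large _ (exprn_gt0 _ _))) => //.
  by rewrite mul1r -exprM mulnC exprM exprVn (_ : 2 ^+ 2 = 4 :> R); last ring.
rewrite mulrDl; lra.
Qed.

End block_moments.

Section zero_moments.
Variable R : realType.
Implicit Types (n p q : nat) (a b : R).

Lemma Pr_block : exists C : R, 0 <= C /\ forall n a b q, (0 < n)%N -> a <= b ->
  Num.sqrt n%:R * (b - a) <= 1 ->
  Pr (gauss R n.+1) (fun c => (q <= ZZ a b c)%N) <= C / 4 ^+ q.
Proof.
have [C [C0 h]] := Pr_block_near0 R; exists C; split=> // n a b q n0 ab ba.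
have s1 : 1 <= Num.sqrt n%:R :> R by rewrite -[leLHS]sqrtr1 ler_wsqrtr // ler1n.
have ba1 : b - a <= 1 by apply: le_trans ba; rewrite ler_peMl // subr_ge0.
pose r := (b - a) / 2; pose s := (a + b) / 2; have p2 := pi_ge2 R.
have sr : Num.sqrt n%:R * `|r| <= 2^-1.
  by rewrite ger0_norm; [rewrite /r mulrA; lra|rewrite /r; lra].
have e c : ZZ a b c = ZZ (- r) r (lact (vv_rot n s) c).
  by rewrite -ZZ_rot; [congr ZZ|]; rewrite /r /s; lra.
rewrite /Pr; under [fun c : n.+1.-tuple R => _]eq_fun do rewrite e.
have mZ : measurable_fun setT (fun c : n.+1.-tuple R => (q <= ZZ (- r) r c)%N).
  by apply: measurable_ZZ_ge; rewrite /r; lra.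
rewrite (Ex_lact (vv_rot_unitary n s) (@bmfun_bool _ _ R _ mZ)).
by apply: h; rewrite ?normrN //; rewrite /r; lra.
Qed.

Lemma sum_lt_le_S (f : nat -> nat) N z : (z < N)%N -> (f z <= \sum_(q < N) f q * (q <= z))%N.
Proof.
move=> zN; rewrite (bigD1 (Ordinal zN)) //= leqnn muln1; exact: leq_addr.
Qed.

(** The moment is at most the sum over [q] of [q ^ p] times the probability of at least [q] zeros;
    [q ^ p <= p ^ p * 2 ^ q] against a tail [4 ^ -q] leaves a geometric series. *)
Lemma Ex_block_moment p : exists B : R, 0 <= B /\ forall n a b, (0 < n)%N -> a <= b ->
  Num.sqrt n%:R * (b - a) <= 1 ->
  Ex (gauss R n.+1) (fun c => (ZZ a b c)%:R ^+ p) <= B.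
Proof.
have [C [C0 h]] := Pr_block; exists (2 * C * (p ^ p)%:R); split=> [|n a b n0 ab ba].
  by rewrite !mulr_ge0.
have s1 : 1 <= Num.sqrt n%:R :> R by rewrite -[leLHS]sqrtr1 ler_wsqrtr // ler1n.
have ba1 : b - a <= 1 by apply: le_trans ba; rewrite ler_peMl // subr_ge0.
have abp : b <= a + pi by have := pi_ge2 R; lra.
have mZ q := @measurable_ZZ_ge R n a b q ab abp.
have bq q : bmfun (fun c : n.+1.-tuple R => (q%:R ^+ p) * (q <= ZZ a b c)%N%:R : R).
  by apply: bmfunM; [exact: bmfun_cst|exact: bmfun_bool].
apply: (@le_trans _ _ (Ex (gauss R n.+1) (fun c => \sum_(q < n.+2) (q%:R ^+ p) * (q <= ZZ a b c)%N%:R))).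
  apply: Ex_le => [||c].
  - by apply: bmfunX; exact: bmfun_ZZ.
  - by apply: bmfun_sum => q; exact: bq.
  have zn : (ZZ a b c < n.+2)%N by rewrite ltnS ZZ_le.
  have := sum_lt_le_S (fun q => q ^ p)%N zn; rewrite -(ler_nat R) natr_sum natrX => /le_trans; apply.
  by apply: ler_sum => q _; rewrite natrM natrX.
rewrite Ex_sum; last by move=> q; exact: bq.
apply: (@le_trans _ _ (\sum_(q < n.+2) (C * (p ^ p)%:R) * ((0 <= q)%N%:R * 2^-1 ^+ q))).
  apply: ler_sum => q _; rewrite ExZ; last exact: bmfun_bool.
  apply: (@le_trans _ _ (q%:R ^+ p * (C / 4 ^+ q))).
    by rewrite ler_wpM2l ?exprn_ge0 //; exact: h.
  rewrite mulrCA -[leRHS]mulrA ler_wpM2l // mul1r.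
  have := expn_le_2expn p q; rewrite -(ler_nat R) natrM !natrX => hq.
  rewrite ler_pdivrMr ?exprn_gt0 // -mulrA -exprMn (_ : 2^-1 * 4 = 2 :> R) //; lra.
rewrite -mulr_sumr -[leRHS]mulrA [leRHS]mulrC ler_wpM2l ?mulr_ge0 //.
have := @geometric_tail R 2^-1 0 n.+2; rewrite expr0 mulr1; apply; lra.
Qed.

Lemma sum_exp_le (N p : nat) (z : 'I_N -> nat) : (0 < N)%N ->
  ((\sum_(i < N) z i) ^ p <= N ^ p * \sum_(i < N) z i ^ p)%N.
Proof.
move=> N0; have [|i0 ei0] := @bigop.eq_bigmax _ z; first by rewrite card_ord.
apply: (@leq_trans ((N * z i0) ^ p)).
  case: p => // p; rewrite leq_exp2r // -[in leqRHS](card_ord N) -sum_nat_const.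
  by apply: leq_sum => i _; rewrite -ei0; exact: bigop.leq_bigmax.
by rewrite expnMn leq_mul2l [X in _ || (_ <= X)%N](bigD1 i0) //= leq_addr orbT.
Qed.

(** Cutting into [L] blocks: the power of the sum costs [L ^ p], the sum over blocks one more factor
    [L]. *)
Lemma Ex_moment p : exists B : R, 0 <= B /\ forall n (L : nat) a b, (0 < n)%N -> (0 < L)%N -> a <= b ->
  b <= a + pi -> Num.sqrt n%:R * (b - a) <= L%:R ->
  Ex (gauss R n.+1) (fun c => (ZZ a b c)%:R ^+ p) <= B * L%:R ^+ p.+1.
Proof.
have [B [B0 h]] := Ex_block_moment p; exists B; split=> // n L a b n0 L0 ab abp bL.
have LR : 0 < L%:R :> R by rewrite ltr0n.
pose z i (c : n.+1.-tuple R) := ZZ (cell a b L i) (cell a b L i.+1) c.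
have w i : cell a b L i.+1 - cell a b L i = (b - a) / L%:R by rewrite cellS addrC addKr.
have bz i : bmfun (fun c => (z i c)%:R ^+ p : R).
  apply: bmfunX; apply: bmfun_ZZ; first exact: cell_le.
  suff : (b - a) / L%:R <= pi by rewrite -(w i); lra.
  by rewrite ler_pdivrMr //; apply: (@le_trans _ _ (pi * 1));
    [lra|rewrite ler_wpM2l ?pi_ge0 // ler1n].
apply: (@le_trans _ _ (Ex (gauss R n.+1) (fun c => L%:R ^+ p * \sum_(i < L) (z i c)%:R ^+ p))).
  apply: Ex_le => [||c].
  - by apply: bmfunX; exact: bmfun_ZZ.
  - by apply: bmfunM; [exact: bmfun_cst|apply: bmfun_sum].
  rewrite (ZZ_cells c ab abp L0) -natrX.
  have := @sum_exp_le L p (fun i => z i c) L0.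
  by rewrite -(ler_nat R) natrM !natrX natr_sum => /le_trans; apply; rewrite !natr_sum;
     under eq_bigr do rewrite natrX.
rewrite ExZ; last by apply: bmfun_sum.
rewrite Ex_sum // exprSr mulrCA ler_wpM2l ?exprn_ge0 //.
apply: (@le_trans _ _ (\sum_(i < L) B)); last by rewrite sumr_const card_ord mulr_natr.
apply: ler_sum => i _; apply: h => //; first exact: cell_le.
by rewrite w mulrA ler_pdivrMr // mul1r.
Qed.

End zero_moments.

(** * Asymptotic independence of distant arcs *)

Section truncation.
Variable R : realType.
Implicit Types (n : nat) (a x y : R).

(* [y ^+ j * (1 - y) ^+ (n - j)] is unimodal with its mode at [y = j / n]. *)
Lemma binomial_unimodal n j x y : (j <= n)%N -> 0 < y < 1 -> 0 <= x <= 1 ->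
  (x - y) * (j%:R - n%:R * y) <= 0 ->
  (1 - x) ^+ (n - j) * x ^+ j <= (1 - y) ^+ (n - j) * y ^+ j.
Proof.
move=> jn /andP[y0 y1] /andP[x0 x1] h.
have h1 : x ^+ j <= y ^+ j * expR (j%:R * (x / y - 1)).
  rewrite expRM_natl -exprMn lerXn2r ?nnegrE ?mulr_ge0 ?expR_ge0 //; first exact: ltW.
  by rewrite mulrC -ler_pdivrMr //; have := expR_ge1Dx (x / y - 1); lra.
have h2 : (1 - x) ^+ (n - j) <= (1 - y) ^+ (n - j) * expR ((n - j)%:R * ((1 - x) / (1 - y) - 1)).
  rewrite expRM_natl -exprMn lerXn2r ?nnegrE ?mulr_ge0 ?expR_ge0 //; [lra|lra|].
  by rewrite mulrC -ler_pdivrMr; [have := expR_ge1Dx ((1 - x) / (1 - y) - 1); lra|lra].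
apply: (le_trans (ler_pM _ _ h2 h1)); rewrite ?exprn_ge0 //; first lra.
rewrite mulrACA -expRD ler_piMr ?mulr_ge0 ?exprn_ge0 //; [lra|lra|].
rewrite -[leRHS]expR0 ler_expR natrB //.
have -> : (n%:R - j%:R) * ((1 - x) / (1 - y) - 1) + j%:R * (x / y - 1) =
    (x - y) * (j%:R - n%:R * y) / (y * (1 - y)) :> R by field; lra.
by rewrite ler_pdivrMr ?mul0r // mulr_gt0 //; lra.
Qed.

(** The squared coordinates are the weights of the binomial law with parameters [n] and
    [sin a ^+ 2]. *)
Lemma vv_sqr n a (j : 'I_n.+1) :
  vv a j ^+ 2 = 'C(n, j)%:R * ((cos a ^+ 2) ^+ (n - j) * (sin a ^+ 2) ^+ j).
Proof.
rewrite /vv; move: (cos a) (sin a) => x y.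
by rewrite (exprMn _ _ (y ^+ j)) exprMn sqr_sqrtr // -!exprM (mulnC 2%N) (mulnC 2%N j) mulrA.
Qed.

Lemma vv_ge0 n a (j : 'I_n.+1) : 0 <= a <= pi / 2 -> 0 <= vv a j.
Proof.
move=> ha; have p0 := pi_gt0 R; rewrite /vv !mulr_ge0 ?sqrtr_ge0 ?exprn_ge0 //.
- apply: cos_ge0_pihalf; lra.
- apply: sin_ge0_pi; lra.
Qed.

Lemma cos_dist_le a x : 0 <= x -> x <= a -> a <= pi / 2 -> 0 <= cos a <= cos x.
Proof.
move=> x0 xa ap; have p0 := pi_gt0 R; apply/andP; split; first by apply: cos_ge0_pihalf; lra.
by rewrite leNgt; apply/negP; rewrite ltr_cos ?in_itv /=; lra.
Qed.

(** On indices beyond the mode of [a0], as seen from [a], unimodality gives [vv a j <= vv a0 j]. The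
    tail of squares is thus at most the full sum of [vv a j * vv a0 j], which [vv_gram] evaluates
    exactly: the Gram identity replaces a large deviation estimate. *)
Lemma vv_tail n a a0 d (J : pred 'I_n.+1) : 0 < a0 < pi / 2 -> 0 <= a <= pi / 2 ->
  0 <= d -> d <= `|a - a0| ->
  (forall j, J j -> (sin a ^+ 2 - sin a0 ^+ 2) * (j%:R - n%:R * sin a0 ^+ 2) <= 0) ->
  \sum_(j < n.+1 | J j) vv a j ^+ 2 <= cos d ^+ n.
Proof.
move=> a00 a1 d0 da hJ; have p0 := pi_gt0 R.
have s0 : 0 < sin a0 by apply: sin_gt0_pi; lra.
have c0 : 0 < cos a0 by apply: cos_gt0_pihalf; lra.
have cs x := cos2Dsin2 x.
have key j : J j -> vv a j <= vv a0 j.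
  move=> Jj; rewrite -(@ler_pXn2r _ 2) ?nnegrE ?vv_ge0 //; last by lra.
  rewrite !vv_sqr ler_wpM2l //.
  have -> : cos a ^+ 2 = 1 - sin a ^+ 2 by have := cs a; lra.
  have -> : cos a0 ^+ 2 = 1 - sin a0 ^+ 2 by have := cs a0; lra.
  apply: binomial_unimodal; [by rewrite -ltnS| | |exact: hJ].
    by have := cs a0; have := exprn_gt0 2 s0; have := exprn_gt0 2 c0; lra.
  by have := cs a; have := sqr_ge0 (sin a); have := sqr_ge0 (cos a); lra.
apply: (@le_trans _ _ (\sum_(j < n.+1) vv a j * vv a0 j)).
  rewrite [leLHS]big_mkcond; apply: ler_sum => j _; case: ifP => Jj.
    by rewrite expr2 ler_wpM2l ?key ?vv_ge0.
  by rewrite mulr_ge0 ?vv_ge0 //; lra.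
rewrite vv_gram -cos_norm; have := @cos_dist_le `|a - a0| d d0 da.
move=> h; have /andP[h1 h2] : 0 <= cos `|a - a0| <= cos d.
  by apply: h; have : a - a0 <= pi / 2 /\ - (a - a0) <= pi / 2 by [lra]; case; case: ler0P; lra.
by apply: lerXn2r; rewrite ?nnegrE //; lra.
Qed.

Lemma sin_sqr_le a x : 0 <= x -> x <= a -> a <= pi / 2 -> sin x ^+ 2 <= sin a ^+ 2.
Proof.
move=> x0 xa ap; have /andP[c0 c1] := cos_dist_le x0 xa ap.
have : cos a ^+ 2 <= cos x ^+ 2 by apply: lerXn2r; rewrite ?nnegrE //; lra.
have := cos2Dsin2 a; have := cos2Dsin2 x; lra.
Qed.

(** Placed at the mode of the binomial weights of the angle [a0]; the successor makes every index
    below the cut at most [n * sin a0 ^+ 2] and every other index larger. *)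
Definition cut n a0 : nat := (Num.truncn (n%:R * sin a0 ^+ 2)).+1.

Lemma cut_le n a0 j : (j < cut n a0)%N -> (j%:R : R) <= n%:R * sin a0 ^+ 2.
Proof.
rewrite ltnS => h; have n0 : 0 <= n%:R * sin a0 ^+ 2 :> R by rewrite mulr_ge0 ?sqr_ge0.
by apply: (@le_trans _ _ (Num.truncn (n%:R * sin a0 ^+ 2))%:R); [rewrite ler_nat|rewrite truncn_le].
Qed.

Lemma cut_gt n a0 j : (cut n a0 <= j)%N -> n%:R * sin a0 ^+ 2 < (j%:R : R).
Proof.
move=> h; apply: (@lt_le_trans _ _ (cut n a0)%:R); last by rewrite ler_nat.
exact: truncnS_gt.
Qed.

Lemma vv_abs n a (j : 'I_n.+1) : vv `|a| j ^+ 2 = vv a j ^+ 2.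
Proof. by rewrite !vv_sqr cos_norm; case: ger0P => // _; rewrite sinN sqrrN. Qed.

Lemma vv_piB n a (j : 'I_n.+1) : vv (pi - a) j ^+ 2 = vv a j ^+ 2.
Proof.
rewrite !vv_sqr addrC cosDpi sinDpi cosN sinN opprK sqrrN //.
Qed.

Lemma vv_tail_low n a al d : 0 <= al -> 0 < d -> al + d < pi / 2 -> `|a| <= al ->
  \sum_(j < n.+1 | (cut n (al + d) <= j)%N) vv a j ^+ 2 <= cos d ^+ n.
Proof.
move=> al0 d0 ad aal; under eq_bigr => j _ do rewrite -vv_abs.
have a0 := normr_ge0 a; apply: (@vv_tail _ _ (al + d)); rewrite ?a0 /=; try lra.
  by rewrite ler0_norm; lra.
move=> j /cut_gt cj; rewrite mulr_le0_ge0 //; last by lra.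
by rewrite subr_le0 sin_sqr_le //; lra.
Qed.

(** The squared coordinates are invariant under the reflection of [a] to [pi - a], which reduces to
    the quarter turn where [vv_tail] applies. *)
Lemma vv_tail_high n a al d : 0 <= al -> 0 < d -> al + d < pi / 2 ->
  al + d + d <= a -> a <= pi - (al + d + d) ->
  \sum_(j < n.+1 | (j < cut n (al + d))%N) vv a j ^+ 2 <= cos d ^+ n.
Proof.
move=> al0 d0 ad a1 a2.
wlog ap : a a1 a2 / a <= pi / 2 => [wl|].
  have [?|h] := lerP a (pi / 2); first exact: wl.
  by under eq_bigr => j _ do rewrite -vv_piB; apply: wl; lra.
apply: (@vv_tail _ _ (al + d)); try lra.
  by rewrite ger0_norm; lra.
move=> j /cut_le cj; rewrite mulr_ge0_le0 //; last by lra.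
by rewrite subr_ge0 sin_sqr_le //; lra.
Qed.

Definition vlow n j0 a (j : 'I_n.+1) : R := if (j < j0)%N then vv a j else 0.
Definition vhigh n j0 a (j : 'I_n.+1) : R := if (j < j0)%N then 0 else vv a j.

Lemma FF_low n j0 a (c : n.+1.-tuple R) : FF (low j0 c) a = dot (vlow j0 a) c.
Proof.
rewrite /FF /dot; apply: eq_bigr => j _; rewrite tnth_mktuple /vlow.
by case: ifP; rewrite ?mulr0 ?mul0r.
Qed.

Lemma FF_high n j0 a (c : n.+1.-tuple R) : FF (high j0 c) a = dot (vhigh j0 a) c.
Proof.
rewrite /FF /dot; apply: eq_bigr => j _; rewrite tnth_mktuple /vhigh.
by case: ifP; rewrite ?mulr0 ?mul0r.
Qed.

Lemma measurable_mul_le0 m (u v : 'I_m -> R) :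
  measurable_fun setT (fun c : m.-tuple R => dot u c * dot v c <= 0).
Proof.
apply: measurable_fun_ler; last exact: measurable_cst.
by apply: measurable_funM; exact: measurable_dot.
Qed.

Lemma Pr_mul_le0 m (u v : 'I_m -> R) (e : R) : \sum_j u j ^+ 2 = 1 -> 0 <= e ->
  \sum_j (u j - v j) ^+ 2 <= e ^+ 2 -> Pr (gauss R m) (fun c => dot u c * dot v c <= 0) <= e.
Proof.
move=> u1 e0 he; have mm := @measurable_mul_le0 m u v.
have [e1|e1] := lerP 1 e; first by apply: le_trans (Pr_le1 _ mm) e1.
pose N2 := \sum_j v j ^+ 2.
have N0 : 0 < N2.
  rewrite lt_neqAle sumr_ge0 ?andbT; last by move=> j _; exact: sqr_ge0.
  apply: contraL e1 => /eqP/esym N20; rewrite -leNgt.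
  have v0 j : v j = 0.
    by apply/eqP; rewrite -sqrf_eq0; apply/eqP; exact: (psumr_eq0P (fun j _ => sqr_ge0 (v j)) N20).
  rewrite -(@ler_pXn2r _ 2) ?nnegrE // expr1n -u1; apply: le_trans he.
  by apply: ler_sum => j _; rewrite v0 subr0.
have v0 : Pr (gauss R m) (fun c => dot v c == 0) = 0.
  pose r := (Num.sqrt N2)^-1.
  have r0 : r != 0 by rewrite invr_eq0 gt_eqF // sqrtr_gt0.
  have w1 : \sum_j (r * v j) ^+ 2 = 1.
    under eq_bigr => j _ do rewrite exprMn.
    by rewrite -mulr_sumr exprVn sqr_sqrtr ?ltW // mulVf // gt_eqF.
  rewrite -[RHS](Pr_dot_eq0 w1); congr Ex; apply/funext => c.
  by rewrite dotZ mulf_eq0 (negbTE r0).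
have u0 := Pr_dot_eq0 u1.
have h1 : Pr (gauss R m) (opposite u v) <= e.
  rewrite -(@ler_pXn2r _ 2) ?nnegrE ?Pr_ge0 //; apply: le_trans he.
  by have := @Pr_opposite_le R m u v; rewrite u1 mulr1; apply.
have mo := @measurable_opposite R m u v.
have mu0 := @measurable_dot_eq0 R m u; have mv0 := @measurable_dot_eq0 R m v.
have mor := measurable_or mu0 mv0.
apply: (@le_trans _ _ (Pr (gauss R m) (fun c => opposite u v c || ((dot u c == 0) || (dot v c == 0))))).
  apply: Pr_le => //; first exact: measurable_or.
  move=> c; rewrite le_eqVlt mulf_eq0 /opposite => /orP[->|->]; by rewrite ?orbT.
apply: (le_trans (Pr_or _ mo mor)); have := Pr_or (gauss R m) mu0 mv0; rewrite u0 v0.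
lra.
Qed.

(** The right-hand side is a square because [Pr_mul_le0] compares a squared distance with
    [e ^+ 2]. *)
Lemma cosX_gauss n (g : R) : (0 < n)%N -> 0 <= g -> g / Num.sqrt n%:R <= pi / 2 ->
  cos (g / Num.sqrt n%:R) ^+ n <= expR (- g ^+ 2 / 4) ^+ 2.
Proof.
move=> n0 g0 gp; have s0 : 0 < Num.sqrt n%:R :> R by rewrite sqrtr_gt0 ltr0n.
have p0 := pi_gt0 R.
have gs : 0 <= g / Num.sqrt n%:R by rewrite divr_ge0 // ltW.
apply: (@le_trans _ _ (expR (- (g / Num.sqrt n%:R) ^+ 2 / 2) ^+ n)).
  apply: lerXn2r; rewrite ?nnegrE ?expR_ge0 ?cos_le_gauss //.
  by apply: cos_ge0_pihalf; lra.
rewrite -!expRM_natl ler_expR expr_div_n sqr_sqrtr //.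
have n1 : (n%:R : R) != 0 by rewrite pnatr_eq0 -lt0n.
rewrite le_eqVlt; apply/orP; left; apply/eqP; by field.
Qed.

Lemma Pr_low n al a g : (0 < n)%N -> 0 <= al -> 0 < g -> al + g / Num.sqrt n%:R < pi / 2 ->
  `|a| <= al ->
  Pr (gauss R n.+1) (fun c => FF c a * FF (low (cut n (al + g / Num.sqrt n%:R)) c) a <= 0) <=
  expR (- g ^+ 2 / 4).
Proof.
move=> n0 al0 g0 ag aal; under [fun c : n.+1.-tuple R => _]eq_fun do rewrite FF_low.
have s0 : 0 < Num.sqrt n%:R :> R by rewrite sqrtr_gt0 ltr0n.
have gs : 0 < g / Num.sqrt n%:R by rewrite divr_gt0.
apply: Pr_mul_le0; [exact: vv_norm|exact: expR_ge0|].
apply: le_trans (cosX_gauss n0 (ltW g0) _); last by lra.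
apply: le_trans (vv_tail_low n al0 gs ag aal).
rewrite [leRHS]big_mkcond; apply: ler_sum => j _; rewrite /vlow.
by case: ltnP => _; rewrite ?subrr ?expr0n ?subr0.
Qed.

Lemma Pr_high n al a g : (0 < n)%N -> 0 <= al -> 0 < g -> al + g / Num.sqrt n%:R < pi / 2 ->
  al + g / Num.sqrt n%:R + g / Num.sqrt n%:R <= a ->
  a <= pi - (al + g / Num.sqrt n%:R + g / Num.sqrt n%:R) ->
  Pr (gauss R n.+1) (fun c => FF c a * FF (high (cut n (al + g / Num.sqrt n%:R)) c) a <= 0) <=
  expR (- g ^+ 2 / 4).
Proof.
move=> n0 al0 g0 ag a1 a2; under [fun c : n.+1.-tuple R => _]eq_fun do rewrite FF_high.
have s0 : 0 < Num.sqrt n%:R :> R by rewrite sqrtr_gt0 ltr0n.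
have gs : 0 < g / Num.sqrt n%:R by rewrite divr_gt0.
apply: Pr_mul_le0; [exact: vv_norm|exact: expR_ge0|].
apply: le_trans (cosX_gauss n0 (ltW g0) _); last by lra.
apply: le_trans (vv_tail_high n al0 gs ag a1 a2).
rewrite [leRHS]big_mkcond; apply: ler_sum => j _; rewrite /vhigh.
by case: ltnP => _; rewrite ?subrr ?expr0n ?subr0.
Qed.

End truncation.

(** * Zeros versus sign changes on a grid *)

Section crossing_counts.
Variable R : realType.
Implicit Types (n k M : nat) (p q : R).

Definition crs n p q M (c : n.+1.-tuple R) : nat :=
  (\sum_(j < M) cross (cell p q M j) (cell p q M j.+1) c)%N.

Lemma crs_le_size n p q M (c : n.+1.-tuple R) : (crs p q M c <= M)%N.
Proof.
rewrite -[leqRHS](card_ord M) -sum1_card; apply: leq_sum => j _; exact: leq_b1.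
Qed.

Lemma crs_le_ZZ n p q M (c : n.+1.-tuple R) : p <= q -> q <= p + pi -> (0 < M)%N ->
  (crs p q M c <= ZZ p q c)%N.
Proof.
rewrite le_eqVlt => /orP[/eqP -> _ M0|pq qp M0].
  rewrite /crs big1 // => j _; rewrite /cell subrr !mul0r /cross -expr2.
  by rewrite ltNge sqr_ge0.
have := @cross_le_ZZ R n c (cell p q M) M (fun i _ => cell_lt i pq M0).
by rewrite cell0 cellN //; exact.
Qed.

Lemma bmfun_crs n p q M : bmfun (fun c : n.+1.-tuple R => (crs p q M c)%:R : R).
Proof. exact: bmfun_crosses. Qed.

Lemma measurable_nat_neq d (T : measurableType d) (X Y : T -> nat) :
  measurable_fun setT (fun c => (X c)%:R : R) -> measurable_fun setT (fun c => (Y c)%:R : R) ->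
  measurable_fun setT (fun c => X c != Y c).
Proof.
move=> mX mY; rewrite (_ : (fun c => _) = (fun c => ~~ ((X c)%:R == (Y c)%:R :> R))).
  by apply: measurable_neg; exact: measurable_fun_eqr.
by apply/funext => c; rewrite eqr_nat.
Qed.

Lemma small_width n p q : (0 < n)%N -> p <= q -> Num.sqrt n%:R * (q - p) <= 1 -> q - p <= 1.
Proof.
move=> n0 pq; apply: le_trans; rewrite ler_peMl ?subr_ge0 //.
by rewrite -[leLHS]sqrtr1 ler_wsqrtr // ler1n.
Qed.

(** Both means are known exactly, so the deficit is at most [M] times the cubic error of [phi_close]
    at a cell of rescaled length at most [1 / M]. *)
Lemma Ex_ZZ_crs n p q M : (0 < n)%N -> (0 < M)%N -> p <= q -> Num.sqrt n%:R * (q - p) <= 1 ->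
  Ex (gauss R n.+1) (fun c => (ZZ p q c)%:R - (crs p q M c)%:R) <= (M%:R ^+ 2)^-1.
Proof.
move=> n0 M0 pq pq1; have s0 : 0 < Num.sqrt n%:R :> R by rewrite sqrtr_gt0 ltr0n.
have p2 := pi_ge2 R; have pq2 := small_width n0 pq pq1.
have MR : 0 < M%:R :> R by rewrite ltr0n.
have M1 : 1 <= M%:R :> R by rewrite ler1n.
have w i : cell p q M i.+1 - cell p q M i = (q - p) / M%:R by rewrite cellS addrC addKr.
have w1 : (q - p) / M%:R <= 1 by rewrite ler_pdivrMr //; lra.
rewrite ExB; [|by apply: bmfun_ZZ; lra|exact: bmfun_crs].
rewrite Ex_ZZ //; last by lra.
rewrite Ex_crosses; [|by move=> i _; exact: cell_le|by move=> i _; rewrite w].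
under eq_bigr => i _ do rewrite w.
rewrite sumr_const card_ord -[X in _ - X]mulr_natl.
pose u := Num.sqrt n%:R * ((q - p) / M%:R); pose f := phi n ((q - p) / M%:R).
have u0 : 0 <= u by rewrite mulr_ge0 ?sqrtr_ge0 // divr_ge0 // subr_ge0.
have uM : u <= M%:R^-1 by rewrite /u mulrA ler_pdivrMr // mulVf ?gt_eqF.
have u1 : u <= 1 by apply: (le_trans uM); rewrite invf_le1.
have uf : `|f - u| <= u ^+ 3 by apply: phi_close => //; rewrite divr_ge0 ?subr_ge0.
have -> : Num.sqrt n%:R * (q - p) / pi - M%:R * (phi n ((q - p) / M%:R) / pi) = M%:R * (u - f) / pi.
  have pn : (pi : R) != 0 by rewrite gt_eqF // pi_gt0.
  have Mn : (M%:R : R) != 0 by rewrite gt_eqF.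
  rewrite /u /f; move: (phi _ _) pn => F; move: (pi : R) => P pn.
  by field; rewrite pn Mn.
rewrite ler_pdivrMr ?pi_gt0 //.
have h3 : u - f <= M%:R^-1 ^+ 3.
  apply: (@le_trans _ _ (u ^+ 3)); first by move: uf; rewrite ler_norml; lra.
  by rewrite lerXn2r ?nnegrE // invr_ge0 ltW.
apply: (@le_trans _ _ (M%:R * M%:R^-1 ^+ 3)); first by rewrite ler_wpM2l.
have -> : M%:R * M%:R^-1 ^+ 3 = (M%:R ^+ 2)^-1 :> R by field; rewrite gt_eqF.
rewrite ler_peMr ?invr_ge0 ?exprn_ge0 //; lra.
Qed.

(** The difference of the counts is a nonnegative integer, so its mean dominates the probability
    that it is nonzero. *)
Lemma Pr_ZZ_crs n p q M : (0 < n)%N -> (0 < M)%N -> p <= q -> Num.sqrt n%:R * (q - p) <= 1 ->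
  Pr (gauss R n.+1) (fun c => ZZ p q c != crs p q M c) <= (M%:R ^+ 2)^-1.
Proof.
move=> n0 M0 pq pq1; have p2 := pi_ge2 R; have pq2 := small_width n0 pq pq1.
apply: le_trans (Ex_ZZ_crs n0 M0 pq pq1).
have bZ : bmfun (fun c : n.+1.-tuple R => (ZZ p q c)%:R : R) by apply: bmfun_ZZ; lra.
apply: Ex_le => [||c].
- apply: bmfun_bool; exact: (measurable_nat_neq bZ.1 (bmfun_crs n p q M).1).
- by apply: bmfunB => //; exact: bmfun_crs.
have h : (crs p q M c <= ZZ p q c)%N by apply: crs_le_ZZ => //; lra.
rewrite -natrB // ler_nat; case: eqVneq => //= ne.
by rewrite subn_gt0 ltn_neqAle h andbT eq_sym.
Qed.

End crossing_counts.

Section products.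
Context d (T : measurableType d) (R : realType) (P : probability T R).

Lemma Ex_close (f g : T -> R) (bad : T -> bool) (K : R) : bmfun f -> bmfun g ->
  measurable_fun setT bad -> (forall x, ~~ bad x -> f x = g x) ->
  (forall x, 0 <= f x <= K) -> (forall x, 0 <= g x <= K) ->
  `|Ex P f - Ex P g| <= K * Pr P bad.
Proof.
move=> bf bg mb fg f0 g0; rewrite -ExB //; apply: (le_trans (Ex_norm _ (bmfunB bf bg))).
rewrite /Pr -ExZ; last exact: bmfun_bool.
apply: Ex_le.
- by apply: bmfun_norm; exact: bmfunB.
- by apply: bmfunM; [exact: bmfun_cst|exact: bmfun_bool].
move=> x; have := f0 x; have := g0 x; case: (boolP (bad x)) => bx.
  by rewrite mulr1 ler_norml; lra.
by rewrite fg // subrr normr0 mulr0.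
Qed.

Variable I : Type.

Lemma prod_le_sum_pow (x : I -> nat) (l : seq I) k : (size l <= k)%N ->
  (\prod_(i <- l) x i <= 2 + \sum_(i <- l) x i ^ k)%N.
Proof.
move=> lk; pose M := (\max_(i <- l) x i)%N.
have h1 : (\prod_(i <- l) x i <= M ^ size l)%N.
  rewrite /M {lk M}; elim: l => [|i l IH]; first by rewrite big_nil.
  rewrite !big_cons /= expnS leq_mul ?leq_maxl //; apply: (leq_trans IH).
  by case: (size l) => // s; rewrite leq_exp2r // leq_maxr.
have h2 : (M ^ k <= 1 + \sum_(i <- l) x i ^ k)%N.
  rewrite /M {lk h1 M}; elim: l => [|i l IH].
    by rewrite !big_nil; case: k => // k; rewrite exp0n.
  rewrite !big_cons /maxn; case: ifP => _.
    by apply: (leq_trans IH); rewrite leq_add2l leq_addl.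
  by rewrite addnCA leq_addr.
apply: (leq_trans h1); have [->|M0] := posnP M.
  by case: (size l) => [|s]; [rewrite expn0 addSn|rewrite exp0n].
apply: (@leq_trans (M ^ k)); first by rewrite leq_pexp2l.
by apply: (leq_trans h2); rewrite leq_add2r.
Qed.

Lemma prod_le_cst (x : I -> R) (K : R) (l : seq I) k : 1 <= K -> (forall i, 0 <= x i <= K) ->
  (size l <= k)%N -> 0 <= \prod_(i <- l) x i <= K ^+ k.
Proof.
move=> K1 x0 lk; have : 0 <= \prod_(i <- l) x i <= K ^+ size l.
  elim: l {lk} => [|i l IH]; first by rewrite big_nil ler01 lexx.
  rewrite big_cons exprS; have /andP[a b] := x0 i; have /andP[e f] := IH.
  by rewrite mulr_ge0 // ler_pM.
by case/andP => -> /le_trans; apply; rewrite ler_weXn2l.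
Qed.

End products.

Section moments_of_blocks.
Variables (R : realType) (I : eqType).
Implicit Types (n k M : nat) (p q : I -> R) (l : seq I).

(** The word [l] lists blocks, possibly with repetition; a repeated letter contributes a power. *)
Definition mom n p q l : R := Ex (gauss R n.+1) (fun c => \prod_(i <- l) (ZZ (p i) (q i) c)%:R).

Definition unit_blocks n p q := forall i, p i <= q i /\ Num.sqrt n%:R * (q i - p i) <= 1.

Lemma bmfun_block n p q i : (0 < n)%N -> unit_blocks n p q ->
  bmfun (fun c : n.+1.-tuple R => (ZZ (p i) (q i) c)%:R : R).
Proof.
move=> n0 ub; have [pq pq1] := ub i; have := small_width n0 pq pq1; have := pi_ge2 R.
by move=> *; apply: bmfun_ZZ; lra.
Qed.

Lemma mom_bound k : exists B : R, 1 <= B /\ forall n p q l, (0 < n)%N -> unit_blocks n p q ->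
  (size l <= k)%N -> 0 <= mom n p q l <= B.
Proof.
have [B [B0 h]] := Ex_block_moment R k; exists (2 + k%:R * B); split=> [|n p q l n0 ub lk].
  by have : 0 <= k%:R * B by [rewrite mulr_ge0]; lra.
have bz i := bmfun_block i n0 ub.
rewrite Ex_ge0 => [|c]; last by apply: prodr_ge0.
apply: (@le_trans _ _ (Ex (gauss R n.+1) (fun c => 2 + \sum_(i <- l) (ZZ (p i) (q i) c)%:R ^+ k))).
  apply: Ex_le => [||c].
  - by apply: bmfun_prod => i; exact: bz.
  - by apply: bmfunD; [exact: bmfun_cst|apply: bmfun_sum => i; exact: bmfunX].
  have := prod_le_sum_pow (fun i => ZZ (p i) (q i) c) lk.
  rewrite -(ler_nat R) natr_prod natrD natr_sum => /le_trans; apply.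
  by rewrite lerD2l; apply: ler_sum => i _; rewrite natrX.
rewrite ExD; [|exact: bmfun_cst|by apply: bmfun_sum => i; exact: bmfunX].
rewrite Ex_cst Ex_sum; last by move=> i; exact: bmfunX.
rewrite /= lerD2l; apply: (@le_trans _ _ (\sum_(i <- l) B)).
  by apply: ler_sum => i _; have [pq pq1] := ub i; exact: h.
by rewrite big_const_seq count_predT iter_addr_0 -[leLHS]mulr_natl ler_wpM2r // ler_nat.
Qed.

(** The two products differ on an event of probability at most [k / M ^+ 2]. There the product of
    zero counts has no bound uniform in the degree, so [Ex_mul_le] is used with its second moment,
    which is the moment of the word [l ++ l]. *)
Lemma mom_crs k : exists C : R, 0 <= C /\ forall n p q l M, (0 < n)%N -> unit_blocks n p q ->
  (size l <= k)%N -> (0 < M)%N ->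
  `|mom n p q l - Ex (gauss R n.+1) (fun c => \prod_(i <- l) (crs (p i) (q i) M c)%:R)| <= C / M%:R.
Proof.
have [B [B1 hB]] := mom_bound (k + k); exists (k%:R + B); split=> [|n p q l M n0 ub lk M0].
  by have : 0 <= k%:R :> R by []; lra.
have MR : 0 < M%:R :> R by rewrite ltr0n.
have bz i := bmfun_block i n0 ub.
pose X (c : n.+1.-tuple R) := \prod_(i <- l) (ZZ (p i) (q i) c)%:R : R.
pose S (c : n.+1.-tuple R) := \prod_(i <- l) (crs (p i) (q i) M c)%:R : R.
have bX : bmfun X by apply: bmfun_prod => i; exact: bz.
have bS : bmfun S by apply: bmfun_prod => i; exact: bmfun_crs.
pose b i (c : n.+1.-tuple R) := ZZ (p i) (q i) c != crs (p i) (q i) M c.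
have mb i : measurable_fun setT (b i).
  exact: (measurable_nat_neq (bz i).1 (bmfun_crs n (p i) (q i) M).1).
pose bad (c : n.+1.-tuple R) := has (b^~ c) l.
have mbad : measurable_fun setT bad by exact: measurable_has.
have bbad := @bmfun_bool _ _ R _ mbad.
have X0 c : 0 <= X c by apply: prodr_ge0.
have SX c : 0 <= S c <= X c.
  rewrite prodr_ge0 //=; apply: ler_prod => i _; rewrite ler0n ler_nat /=.
  have [pq pq1] := ub i; have := small_width n0 pq pq1; have := pi_ge2 R.
  by move=> *; apply: crs_le_ZZ => //; lra.
have step : `|Ex (gauss R n.+1) X - Ex (gauss R n.+1) S| <=
    Ex (gauss R n.+1) (fun c => (bad c)%:R * X c).
  rewrite -ExB //; apply: (le_trans (Ex_norm _ (bmfunB bX bS))); apply: Ex_le.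
  - by apply: bmfun_norm; exact: bmfunB.
  - exact: bmfunM.
  move=> c; have := SX c; case: (boolP (bad c)) => bc.
    by rewrite mul1r ler_norml; lra.
  rewrite (_ : S c = X c) ?subrr ?normr0 ?mul0r // /S /X big_seq [RHS]big_seq.
  apply: eq_bigr => i il; move: bc; rewrite -all_predC => /allP/(_ i il) /=.
  by rewrite negbK => /eqP ->.
apply: (le_trans step).
have hP : Ex (gauss R n.+1) (fun c => (bad c)%:R) <= k%:R / M%:R ^+ 2.
  apply: (le_trans (@Pr_has _ _ R (gauss R n.+1) _ l b mb)).
  apply: (@le_trans _ _ (\sum_(i <- l) (M%:R ^+ 2)^-1)).
    by apply: ler_sum => i _; have [pq pq1] := ub i; exact: Pr_ZZ_crs.
  by rewrite big_const_seq count_predT iter_addr_0 -[leLHS]mulr_natl ler_wpM2r ?invr_ge0 ?exprn_ge0 // ler_nat.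
have b01 c : 0 <= (bad c)%:R :> R by [].
(* The threshold [M] balances the two terms: [M] times [k / M ^+ 2], and the second moment over
   [M]. *)
apply: (le_trans (@Ex_mul_le _ _ R (gauss R n.+1) _ _ M%:R 1 bbad bX MR b01 X0)).
rewrite expr1 mulrDl; apply: lerD.
  apply: (@le_trans _ _ (M%:R * (k%:R / M%:R ^+ 2))); first by rewrite ler_wpM2l // ltW.
  by rewrite le_eqVlt; apply/orP; left; apply/eqP; field; rewrite gt_eqF.
rewrite ler_wpM2r ?invr_ge0 //.
have lk2 : (size (l ++ l) <= k + k)%N by rewrite size_cat leq_add.
have /andP[_ h2] := hB n p q (l ++ l) n0 ub lk2.
apply: le_trans h2; apply: Ex_le.
- by apply: bmfunM => //; exact: bmfunX.
- by apply: bmfun_prod => i; exact: bz.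
move=> c; rewrite big_cat /= -/(X c) -expr2.
by case: (bad c); rewrite ?mul1r // mul0r sqr_ge0.
Qed.

Lemma mom_rot n p q s l : (forall i, p i <= q i) -> (forall i, q i <= p i + pi) ->
  mom n (fun i => p i + s) (fun i => q i + s) l = mom n p q l.
Proof.
move=> pq qp; rewrite /mom.
under [fun c : n.+1.-tuple R => _]eq_fun do under eq_bigr => i _ do rewrite ZZ_rot //.
rewrite (Ex_lact (vv_rot_unitary n s) (f := fun c => \prod_(i <- l) (ZZ (p i) (q i) c)%:R)) //.
by apply: bmfun_prod => i; exact: bmfun_ZZ.
Qed.

End moments_of_blocks.

(** * Factorization of the moments of separated groups of blocks *)

Section decoupling.
Variables (R : realType) (I : eqType).
Implicit Types (n k M : nat) (p q : I -> R) (l : seq I).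

(** Completing the square: [G * k <= G ^+ 2 / 16 + 4 * k ^+ 2]. *)
Lemma gauss_tail_beats_exp k : exists C : R, 0 <= C /\
  forall G : nat, 2 ^+ (G * k) * expR (- (G%:R / 2) ^+ 2 / 4) <= C.
Proof.
exists (expR (4 * k%:R ^+ 2)); split; first exact: expR_ge0.
move=> G; have h2 : 2 <= expR 1 :> R by have := expR_ge1Dx (1 : R); lra.
apply: (@le_trans _ _ (expR 1 ^+ (G * k) * expR (- (G%:R / 2) ^+ 2 / 4))).
  by rewrite ler_wpM2r ?expR_ge0 // lerXn2r ?nnegrE ?expR_ge0.
rewrite -expRM_natl -expRD ler_expR mulr1 natrM.
have := sqr_ge0 (G%:R / 4 - 2 * k%:R : R); rewrite sqrrB !exprMn !expr2; lra.
Qed.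

Lemma same_sign (x y u v : R) : 0 < x * u -> 0 < y * v -> (x * y < 0) = (u * v < 0).
Proof.
move=> xu yv; have h : 0 < (x * y) * (u * v) by rewrite mulrACA mulr_gt0.
have [a|a|a] := ltrgt0P (x * y); have [b|b|b] := ltrgt0P (u * v) => //.
- by have := pmulr_rlt0 (u * v) a; rewrite b; lra.
- by have := nmulr_rlt0 (u * v) a; rewrite b; lra.
- by rewrite b mulr0 ltxx in h.
- by rewrite a mul0r ltxx in h.
Qed.

Lemma crs_same_sign n (a b : R) M (c c' : n.+1.-tuple R) :
  ~~ has (fun j => FF c (cell a b M j) * FF c' (cell a b M j) <= 0) (iota 0 M.+1) ->
  crs a b M c = crs a b M c'.
Proof.
rewrite -all_predC => /allP h; apply: eq_bigr => j _; rewrite /cross; congr (nat_of_bool _).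
have jM := ltn_ord j.
by apply: same_sign; rewrite ltNge; apply: h; rewrite mem_iota /= add0n ltnS // ltnW.
Qed.

(** A product of sign change counts depends only on signs at grid points, [M.+1] for each letter. A
    union bound over these points is multiplied by the largest possible value [M ^ k] of the
    product. *)
Lemma Ex_prod_crs_trunc n p q l M k (tr : I -> n.+1.-tuple R -> n.+1.-tuple R) (e : R) :
  (0 < M)%N -> (size l <= k)%N -> 0 <= e ->
  (forall i, measurable_fun setT (tr i)) ->
  (forall i j, i \in l -> (j <= M)%N ->
    Pr (gauss R n.+1) (fun c => FF c (cell (p i) (q i) M j) * FF (tr i c) (cell (p i) (q i) M j) <= 0) <= e) ->
  `|Ex (gauss R n.+1) (fun c => \prod_(i <- l) (crs (p i) (q i) M c)%:R) -
    Ex (gauss R n.+1) (fun c => \prod_(i <- l) (crs (p i) (q i) M (tr i c))%:R)| <=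
  M%:R ^+ k * (k%:R * (M.+1%:R * e)).
Proof.
move=> M0 lk e0 mtr he; have M1 : 1 <= M%:R :> R by rewrite ler1n.
pose b i j (c : n.+1.-tuple R) := FF c (cell (p i) (q i) M j) * FF (tr i c) (cell (p i) (q i) M j) <= 0.
have mb i j : measurable_fun setT (b i j).
  apply: measurable_fun_ler; last exact: measurable_cst.
  apply: measurable_funM; first exact: measurable_FF.
  exact: (measurableT_comp (@measurable_FF R n _) (mtr i)).
pose bi i (c : n.+1.-tuple R) := has (fun j => b i j c) (iota 0 M.+1).
have mbi i : measurable_fun setT (bi i) by exact: (@measurable_has _ _ _ _ (b i)).
pose bad (c : n.+1.-tuple R) := has (bi^~ c) l.
have mbad : measurable_fun setT bad by exact: measurable_has.
have btr i : bmfun (fun c : n.+1.-tuple R => (crs (p i) (q i) M (tr i c))%:R : R).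
  exact: (bmfun_comp (mtr i) (@bmfun_crs R n (p i) (q i) M)).
have c0 i (c : n.+1.-tuple R) : 0 <= ((crs (p i) (q i) M c)%:R : R) <= M%:R.
  by rewrite ler0n ler_nat crs_le_size.
have close : `|Ex (gauss R n.+1) (fun c => \prod_(i <- l) (crs (p i) (q i) M c)%:R) -
    Ex (gauss R n.+1) (fun c => \prod_(i <- l) (crs (p i) (q i) M (tr i c))%:R)| <=
    M%:R ^+ k * Pr (gauss R n.+1) bad.
  apply: Ex_close => //.
  - by apply: bmfun_prod => i; exact: bmfun_crs.
  - exact: bmfun_prod.
  - move=> c; rewrite -all_predC => /allP nb; rewrite big_seq [RHS]big_seq.
    by apply: eq_bigr => i il; rewrite (@crs_same_sign n _ _ _ c (tr i c)) //; exact: nb.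
  - by move=> c; exact: (prod_le_cst M1 (fun i => c0 i c) lk).
  - by move=> c; exact: (prod_le_cst M1 (fun i => c0 i (tr i c)) lk).
apply: (le_trans close); rewrite ler_wpM2l ?exprn_ge0 //.
apply: (le_trans (@Pr_has _ _ R (gauss R n.+1) _ l bi mbi)).
apply: (@le_trans _ _ (\sum_(i <- l) (M.+1%:R * e))); last first.
  rewrite big_const_seq count_predT iter_addr_0 -[leLHS]mulr_natl ler_wpM2r ?ler_nat //.
  by rewrite mulr_ge0.
rewrite big_seq [leRHS]big_seq; apply: ler_sum => i il.
apply: (le_trans (@Pr_has _ _ R (gauss R n.+1) _ (iota 0 M.+1) (b i) (mb i))).
apply: (@le_trans _ _ (\sum_(j <- iota 0 M.+1) e)); last first.
  by rewrite big_const_seq count_predT size_iota iter_addr_0 -[leLHS]mulr_natl.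
rewrite big_seq [leRHS]big_seq; apply: ler_sum => j; rewrite mem_iota => /andP[_ jM].
exact: he.
Qed.

Section centered.
Variables (n : nat) (p q : I -> R) (a P : pred I) (al : R) (G : nat).
Hypotheses (n0 : (0 < n)%N) (ub : unit_blocks n p q) (al0 : 0 <= al) (G0 : (0 < G)%N).
Let gap : R := G%:R / Num.sqrt n%:R.
Hypotheses (alG : al + gap <= pi / 2).
Hypotheses (inA : forall i, P i -> a i -> - al <= p i /\ q i <= al).
Hypotheses (inB : forall i, P i -> ~~ a i -> al + gap <= p i /\ q i <= pi - (al + gap)).

(** The coefficients are cut at the mode of the angle in the middle of the gap, at rescaled distance
    [G / 2] from both groups. *)
Let j0 := cut n (al + (G%:R / 2) / Num.sqrt n%:R).
Let tr (i : I) (c : n.+1.-tuple R) := if a i then low j0 c else high j0 c.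

Lemma cell_between i M j : (j <= M)%N -> p i <= cell (p i) (q i) M j <= q i.
Proof. by move=> jM; have [pq _] := ub i; rewrite cell_ge // cell_le_end. Qed.

Lemma Pr_tr i M j : P i -> (j <= M)%N ->
  Pr (gauss R n.+1) (fun c => FF c (cell (p i) (q i) M j) * FF (tr i c) (cell (p i) (q i) M j) <= 0)
  <= expR (- (G%:R / 2) ^+ 2 / 4).
Proof.
move=> Pi jM; have /andP[c1 c2] := cell_between i jM.
have s0 : 0 < Num.sqrt n%:R :> R by rewrite sqrtr_gt0 ltr0n.
have g0 : 0 < G%:R / 2 :> R by rewrite divr_gt0 // ltr0n.
have gh : G%:R / 2 / Num.sqrt n%:R + G%:R / 2 / Num.sqrt n%:R = gap by rewrite -mulrDl /gap -splitr.
have gp : 0 < G%:R / 2 / Num.sqrt n%:R :> R by rewrite divr_gt0.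
have hd : al + G%:R / 2 / Num.sqrt n%:R < pi / 2.
  by move: alG gh gp; move: (_ / _ / _) gap => x y; lra.
rewrite /tr; case: (boolP (a i)) => ai.
  have [h1 h2] := inA Pi ai; apply: Pr_low => //.
  by rewrite ler_norml; lra.
have gh' : al + G%:R / 2 / Num.sqrt n%:R + G%:R / 2 / Num.sqrt n%:R = al + gap by rewrite -addrA gh.
have [h1 h2] := inB Pi ai; apply: Pr_high => //; rewrite gh'.
  exact: le_trans h1 c1.
exact: le_trans c2 h2.
Qed.

(** After truncation the two groups read disjoint sets of coefficients, so they are exactly
    independent. *)
Lemma Ex_tr_factor l M :
  Ex (gauss R n.+1) (fun c => \prod_(i <- l) (crs (p i) (q i) M (tr i c))%:R) =
  Ex (gauss R n.+1) (fun c => \prod_(i <- seq.filter a l) (crs (p i) (q i) M (tr i c))%:R) *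
  Ex (gauss R n.+1) (fun c => \prod_(i <- seq.filter (predC a) l) (crs (p i) (q i) M (tr i c))%:R).
Proof.
pose f (c : n.+1.-tuple R) : R := \prod_(i <- seq.filter a l) (crs (p i) (q i) M c)%:R.
pose g (c : n.+1.-tuple R) : R := \prod_(i <- seq.filter (predC a) l) (crs (p i) (q i) M c)%:R.
have ef c : \prod_(i <- seq.filter a l) (crs (p i) (q i) M (tr i c))%:R = f (low j0 c).
  by rewrite /f !big_filter; apply: eq_bigr => i ai; rewrite /tr ai.
have eg c : \prod_(i <- seq.filter (predC a) l) (crs (p i) (q i) M (tr i c))%:R = g (high j0 c).
  by rewrite /g !big_filter; apply: eq_bigr => i /= /negbTE ai; rewrite /tr ai.
have efg c : \prod_(i <- l) (crs (p i) (q i) M (tr i c))%:R = f (low j0 c) * g (high j0 c).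
  by rewrite -ef -eg !big_filter (bigID a).
rewrite (_ : (fun c => \prod_(i <- l) _) = fun c => f (low j0 c) * g (high j0 c)); last exact/funext.
rewrite (_ : (fun c => \prod_(i <- seq.filter a l) _) = fun c => f (low j0 c)); last exact/funext.
rewrite (_ : (fun c => \prod_(i <- seq.filter (predC a) l) _) = fun c => g (high j0 c)); last exact/funext.
by apply: Ex_low_high; apply: bmfun_prod => i; exact: bmfun_crs.
Qed.

End centered.

(** The separation [G] also fixes the grid: [2 ^ G] cells per block give a discretization error of
    order [2 ^ -G], while the truncation error per grid point, [expR (- G ^+ 2 / 16)], beats every
    power of [2 ^ G]. *)
Lemma mixing_centered k : exists C : R, 0 <= C /\
  forall n p q (a P : pred I) (al : R) (G : nat), (0 < n)%N -> unit_blocks n p q -> 0 <= al ->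
  (0 < G)%N -> al + G%:R / Num.sqrt n%:R <= pi / 2 ->
  (forall i, P i -> a i -> - al <= p i /\ q i <= al) ->
  (forall i, P i -> ~~ a i -> al + G%:R / Num.sqrt n%:R <= p i /\
    q i <= pi - (al + G%:R / Num.sqrt n%:R)) ->
  forall l, all P l -> (size l <= k)%N ->
  `|mom n p q l - mom n p q (seq.filter a l) * mom n p q (seq.filter (predC a) l)| <= C / 2 ^+ G.
Proof.
have [B [B1 hB]] := mom_bound R I k.
have [C1 [C10 hC1]] := mom_crs R I k.
(* The exponent [k + 2] collects [M ^ k] from the size of the products, one factor [M] from the
   number of grid points, and one from the target [2 ^ -G]. *)
have [C2 [C20 hC2]] := gauss_tail_beats_exp (k + 2).
pose C := C1 + 2 * k%:R * C2.
have C0 : 0 <= C by rewrite addr_ge0 // !mulr_ge0.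
exists (C * (1 + B + (B + C))); split; first by rewrite mulr_ge0 //; lra.
move=> n p q a P al G n0 ub al0 G0 alG inA inB l Pl lk.
pose j0 := cut n (al + (G%:R / 2) / Num.sqrt n%:R).
pose tr (i : I) (c : n.+1.-tuple R) := if a i then low j0 c else high j0 c.
have mtr i : measurable_fun setT (tr i).
  by rewrite /tr; case: (a i); [exact: measurable_low|exact: measurable_high].
pose M := (2 ^ G)%N; have M0 : (0 < M)%N by rewrite expn_gt0.
have MR : M%:R = 2 ^+ G :> R by rewrite natrX.
pose z l' := Ex (gauss R n.+1) (fun c => \prod_(i <- l') (crs (p i) (q i) M (tr i c))%:R).
have g2 : 0 < 2 ^+ G :> R by rewrite exprn_gt0.
have close l' : all P l' -> (size l' <= k)%N -> `|mom n p q l' - z l'| <= C / 2 ^+ G.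
  move=> Pl' lk'; have h1 := hC1 n p q l' M n0 ub lk' M0.
  have h2 := @Ex_prod_crs_trunc n p q l' M k tr _ M0 lk' (expR_ge0 _)
    mtr (fun i j il jM => Pr_tr n0 ub al0 G0 alG inA inB (allP Pl' _ il) jM).
  apply: (le_trans (ler_distD (Ex (gauss R n.+1) (fun c => \prod_(i <- l') (crs (p i) (q i) M c)%:R)) _ _)).
  rewrite /C mulrDl -MR; apply: lerD => //; apply: (le_trans h2).
  have h3 := hC2 G; set e := expR _ in h3 *.
  rewrite MR ler_pdivlMr //.
  have hM : M.+1%:R <= 2 * 2 ^+ G :> R by rewrite -MR -natr1; have : 1 <= M%:R :> R by [rewrite ler1n]; lra.
  apply: (@le_trans _ _ ((2 ^+ G) ^+ k * (k%:R * ((2 * 2 ^+ G) * e)) * 2 ^+ G)).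
    rewrite ler_wpM2r ?exprn_ge0 // ler_wpM2l ?exprn_ge0 // ler_wpM2l //.
    by rewrite ler_wpM2r ?expR_ge0.
  have -> : (2 ^+ G) ^+ k * (k%:R * ((2 * 2 ^+ G) * e)) * 2 ^+ G = 2 * k%:R * (2 ^+ (G * (k + 2)) * e) :> R.
    rewrite mulnDr exprD !exprM; ring.
  by rewrite ler_wpM2l // mulr_ge0.
have la : all P (seq.filter a l) by rewrite all_filter; apply/sub_all: Pl => i /= ->; rewrite implybT.
have lb : all P (seq.filter (predC a) l) by rewrite all_filter; apply/sub_all: Pl => i /= ->; rewrite implybT.
have sa : (size (seq.filter a l) <= k)%N by apply: leq_trans lk; rewrite size_filter count_size.
have sb : (size (seq.filter (predC a) l) <= k)%N by apply: leq_trans lk; rewrite size_filter count_size.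
have h := close l Pl lk; have ha := close _ la sa; have hb := close _ lb sb.
have hz : z l = z (seq.filter a l) * z (seq.filter (predC a) l) by apply: Ex_tr_factor.
have /andP[ma0 ma] := hB n p q _ n0 ub sa; have /andP[mb0 mb] := hB n p q _ n0 ub sb.
set e := C / 2 ^+ G in h ha hb *; have e0 : 0 <= e by rewrite divr_ge0 // ltW.
have eC : e <= C by rewrite ler_pdivrMr // ler_peMr // exprn_ege1 //; lra.
rewrite hz in h; rewrite mulrAC -/e.
move: h ha hb ma0 ma mb0 mb.
move: (mom n p q l) (mom n p q (seq.filter a l)) (mom n p q (seq.filter (predC a) l)).
move: (z (seq.filter a l)) (z (seq.filter (predC a) l)) => za zb m ma mb h ha hb ma0 maB mb0 mbB.
have -> : m - ma * mb = (m - za * zb) + (za * (zb - mb) + (za - ma) * mb) by ring.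
have hza : `|za| <= B + C.
  have -> : za = ma - (ma - za) by ring.
  by apply: (le_trans (ler_normB _ _)); apply: lerD; [rewrite ger0_norm|apply: le_trans eC].
have k1 : `|za * (zb - mb)| <= (B + C) * e by rewrite normrM distrC ler_pM.
have k2 : `|(za - ma) * mb| <= e * B by rewrite normrM distrC ler_pM // ger0_norm.
have -> : e * (1 + B + (B + C)) = e + ((B + C) * e + e * B) by ring.
apply: (le_trans (ler_normD _ _)); apply: lerD => //.
by apply: (le_trans (ler_normD _ _)); apply: lerD.
Qed.

End decoupling.

(** * Joint cumulants *)

Section splits.
Variable I : eqType.
Implicit Types (l w T U : seq I).

(* All ways of distributing the letters of [l] over two ordered subwords. *)
Fixpoint splits l : seq (seq I * seq I) :=
  if l is x :: l' then
    [seq (x :: p.1, p.2) | p <- splits l'] ++ [seq (p.1, x :: p.2) | p <- splits l']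
  else [:: ([::], [::])].

Lemma splits_perm l p : p \in splits l -> perm_eq (p.1 ++ p.2) l.
Proof.
elim: l p => [|x l IH] p /=; first by rewrite inE => /eqP ->.
rewrite mem_cat => /orP[] /mapP[q /IH h ->] /=; first by rewrite perm_cons.
by rewrite -cat1s perm_catCA perm_cons.
Qed.

Lemma size_split l p : p \in splits l -> (size p.1 + size p.2 = size l)%N.
Proof. by move/splits_perm/perm_size; rewrite size_cat. Qed.

Lemma all_split (P : pred I) l p : p \in splits l -> all P l = all P p.1 && all P p.2.
Proof. by move/splits_perm/perm_all => <-; rewrite all_cat. Qed.

Lemma size_splits l : size (splits l) = (2 ^ size l)%N.
Proof. by elim: l => //= x l IH; rewrite size_cat !size_map IH expnS mul2n addnn. Qed.

Variable R : numDomainType.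

Lemma sum_splits_cons x l (f : seq I * seq I -> R) :
  \sum_(p <- splits (x :: l)) f p =
  \sum_(p <- splits l) f (x :: p.1, p.2) + \sum_(p <- splits l) f (p.1, x :: p.2).
Proof. by rewrite /= big_cat !big_map. Qed.

Lemma sum_splits_nil l (f : seq I * seq I -> R) :
  \sum_(p <- splits l | p.2 == [::]) f p = f (l, [::]).
Proof.
elim: l f => [|x l IH] f; first by rewrite /= big_cons big_nil eqxx addr0.
by rewrite /= big_cat !big_map /= IH big_pred0 ?addr0.
Qed.

Lemma sum_splits_neq0 l (f : seq I * seq I -> R) :
  \sum_(p <- splits l | p.2 != [::]) f p = \sum_(p <- splits l) f p - f (l, [::]).
Proof.
by rewrite [in RHS](bigID (fun p => p.2 == [::])) /= sum_splits_nil addrC addrK.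
Qed.

(** When the first subword uses letters of [a] only, all other letters are forced into the second
    one; what remains to choose is a split of the letters of [a]. *)
Lemma sum_splits_filter (a : pred I) l (f : seq I -> seq I -> seq I -> R) :
  \sum_(p <- splits l | all a p.1) f p.1 (seq.filter a p.2) (seq.filter (predC a) p.2) =
  \sum_(p <- splits (seq.filter a l)) f p.1 p.2 (seq.filter (predC a) l).
Proof.
elim: l f => [|x l IH] f; first by rewrite /= !big_cons !big_nil.
rewrite /= big_cat !big_map /=; case: (boolP (a x)) => ax /=.
  by rewrite big_cat !big_map /= (IH (fun T => f (x :: T))) (IH (fun T U => f T (x :: U))).
by rewrite big_pred0 // add0r (IH (fun T U V => f T U (x :: V))).
Qed.

End splits.

Section words.
Variables (I : eqType) (R : numDomainType).
Implicit Types (s w : seq I).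

Fixpoint words s (k : nat) : seq (seq I) :=
  if k is k'.+1 then [seq i :: w | i <- s, w <- words s k'] else [:: [::]].

Lemma sum_wordsS s k (f : seq I -> R) :
  \sum_(w <- words s k.+1) f w = \sum_(i <- s) \sum_(w <- words s k) f (i :: w).
Proof. by rewrite /= big_allpairs_dep. Qed.

Lemma mem_words s k w : w \in words s k -> size w = k /\ all (mem s) w.
Proof.
elim: k w => [|k IH] w /=; first by rewrite inE => /eqP ->.
case/allpairsP => -[i l] /= [si /IH[<- al] ->]; split=> //=.
by rewrite si al.
Qed.

Lemma sum_words_filter (p : pred I) s k (f : seq I -> R) :
  \sum_(w <- words (seq.filter p s) k) f w = \sum_(w <- words s k | all p w) f w.
Proof.
elim: k f => [|k IH] f; first by rewrite /= !big_cons !big_nil.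
rewrite sum_wordsS [RHS]big_mkcond [RHS]sum_wordsS big_filter [LHS]big_mkcond /=.
apply: eq_bigr => i _; rewrite IH [X in if _ then X else _]big_mkcond; case: (p i) => //=.
by rewrite big1.
Qed.

Lemma sum_words_prod s k (g : I -> R) :
  \sum_(w <- words s k) \prod_(i <- w) g i = (\sum_(i <- s) g i) ^+ k.
Proof.
elim: k => [|k IH]; first by rewrite /= big_cons !big_nil addr0.
rewrite sum_wordsS exprS mulr_suml; apply: eq_bigr => i _.
by rewrite -IH mulr_sumr; apply: eq_bigr => w _; rewrite big_cons.
Qed.

(** Positions are split first, through the word [nseq k tt], and the two subwords are then chosen
    freely. *)
Lemma sum_words_splits s k (f : seq I -> seq I -> R) :
  \sum_(w <- words s k) \sum_(p <- splits w) f p.1 p.2 =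
  \sum_(p <- splits (nseq k tt))
    \sum_(T <- words s (size p.1)) \sum_(U <- words s (size p.2)) f T U.
Proof.
elim: k f => [|k IH] f; first by rewrite /= !big_seq1 /= ?big_seq1.
rewrite sum_wordsS sum_splits_cons /=.
under eq_bigr => i _ do (under eq_bigr => w _ do rewrite sum_splits_cons /=; rewrite big_split /=
  (IH (fun T => f (i :: T))) (IH (fun T U => f T (i :: U)))).
rewrite big_split /= exchange_big [X in _ + X]exchange_big /=; congr (_ + _).
  by apply: eq_bigr => p _; rewrite big_allpairs_dep.
apply: eq_bigr => p _; rewrite exchange_big /=.
by apply: eq_bigr => T _; rewrite big_allpairs_dep.
Qed.

End words.

Section joint_cumulants.
Variables (I : eqType) (R : realFieldType).
Implicit Types (l w : seq I) (m : seq I -> R).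

(* [m w] is the joint moment of the variables listed in [w]; the fuel [n] only
   needs to be at least [size w]. *)
Fixpoint kapf m (n : nat) w : R :=
  if n is n'.+1 then
    if w is x :: l then
      m w - \sum_(p <- splits l | p.2 != [::]) kapf m n' (x :: p.1) * m p.2
    else 0
  else 0.

Definition kap m w := kapf m (size w) w.

Lemma kapf_fuel m n n' w : (size w <= n)%N -> (size w <= n')%N -> kapf m n w = kapf m n' w.
Proof.
elim: n n' w => [|n IH] [|n'] [|x l] //= ln ln'; congr (_ - _).
rewrite [LHS]big_seq_cond [RHS]big_seq_cond; apply: eq_bigr => p /andP[/size_split sp p2].
have ps : (size (x :: p.1) <= size l)%N.
  by rewrite -sp /=; case: p.2 p2 => // *; rewrite addnS ltnS leq_addr.
by rewrite (IH n') //; apply: leq_trans ps _.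
Qed.

(** The defining recursion freed of its fuel: in the moment-cumulant formula sorted by the block
    containing [x], the blocks without [x] recombine into the moment [m p.2]. *)
Lemma kap_cons m x l : kap m (x :: l) =
  m (x :: l) - \sum_(p <- splits l | p.2 != [::]) kap m (x :: p.1) * m p.2.
Proof.
rewrite /kap /=; congr (_ - _).
rewrite [LHS]big_seq_cond [RHS]big_seq_cond; apply: eq_bigr => p /andP[/size_split sp p2].
have ps : (size (x :: p.1) <= size l)%N.
  by rewrite -sp /=; case: p.2 p2 => // *; rewrite addnS ltnS leq_addr.
by rewrite (@kapf_fuel m _ (size (x :: p.1))).
Qed.

Lemma moment_kap m x l : m [::] = 1 ->
  m (x :: l) = \sum_(p <- splits l) kap m (x :: p.1) * m p.2.
Proof.
move=> m1; have := kap_cons m x l; rewrite sum_splits_neq0 /= m1 mulr1 => e.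
by move: e; lra.
Qed.

Lemma split_size_ltn l (p : seq I * seq I) : p \in splits l -> p.2 != [::] -> (size p.1 < size l)%N.
Proof.
move=> /size_split <-; case: p => T [|y U] //= _; by rewrite addnS ltnS leq_addr.
Qed.

(** Follows [kap_cons]: [2 ^ n'] splits of the tail, each bringing in a cumulant of a shorter
    word. *)
Fixpoint kap_cst (n : nat) : R := if n is n'.+1 then 1 + 2 ^+ n' * kap_cst n' else 1.

Lemma kap_cst_ge1 n : 1 <= kap_cst n.
Proof. by case: n => //= n; elim: n => [|n IH] /=; [lra|rewrite lerDl mulr_ge0 ?exprn_ge0 //; lra]. Qed.

Lemma kap_cst_mono n n' : (n <= n')%N -> kap_cst n <= kap_cst n'.
Proof.
elim: n' => [|n' IH]; first by rewrite leqn0 => /eqP ->.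
rewrite leq_eqVlt => /orP[/eqP -> //|/IH h]; apply: (le_trans h) => /=.
have : 1 * kap_cst n' <= 2 ^+ n' * kap_cst n'.
  by rewrite ler_wpM2r ?exprn_ege1 //; [have := kap_cst_ge1 n'; lra|lra].
lra.
Qed.

Lemma kap_bound m (P : pred I) (B : R) n w : 1 <= B ->
  (forall l, all P l -> (size l <= n)%N -> `|m l| <= B) ->
  all P w -> (size w <= n)%N -> `|kap m w| <= kap_cst (size w) * B ^+ size w.
Proof.
move=> B1 mB; have B0 : 0 <= B by lra.
have [N sN] := ubnP (size w); elim: N w sN => // N IH [|x l] sN Pw wn.
  by rewrite /kap /= normr0 mulr_ge0.
have K0 := kap_cst_ge1 (size l).
have /andP[Px Pl] : P x && all P l := Pw.
rewrite kap_cons; apply: (le_trans (ler_normB _ _)).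
have -> : kap_cst (size (x :: l)) * B ^+ size (x :: l) =
    B * B ^+ size l + \sum_(p <- splits l) (kap_cst (size l) * B ^+ size l) * B.
  rewrite big_const_seq count_predT iter_addr_0 size_splits -mulr_natl natrX /= exprS; ring.
apply: lerD.
  by apply: (le_trans (mB _ Pw wn)); rewrite ler_peMr // exprn_ege1.
apply: (le_trans (ler_norm_sum _ _ _)); rewrite big_mkcond big_seq [leRHS]big_seq.
apply: ler_sum => p ps; have := all_split P ps; rewrite Pl => /esym/andP[P1 P2].
case: ifPn => p2; last by rewrite !mulr_ge0 ?exprn_ge0 //; lra.
have s1 := split_size_ltn ps p2; have sp := size_split ps.
rewrite normrM; apply: ler_pM => //; last first.
  by apply: mB => //; apply: (@leq_trans (size l)); [rewrite -sp leq_addl|exact: ltnW].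
apply: (le_trans (IH (x :: p.1) (leq_ltn_trans s1 sN) _ _)).
- by rewrite /= Px.
- exact: leq_trans s1 (ltnW wn).
by apply: ler_pM; rewrite ?exprn_ge0 ?ler_weXn2l ?kap_cst_mono //; have := kap_cst_ge1 (size p.1).+1; rewrite /=; lra.
Qed.

Fixpoint kap_lip (n : nat) : R := if n is n'.+1 then 1 + 2 ^+ n' * (kap_lip n' + kap_cst n') else 1.

Lemma kap_lip_ge1 n : 1 <= kap_lip n.
Proof.
elim: n => //= n IH; rewrite lerDl mulr_ge0 ?exprn_ge0 //; have := kap_cst_ge1 n; lra.
Qed.

Lemma kap_lip_mono n n' : (n <= n')%N -> kap_lip n <= kap_lip n'.
Proof.
elim: n' => [|n' IH]; first by rewrite leqn0 => /eqP ->.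
rewrite leq_eqVlt => /orP[/eqP -> //|/IH h]; apply: (le_trans h) => /=.
have h1 := kap_cst_ge1 n'; have h2 := kap_lip_ge1 n'.
have : 1 * (kap_lip n' + kap_cst n') <= 2 ^+ n' * (kap_lip n' + kap_cst n').
  by rewrite ler_wpM2r ?exprn_ege1 //; lra.
lra.
Qed.

(** Cumulants are polynomials in the moments, hence Lipschitz where the moments are bounded; the
    constant obeys the same recursion as [kap_cst]. *)
Lemma kap_perturb m m' (P : pred I) (B d : R) n w : 1 <= B -> 0 <= d ->
  (forall l, all P l -> (size l <= n)%N -> `|m l| <= B) ->
  (forall l, all P l -> (size l <= n)%N -> `|m' l| <= B) ->
  (forall l, all P l -> (size l <= n)%N -> `|m l - m' l| <= d) ->
  all P w -> (size w <= n)%N -> `|kap m w - kap m' w| <= kap_lip (size w) * B ^+ size w * d.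
Proof.
move=> B1 d0 mB m'B md; have B0 : 0 <= B by lra.
have [N sN] := ubnP (size w); elim: N w sN => // N IH [|x l] sN Pw wn.
  by rewrite /kap /= subr0 normr0 !mulr_ge0.
have K0 := kap_cst_ge1 (size l); have L0 := kap_lip_ge1 (size l).
have /andP[Px Pl] : P x && all P l := Pw.
have sub4 (t u v z : R) : (t - u) - (v - z) = (t - v) - (u - z) by ring.
rewrite !kap_cons sub4 -sumrB.
apply: (le_trans (ler_normB _ _)).
have -> : kap_lip (size (x :: l)) * B ^+ size (x :: l) * d =
    B * B ^+ size l * d +
    \sum_(p <- splits l) ((kap_lip (size l) + kap_cst (size l)) * B ^+ size l) * B * d.
  rewrite big_const_seq count_predT iter_addr_0 size_splits -mulr_natl natrX /= exprS; ring.
apply: lerD.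
  apply: (le_trans (md _ Pw wn)); rewrite ler_peMl // -[leLHS]mulr1 ler_pM ?exprn_ege1 //.
apply: (le_trans (ler_norm_sum _ _ _)); rewrite big_mkcond big_seq [leRHS]big_seq.
apply: ler_sum => p ps; have := all_split P ps; rewrite Pl => /esym/andP[P1 P2].
case: ifPn => p2; last by rewrite !mulr_ge0 ?exprn_ge0 //; lra.
have s1 := split_size_ltn ps p2; have sp := size_split ps.
have s2 : (size p.2 <= n)%N.
  by apply: (@leq_trans (size l)); [rewrite -sp leq_addl|exact: ltnW].
have s3 : (size (x :: p.1) <= n)%N := leq_trans s1 (ltnW wn).
have P3 : all P (x :: p.1) by rewrite /= Px.
have h1 : `|kap m (x :: p.1) - kap m' (x :: p.1)| <= kap_lip (size l) * B ^+ size l * d.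
  apply: (le_trans (IH (x :: p.1) (leq_ltn_trans s1 sN) P3 s3)).
  rewrite ler_wpM2r //; apply: ler_pM; rewrite ?exprn_ge0 ?ler_weXn2l ?kap_lip_mono //.
  by have := kap_lip_ge1 (size p.1).+1; rewrite /=; lra.
have h2 : `|kap m' (x :: p.1)| <= kap_cst (size l) * B ^+ size l.
  apply: (le_trans (kap_bound B1 m'B P3 s3)).
  apply: ler_pM; rewrite ?exprn_ge0 ?ler_weXn2l ?kap_cst_mono //.
  by have := kap_cst_ge1 (size p.1).+1; rewrite /=; lra.
have -> : kap m (x :: p.1) * m p.2 - kap m' (x :: p.1) * m' p.2 =
  (kap m (x :: p.1) - kap m' (x :: p.1)) * m p.2 + kap m' (x :: p.1) * (m p.2 - m' p.2) by ring.
apply: (le_trans (ler_normD _ _)); rewrite !normrM.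
have h3 : `|kap m (x :: p.1) - kap m' (x :: p.1)| * `|m p.2| <= kap_lip (size l) * B ^+ size l * d * B.
  by apply: ler_pM => //; exact: mB.
have h4 : `|kap m' (x :: p.1)| * `|m p.2 - m' p.2| <= kap_cst (size l) * B ^+ size l * d.
  by apply: ler_pM => //; exact: md.
have h5 : 0 <= kap_cst (size l) * B ^+ size l * d by rewrite !mulr_ge0 ?exprn_ge0 //; lra.
have h6 : kap_cst (size l) * B ^+ size l * d * 1 <= kap_cst (size l) * B ^+ size l * d * B.
  by rewrite ler_wpM2l.
rewrite mulr1 in h6.
apply: (le_trans (lerD h3 (le_trans h4 h6))); rewrite le_eqVlt; apply/orP; left; apply/eqP; ring.
Qed.

(** Strong induction with the first letter in [a]. In the recursion the mixed shorter cumulants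
    vanish; in the other terms the moment of the letters outside [a] factors out, and the remaining
    sum is [moment_kap] for the letters in [a], which cancels the leading term. *)
Lemma kap_independent m (a : pred I) w : m [::] = 1 ->
  has a w -> has (predC a) w ->
  kap (fun l => m (seq.filter a l) * m (seq.filter (predC a) l)) w = 0.
Proof.
(* The product is symmetric in [a] and its complement, so the first letter may be assumed to lie in
   [a]. *)
move=> m1; wlog wa : a w / head true (map a w).
  case: w => // x l wl hx hy; case: (boolP (a x)) => ax; first exact: wl.
  rewrite -[RHS](wl (predC a) (x :: l)) //=; last first.
    by move: hx => /=; rewrite (negbTE ax) /=; congr (is_true _); apply: eq_has => z /=; rewrite negbK.
  congr kap; apply/funext => u /=; rewrite mulrC; congr (_ * m _).
  by apply: eq_filter => z /=; rewrite negbK.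
pose m' l := m (seq.filter a l) * m (seq.filter (predC a) l).
have [N sN] := ubnP (size w); elim: N w sN wa => // N IH [|x l] //= sN ax _ /orP[|nal]; first by rewrite ax.
rewrite kap_cons -/m'.
have m'1 : m' [::] = 1 by rewrite /m' /= m1 mulr1.
have m'a l' : all a l' -> m' l' = m l'.
  move=> al; rewrite /m' (all_filterP al) (_ : seq.filter (predC a) l' = [::]) ?m1 ?mulr1 //.
  by apply/eqP; rewrite -size_eq0 size_filter -leqn0 leqNgt -has_count -all_predC;
     apply/sub_all: al => z /= ->.
have e : \sum_(p <- splits l | p.2 != [::]) kap m' (x :: p.1) * m' p.2 =
    \sum_(p <- splits l | all a p.1) kap m' (x :: p.1) *
       m (seq.filter a p.2) * m (seq.filter (predC a) p.2).
  rewrite big_mkcond [RHS]big_mkcond [LHS]big_seq [RHS]big_seq; apply: eq_bigr => p ps.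
  have sp := size_split ps; case: (boolP (all a p.1)) => a1.
    rewrite ifT; first by rewrite -mulrA.
    apply: contraTneq nal => p20.
    by rewrite has_predC negbK (all_split a ps) a1 p20.
  case: ifPn => // p2; have s1 := split_size_ltn ps p2.
  by rewrite [kap _ _]IH ?mul0r //= ?ax ?orbT //; [lia|rewrite has_predC a1].
rewrite e (sum_splits_filter a l (fun T U V => kap m' (x :: T) * m U * m V)) /=.
rewrite ax -mulr_suml /=.
suff -> : \sum_(p <- splits (seq.filter a l)) kap m' (x :: p.1) * m p.2 = m (x :: seq.filter a l).
  by rewrite subrr.
have al : all a (x :: seq.filter a l) by rewrite /= ax filter_all.
rewrite -(m'a _ al) (moment_kap _ _ m'1) [LHS]big_seq [RHS]big_seq; apply: eq_bigr => p ps.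
by have := all_split a ps; rewrite filter_all => /esym/andP[_ a2]; rewrite m'a.
Qed.

End joint_cumulants.

(** * Cumulants of bounded counting variables *)

Section derivatives.
Variable R : realType.
Implicit Types (t : R).

Lemma is_derive_add t (f g : R -> R) df dg : is_derive t 1 f df -> is_derive t 1 g dg ->
  is_derive t 1 (fun u => f u + g u) (df + dg).
Proof. exact: is_deriveD. Qed.

Lemma is_derive_mul t (f g : R -> R) df dg : is_derive t 1 f df -> is_derive t 1 g dg ->
  is_derive t 1 (fun u => f u * g u) (df * g t + f t * dg).
Proof.
move=> hf hg; have h := is_deriveM hf hg; apply: (is_derive_eq h).
by rewrite /GRing.scale /= addrC mulrC.
Qed.

Lemma is_derive_opp t (f : R -> R) df : is_derive t 1 f df ->
  is_derive t 1 (fun u => - f u) (- df).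
Proof. exact: is_deriveN. Qed.

(** Arranged so that the derivative of a tilted moment reads as the moment with one more factor
    minus a product of two tilted moments. *)
Lemma is_derive_div t (f g : R -> R) df dg : g t != 0 -> is_derive t 1 f df -> is_derive t 1 g dg ->
  is_derive t 1 (fun u => f u / g u) (df / g t - f t / g t * (dg / g t)).
Proof.
move=> g0 hf hg; have hv := is_deriveV g0 hg.
apply: (is_derive_eq (is_derive_mul hf hv)).
rewrite /GRing.scale /=; by field.
Qed.

Lemma is_derive_bigsum (J : eqType) (s : seq J) (P : pred J) (h : J -> R -> R) (dh : J -> R) t :
  (forall j, j \in s -> P j -> is_derive t 1 (h j) (dh j)) ->
  is_derive t 1 (fun u => \sum_(j <- s | P j) h j u) (\sum_(j <- s | P j) dh j).
Proof.
elim: s => [|x s IH] hh.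
  under [fun u : R => _]eq_fun do rewrite big_nil.
  by rewrite big_nil; exact: is_derive_cst.
have {}IH := IH (fun j js => hh j (mem_behead (s := x :: s) js)).
rewrite big_cons; case: (boolP (P x)) => Px.
  under [fun u : R => _]eq_fun do rewrite big_cons Px.
  by apply: is_derive_add => //; apply: hh; rewrite ?mem_head.
by under [fun u : R => _]eq_fun do rewrite big_cons (negbTE Px).
Qed.

End derivatives.

Section tilted_cumulants.
Variables (R : realType) (I : eqType) (x : I) (m : R -> seq I -> R).
Hypothesis dm : forall (t : R) u, is_derive t 1 (fun s : R => m s u) (m t (x :: u) - m t u * m t [:: x]).

(* Exponential tilting turns differentiation into adding one more copy of [x]. *)
Lemma is_derive_kap l (t : R) :
  is_derive t 1 (fun s : R => kap (m s) (x :: l)) (kap (m t) [:: x, x & l]).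
Proof.
have [N sN] := ubnP (size l); elim: N l sN => // N IH l sN.
under [fun s : R => _]eq_fun do rewrite kap_cons.
pose dk (p : seq I * seq I) := kap (m t) [:: x, x & p.1] * m t p.2 +
  kap (m t) (x :: p.1) * (m t (x :: p.2) - m t p.2 * m t [:: x]).
have h : is_derive t 1 (fun s : R => m s (x :: l) - \sum_(p <- splits l | p.2 != [::]) kap (m s) (x :: p.1) * m s p.2)
    (m t [:: x, x & l] - m t (x :: l) * m t [:: x] - \sum_(p <- splits l | p.2 != [::]) dk p).
  apply: (is_derive_add (dm t (x :: l))).
  apply: is_derive_opp; apply: is_derive_bigsum => p ps p2.
  by apply: (is_derive_mul (IH p.1 (leq_trans (split_size_ltn ps p2) sN)) (dm t p.2)).
apply: (is_derive_eq h).
rewrite [in RHS]kap_cons /= big_cat !big_map /=.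
have e1 : \sum_(p <- splits l | p.2 != [::]) dk p =
   \sum_(p <- splits l | p.2 != [::]) kap (m t) [:: x, x & p.1] * m t p.2 +
   \sum_(p <- splits l | p.2 != [::]) kap (m t) (x :: p.1) * m t (x :: p.2) -
   (\sum_(p <- splits l | p.2 != [::]) kap (m t) (x :: p.1) * m t p.2) * m t [:: x].
  rewrite mulr_suml -big_split -sumrB /=; apply: eq_bigr => p _; rewrite /dk; ring.
(* The terms from the normalization in [dm] recombine into the cumulant by [kap_cons]; [e3] supplies
   the split whose second subword is the added [x] alone. *)
have e2 : \sum_(p <- splits l | p.2 != [::]) kap (m t) (x :: p.1) * m t p.2 =
  m t (x :: l) - kap (m t) (x :: l) by rewrite kap_cons; ring.
have e3 := sum_splits_neq0 l (fun p => kap (m t) (x :: p.1) * m t (x :: p.2)).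
rewrite e1 e2 e3 /=; ring.
Qed.

End tilted_cumulants.

Section one_variable.
Variable R : realType.

(** A single variable is coded by words over [unit], of which only the length matters, so that the
    results on [kap] apply unchanged. *)
Definition kap1 (mu : nat -> R) (k : nat) : R :=
  kap (fun u : seq unit => mu (size u)) (nseq k tt).

Lemma unit_seq (u : seq unit) : u = nseq (size u) tt.
Proof. by elim: u => //= -[] u {1}->. Qed.

(* Multilinearity: the cumulant of a sum of variables. *)
Lemma kap1_sum (I : eqType) (m : seq I -> R) s k :
  kap1 (fun j => \sum_(w <- words s j) m w) k = \sum_(w <- words s k) kap m w.
Proof.
have [N kN] := ubnP k; elim: N k kN => // N IH [|k] kN; first by rewrite /= big_seq1.
rewrite (sum_wordsS s k (kap m)) /kap1 -[nseq k.+1 tt]/(tt :: nseq k tt) kap_cons.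
rewrite -[size (tt :: nseq k tt)]/(size (nseq k tt)).+1 size_nseq sum_wordsS.
under [in RHS]eq_bigr => i _ do under eq_bigr => w _ do rewrite kap_cons [X in _ - X]big_mkcond.
under [in RHS]eq_bigr => i _ do rewrite big_split sumrN /= (sum_words_splits s k (fun T U => if U != [::] then kap m (i :: T) * m U else 0)).
rewrite sumrB; congr (_ - _).
rewrite exchange_big /= big_mkcond [LHS]big_seq [RHS]big_seq; apply: eq_bigr => p ps.
case: ifPn => p2; last first.
  rewrite negbK in p2; rewrite (eqP p2) /= big1 // => i _; rewrite big1 // => T _.
  by rewrite big_seq1 eqxx.
have s1 := split_size_ltn ps p2; rewrite size_nseq in s1.
have := IH (size p.1).+1; rewrite /kap1 /= -unit_seq => ->; last by apply: leq_ltn_trans s1 _.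
rewrite sum_wordsS mulr_suml; apply: eq_bigr => i _.
rewrite mulr_suml; apply: eq_bigr => T _; rewrite mulr_sumr.
rewrite [LHS]big_seq [RHS]big_seq; apply: eq_bigr => U /mem_words[sU _].
by rewrite ifT // -size_eq0 sU size_eq0.
Qed.

Lemma kap1_bound (mu : nat -> R) (B : R) k : 1 <= B ->
  (forall j, (j <= k)%N -> `|mu j| <= B) -> `|kap1 mu k| <= kap_cst R k * B ^+ k.
Proof.
move=> B1 h; rewrite -[in leRHS](size_nseq k tt).
by apply: (@kap_bound _ _ _ predT B k) => //; rewrite ?all_predT ?size_nseq // => l _; exact: h.
Qed.

Lemma kap1_perturb (mu mu' : nat -> R) (B d : R) k : 1 <= B -> 0 <= d ->
  (forall j, (j <= k)%N -> `|mu j| <= B) -> (forall j, (j <= k)%N -> `|mu' j| <= B) ->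
  (forall j, (j <= k)%N -> `|mu j - mu' j| <= d) ->
  `|kap1 mu k - kap1 mu' k| <= kap_lip R k * B ^+ k * d.
Proof.
move=> B1 d0 h h' hd; rewrite -[in leRHS](size_nseq k tt).
by apply: (@kap_perturb _ _ _ _ predT B d k) => //; rewrite ?all_predT ?size_nseq // => l _;
  [exact: h|exact: h'|exact: hd].
Qed.

Lemma eq_kap1 (mu mu' : nat -> R) k : mu =1 mu' -> kap1 mu k = kap1 mu' k.
Proof. by move=> h; congr kap1; exact/funext. Qed.

(** The moments under the weights [q v * expR (t * v)], normalized by [M 0 t], satisfy the
    hypothesis of [is_derive_kap]; the first derivative of the logarithm is the cumulant of one
    letter, each further one adds a letter, and the tilt disappears at [t = 0]. *)
Lemma derive1n_ln_expsum (N : nat) (q : nat -> R) k : (0 < k)%N ->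
  (forall v, 0 <= q v) -> \sum_(v < N) q v = 1 ->
  derive1n k (fun t => ln (\sum_(v < N) q v * expR (t * v%:R))) 0 =
  kap1 (fun j => \sum_(v < N) q v * v%:R ^+ j) k.
Proof.
case: k => // k _ q0 q1.
pose M j (t : R) : R := \sum_(v < N) q v * v%:R ^+ j * expR (t * v%:R).
have M0 t : 0 < M 0%N t.
  have [v qv] : exists v : 'I_N, 0 < q v.
    apply: contrapT => /forallNP h; have : \sum_(v < N) q v = 0.
      by apply: big1 => v _; apply/eqP; rewrite eq_le q0 andbT leNgt; apply/negP/h.
    by rewrite q1 => /eqP; rewrite oner_eq0.
  rewrite /M (bigD1 v) //= ltr_pwDl //; first by rewrite mulr1 mulr_gt0 ?expR_gt0.
  by apply: sumr_ge0 => u _; rewrite !mulr_ge0 ?expR_ge0 ?exprn_ge0.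
have dM j (t : R) : is_derive t 1 (M j) (M j.+1 t).
  rewrite /M; apply: (@is_derive_bigsum R _ (index_enum 'I_N) xpredT
    (fun (v : 'I_N) t => q v * v%:R ^+ j * expR (t * v%:R))
    (fun v : 'I_N => q v * v%:R ^+ j.+1 * expR (t * v%:R)) t) => v _ _.
  have h1 : is_derive t 1 (fun t : R => t * v%:R) (v%:R : R).
    apply: (is_derive_eq (is_derive_mul (is_derive_id t 1) (is_derive_cst (v%:R : R) t 1))).
    by rewrite mulr0 addr0 mul1r.
  have h2 := @is_derive1_comp R expR (fun t : R => t * v%:R) t _ _ (is_derive_expR (t * v%:R)) h1.
  apply: (is_derive_eq (is_derive_mul (is_derive_cst (q v * v%:R ^+ j) t 1) h2)).
  rewrite mul0r add0r exprSr /=; ring.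
pose m (t : R) (u : seq unit) := M (size u) t / M 0%N t.
have dm (t : R) u : is_derive t 1 (fun s : R => m s u) (m t (tt :: u) - m t u * m t [:: tt]).
  rewrite /m /=; apply: (is_derive_div _ (dM _ t) (dM _ t)); by rewrite gt_eqF.
have M0E : (fun t => ln (\sum_(v < N) q v * expR (t * v%:R))) = (fun t => ln (M 0%N t)).
  apply/funext => t; congr ln; apply: eq_bigr => v _; by rewrite expr0 mulr1.
rewrite M0E.
have -> : derive1n k.+1 (fun t => ln (M 0%N t)) = (fun t => kap (m t) (nseq k.+1 tt)).
  elim: k => [|k IH].
    apply/funext => t; rewrite derive1n1 derive1E.
    have h := @is_derive1_comp R (@ln R) (M 0%N) t _ _ (is_derive1_ln (M0 t)) (dM 0%N t).
    rewrite [LHS](@derive_val _ _ _ _ _ _ _ h) /= kap_cons /= big_cons big_nil eqxx subr0.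
    by rewrite /m mulrC.
  apply/funext => t; rewrite derive1nS IH derive1E.
  have h := @is_derive_kap R unit tt m dm (nseq k tt) t.
  by rewrite (@derive_val _ _ _ _ _ _ _ h).
congr kap; apply/funext => u.
have -> : m 0 u = M (size u) 0.
  rewrite /m (_ : M 0%N 0 = 1) ?divr1 // /M -[RHS]q1; apply: eq_bigr => v _.
  by rewrite mul0r expR0 expr0 !mulr1.
by rewrite /M; apply: eq_bigr => v _; rewrite mul0r expR0 mulr1.
Qed.

Lemma cumulant_bounded_nat d (T : measurableType d) (P : probability T R) (Z : T -> nat) N k :
  (0 < k)%N -> measurable_fun setT (fun w => (Z w)%:R : R) -> (forall w, (Z w < N)%N) ->
  cumulant P k (fun w => (Z w)%:R) = kap1 (fun j => Ex P (fun w => (Z w)%:R ^+ j)) k.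
Proof.
move=> k0 mZ ZN.
have mb v : measurable_fun setT (fun w => Z w == v).
  rewrite (_ : (fun w => _) = (fun w => ((Z w)%:R : R) == v%:R)); last first.
    by apply/funext => w; rewrite eqr_nat.
  by apply: measurable_fun_eqr => //; exact: measurable_cst.
have bb v : bmfun (fun w => (Z w == v)%:R : R) by exact: bmfun_bool.
have e (f : nat -> R) w : f (Z w) = \sum_(v < N) f v * (Z w == v)%:R.
  rewrite (bigD1 (Ordinal (ZN w))) //= eqxx mulr1 big1 ?addr0 // => v vZ.
  by rewrite (_ : (Z w == v) = false) ?mulr0 //; apply/negbTE; apply: contraNneq vZ => e; apply/eqP/val_inj.
have Ef (f : nat -> R) : Ex P (fun w => f (Z w)) = \sum_(v < N) Pr P (fun w => Z w == v) * f v.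
  under [fun w : T => _]eq_fun do rewrite e.
  rewrite Ex_sum; last by move=> v; apply: bmfunM => //; exact: bmfun_cst.
  by apply: eq_bigr => v _; rewrite ExZ // mulrC.
rewrite /cumulant.
have -> : (fun t => ln (fine (mmt_gen_fun P (fun w => (Z w)%:R) t))) =
    (fun t => ln (\sum_(v < N) Pr P (fun w => Z w == v) * expR (t * v%:R))).
  apply/funext => t; congr ln; rewrite -(Ef (fun v => expR (t * v%:R))).
  rewrite /mmt_gen_fun unlock /Ex /Rintegral; congr (fine (integral _ _ _)).
  by apply/funext => w /=; rewrite mulrC.
rewrite (@derive1n_ln_expsum N (fun v => Pr P (fun w => Z w == v)) k k0).
- by congr kap1; apply/funext => j; rewrite (Ef (fun v => v%:R ^+ j)).
- by move=> v; exact: Pr_ge0.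
- rewrite -[RHS](Ex_cst P 1) (Ef (fun=> 1)); by apply: eq_bigr => v _; rewrite mulr1.
Qed.

End one_variable.

(** * Almost linearity in the length of the arc *)

Section second_difference.
Variable R : realType.
Implicit Types (n k : nat).

(** Pigeonhole: one of the [k] letters lies outside the [k] windows, so the remaining ones cannot
    meet all of them. *)
Lemma empty_window (w : seq nat) k (b e G : nat) : (0 < G)%N -> size w = k -> b \in w ->
  ~~ (e <= b < e + k * G)%N ->
  exists2 j, (j < k)%N & forall i, i \in w -> ~~ (e + j * G <= i < e + j.+1 * G)%N.
Proof.
move=> G0 sw bw be; apply: contrapT => none.
pose f i := ((i - e) %/ G)%N.
have sub : {subset iota 0 k <= map f (seq.filter (fun i => (e <= i < e + k * G)%N) w)}.
  move=> j; rewrite mem_iota add0n /= => jk; apply: contrapT => nj; apply: none; exists j => // i iw.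
  apply/negP => /andP[i1 i2]; apply: nj; apply/mapP; exists i.
    rewrite mem_filter iw andbT (leq_trans (leq_addr _ _) i1) /= (leq_trans i2) //.
    by rewrite leq_add2l leq_mul2r jk orbT.
  have h1 : (j <= f i)%N by rewrite /f leq_divRL // leq_subRL // (leq_trans (leq_addr _ _) i1).
  have h2 : (f i < j.+1)%N by rewrite /f ltn_divLR // ltn_subLR // (leq_trans (leq_addr _ _) i1).
  by apply/eqP; rewrite eqn_leq h1.
have := uniq_leq_size (iota_uniq 0 k) sub; rewrite size_iota size_map size_filter leqNgt => /negP; apply.
pose p i := (e <= i < e + k * G)%N; have := count_predC p w; rewrite sw => hk.
have : (0 < count (predC p) w)%N by rewrite -has_count; apply/hasP; exists b.
by move=> h; rewrite -/p -[ltnRHS]hk -addn1 leq_add2l.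
Qed.

Lemma ZZ_periodic n (c : n.+1.-tuple R) (a b : R) : ZZ (a + pi) (b + pi) c = ZZ a b c.
Proof.
rewrite /ZZ; case: ifP => // _; rewrite /crd.
have -> : zeros c (a + pi) (b + pi) = (fun t => t + pi) @` zeros c a b.
  apply/seteqP; split => t /=.
    move=> [h ht]; exists (t - pi); last by rewrite subrK.
    split; first by lra.
    apply/eqP; have := FF_periodic c (t - pi); rewrite subrK ht => /esym/eqP.
    by rewrite mulf_eq0 signr_eq0.
  by move=> [s [h hs] <-]; split; [lra|rewrite FF_periodic hs mulr0].
have [fin|inf] := pselect (finite_set (zeros c a b)).
  by apply: (crd_image fin) => x y _ _ /addIr.
rewrite -[LHS]/(crd _) -[RHS]/(crd _) !crd_infinite // => fin; apply: inf.
have -> : zeros c a b = (fun t => t - pi) @` ((fun t => t + pi) @` zeros c a b).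
  apply/seteqP; split => t /=; first by exists (t + pi); [exists t|rewrite addrK].
  by case=> _ [u hu <-] <-; rewrite addrK.
exact: finite_image.
Qed.

(* The [k]-th cumulant of the number of zeros in [[a, b[]. *)
Definition ZK n k (a b : R) : R :=
  kap1 (fun j => Ex (gauss R n.+1) (fun c => (ZZ a b c)%:R ^+ j)) k.

Lemma ZK_rot n k a b s : a <= b -> b <= a + pi -> ZK n k (a + s) (b + s) = ZK n k a b.
Proof.
move=> ab abp; apply: eq_kap1 => j.
under [fun c : n.+1.-tuple R => _]eq_fun do rewrite ZZ_rot //.
rewrite (Ex_lact (vv_rot_unitary n s) (f := fun c => (ZZ a b c)%:R ^+ j)) //.
by apply: bmfunX; exact: bmfun_ZZ.
Qed.

(** * Blocks of an arc and separated clusters of letters *)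

Section blocks.
Variables (n k L : nat) (x : R).
Hypotheses (n0 : (0 < n)%N) (x01 : 0 <= x <= 1) (fit : L.+1%:R + x <= pi * Num.sqrt n%:R).
Let s : R := Num.sqrt n%:R.
Let b := L.+1.

(** The fractional block, of rescaled length [x], comes last and has index [L.+1]. Further ticks
    repeat the end of the arc, so every index names a legitimate block. *)
Definition tick (i : nat) : R := (if (i <= L.+1)%N then i%:R else L.+1%:R + x) / Num.sqrt n%:R.

Let s0 : 0 < s. Proof. by rewrite sqrtr_gt0 ltr0n. Qed.

Lemma tick_small i : (i <= b)%N -> tick i = i%:R / s.
Proof. by rewrite /tick => ->. Qed.

Lemma tick_big i : (b < i)%N -> tick i = (b%:R + x) / s.
Proof. by move=> bi; rewrite /tick leqNgt bi. Qed.

Lemma tick_step i : tick i <= tick i.+1 /\ s * (tick i.+1 - tick i) <= 1.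
Proof.
have /andP[x0 x1] := x01; have sn : s != 0 by rewrite gt_eqF.
have e u v : s * (u / s - v / s) = u - v by rewrite -mulrBl mulrC divfK.
have [ib|bi] := ltnP i b.
  by rewrite !tick_small ?(ltnW ib) // e -natr1 ler_pM2r ?invr_gt0 //; lra.
rewrite (tick_big (i := i.+1)) //; have [->|ne] := eqVneq i b.
  by rewrite tick_small // e ler_pM2r ?invr_gt0 //; lra.
have lt : (b < i)%N by rewrite ltn_neqAle eq_sym ne.
by rewrite tick_big // lexx subrr mulr0.
Qed.

Lemma tick_le i j : (i <= j)%N -> tick i <= tick j.
Proof.
elim: j => [|j IH]; first by rewrite leqn0 => /eqP ->.
rewrite leq_eqVlt => /orP[/eqP -> //|/IH h]; exact: le_trans h (tick_step j).1.
Qed.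

Lemma tick0 : tick 0 = 0.
Proof. by rewrite tick_small // mul0r. Qed.

Lemma tick_pi i : tick i <= pi.
Proof.
have h : (b%:R + x) / s <= pi by rewrite ler_pdivrMr.
have [ib|bi] := leqP i b; last by rewrite tick_big.
apply: le_trans h; rewrite tick_small // ler_pM2r ?invr_gt0 //.
have : i%:R <= b%:R :> R by rewrite ler_nat.
have /andP[x0 x1] := x01; lra.
Qed.

Definition bmom (l : seq nat) : R := mom n tick (fun i => tick i.+1) l.

Lemma tick_blocks : unit_blocks n tick (fun i => tick i.+1).
Proof. exact: tick_step. Qed.

(** The count is the sum of the block counts, and [kap1_sum] expands its cumulant multilinearly. *)
Lemma ZK_words u v : (u <= v)%N -> ZK n k (tick u) (tick v) = \sum_(w <- words (iota u (v - u)) k) kap bmom w.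
Proof.
move=> uv; rewrite -kap1_sum; apply: eq_kap1 => j.
pose X i (c : n.+1.-tuple R) : R := (ZZ (tick i) (tick i.+1) c)%:R.
have bX i : bmfun (X i) by apply: bmfun_block n0 tick_blocks.
have e c : (ZZ (tick u) (tick v) c)%:R ^+ j = \sum_(w <- words (iota u (v - u)) j) \prod_(i <- w) X i c.
  rewrite sum_words_prod; congr (_ ^+ _).
  have := @ZZ_grid R n c (fun i => tick (u + i)) (v - u); rewrite addn0 subnKC // => ->.
  - rewrite natr_sum -[in RHS](addn0 u) iotaDl big_map.
    rewrite -(big_mkord xpredT (fun i => (ZZ (tick (u + i)) (tick (u + i.+1)) c)%:R : R)).
    by rewrite /index_iota subn0 (addn0 u); apply: eq_bigr => i _; rewrite /X addnS.
  - by move=> i _; apply: tick_le; rewrite leq_add2l.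
  - have := tick_pi v; have := tick_le (leq0n u); rewrite tick0; lra.
under [fun c : n.+1.-tuple R => _]eq_fun do rewrite e.
by rewrite Ex_sum //; move=> w; apply: bmfun_prod.
Qed.

Section clusters.
(** The cluster consists of the letters in [[u, v[]; [P] below forbids the letters in the windows of
    length [G] on its two sides. [wrap] makes the left gap genuine on the circle: either a room [G]
    is free beyond the end of the arc, or the left window fits inside the arc. *)
Variables (i0 u v G : nat).
Hypotheses (G0 : (0 < G)%N) (ui : (u <= i0)%N) (iv : (i0 < v)%N) (vb : (v + G <= b)%N).
Hypotheses (wrap : b%:R + x + G%:R <= pi * s \/ (G <= u)%N).

Let a i := (u <= i < v)%N.
Let P i := [&& (i <= b)%N, ~~ (v <= i < v + G)%N & ~~ (u <= i + G)%N || (u <= i)%N].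

(** Blocks before the cluster are moved by one period [pi], which keeps their counts, and everything
    is then recentred at [sh]. All letters outside the cluster thereby end up on the same side of
    it, as [mixing_centered] requires. *)
Lemma shifted_mom (sh : R) l :
  mom n (fun i => tick i + (if (i < u)%N then pi else 0) - sh)
        (fun i => tick i.+1 + (if (i < u)%N then pi else 0) - sh) l = bmom l.
Proof.
rewrite mom_rot => [|i|i].
- rewrite /bmom /mom; congr Ex; apply/funext => c; apply: eq_bigr => i _.
  by case: ifP => _; rewrite ?ZZ_periodic ?addr0.
- by rewrite lerD2r; exact: (tick_step i).1.
- have := tick_pi i.+1; have := tick_le (leq0n i); rewrite tick0; lra.
Qed.

Lemma cluster_gap (C : R) (hC : forall n p q (a P : pred nat) (al : R) (G : nat), (0 < n)%N -> unit_blocks n p q -> 0 <= al ->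
  (0 < G)%N -> al + G%:R / Num.sqrt n%:R <= pi / 2 ->
  (forall i, P i -> a i -> - al <= p i /\ q i <= al) ->
  (forall i, P i -> ~~ a i -> al + G%:R / Num.sqrt n%:R <= p i /\
    q i <= pi - (al + G%:R / Num.sqrt n%:R)) ->
  forall l, all P l -> (size l <= k)%N ->
  `|mom n p q l - mom n p q (seq.filter a l) * mom n p q (seq.filter (predC a) l)| <= C / 2 ^+ G) l :
  all P l -> (size l <= k)%N ->
  `|bmom l - bmom (seq.filter a l) * bmom (seq.filter (predC a) l)| <= C / 2 ^+ G.
Proof.
move=> Pl lk; pose sh := (tick u + tick v) / 2; pose al := (tick v - tick u) / 2.
pose g := G%:R / s; have /andP[x0 x1] := x01.
have tuv : tick u <= tick v by apply: tick_le; apply: leq_trans ui (ltnW iv).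
have vb' : (v <= b)%N by apply: leq_trans vb; rewrite leq_addr.
have vG : tick v + g = (v + G)%:R / s by rewrite tick_small // /g -mulrDl natrD.
have right i : (i <= b)%N -> (v + G <= i)%N -> tick v + g <= tick i.
  by move=> ib vi; rewrite vG tick_small // ler_pM2r ?invr_gt0 // ler_nat.
(* No block comes within [g] of the copy of the cluster one period later. *)
have endg i : tick i <= pi + tick u - g.
  case: wrap => [h|Gu].
    have h1 : (b%:R + x) / s + g <= pi by rewrite /g -mulrDl ler_pdivrMr.
    have h2 : tick i <= (b%:R + x) / s.
      have [ib|bi] := leqP i b; last by rewrite tick_big.
      rewrite tick_small // ler_pM2r ?invr_gt0 //.
      have : i%:R <= b%:R :> R by rewrite ler_nat.
      lra.
    have := tick_le (leq0n u); rewrite tick0; lra.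
  have ub : (u <= b)%N by apply: leq_trans vb'; apply: leq_trans ui (ltnW iv).
  have : g <= tick u by rewrite tick_small // /g ler_pM2r ?invr_gt0 // ler_nat.
  have := tick_pi i; lra.
rewrite -!(shifted_mom sh); apply: (hC n _ _ a P al) => //.
- move=> i; have [h1 h2] := tick_step i; split; first by lra.
  by rewrite [X in _ * X](_ : _ = tick i.+1 - tick i) //; ring.
- by rewrite /al; lra.
- have := right b (leqnn _) vb; have := endg b; rewrite -/s -/g /al; lra.
- move=> i Pi /andP[ui' iv']; rewrite ltnNge ui' /=.
  by have := tick_le ui'; have := tick_le iv'; rewrite /al /sh; lra.
- move=> i /and3P[ib r l'] na; rewrite -/s -/g.
  have [iu|ui'] := ltnP i u.
    have iG : (i + G < u)%N by move: l'; rewrite leqNgt negbK (leqNgt u i) iu orbF.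
    have h1 := tick_le (leq0n i); rewrite tick0 in h1.
    have h2 : tick i.+1 + g <= tick u.
      have ub : (u <= b)%N by apply: leq_trans vb'; apply: leq_trans ui (ltnW iv).
      rewrite !tick_small ?(leq_trans _ ub) // /g -mulrDl ler_pM2r ?invr_gt0 // -natrD ler_nat.
      by rewrite addSn.
    have h3 := right b (leqnn _) vb; have h4 := tick_pi b.
    by rewrite /al /sh; split; lra.
  have vi : (v + G <= i)%N.
    move: na r; rewrite /a ui' /= -leqNgt => vi; by rewrite vi /= -leqNgt.
  by have := right i ib vi; have := endg i.+1; rewrite /al /sh; split; lra.
Qed.

End clusters.

End blocks.

End second_difference.

(** * Decay of joint cumulants and of second differences *)

Section far_letters.
Variable R : realType.
Implicit Types (n k : nat) (x : R).

Lemma bmom_bound k : exists B : R, 1 <= B /\ forall n L x l, (0 < n)%N -> 0 <= x <= 1 ->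
  (size l <= k)%N -> `|bmom n L x l| <= B.
Proof.
have [B [B1 h]] := mom_bound R nat k; exists B; split=> // n L x l n0 x01 lk.
by have /andP[h0 h1] := h n _ _ l n0 (tick_blocks L n0 x01) lk; rewrite ger0_norm.
Qed.

Lemma bmom_nil n L x : bmom n L x [::] = 1.
Proof.
rewrite /bmom /mom -[RHS](Ex_cst (gauss R n.+1) 1); congr Ex.
by apply/funext => c; rewrite big_nil.
Qed.

(** On the circle a cluster has to be isolated on both sides. An empty window is found to the right
    of [i0] before the last block, and another on the left, possibly in the free room [r]. The
    cluster and the rest are then independent up to [2 ^ -G], and [kap_independent] with
    [kap_perturb] bounds the cumulant. *)
Lemma far_cumulant k : exists C : R, 0 <= C /\ forall n L x (r D i0 : nat) (w : seq nat),
  (0 < n)%N -> 0 <= x <= 1 -> L.+1%:R + x + r%:R <= pi * Num.sqrt n%:R ->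
  size w = k -> all (fun i => (i <= L.+1)%N) w -> L.+1 \in w -> i0 \in w ->
  (D <= L.+1 - i0)%N -> (D <= r + i0)%N ->
  `|kap (bmom n L x) w| <= C / 2 ^+ (D.-1 %/ k.+1).
Proof.
have [B [B1 hB]] := bmom_bound k.
have [C [C0 hC]] := mixing_centered R nat k.
have B2 : 1 <= B ^+ 2 by rewrite expr_ge1 //; lra.
exists (kap_cst R k * B ^+ k + kap_lip R k * (B ^+ 2) ^+ k * C); split.
  have := kap_cst_ge1 R k; have := kap_lip_ge1 R k => *.
  by rewrite addr_ge0 // !mulr_ge0 ?exprn_ge0 //; lra.
move=> n L x r D i0 w n0 x01 fit sw wN bw iw D1 D2.
(* The distance has to hold [k] candidate windows of length [G] and one more length [G] to spare,
   whence the division by [k.+1]. *)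
set G := (D.-1 %/ k.+1)%N.
have T1 : 0 <= kap_cst R k * B ^+ k.
  by have := kap_cst_ge1 R k => *; rewrite mulr_ge0 ?exprn_ge0 //; lra.
have T2 : 0 <= kap_lip R k * (B ^+ 2) ^+ k * C.
  by have := kap_lip_ge1 R k => *; rewrite !mulr_ge0 ?exprn_ge0 //; lra.
have mB l : all predT l -> (size l <= k)%N -> `|bmom n L x l| <= B by move=> _; exact: hB.
have [G0|G0] := posnP G.
  rewrite G0 expr0 divr1; apply: (@le_trans _ _ (kap_cst R k * B ^+ k)); last by lra.
  by rewrite -sw; apply: (@kap_bound _ _ _ predT B k) => //; rewrite ?all_predT ?sw.
have DG : (k.+1 * G <= D.-1)%N by rewrite mulnC leq_divM.
have D0 : (0 < D)%N.
  by rewrite lt0n; apply: contraTneq G0 => D00; rewrite /G D00 div0n.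
clearbody G; rewrite mulSn in DG.
have kG : (k * G + G < D)%N by clear -DG D0; lia.
have x0 : 0 <= x by case/andP: x01.
have fit' : L.+1%:R + x <= pi * Num.sqrt n%:R by have : 0 <= r%:R :> R by []; lra.
have nb1 : ~~ (i0.+1 <= L.+1 < i0.+1 + k * G)%N by clear -kG D1; lia.
have [j1 j1k hj1] := empty_window G0 sw bw nb1.
pose v := (i0.+1 + j1 * G)%N.
have j1G : (j1.+1 * G <= k * G)%N by rewrite leq_mul2r j1k orbT.
have vb : (v + G <= L.+1)%N by rewrite /v; rewrite mulSn in j1G; clear -j1G kG D1; lia.
have rg i : i \in w -> ~~ (v <= i < v + G)%N.
  by move=> iw'; have := hj1 i iw'; rewrite /v mulSn (addnC G) addnA.
have [u [ui lg wrap]] : exists u, [/\ (u <= i0)%N, forall i, i \in w -> ~~ (u <= i + G)%N || (u <= i)%N &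
    L.+1%:R + x + G%:R <= pi * Num.sqrt n%:R \/ (G <= u)%N].
  (* If the free room holds a window, the cluster may start at 0; otherwise almost all of the
     distance lies inside the arc, and the pigeonhole is used a second time. *)
  have [Gr|rG] := leqP G r.
    exists 0%N; split=> //; left; apply: le_trans fit.
    by rewrite lerD2l ler_nat.
  have kGi : (k * G <= i0)%N by clear -kG D2 rG; lia.
  have nb2 : ~~ (i0 - k * G <= L.+1 < i0 - k * G + k * G)%N by clear -kG kGi D1; lia.
  have [j2 j2k hj2] := empty_window G0 sw bw nb2.
  have j2G : (j2.+1 * G <= k * G)%N by rewrite leq_mul2r j2k orbT.
  exists (i0 - k * G + j2.+1 * G)%N; split.
  - by clear -j2G kGi; lia.
  - by move=> i iw'; have := hj2 i iw'; rewrite mulSn; clear; lia.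
  - by right; rewrite mulSn; clear; lia.
pose a i := (u <= i < v)%N.
pose P i := [&& (i <= L.+1)%N, ~~ (v <= i < v + G)%N & ~~ (u <= i + G)%N || (u <= i)%N].
have iv : (i0 < v)%N by rewrite /v addSn ltnS leq_addr.
have gap l : all P l -> (size l <= k)%N ->
    `|bmom n L x l - bmom n L x (seq.filter a l) * bmom n L x (seq.filter (predC a) l)| <= C / 2 ^+ G.
  exact: (cluster_gap n0 x01 fit' G0 ui iv vb wrap hC).
have Pw : all P w by apply/allP => i iw'; rewrite /P (allP wN) // rg // lg.
have sz (l : seq nat) (p : pred nat) : (size l <= k)%N -> (size (seq.filter p l) <= k)%N.
  by apply: leq_trans; rewrite size_filter count_size.
have BB : B <= B ^+ 2 by rewrite expr2 ler_peMl //; lra.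
have := @kap_perturb _ _ (bmom n L x) (fun l => bmom n L x (seq.filter a l) * bmom n L x (seq.filter (predC a) l))
  P (B ^+ 2) (C / 2 ^+ G) k w B2 _ _ _ gap Pw.
rewrite (kap_independent (bmom_nil n L x)) ?subr0 ?sw; first last.
- by apply/hasP; exists L.+1 => //=; rewrite /a negb_and -!leqNgt; apply/orP; right; clear -vb G0; lia.
- by apply/hasP; exists i0 => //; rewrite /a ui iv.
move=> h; apply: (@le_trans _ _ (kap_lip R k * (B ^+ 2) ^+ k * (C / 2 ^+ G))).
  apply: h => //.
  - by rewrite divr_ge0 // exprn_ge0.
  - by move=> l _ lk; apply: le_trans BB; exact: hB.
  - by move=> l _ lk; rewrite normrM expr2 ler_pM // hB // sz.
by rewrite mulrA ler_wpM2r ?invr_ge0 ?exprn_ge0 //; lra.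
Qed.

Lemma seq_argmax (f : nat -> nat) (w : seq nat) : w != [::] ->
  exists2 i, i \in w & forall j, j \in w -> (f j <= f i)%N.
Proof.
elim: w => // x w IH _; have [->|/IH[i iw hi]] := eqVneq w [::].
  by exists x => [|j]; rewrite mem_seq1 // => /eqP ->.
have [h|h] := leqP (f x) (f i).
  by exists i => [|j]; rewrite inE ?iw ?orbT // => /orP[/eqP ->|/hi].
exists x => [|j]; rewrite inE ?eqxx // => /orP[/eqP ->|/hi] // hj.
by apply: leq_trans hj (ltnW h).
Qed.

Lemma iota_neq_last a N : iota a N = seq.filter (fun i => i != (a + N)%N) (iota a N.+1).
Proof.
rewrite -[N.+1]addn1 iotaD filter_cat /= eqxx cats0; apply/esym/all_filterP/allP => i.
by rewrite mem_iota => /andP[_ /ltn_eqF ->].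
Qed.

Lemma iota_neq0 N : iota 1 N = seq.filter (fun i => i != 0%N) (iota 0 N.+1).
Proof.
rewrite [RHS](_ : _ = seq.filter (fun i => i != 0%N) (iota 1 N)) //; apply/esym/all_filterP/allP => i.
by rewrite mem_iota => /andP[i1 _]; rewrite -lt0n.
Qed.

Lemma geometric_le (t : R) N : 0 <= t < 1 -> \sum_(i < N) t ^+ i <= (1 - t)^-1.
Proof.
move=> /andP[t0 t1]; suff : \sum_(i < N) t ^+ i = (1 - t ^+ N) / (1 - t).
  by move=> ->; rewrite ler_pdivrMr; [rewrite mulVf; [have := exprn_ge0 N t0; lra|lra]|lra].
by rewrite -[1 - t ^+ N]opprB subrX1 -mulNr opprB mulrC mulKf //; lra.
Qed.

(** The rate is weakened so that the decay [2 ^ -(D / k.+1)] pays for [k.+1] factors [t ^ D]: one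
    for each letter of a word, and one for the bound that remains after summation. *)
Lemma half_root k : exists t : R, [/\ 0 < t, t < 1 & 2^-1 <= t ^+ (k.+1 * k.+1)].
Proof.
pose q := (k.+1 * k.+1)%N; have q1 : 1 <= q%:R :> R by rewrite ler1n muln_gt0.
have qi : 0 < (2 * q%:R)^-1 :> R by rewrite invr_gt0; lra.
have qi1 : (2 * q%:R)^-1 <= 2^-1 :> R by rewrite lef_pV2 ?posrE; lra.
exists (1 - (2 * q%:R)^-1); split; [lra|lra|].
apply: le_trans (bernoulli_le _ (_ : 0 <= (2 * q%:R)^-1 <= 1)); last by lra.
have e : q%:R * (2 * q%:R)^-1 = 2^-1 :> R by field; lra.
by rewrite -/q e; lra.
Qed.

Definition arcK n k (l : R) : R := ZK n k 0 (l / Num.sqrt n%:R).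

(** Inclusion-exclusion keeps exactly the words containing both the first block 0 and the last block
    [L.+1]. Their cumulants decay in the largest distance [d], measured on the circle, from a letter
    to the last block. Sharing this decay among the letters makes the sum over words a [k]-th power
    of a geometric sum. *)
Lemma arcK_second_diff k : exists C t : R, [/\ 0 <= C, 0 < t, t < 1 & forall n (L r : nat) x,
  (0 < n)%N -> 0 <= x <= 1 -> L.+1%:R + x + r%:R <= pi * Num.sqrt n%:R ->
  `|arcK n k (L.+1%:R + x) - arcK n k L.+1%:R - arcK n k (L%:R + x) + arcK n k L%:R| <= C * (t ^+ L.+1 + t ^+ r)].
Proof.
have [C0 [C00 hC0]] := far_cumulant k.
have [t [t0 t1 ht]] := half_root k.
have g0 : 0 < (1 - t)^-1 by rewrite invr_gt0; lra.
exists (2 * C0 * (2 * (1 - t)^-1) ^+ k), t; split=> //.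
  by rewrite !mulr_ge0 ?exprn_ge0 // ltW // mulr_gt0.
move=> n L r x n0 x01 fit; set F := arcK n k.
have /andP[x0 x1] := x01; have r0 : 0 <= r%:R :> R by [].
have fit' : L.+1%:R + x <= pi * Num.sqrt n%:R by lra.
have s0 : 0 < Num.sqrt n%:R :> R by rewrite sqrtr_gt0 ltr0n.
have L0 : 0 <= L%:R :> R by [].
have fit2 : L%:R + x + 1 <= pi * Num.sqrt n%:R by move: fit'; rewrite -(natr1 L); lra.
have fit3 : L%:R + 1 <= (pi : R) * Num.sqrt n%:R by apply: le_trans fit2; rewrite lerD2r lerDl.
pose W s' := \sum_(w <- words s' k) kap (bmom n L x) w.
have zk u N : ZK n k (tick n L x u) (tick n L x (u + N)) = W (iota u N).
  by rewrite ZK_words ?leq_addr // addKn.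
have rot y z : 0 <= y -> 0 <= z -> z + y <= pi * Num.sqrt n%:R ->
    ZK n k (y / Num.sqrt n%:R) ((z + y) / Num.sqrt n%:R) = F z.
  move=> y0 z0 h; rewrite mulrDl /F /arcK.
  have h1 : 0 <= z / Num.sqrt n%:R by rewrite divr_ge0 // ltW.
  have h2 : z / Num.sqrt n%:R <= 0 + pi by rewrite add0r ler_pdivrMr //; lra.
  by rewrite -(@ZK_rot R n k _ _ (y / Num.sqrt n%:R) h1 h2) add0r.
have e1 : F (L.+1%:R + x) = W (iota 0 L.+2).
  by rewrite -(zk 0%N L.+2) add0n (tick_big n x (ltnSn L.+1)) tick0.
have e2 : F L.+1%:R = W (iota 0 L.+1).
  by rewrite -(zk 0%N L.+1) add0n (tick_small n x (leqnn L.+1)) tick0.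
have e3 : F (L%:R + x) = W (iota 1 L.+1).
  rewrite -(zk 1%N L.+1) add1n (tick_big n x (ltnSn L.+1)) (tick_small n x (isT : (1 <= L.+1)%N)).
  rewrite -(rot 1%:R (L%:R + x) ler01 (addr_ge0 L0 x0) fit2).
  by rewrite -(natr1 L) addrAC.
have e4 : F L%:R = W (iota 1 L).
  rewrite -(zk 1%N L) add1n (tick_small n x (leqnn L.+1)) (tick_small n x (isT : (1 <= L.+1)%N)).
  by rewrite -(rot 1%:R L%:R ler01 L0 fit3) natr1.
have f1 : iota 0 L.+1 = seq.filter (fun i => i != L.+1) (iota 0 L.+2) := iota_neq_last 0 L.+1.
have f2 : iota 1 L.+1 = seq.filter (fun i => i != 0%N) (iota 0 L.+2).
  exact: iota_neq0.
have f3 : iota 1 L = seq.filter (fun i => (i != L.+1) && (i != 0%N)) (iota 0 L.+2).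
  rewrite [RHS](_ : _ = seq.filter (fun i => i != L.+1) (seq.filter (fun i => i != 0%N) (iota 0 L.+2))).
    by rewrite -f2 [LHS]iota_neq_last add1n.
  exact: filter_predI.
rewrite e1 e2 e3 e4 f1 f2 f3 /W !sum_words_filter.
rewrite [X in _ - X - _ + _]big_mkcond [X in _ - _ - X + _]big_mkcond [X in _ - _ - _ + X]big_mkcond.
rewrite -!sumrB -big_split /=.
pose d i := minn (L.+1 - i) (r + i).
have term w : w \in words (iota 0 L.+2) k ->
  `|kap (bmom n L x) w - (if all (fun i => i != L.+1) w then kap (bmom n L x) w else 0) -
    (if all (fun i => i != 0%N) w then kap (bmom n L x) w else 0) +
    (if all (fun i => (i != L.+1) && (i != 0%N)) w then kap (bmom n L x) w else 0)| <=
  2 * C0 * t ^+ d 0%N * \prod_(i <- w) t ^+ d i.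
  move=> /mem_words[sw ws]; set K := kap _ _.
  rewrite (all_predI (fun i => i != L.+1) (fun i => i != 0%N)).
  have rhs0 : 0 <= 2 * C0 * t ^+ d 0%N * \prod_(i <- w) t ^+ d i.
    by rewrite !mulr_ge0 ?exprn_ge0 ?prodr_ge0 // => *; rewrite ?exprn_ge0 // ltW.
  case: (boolP (all (fun i => i != L.+1) w)) => [_|b1] /=.
    by case: (all _ w); rewrite subrr sub0r ?addNr ?normr0 // oppr0 addr0 normr0.
  case: (boolP (all (fun i => i != 0%N) w)) => [_|b2] /=.
    by rewrite subr0 subrr addr0 normr0.
  rewrite !subr0 addr0.
  have bw : L.+1 \in w by move: b1; rewrite -has_predC => /hasP[i iw /=]; rewrite negbK => /eqP <-.
  have zw : 0%N \in w by move: b2; rewrite -has_predC => /hasP[i iw /=]; rewrite negbK => /eqP <-.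
  have w0 : w != [::] by apply: contraTneq bw => ->.
  have [i0 iw hi0] := seq_argmax d w0.
  have wN : all (fun i => (i <= L.+1)%N) w.
    by apply/allP => i /(allP ws) h; have : i \in iota 0 L.+2 := h; rewrite mem_iota.
  have h := hC0 n L x r (d i0) i0 w n0 x01 fit sw wN bw iw (geq_minl _ _) (geq_minr _ _).
  apply: (le_trans h); set G := (_ %/ _)%N.
  (* By the choice of [i0] every [d i] is at most [d i0], and so is [d 0] because 0 is a letter of
     [w]. *)
  have tD : t ^+ (k.+1 * d i0) <= t ^+ d 0%N * \prod_(i <- w) t ^+ d i.
    rewrite mulSn exprD; apply: ler_pM; rewrite ?exprn_ge0 ?(ltW t0) //.
      by rewrite ler_wiXn2l ?(ltW t0) ?(ltW t1) // hi0.
    have -> : t ^+ (k * d i0) = \prod_(i <- w) t ^+ d i0.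
      by rewrite big_const_seq count_predT sw iter_mulr_1 -exprM mulnC.
    rewrite big_seq [leRHS]big_seq.
    apply: ler_prod => i iw'; rewrite exprn_ge0 ?(ltW t0) //=.
    by rewrite ler_wiXn2l ?(ltW t0) ?(ltW t1) // hi0.
  have DG : (d i0 <= G.+1 * k.+1)%N.
    have := ltn_ceil (d i0).-1 (ltn0Sn k); rewrite -/G; by case: (d i0).
  have tG : (2 ^+ G)^-1 <= 2 * t ^+ (k.+1 * d i0).
    apply: (@le_trans _ _ (2 * (t ^+ (k.+1 * k.+1)) ^+ G.+1)).
      rewrite -exprVn -[leLHS]mul1r -[X in X * _](divff (_ : 2 != 0 :> R)) // -mulrA -exprS.
      by rewrite ler_wpM2l // lerXn2r ?nnegrE ?invr_ge0 // (le_trans _ ht).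
    rewrite ler_wpM2l // -exprM ler_wiXn2l ?(ltW t0) ?(ltW t1) //.
    by rewrite -mulnA leq_mul2l mulnC DG orbT.
  apply: (@le_trans _ _ (C0 * (2 * t ^+ (k.+1 * d i0)))); first by rewrite ler_wpM2l.
  have -> : 2 * C0 * t ^+ d 0%N * \prod_(i <- w) t ^+ d i = C0 * (2 * (t ^+ d 0%N * \prod_(i <- w) t ^+ d i)) by ring.
  by rewrite !ler_wpM2l.
apply: (le_trans (ler_norm_sum _ _ _)).
apply: (@le_trans _ _ (\sum_(w <- words (iota 0 L.+2) k) 2 * C0 * t ^+ d 0%N * \prod_(i <- w) t ^+ d i)).
  by rewrite big_seq [leRHS]big_seq; apply: ler_sum => w; exact: term.
rewrite -mulr_sumr sum_words_prod.
have h1 : t ^+ d 0%N <= t ^+ L.+1 + t ^+ r.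
  rewrite /d subn0 addn0 /minn; case: ifP => _; first by rewrite lerDl exprn_ge0 // ltW.
  by rewrite lerDr exprn_ge0 // ltW.
have g1 N : \sum_(i < N) t ^+ i <= (1 - t)^-1 by apply: geometric_le; rewrite t1 ltW.
have S0 : 0 <= \sum_(i <- iota 0 L.+2) t ^+ d i by apply: sumr_ge0 => i _; rewrite exprn_ge0 // ltW.
have h2 : \sum_(i <- iota 0 L.+2) t ^+ d i <= 2 * (1 - t)^-1.
  rewrite -[iota 0 L.+2]/(index_iota 0 L.+2) big_mkord.
  apply: (@le_trans _ _ (\sum_(i < L.+2) t ^+ (L.+1 - i) + \sum_(i < L.+2) t ^+ i)).
    rewrite -big_split /=; apply: ler_sum => i _; rewrite /d /minn.
    case: ifP => _; first by rewrite lerDl exprn_ge0 // ltW.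
    apply: (@le_trans _ _ (t ^+ i)); last by rewrite lerDr exprn_ge0 // ltW.
    by rewrite ler_wiXn2l ?(ltW t0) ?(ltW t1) // leq_addl.
  have -> : \sum_(i < L.+2) t ^+ (L.+1 - i) = \sum_(i < L.+2) t ^+ i.
    by rewrite (reindex_inj rev_ord_inj) /=; apply: eq_bigr => i _; rewrite subSS subKn // -ltnS.
  by rewrite -mulr2n -[leLHS]mulr_natl ler_wpM2l.
have h3 : (\sum_(i <- iota 0 L.+2) t ^+ d i) ^+ k <= (2 * (1 - t)^-1) ^+ k.
  by rewrite lerXn2r ?nnegrE ?mulr_ge0 ?(ltW g0).
have -> : 2 * C0 * (2 * (1 - t)^-1) ^+ k * (t ^+ L.+1 + t ^+ r) =
  2 * C0 * (t ^+ L.+1 + t ^+ r) * (2 * (1 - t)^-1) ^+ k by ring.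
apply: ler_pM => //; rewrite ?exprn_ge0 ?mulr_ge0 ?exprn_ge0 ?(ltW t0) //.
by rewrite ler_wpM2l ?mulr_ge0.
Qed.

End far_letters.

(** Unit differences [dd L] vary by amounts that decay geometrically away from both ends of the
    range, so the slope is taken in the middle [h]. Summing the differences settles integer points,
    and [linear_shift] adds a fractional part. *)
Lemma almost_linear (R : realType) (F : R -> R) (m C t B : R) :
  0 <= C -> 0 < t -> t < 1 -> 1 <= m ->
  (forall (L r : nat) (x : R), 0 <= x <= 1 -> L.+1%:R + x + r%:R <= m ->
    `|F (L.+1%:R + x) - F L.+1%:R - F (L%:R + x) + F L%:R| <= C * (t ^+ L.+1 + t ^+ r)) ->
  (forall x : R, 0 <= x <= 1 -> `|F x| <= B) ->
  exists c : R, (forall l, 0 <= l -> l <= m ->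
      `|F l - c * l| <= 4 * C * (1 - t)^-1 + 4 * C * (1 - t)^-1 ^+ 2 + 3 * B) /\
    (forall L : nat, (L <= (Num.truncn m).-1./2)%N ->
      `|F L.+1%:R - F L%:R - c| <= 2 * C * (1 - t)^-1 * t ^+ L).
Proof.
move=> C0 t0 t1 m1 second_diff bounded.
pose M := Num.truncn m; pose h := (M.-1)./2; pose g := (1 - t)^-1.
pose dd (L : nat) := F L.+1%:R - F L%:R; pose slope := dd h.
have m0 : 0 <= m.
  exact: le_trans ler01 m1.
have Mm : M%:R <= m.
  by rewrite /M truncn_le.
have M1 : (0 < M)%N.
  by rewrite /M truncn_gt0.
have g0 : 0 < g.
  by rewrite invr_gt0; lra.
(* A geometric term written as a difference, so that the error bounds telescope in the inductions
   below. *)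
have gE i : t ^+ i = g * (t ^+ i - t ^+ i.+1).
  by rewrite exprS -[X in X - _]mul1r -mulrBl mulrA mulVf ?mul1r //; lra.
have tge0 i : 0 <= t ^+ i.
  by rewrite exprn_ge0 // ltW.
have tle1 i : t ^+ i <= 1.
  by rewrite exprn_ile1 // ltW.
have tmono i j : (i <= j)%N -> t ^+ j <= t ^+ i.
  by move=> ij; rewrite ler_wiXn2l // ltW.
have diff_close i j : (i <= j)%N -> (j < M)%N ->
  `|dd j - dd i| <= C * (g * (t ^+ i.+1 - t ^+ j.+1 + t ^+ (M - j.+1) - t ^+ (M - i.+1))).
  elim: j => [|j IH].
    by rewrite leqn0 => /eqP -> _; rewrite subrr normr0 subrr add0r subrr !mulr0.
  rewrite leq_eqVlt => /orP[/eqP -> _|]; first by rewrite subrr normr0 subrr add0r subrr !mulr0.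
  rewrite ltnS => ij jM; have {}IH := IH ij (ltnW jM).
  have step : `|dd j.+1 - dd j| <= C * (t ^+ j.+1 + t ^+ (M - j.+2)).
    have h11 : 0 <= (1 : R) <= 1 by rewrite ler01 lexx.
    have hM : j.+1%:R + 1 + (M - j.+2)%:R <= m by rewrite natr1 -natrD subnKC.
    have := second_diff j (M - j.+2)%N 1 h11 hM; rewrite (natr1 j.+1) (natr1 j).
    by have -> : F j.+2%:R - F j.+1%:R - F j.+1%:R + F j%:R = dd j.+1 - dd j by rewrite /dd; ring.
  have -> : dd j.+1 - dd i = (dd j.+1 - dd j) + (dd j - dd i) by ring.
  apply: (le_trans (ler_normD _ _)); apply: (le_trans (lerD step IH)).
  rewrite -mulrDr ler_wpM2l //; have := gE j.+1; have := gE (M - j.+2)%N.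
  rewrite (_ : (M - j.+2).+1 = (M - j.+1)%N); last by rewrite subnSK.
  move: (t ^+ j.+1) (t ^+ j.+2) (t ^+ (M - j.+1)) (t ^+ (M - j.+2)) => u1 u2 u3 u4; clear; lra.
have half_bounds : (h <= M - h.+1)%N /\ (M - h.+1 <= h.+1)%N.
  have := odd_double_half M.-1; rewrite -/h -addnn; move: M1; case: (odd _); clear; lia.
have slope_close L : (L <= h)%N -> `|dd L - slope| <= 2 * C * g * t ^+ L.
  move=> Lh; have [h1 h2] := half_bounds; have hM : (h < M)%N by clear -h1 M1; lia.
  rewrite distrC; apply: (le_trans (diff_close L h Lh hM)).
  have -> : 2 * C * g * t ^+ L = C * (g * (t ^+ L + t ^+ L)) by ring.
  rewrite !ler_wpM2l // ?(ltW g0) //.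
  have := tmono L L.+1 (leqnSn _); have := tmono L (M - h.+1)%N (leq_trans Lh h1).
  have := tge0 h.+1; have := tge0 (M - L.+1)%N; lra.
have slope_close_any L : (L < M)%N -> `|dd L - slope| <= 2 * C * g * (t ^+ L + t ^+ (M - L.+1)).
  move=> LM; have cg : 0 <= 2 * C * g by rewrite !mulr_ge0 // ltW.
  have [Lh|hL] := leqP L h.
    apply: (le_trans (slope_close L Lh)); rewrite ler_wpM2l // lerDl //.
  have [h1 h2] := half_bounds; apply: (le_trans (diff_close h L (ltnW hL) LM)).
  apply: (@le_trans _ _ (2 * C * g * t ^+ (M - L.+1))); last by rewrite ler_wpM2l // lerDr.
  have -> : 2 * C * g * t ^+ (M - L.+1) = C * (g * (t ^+ (M - L.+1) + t ^+ (M - L.+1))) by ring.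
  rewrite !ler_wpM2l // ?(ltW g0) //.
  have lt : (M - L.+1 <= h.+1)%N by apply: leq_trans h2; rewrite leq_sub2l // ltnS ltnW.
  by have := tmono _ _ lt; have := tge0 L.+1; have := tge0 (M - h.+1)%N; lra.
have linear_integer L : (L <= M)%N ->
  `|F L%:R - F 0 - slope * L%:R| <= 2 * C * g * (g * (1 - t ^+ L + t ^+ (M - L) - t ^+ M)).
  elim: L => [|L IH LM].
    by move=> _; rewrite mulr0 subrr subr0 normr0 subn0 expr0 subrr add0r subrr !mulr0.
  have cg : 0 <= 2 * C * g by rewrite !mulr_ge0 // ltW.
  have -> : F L.+1%:R - F 0 - slope * L.+1%:R = (dd L - slope) + (F L%:R - F 0 - slope * L%:R).
    by rewrite /dd -[in slope * _](natr1 L); ring.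
  apply: (le_trans (ler_normD _ _)); apply: (le_trans (lerD (slope_close_any L LM) (IH (ltnW LM)))).
  rewrite -mulrDr ler_wpM2l //; have := gE L; have := gE (M - L.+1)%N.
  rewrite (_ : (M - L.+1).+1 = (M - L)%N); last by rewrite subnSK.
  move: (t ^+ L) (t ^+ L.+1) (t ^+ (M - L.+1)) (t ^+ (M - L)) => u1 u2 u3 u4; clear; lra.
have linear_shift L x : 0 <= x <= 1 -> L%:R + x <= m ->
  `|F (L%:R + x) - F L%:R - F x + F 0| <= C * (g * 2).
  move=> x01 Lx; have /andP[x0 x1] := x01; pose M' := Num.truncn (m - x).
  have LM : (L <= M')%N by rewrite /M' truncn_ge_nat; lra.
  have M'm : M'%:R <= m - x by rewrite /M' truncn_le; have := ler0n R L; lra.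
  suff h' l : (l <= L)%N -> `|F (l%:R + x) - F l%:R - F x + F 0| <=
      C * (g * (t - t ^+ l.+1 + t ^+ (M' - l) - t ^+ M')).
    apply: (le_trans (h' L (leqnn _))); rewrite !ler_wpM2l // ?(ltW g0) //.
    by have := tge0 L.+1; have := tge0 M'; have := tle1 (M' - L)%N; lra.
  elim: l => [_|l IH lL].
    have -> : F (0 + x) - F 0 - F x + F 0 = 0 by rewrite add0r; ring.
    by rewrite normr0 expr1 subn0 subrr add0r subrr !mulr0.
  have lM : (l < M')%N by apply: leq_trans LM.
  have hM : l.+1%:R + x + (M' - l.+1)%:R <= m by rewrite addrAC -natrD subnKC //; lra.
  have step := second_diff l (M' - l.+1)%N x x01 hM.
  have -> : F (l.+1%:R + x) - F l.+1%:R - F x + F 0 =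
    (F (l.+1%:R + x) - F l.+1%:R - F (l%:R + x) + F l%:R) + (F (l%:R + x) - F l%:R - F x + F 0) by ring.
  apply: (le_trans (ler_normD _ _)); apply: (le_trans (lerD step (IH (ltnW lL)))).
  rewrite -mulrDr ler_wpM2l //; have := gE l.+1; have := gE (M' - l.+1)%N.
  rewrite (_ : (M' - l.+1).+1 = (M' - l)%N); last by rewrite subnSK.
  move: (t ^+ l.+1) (t ^+ l.+2) (t ^+ (M' - l.+1)) (t ^+ (M' - l)) => u1 u2 u3 u4; clear; lra.
exists slope; split=> // l l0 lm; rewrite -/g.
  pose L := Num.truncn l; pose x := l - L%:R.
  have /andP[L1 L2] := truncn_itv l0.
  have x01 : 0 <= x <= 1 by move: L1 L2; rewrite -(natr1 (Num.truncn l)) -/L /x => *; apply/andP; split; lra.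
  have el : l = L%:R + x by rewrite /x; ring.
  have LM : (L <= M)%N by rewrite /M truncn_ge_nat //; lra.
  have Lx : L%:R + x <= m by rewrite -el.
  have s1 := linear_shift L x x01 Lx; rewrite -el in s1.
  have s2 : `|F L%:R - F 0 - slope * L%:R| <= 4 * C * g ^+ 2.
    apply: (le_trans (linear_integer L LM)).
    have -> : 4 * C * g ^+ 2 = 2 * C * g * (g * 2) by ring.
    rewrite !ler_wpM2l ?mulr_ge0 // ?(ltW g0) //.
    by have := tge0 L; have := tge0 M; have := tle1 (M - L)%N; lra.
  have B0 : `|F 0| <= B by apply: bounded; rewrite ?lexx ?ler01.
  have B1 : `|F 1| <= B by apply: bounded; rewrite ?lexx ?ler01.
  have Bx := bounded x x01.
  have s3 : `|slope| <= 2 * C * g + 2 * B.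
    have h0 := slope_close 0%N isT; rewrite expr0 mulr1 in h0.
    have -> : slope = (F 1 - F 0) - (dd 0%N - slope) by rewrite /dd; ring.
    apply: (le_trans (ler_normB _ _)); rewrite addrC lerD //.
    apply: (le_trans (ler_normB _ _)); lra.
  have -> : F l - slope * l = (F l - F L%:R - F x + F 0) + (F L%:R - F 0 - slope * L%:R) + (F x - slope * x).
    by rewrite [in slope * l]el; ring.
  apply: (le_trans (ler_normD _ _)).
  have s4 : `|F x - slope * x| <= B + (2 * C * g + 2 * B).
    apply: (le_trans (ler_normB _ _)); rewrite lerD // normrM.
    have /andP[x0 x1] := x01; rewrite (ger0_norm x0); apply: le_trans s3.
    by rewrite ler_piMr.
  have s5 := ler_normD (F l - F L%:R - F x + F 0) (F L%:R - F 0 - slope * L%:R).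
  lra.
Qed.

Section arcs.
Variable R : realType.
Implicit Types (n k : nat).

Lemma moments_upto k : exists B : R, 1 <= B /\ forall n (a b : R) j, (0 < n)%N -> a <= b ->
  Num.sqrt n%:R * (b - a) <= 1 -> (j <= k)%N ->
  0 <= Ex (gauss R n.+1) (fun c => (ZZ a b c)%:R ^+ j) <= B.
Proof.
have [B [B1 h]] := mom_bound R unit k; exists B; split=> // n a b j n0 ab ab1 jk.
have := h n (fun=> a) (fun=> b) (nseq j tt) n0 (fun _ => conj ab ab1).
rewrite size_nseq /mom => /(_ jk).
by under [fun c : n.+1.-tuple R => _]eq_fun do rewrite big_nseq iter_mulr_1.
Qed.

(** Only the slope [c n] still depends on the degree. Unit differences are estimated in the first
    half of the circle, where the distance to the far end is the larger one. *)
Lemma arcK_linear k : exists (c : nat -> R) (K t : R), [/\ 0 <= K, 0 < t, t < 1 &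
  forall n, (0 < n)%N ->
    (forall l : R, 0 <= l -> l <= (pi : R) * Num.sqrt n%:R -> `|arcK n k l - c n * l| <= K) /\
    (forall L : nat, (L.*2.+1)%:R <= (pi : R) * Num.sqrt n%:R ->
      `|arcK n k L.+1%:R - arcK n k L%:R - c n| <= K * t ^+ L)].
Proof.
have [C [t [C0 t0 t1 hC]]] := arcK_second_diff R k.
have [B [B1 hB]] := moments_upto k.
pose g := (1 - t)^-1; have g0 : 0 < g by rewrite invr_gt0; lra.
pose B' := kap_cst R k * B ^+ k.
have B'0 : 0 <= B' by have := kap_cst_ge1 R k => *; rewrite mulr_ge0 ?exprn_ge0 //; lra.
pose K := 4 * C * g + 4 * C * g ^+ 2 + 3 * B'.
have K1 : 0 <= C * g by rewrite mulr_ge0 // ltW.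
have K2 : 0 <= 4 * C * g ^+ 2 by rewrite !mulr_ge0 ?exprn_ge0 // ltW.
have K0 : 0 <= K by rewrite /K; lra.
suff slope n : (0 < n)%N -> exists c : R,
    (forall l : R, 0 <= l -> l <= (pi : R) * Num.sqrt n%:R -> `|arcK n k l - c * l| <= K) /\
    (forall L : nat, (L.*2.+1)%:R <= (pi : R) * Num.sqrt n%:R ->
      `|arcK n k L.+1%:R - arcK n k L%:R - c| <= K * t ^+ L).
  have sl n : exists c : R, (0 < n)%N -> (forall l : R, 0 <= l -> l <= (pi : R) * Num.sqrt n%:R -> `|arcK n k l - c * l| <= K) /\
    (forall L : nat, (L.*2.+1)%:R <= (pi : R) * Num.sqrt n%:R ->
      `|arcK n k L.+1%:R - arcK n k L%:R - c| <= K * t ^+ L).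
    by have [->|/slope[c hc]] := posnP n; [exists 0|exists c].
  by have [c hc] := choice sl; exists c, K, t; split.
move=> n0; have s1 : 1 <= Num.sqrt n%:R :> R by rewrite -[leLHS]sqrtr1 ler_wsqrtr // ler1n.
have p2 := pi_ge2 R.
have m1 : 1 <= pi * Num.sqrt n%:R :> R by rewrite -[leLHS]mulr1 ler_pM //; lra.
have bd (x : R) : 0 <= x <= 1 -> `|arcK n k x| <= B'.
  move=> /andP[x0 x1]; apply: kap1_bound => // j jk.
  have s0 : 0 < Num.sqrt n%:R :> R by lra.
  have w1 : Num.sqrt n%:R * (x / Num.sqrt n%:R - 0) <= 1 by rewrite subr0 mulrC divfK // gt_eqF.
  have /andP[e0 e1] := hB n 0 (x / Num.sqrt n%:R) j n0 (divr_ge0 x0 (ltW s0)) w1 jk.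
  by rewrite ger0_norm.
have sd (L r : nat) (x : R) : 0 <= x <= 1 -> L.+1%:R + x + r%:R <= pi * Num.sqrt n%:R ->
  `|arcK n k (L.+1%:R + x) - arcK n k L.+1%:R - arcK n k (L%:R + x) + arcK n k L%:R| <=
  C * (t ^+ L.+1 + t ^+ r) by exact: hC.
have [c [h1 h2]] := almost_linear C0 t0 t1 m1 sd bd.
exists c; split=> [l l0 lm|L Lm]; first exact: h1.
have Lh : (L <= (Num.truncn ((pi : R) * Num.sqrt n%:R)).-1./2)%N.
  have : (L.*2.+1 <= Num.truncn ((pi : R) * Num.sqrt n%:R))%N by rewrite truncn_ge_nat //; lra.
  by case: (Num.truncn _) => // T; rewrite ltnS /= => /half_leq; rewrite doubleK.
apply: (le_trans (h2 L Lh)); rewrite ler_wpM2r ?exprn_ge0 ?(ltW t0) //.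
by rewrite -/g /K; lra.
Qed.

End arcs.

(** * Comparison of two degrees *)

Section coefficient_comparison.
Variable R : realType.
Implicit Types (n N j : nat) (x y : R).

Definition coef2 n j : R := 'C(n, j)%:R / n%:R ^+ j.

Lemma coef2_ge0 n j : 0 <= coef2 n j.
Proof. by rewrite divr_ge0 // exprn_ge0. Qed.

Lemma coef2S n j : (0 < n)%N -> coef2 n j.+1 = coef2 n j * ((n - j)%:R / n%:R) / j.+1%:R.
Proof.
move=> n0; have nR : (n%:R : R) != 0 by rewrite pnatr_eq0 -lt0n.
have := mul_bin_left n j => /(congr1 (fun m => m%:R : R)); rewrite !natrM => h.
have jR : (j.+1%:R : R) != 0 by rewrite pnatr_eq0.
have nX : (n%:R ^+ j : R) != 0 by rewrite expf_neq0.
rewrite /coef2 exprS; apply: (mulfI jR).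
have -> : j.+1%:R * ('C(n, j.+1)%:R / (n%:R * n%:R ^+ j)) = (j.+1%:R * 'C(n, j.+1)%:R) / (n%:R * n%:R ^+ j) :> R.
  by rewrite mulrA.
by rewrite h [RHS]mulrC divfK // invfM; ring.
Qed.

Lemma subn_ratio n n' j : (0 < n)%N -> (n <= n')%N ->
  (n - j)%:R / n%:R <= (n' - j)%:R / n'%:R :> R /\ (n' - j)%:R / n'%:R <= 1 :> R.
Proof.
move=> n0 nn'; have n'0 : (0 < n')%N by apply: leq_trans nn'.
split; last by rewrite ler_pdivrMr ?ltr0n // mul1r ler_nat leq_subr.
rewrite ler_pdivrMr ?ltr0n // mulrAC ler_pdivlMr ?ltr0n // -!natrM ler_nat !mulnBl.
by rewrite (mulnC n') leq_sub2l // leq_mul2l nn' orbT.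
Qed.

Lemma falling2_ge0 j : 0 <= j%:R * (j%:R - 1) :> R.
Proof. by case: j => [|j]; [rewrite mul0r|rewrite mulr_ge0 // subr_ge0 ler1n]. Qed.

(** Up to the inverse of [j] factorial, [coef2 n j] is the product of the [1 - i / n] for [i < j]:
    increasing in [n], with a relative loss of at most the sum of the [i / n]. *)
Lemma coef2_close n n' j : (0 < n)%N -> (n <= n')%N ->
  coef2 n j <= coef2 n' j /\
  coef2 n' j * (1 - j%:R * (j%:R - 1) / (2 * n%:R)) <= coef2 n j.
Proof.
move=> n0 nn'; have n'0 : (0 < n')%N by apply: leq_trans nn'.
have nR : 0 < n%:R :> R by rewrite ltr0n.
elim: j => [|j [h1 h2]]; first by rewrite /coef2 !bin0 !expr0 mul0r mul0r subr0 mulr1 lexx.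
have [r1 r2] := subn_ratio j n0 nn'; have jR : 0 < j.+1%:R :> R by rewrite ltr0n.
have s0 : 0 <= (n - j)%:R / n%:R :> R by rewrite divr_ge0.
have c0 := coef2_ge0 n j; have c0' := coef2_ge0 n' j.
rewrite !coef2S //; split; first by rewrite ler_pM2r ?invr_gt0 // ler_pM.
set q := 1 - _; have [q0|q0] := lerP q 0.
  apply: (@le_trans _ _ 0); last by rewrite !mulr_ge0 // ?invr_ge0 ltW.
  rewrite mulr_ge0_le0 // !mulr_ge0 // ?invr_ge0 ?(ltW jR) //; exact: le_trans r1.
rewrite mulrAC ler_pM2r ?invr_gt0 //.
have jn : (j <= n)%N.
  rewrite leqNgt; apply/negP => nj; move: q0; apply/negP; rewrite -leNgt /q subr_le0.
  rewrite ler_pdivlMr ?mulr_gt0 // mul1r -(natr1 j) addrK.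
  have h3 : n%:R <= j%:R :> R by rewrite ler_nat ltnW.
  have h4 : 1 <= j%:R :> R by rewrite ler1n; apply: leq_trans nj.
  by apply: ler_pM; rewrite ?ler0n //; lra.
have e1 : (n - j)%:R / n%:R = 1 - j%:R / n%:R :> R by rewrite natrB // mulrBl divff ?gt_eqF.
set p := 1 - j%:R * (j%:R - 1) / (2 * n%:R) in h2.
have eq_ : q = p - j%:R / n%:R by rewrite /q /p -(natr1 j); field; lra.
have jn0 : 0 <= j%:R / n%:R :> R by rewrite divr_ge0 // ltW.
have p1 : p <= 1.
  by rewrite /p lerBlDr lerDl divr_ge0 ?falling2_ge0 // mulr_ge0 // ltW.
have p0 : 0 <= p by lra.
apply: (@le_trans _ _ (coef2 n' j * q)).
  by rewrite -mulrA ler_wpM2l // ler_piMl // ltW.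
apply: (@le_trans _ _ (coef2 n' j * p * (1 - j%:R / n%:R))); last first.
  by rewrite e1 ler_wpM2r // -e1.
rewrite -mulrA ler_wpM2l // eq_ mulrBr mulr1 lerD2l lerN2.
by rewrite ler_piMl.
Qed.

(** Passing to square roots does not increase the relative error. *)
Lemma scaled_coef_close n n' j : (0 < n)%N -> (n <= n')%N ->
  (scaled_coef R n' j - scaled_coef R n j) ^+ 2 <=
  coef2 n' j * (j%:R * (j%:R - 1) / (2 * n%:R)) ^+ 2.
Proof.
move=> n0 nn'; have [h1 h2] := coef2_close j n0 nn'.
have s1 := scaled_coef_sqr R n j; have s2 := scaled_coef_sqr R n' j.
have p1 := scaled_coef_ge0 R n j; have p2 := scaled_coef_ge0 R n' j.
rewrite -/(coef2 n j) in s1; rewrite -/(coef2 n' j) in s2.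
have T0 : 0 <= j%:R * (j%:R - 1) / (2 * n%:R) :> R.
  by rewrite divr_ge0 ?falling2_ge0 // mulr_ge0.
move: T0 h2; move: (j%:R * (j%:R - 1) / (2 * n%:R)) => T T0 h2.
rewrite -s2 -exprMn; move: (scaled_coef R n j) (scaled_coef R n' j) s1 s2 p1 p2 => a b s1 s2 p1 p2.
have ab : a <= b by rewrite -(@ler_pXn2r _ 2) ?nnegrE // s1 s2.
apply: lerXn2r; rewrite ?nnegrE ?subr_ge0 ?mulr_ge0 //.
suff : b * (1 - T) <= a by lra.
have [T1|T1] := lerP (1 - T) 0; first by apply: (le_trans _ p1); rewrite mulr_ge0_le0.
have T2 := ltW T1; rewrite -(@ler_pXn2r _ 2) ?nnegrE ?mulr_ge0 // exprMn s1; apply: le_trans h2.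
rewrite s2 ler_wpM2l ?coef2_ge0 // expr2 ler_piMl //; lra.
Qed.

(** Factorial moments of unnormalized binomial weights: absorbing a factor [j] into the binomial
    coefficient lowers [N] and [r] together. *)
Lemma binomial_factorial_moment N r x : 0 <= x ->
  \sum_(j < N.+1) 'C(N, j)%:R * x ^+ j * (j ^_ r)%:R <= (N%:R * x) ^+ r * (1 + x) ^+ N.
Proof.
move=> x0; elim: r N => [|r IH] N.
  under eq_bigr => j _ do rewrite ffactn0 mulr1.
  rewrite expr0 mul1r exprDn_comm ?lexx; last exact: mulrC.
  by rewrite le_eqVlt; apply/orP; left; apply/eqP; apply: eq_bigr => j _; rewrite expr1n mul1r mulr_natl.
rewrite big_ord_recl /= ffact0n mulr0 add0r.
case: N => [|N]; first by rewrite big_ord0 mul0r expr0n mul0r.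
have -> : \sum_(i < N.+1) 'C(N.+1, bump 0 i)%:R * x ^+ bump 0 i * (bump 0 i ^_ r.+1)%:R =
    N.+1%:R * x * \sum_(i < N.+1) 'C(N, i)%:R * x ^+ i * (i ^_ r)%:R.
  rewrite mulr_sumr; apply: eq_bigr => i _; rewrite /bump leq0n add1n ffactSS natrM exprS.
  have := mul_bin_diag N.+1 i => /(congr1 (fun m => m%:R : R)); rewrite !natrM /= => h.
  have -> : 'C(N.+1, i.+1)%:R * (x * x ^+ i) * (i.+1%:R * (i ^_ r)%:R) =
    (i.+1%:R * 'C(N.+1, i.+1)%:R) * (x * x ^+ i * (i ^_ r)%:R) by ring.
  by rewrite -h; ring.
apply: (@le_trans _ _ (N.+1%:R * x * ((N%:R * x) ^+ r * (1 + x) ^+ N))).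
  by rewrite ler_wpM2l ?mulr_ge0.
rewrite (exprS (N.+1%:R * x)) -[leRHS]mulrA ler_wpM2l ?mulr_ge0 //.
apply: ler_pM; rewrite ?exprn_ge0 ?mulr_ge0 ?addr_ge0 //.
  by rewrite lerXn2r ?nnegrE ?mulr_ge0 // ler_wpM2r // ler_nat.
by rewrite ler_weXn2l // lerDl.
Qed.

Lemma sqr_falling j : ((j * j.-1) * (j * j.-1) <= 6 * j ^_ 4 + 6 * j ^_ 2)%N.
Proof.
case: j => [|[|[|[|j]]]] //; rewrite !ffactSS ffactn0 muln1 /=; nia.
Qed.

Lemma coef2_moment n x : (0 < n)%N -> 0 <= x ->
  \sum_(j < n.+1) coef2 n j * x ^+ j * (j%:R * (j%:R - 1)) ^+ 2 <=
  (6 * x ^+ 4 + 6 * x ^+ 2) * (1 + x / n%:R) ^+ n.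
Proof.
move=> n0 x0; have nR : 0 < n%:R :> R by rewrite ltr0n.
have z0 : 0 <= x / n%:R by rewrite divr_ge0 // ltW.
apply: (@le_trans _ _ (6 * (\sum_(j < n.+1) 'C(n, j)%:R * (x / n%:R) ^+ j * (j ^_ 4)%:R) +
   6 * (\sum_(j < n.+1) 'C(n, j)%:R * (x / n%:R) ^+ j * (j ^_ 2)%:R))).
  rewrite !mulr_sumr -big_split /=; apply: ler_sum => j _.
  have -> : coef2 n j * x ^+ j = 'C(n, j)%:R * (x / n%:R) ^+ j.
    by rewrite /coef2 expr_div_n mulrAC mulrA.
  have := sqr_falling j; rewrite -(ler_nat R) natrD [(6 * j ^_ 4)%N%:R]natrM [(6 * j ^_ 2)%N%:R]natrM [(j * j.-1 * (j * j.-1))%N%:R]natrM [(j * j.-1)%N%:R]natrM => h.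
  have -> : 6 * ('C(n, j)%:R * (x / n%:R) ^+ j * (j ^_ 4)%:R) + 6 * ('C(n, j)%:R * (x / n%:R) ^+ j * (j ^_ 2)%:R) =
    'C(n, j)%:R * (x / n%:R) ^+ j * (6 * (j ^_ 4)%:R + 6 * (j ^_ 2)%:R) :> R by ring.
  rewrite ler_wpM2l ?mulr_ge0 ?exprn_ge0 //; apply: le_trans h; rewrite expr2.
  by case: (val j) => [|i]; [rewrite !mul0r|rewrite /= -(natr1 i) addrK].
have h r := binomial_factorial_moment n r z0.
have e : n%:R * (x / n%:R) = x by rewrite mulrC divfK // gt_eqF.
have h4 := h 4%N; have h2 := h 2%N; rewrite e in h4 h2.
by rewrite [leRHS]mulrDl; apply: lerD; rewrite -[leRHS]mulrA ler_wpM2l.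
Qed.

End coefficient_comparison.

(** * Comparison of signs at one point *)

Section point_comparison.
Variable R : realType.
Implicit Types (n : nat) (u x y : R).

Lemma cos2_atan x : cos (atan x) ^+ 2 = (1 + x ^+ 2)^-1.
Proof. by rewrite cos_atan exprVn sqr_sqrtr // addr_ge0 ?sqr_ge0. Qed.

Lemma vv_scaled n a (j : 'I_n.+1) : (0 < n)%N -> cos a != 0 ->
  vv a j = cos a ^+ n * (scaled_coef R n j * (Num.sqrt n%:R * tan a) ^+ j).
Proof.
move=> n0 ca; have jn : (j <= n)%N by rewrite -ltnS.
have s0 : Num.sqrt n%:R != 0 :> R by rewrite gt_eqF // sqrtr_gt0 ltr0n.
have e : sin a = tan a * cos a by rewrite /tan divfK.
have h : scaled_coef R n j * Num.sqrt n%:R ^+ j = Num.sqrt 'C(n, j)%:R.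
  by rewrite /scaled_coef divfK // expf_neq0.
have en : cos a ^+ n = cos a ^+ (n - j) * cos a ^+ j by rewrite -exprD subnK.
have es : sin a ^+ j = tan a ^+ j * cos a ^+ j by rewrite -(exprMn j (tan a) (cos a)) -e.
rewrite /vv en es -h (exprMn j (Num.sqrt n%:R) (tan a)).
by move: (tan a ^+ j) (cos a ^+ j) (cos a ^+ (n - j)) (scaled_coef R n j) (Num.sqrt _ ^+ _) => *; ring.
Qed.

(* Through [y = sqrt n * tan a] both processes become polynomials in [y] whose
   coefficients agree up to a relative error [O(j ^ 2 / n)]. *)
Lemma Pr_change_degree n n' a (Y : R) (W : 'M[R]_(n.+1, n'.+1)) : (0 < n)%N -> (n <= n')%N -> 0 < cos a ->
  (forall (i : 'I_n.+1) (j : 'I_n'.+1), W i j = (i == j :> nat)%:R) ->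
  `|Num.sqrt n%:R * tan a| <= Y -> 1 <= Y ->
  Pr (gauss R n'.+1) (fun c => FF c (atan (Num.sqrt n%:R * tan a / Num.sqrt n'%:R)) *
     FF (lact W c) a <= 0) <= 2 * Y ^+ 4 / n%:R.
Proof.
move=> n0 nn' ca WE yY Y1; have n'0 : (0 < n')%N by apply: leq_trans nn'.
have nR : 0 < n%:R :> R by rewrite ltr0n.
have s0' : 0 < Num.sqrt n'%:R :> R by rewrite sqrtr_gt0 ltr0n.
set y := Num.sqrt n%:R * tan a in yY *; set b := atan (y / Num.sqrt n'%:R).
have cb : 0 < cos b by rewrite cos_atan invr_gt0 sqrtr_gt0; have := sqr_ge0 (y / Num.sqrt n'%:R); lra.
have yb : Num.sqrt n'%:R * tan b = y by rewrite atanK mulrC divfK // gt_eqF.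
pose v (j : 'I_n'.+1) := cos b ^+ n' * (scaled_coef R n j * y ^+ j).
(* A positive factor: [dot v] has the sign of the process of degree [n], in the normalization that
   makes [v] close to the unit vector [vv b]. *)
pose r := cos a ^+ n / cos b ^+ n'; have r0 : 0 < r by rewrite divr_gt0 // exprn_gt0.
have Fv c : FF (lact W c) a = r * dot v c.
  have -> : r * dot v c = \sum_(j < n'.+1) (cos a ^+ n * (scaled_coef R n j * y ^+ j)) * tnth c j.
    rewrite /dot mulr_sumr; apply: eq_bigr => j _; rewrite /v /r; field.
    by rewrite expf_neq0 // gt_eqF.
  rewrite /FF /dot; under eq_bigr => i _ do rewrite tnth_lact vv_scaled ?gt_eqF // mulr_sumr.
  rewrite exchange_big /=; apply: eq_bigr => j _.
  have [jn|nj] := ltnP j n.+1.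
    rewrite (bigD1 (Ordinal jn)) //= big1 ?addr0.
      by rewrite WE /= eqxx mul1r.
    move=> i ij; rewrite WE (_ : (i == j :> nat) = false) ?mul0r ?mulr0 //.
    by apply/negbTE; apply: contraNneq ij => e; apply/eqP/val_inj.
  rewrite big1; last first.
    move=> i _; rewrite WE (_ : (i == j :> nat) = false) ?mul0r ?mulr0 //.
    by apply/negbTE; rewrite neq_ltn (leq_trans (ltn_ord i) nj).
  by rewrite /scaled_coef bin_small // sqrtr0 !mul0r mulr0 mul0r.
have -> : (fun c : n'.+1.-tuple R => FF c b * FF (lact W c) a <= 0) =
    (fun c => dot (vv b) c * dot v c <= 0).
  by apply/funext => c; rewrite Fv /FF mulrCA pmulr_rle0.
apply: Pr_mul_le0; [exact: vv_norm|by rewrite divr_ge0 ?mulr_ge0 ?exprn_ge0 ?(ltW nR) //; lra|].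
have e j : (vv b j - v j) ^+ 2 = cos b ^+ (2 * n') * ((scaled_coef R n' j - scaled_coef R n j) ^+ 2 * (y ^+ 2) ^+ j).
  have ey : (y ^+ 2) ^+ j = (y ^+ j) ^+ 2 by rewrite -!exprM mulnC.
  have ec : cos b ^+ (2 * n') = (cos b ^+ n') ^+ 2 by rewrite mulnC exprM.
  rewrite vv_scaled ?gt_eqF // yb /v ey ec.
  by move: (scaled_coef R n' j) (scaled_coef R n j) (y ^+ j) (cos b ^+ n') => *; ring.
under eq_bigr => j _ do rewrite e.
rewrite -mulr_sumr.
have y2 : 0 <= y ^+ 2 by exact: sqr_ge0.
(* The normalization of [vv b] cancels exactly the growth factor in [coef2_moment]. *)
have cE : cos b ^+ (2 * n') * (1 + y ^+ 2 / n'%:R) ^+ n' = 1.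
  rewrite exprM cos2_atan -exprMn expr_div_n sqr_sqrtr // mulVf ?expr1n // gt_eqF //.
  by have : 0 <= y ^+ 2 / n'%:R by [rewrite divr_ge0]; lra.
apply: (@le_trans _ _ (cos b ^+ (2 * n') * ((6 * (y ^+ 2) ^+ 4 + 6 * (y ^+ 2) ^+ 2) * (1 + y ^+ 2 / n'%:R) ^+ n' / (2 * n%:R) ^+ 2))).
  rewrite ler_wpM2l ?exprn_ge0 ?(ltW cb) //.
  apply: (@le_trans _ _ ((\sum_(j < n'.+1) coef2 R n' j * (y ^+ 2) ^+ j * (j%:R * (j%:R - 1)) ^+ 2) / (2 * n%:R) ^+ 2)).
    rewrite mulr_suml; apply: ler_sum => j _.
    have := @scaled_coef_close R n n' j n0 nn'; rewrite expr_div_n => h.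
    apply: (le_trans (ler_wpM2r (exprn_ge0 j y2) h)).
    by rewrite le_eqVlt; apply/orP; left; apply/eqP; ring.
  by rewrite ler_wpM2r ?coef2_moment // invr_ge0 exprn_ge0 // mulr_ge0 // ltW.
have reorg (p q A1 B1 : R) : p * q = 1 -> p * (A1 * q / B1) = A1 / B1.
  by move=> pq; rewrite -[RHS]mul1r -pq; ring.
rewrite (reorg _ _ _ _ cE).
have yY2 : y ^+ 2 <= Y ^+ 2 by rewrite -real_normK ?num_real // lerXn2r ?nnegrE //; lra.
have Y2 : 1 <= Y ^+ 2 by rewrite expr_ge1 //; lra.
have h4 : (y ^+ 2) ^+ 4 <= (Y ^+ 2) ^+ 4 by rewrite lerXn2r ?nnegrE //; lra.
have h2 : (y ^+ 2) ^+ 2 <= (Y ^+ 2) ^+ 4.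
  by apply: (@le_trans _ _ ((Y ^+ 2) ^+ 2)); [rewrite lerXn2r ?nnegrE //; lra|rewrite ler_weXn2l].
have -> : (2 * Y ^+ 4 / n%:R) ^+ 2 = 16 * (Y ^+ 2) ^+ 4 / (2 * n%:R) ^+ 2 by field; lra.
rewrite ler_wpM2r ?invr_ge0 ?exprn_ge0 ?mulr_ge0 ?(ltW nR) //; have := exprn_ge0 4 (sqr_ge0 Y); lra.
Qed.

(** Two unit vectors with scalar product [cos (a - b) ^+ n]; Bernoulli's inequality bounds their
    squared distance by [n] times the square of [a - b]. *)
Lemma Pr_move n a b : (0 < n)%N -> `|a - b| <= 1 ->
  Pr (gauss R n.+1) (fun c => FF c a * FF c b <= 0) <= Num.sqrt n%:R * `|a - b|.
Proof.
move=> n0 ab; apply: Pr_mul_le0; [exact: vv_norm|by rewrite mulr_ge0 ?sqrtr_ge0|].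
have -> : \sum_(j < n.+1) (vv a j - vv b j) ^+ 2 = 2 - 2 * cos (a - b) ^+ n.
  under eq_bigr => j _ do rewrite sqrrB.
  rewrite big_split /= vv_norm sumrB vv_norm -vv_gram mulr_sumr.
  under eq_bigr => j _ do rewrite -mulr_natl.
  ring.
rewrite -(cos_norm (a - b)) exprMn sqr_sqrtr //; move: (normr_ge0 (a - b)) ab.
move: `|a - b| => h h0 h1; have p2 := pi_ge2 R.
have c1 := cos_le1 h; have c0 : 0 <= cos h by apply: cos_ge0_pihalf; lra.
have x01 : 0 <= 1 - cos h <= 1 by lra.
have e1 : 1 - (1 - cos h) = cos h by ring.
have := bernoulli_le n x01; rewrite e1.
have := ler_wpM2l (ler0n R n) (cos_ge_quadratic h0); move: (cos h ^+ n) (cos h) => z w.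
lra.
Qed.

Lemma tan_bounds x : 0 <= x -> x <= 2^-1 -> x <= tan x /\ tan x <= x + x ^+ 3.
Proof.
move=> x0 x1; have x2 : x ^+ 2 <= 2^-1 * 2^-1 by rewrite expr2 ler_pM.
have q := cos_ge_quadratic x0; have c0 : 0 < cos x by lra.
have s1 := sin_le_id x0; have s3 := sin_ge_cubic x0; have c4 := cos_le_quartic x0.
have x22 := sqr_ge0 x.
split.
  rewrite /tan ler_pdivlMr //; apply: (le_trans (ler_wpM2l x0 c4)); apply: le_trans s3.
  have -> : x * (1 - x ^+ 2 / 2 + x ^+ 4 / 24) = x - x * (x ^+ 2 * (2^-1 - x ^+ 2 / 24)) by field.
  have -> : x - x ^+ 3 / 6 = x - x * (x ^+ 2 * 6^-1) by field.
  rewrite lerD2l lerN2 ler_wpM2l // ler_wpM2l //; lra.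
rewrite /tan ler_pdivrMr //; apply: (le_trans s1).
have -> : x + x ^+ 3 = x * (1 + x ^+ 2) by ring.
rewrite -mulrA ler_peMr //; apply: (@le_trans _ _ ((1 + x ^+ 2) * (1 - x ^+ 2 / 2))); last first.
  by rewrite ler_wpM2l //; lra.
have : 0 <= x ^+ 2 * (1 - x ^+ 2) by rewrite mulr_ge0 //; lra.
lra.
Qed.

(** [y] equals [u] up to a relative error [u ^+ 2 / n], and [atan] undoes the rescaling with an
    error of the same order; both follow from the cubic bounds on [tan]. *)
Lemma atan_rescaled n n' u : (0 < n)%N -> (n <= n')%N -> 0 <= u -> 4 * u <= Num.sqrt n%:R ->
  let y := Num.sqrt n%:R * tan (u / Num.sqrt n%:R) in
  [/\ 0 <= y, y <= 2 * u &
   `|atan (y / Num.sqrt n'%:R) - u / Num.sqrt n'%:R| * Num.sqrt n'%:R <= 8 * u ^+ 3 / n%:R].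
Proof.
move=> n0 nn' u0 un y; set s := Num.sqrt n%:R in un y *; set s' := Num.sqrt n'%:R.
have n'0 : (0 < n')%N by apply: leq_trans nn'.
have s0 : 0 < s by rewrite sqrtr_gt0 ltr0n.
have s'0 : 0 < s' by rewrite sqrtr_gt0 ltr0n.
have ss' : s <= s' by rewrite ler_wsqrtr // ler_nat.
have sE : s ^+ 2 = n%:R by rewrite sqr_sqrtr.
have x0 : 0 <= u / s by rewrite divr_ge0 // ltW.
have x4 : u / s <= 4^-1 by rewrite ler_pdivrMr //; lra.
have x1 : u / s <= 2^-1 by lra.
have [t1 t2] := tan_bounds x0 x1.
have su : s * (u / s) = u by rewrite mulrC divfK // gt_eqF.
have y1 : u <= y by rewrite -[leLHS]su /y ler_wpM2l // ltW.
have y2 : y <= u + u ^+ 3 / n%:R.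
  have -> : u + u ^+ 3 / n%:R = s * (u / s + (u / s) ^+ 3) by rewrite -sE; field; rewrite gt_eqF.
  by rewrite /y ler_wpM2l // ltW.
have u3 : u ^+ 3 / n%:R = u * (u / s) ^+ 2 by rewrite -sE; field; rewrite gt_eqF.
have x22 : (u / s) ^+ 2 <= 4^-1 * 4^-1 by rewrite expr2 ler_pM.
have y3 : y <= 2 * u.
  apply: (le_trans y2); rewrite u3.
  have : u * (u / s) ^+ 2 <= u * 1 by rewrite ler_wpM2l //; lra.
  lra.
have y0 : 0 <= y by lra.
split=> //; pose z := y / s'; have z0 : 0 <= z by rewrite divr_ge0 // ltW.
have z2 : z <= 2^-1.
  rewrite /z ler_pdivrMr //; lra.
pose b := atan z; have tb : tan b = z := atanK z.
have p2 := pi_ge2 R.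
have b0 : 0 <= b by rewrite -[leLHS](atan0 R); exact: le_atan.
have bz : b <= z.
  have [zt _] := tan_bounds z0 z2.
  have zi : z \in `](- (pi / 2)), (pi / 2)[ by rewrite in_itv /=; lra.
  by rewrite -[leRHS](tanK zi); exact: le_atan.
have [t3 t4] := tan_bounds b0 (le_trans bz z2); rewrite tb in t4.
have b3 : b ^+ 3 <= z ^+ 3 by rewrite lerXn2r ?nnegrE.
have zs : z * s' = y by rewrite /z divfK // gt_eqF.
have us : u / s' * s' = u by rewrite divfK // gt_eqF.
have -> : `|atan (y / s') - u / s'| * s' = `|b * s' - u|.
  by rewrite -[in RHS]us -mulrBl normrM (gtr0_norm s'0).
have up : b * s' <= y by rewrite -zs ler_wpM2r // ltW.
have lo : y - z ^+ 3 * s' <= b * s'.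
  by rewrite -zs -mulrBl ler_wpM2r ?(ltW s'0) //; lra.
have z3 : z ^+ 3 * s' <= 8 * u ^+ 3 / n%:R.
  have -> : z ^+ 3 * s' = y ^+ 3 / s' ^+ 2 by rewrite /z; field; rewrite gt_eqF.
  apply: ler_pM; rewrite ?exprn_ge0 ?invr_ge0 ?exprn_ge0 ?(ltW s'0) //.
    by apply: (@le_trans _ _ ((2 * u) ^+ 3)); [rewrite lerXn2r ?nnegrE //; lra|rewrite exprMn; lra].
  have ns2 : n%:R <= s' ^+ 2 by rewrite -sE lerXn2r ?nnegrE // ltW.
  have nR : 0 < n%:R :> R by rewrite ltr0n.
  by rewrite lef_pV2 // posrE // exprn_gt0.
have u8 : 0 <= u ^+ 3 / n%:R by rewrite divr_ge0 ?exprn_ge0.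
rewrite ler_norml; apply/andP; split; lra.
Qed.

Lemma atan_rescaled_abs n n' u : (0 < n)%N -> (n <= n')%N -> 4 * `|u| <= Num.sqrt n%:R ->
  let y := Num.sqrt n%:R * tan (u / Num.sqrt n%:R) in
  `|y| <= 2 * `|u| /\
  `|atan (y / Num.sqrt n'%:R) - u / Num.sqrt n'%:R| * Num.sqrt n'%:R <= 8 * `|u| ^+ 3 / n%:R.
Proof.
move=> n0 nn' un; have [y0 y1 y2] := atan_rescaled n0 nn' (normr_ge0 u) un.
have [u0|u0] := lerP 0 u.
  by rewrite (ger0_norm u0) in y0 y1 y2 *; split=> //; rewrite ger0_norm.
rewrite (ltr0_norm u0) !mulNr tanN mulrN mulNr atanN in y0 y1 y2.
rewrite (ltr0_norm u0); split.
  by rewrite -normrN ger0_norm.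
by move: y2; rewrite -opprD normrN.
Qed.

(** Keeps the first [n.+1] coefficients, so that both degrees are driven by the same Gaussian
    vector. *)
Definition proj_mx n n' : 'M[R]_(n.+1, n'.+1) := \matrix_(i, j) (i == j :> nat)%:R.

Lemma proj_mx_unitary n n' : (n <= n')%N -> proj_mx n n' *m (proj_mx n n')^T = 1%:M.
Proof.
move=> nn'; apply/matrixP => i i'; rewrite !mxE.
rewrite (bigD1 (widen_ord (nn' : (n.+1 <= n'.+1)%N) i)) //= !mxE /= eqxx mul1r big1 ?addr0.
  by congr (_%:R); rewrite eq_sym.
move=> j ji; rewrite !mxE (_ : (i == j :> nat) = false) ?mul0r //.
by apply/negbTE; apply: contraNneq ji => e; apply/eqP/val_inj.
Qed.

(** Two moves: from degree [n] to degree [n'] at the angle [b] with the same [y], then from [b] to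
    the nearby angle [u / sqrt n']. Signs that agree with that of [FF c b] agree with each other. *)
Lemma Pr_grid_mismatch n n' u (l : R) : (0 < n)%N -> (n <= n')%N -> 1 <= l -> `|u| <= l / 2 ->
  2 * l <= Num.sqrt n%:R ->
  Pr (gauss R n'.+1) (fun c => FF (lact (proj_mx n n') c) (u / Num.sqrt n%:R) *
    FF c (u / Num.sqrt n'%:R) <= 0) <= 3 * l ^+ 4 / n%:R.
Proof.
move=> n0 nn' l1 ul ln; have n'0 : (0 < n')%N by apply: leq_trans nn'.
have nR : 0 < n%:R :> R by rewrite ltr0n.
have u4 : 4 * `|u| <= Num.sqrt n%:R by lra.
have [y1 y2] := atan_rescaled_abs n0 nn' u4.
set s := Num.sqrt n%:R in y1 y2 u4 ln *; set s' := Num.sqrt n'%:R in y2 *.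
have s0 : 0 < s by rewrite sqrtr_gt0 ltr0n.
have s'0 : 0 < s' by rewrite sqrtr_gt0 ltr0n.
have ss' : s <= s' by rewrite ler_wsqrtr // ler_nat.
have sE : s ^+ 2 = n%:R by rewrite sqr_sqrtr.
have u0 := normr_ge0 u; have p2 := pi_ge2 R.
set b := atan (s * tan (u / s) / s') in y2.
have us : `|u / s| <= 4^-1 by rewrite normrM normfV (gtr0_norm s0) ler_pdivrMr //; lra.
have cu : 0 < cos (u / s) by apply: cos_gt0_pihalf; move: us; rewrite ler_norml; lra.
have yl : `|s * tan (u / s)| <= l by lra.
have h1 := Pr_change_degree n0 nn' cu (fun i j => mxE _ _ i j) yl l1.
rewrite -/s -/s' -/b in h1.
have u3 : 8 * `|u| ^+ 3 / n%:R <= l ^+ 3 / n%:R.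
  rewrite ler_wpM2r ?invr_ge0 ?(ltW nR) //.
  have -> : 8 * `|u| ^+ 3 = (2 * `|u|) ^+ 3 by rewrite exprMn; ring.
  by rewrite lerXn2r ?nnegrE //; lra.
have l3 : l ^+ 3 / n%:R <= s'.
  rewrite ler_pdivrMr // -sE; apply: (@le_trans _ _ (s ^+ 3)).
    by rewrite lerXn2r ?nnegrE //; lra.
  by rewrite exprS ler_wpM2r ?exprn_ge0 // ltW.
have b1 : `|b - u / s'| <= 1.
  by rewrite -(ler_pM2r s'0) mul1r; apply: (le_trans y2); lra.
have h2 := Pr_move n'0 b1; rewrite -/s' [X in _ <= X]mulrC in h2.
pose e1 (c : n'.+1.-tuple R) := FF c b * FF (lact (proj_mx n n') c) (u / s) <= 0.
pose e2 (c : n'.+1.-tuple R) := FF c b * FF c (u / s') <= 0.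
pose e3 (c : n'.+1.-tuple R) := FF (lact (proj_mx n n') c) (u / s) * FF c (u / s') <= 0.
have mF a := @measurable_FF R n' a.
have mFW : measurable_fun setT (fun c : n'.+1.-tuple R => FF (lact (proj_mx n n') c) (u / s)).
  exact: (measurableT_comp (@measurable_FF R n (u / s)) (measurable_lact (proj_mx n n'))).
have m1 : measurable_fun setT e1.
  by apply: measurable_fun_ler; [exact: measurable_funM|exact: measurable_cst].
have m2 : measurable_fun setT e2.
  by apply: measurable_fun_ler; [exact: measurable_funM|exact: measurable_cst].
have m3 : measurable_fun setT e3.
  by apply: measurable_fun_ler; [exact: measurable_funM|exact: measurable_cst].
have sub c : e3 c -> e1 c || e2 c.
  rewrite /e1 /e2 /e3; apply: contraTT; rewrite negb_or -!ltNge => /andP[a1 a2].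
  have : 0 < (FF c b * FF (lact (proj_mx n n') c) (u / s)) * (FF c b * FF c (u / s')) by rewrite mulr_gt0.
  rewrite mulrACA -expr2 pmulr_rgt0 //.
  by rewrite exprn_even_gt0 //=; apply: contraTneq a1 => ->; rewrite mul0r ltxx.
apply: (le_trans (Pr_le _ m3 (measurable_or m1 m2) sub)).
apply: (le_trans (Pr_or _ m1 m2)).
have l34 : l ^+ 3 / n%:R <= l ^+ 4 / n%:R by rewrite ler_wpM2r ?invr_ge0 ?(ltW nR) // ler_weXn2l.
have -> : 3 * l ^+ 4 / n%:R = 2 * l ^+ 4 / n%:R + l ^+ 4 / n%:R by ring.
have h2' : Pr (gauss R n'.+1) e2 <= l ^+ 4 / n%:R by move: h2; rewrite -/e2; lra.
by apply: lerD; [exact: h1|exact: h2'].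
Qed.

End point_comparison.

Section degree_comparison.
Variable R : realType.
Implicit Types (n k l M : nat) (p q : R).

Lemma Pr_ZZ_crs_long n p q (l M : nat) : (0 < n)%N -> (0 < l <= M)%N -> p <= q -> q <= p + pi ->
  Num.sqrt n%:R * (q - p) = l%:R ->
  Pr (gauss R n.+1) (fun c => ZZ p q c != crs p q M c) <= l%:R ^+ 3 / M%:R ^+ 2.
Proof.
move=> n0 /andP[l0 lM] pq qp pql; have s0 : 0 < Num.sqrt n%:R :> R by rewrite sqrtr_gt0 ltr0n.
have M0 : (0 < M)%N by apply: leq_trans lM.
have s1 : 1 <= Num.sqrt n%:R :> R by rewrite -[leLHS]sqrtr1 ler_wsqrtr // ler1n.
have MR : 0 < M%:R :> R by rewrite ltr0n.
have lMR : l%:R <= M%:R :> R by rewrite ler_nat.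
have p2 := pi_ge2 R.
have w i : cell p q M i.+1 - cell p q M i = (q - p) / M%:R by rewrite cellS addrC addKr.
have qpl : q - p <= l%:R by rewrite -pql ler_peMl // subr_ge0.
have w1 : (q - p) / M%:R <= 1 by rewrite ler_pdivrMr // mul1r; apply: le_trans lMR.
have bZ : bmfun (fun c : n.+1.-tuple R => (ZZ p q c)%:R : R) by exact: bmfun_ZZ.
apply: (@le_trans _ _ (Ex (gauss R n.+1) (fun c => (ZZ p q c)%:R - (crs p q M c)%:R))).
  apply: Ex_le => [||c].
  - apply: bmfun_bool; exact: (measurable_nat_neq bZ.1 (bmfun_crs n p q M).1).
  - by apply: bmfunB => //; exact: bmfun_crs.
  have h : (crs p q M c <= ZZ p q c)%N by exact: crs_le_ZZ.
  rewrite -natrB // ler_nat; case: eqVneq => //= ne.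
  by rewrite subn_gt0 ltn_neqAle h andbT eq_sym.
rewrite ExB; [|exact: bZ|exact: bmfun_crs].
rewrite Ex_ZZ // Ex_crosses; [|by move=> i _; exact: cell_le|by move=> i _; rewrite w].
under eq_bigr => i _ do rewrite w.
rewrite sumr_const card_ord -[X in _ - X]mulr_natl.
pose u := Num.sqrt n%:R * ((q - p) / M%:R); pose f := phi n ((q - p) / M%:R).
have u0 : 0 <= u by rewrite mulr_ge0 ?sqrtr_ge0 // divr_ge0 // subr_ge0.
have uM : u = l%:R / M%:R by rewrite /u mulrA pql.
have u1 : u <= 1 by rewrite uM ler_pdivrMr // mul1r.
have uf : `|f - u| <= u ^+ 3 by apply: phi_close => //; rewrite divr_ge0 ?subr_ge0.
have -> : Num.sqrt n%:R * (q - p) / pi - M%:R * (phi n ((q - p) / M%:R) / pi) = M%:R * (u - f) / pi.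
  have pn : (pi : R) != 0 by rewrite gt_eqF // pi_gt0.
  have Mn : (M%:R : R) != 0 by rewrite gt_eqF.
  rewrite /u /f; move: (phi _ _) pn => F; move: (pi : R) => P pn.
  by field; rewrite pn Mn.
rewrite ler_pdivrMr ?pi_gt0 //.
have h3 : u - f <= u ^+ 3 by move: uf; rewrite ler_norml => /andP[]; lra.
apply: (@le_trans _ _ (M%:R * u ^+ 3)); first by rewrite ler_wpM2l.
have -> : M%:R * u ^+ 3 = l%:R ^+ 3 / M%:R ^+ 2 by rewrite uM; field; rewrite gt_eqF.
by rewrite ler_peMr ?divr_ge0 ?exprn_ge0 //; lra.
Qed.

Lemma cell_scale (x y r : R) M i : cell (x / r) (y / r) M i = cell x y M i / r.
Proof. rewrite /cell; ring. Qed.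

Definition half_arc n (l : nat) : R := l%:R / 2 / Num.sqrt n%:R.

Lemma half_arcP n (l : nat) : (0 < n)%N -> 2 * l%:R <= Num.sqrt n%:R :> R ->
  [/\ - half_arc n l <= half_arc n l, half_arc n l <= - half_arc n l + pi &
   Num.sqrt n%:R * (half_arc n l - - half_arc n l) = l%:R].
Proof.
move=> n0 ln; have s0 : 0 < Num.sqrt n%:R :> R by rewrite sqrtr_gt0 ltr0n.
have h0 : 0 <= half_arc n l by rewrite !divr_ge0 // ltW.
have h1 : half_arc n l <= 1.
  by rewrite /half_arc ler_pdivrMr //; have := ler0n R l; lra.
have p2 := pi_ge2 R; split; [lra|lra|].
by rewrite opprK /half_arc; field; rewrite gt_eqF.
Qed.

(** The counts agree unless one of them differs from its grid count or the signs differ at a grid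
    point. *)
Lemma Pr_ZZ_mismatch n n' (l M : nat) : (0 < n)%N -> (n <= n')%N -> (0 < l <= M)%N ->
  2 * l%:R <= Num.sqrt n%:R :> R ->
  Pr (gauss R n'.+1) (fun c =>
    ZZ (- half_arc n l) (half_arc n l) (lact (proj_mx R n n') c) !=
    ZZ (- half_arc n' l) (half_arc n' l) c) <=
  2 * l%:R ^+ 3 / M%:R ^+ 2 + M.+1%:R * (3 * l%:R ^+ 4 / n%:R).
Proof.
move=> n0 nn' lM ln; have n'0 : (0 < n')%N by apply: leq_trans nn'.
have ln' : 2 * l%:R <= Num.sqrt n'%:R :> R by apply: (le_trans ln); rewrite ler_wsqrtr // ler_nat.
have [a1 a2 a3] := half_arcP n0 ln; have [b1 b2 b3] := half_arcP n'0 ln'.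
have h1 := Pr_ZZ_crs_long n0 lM a1 a2 a3; have h2 := Pr_ZZ_crs_long n'0 lM b1 b2 b3.
set p := half_arc n l in a1 a2 a3 h1 *; set p' := half_arc n' l in b1 b2 b3 h2 *.
pose W := proj_mx R n n'; have Wu := @proj_mx_unitary R n n' nn'.
pose e1 (c : n.+1.-tuple R) := ZZ (- p) p c != crs (- p) p M c.
pose e2 (c : n'.+1.-tuple R) := ZZ (- p') p' c != crs (- p') p' M c.
have m1 : measurable_fun setT e1.
  exact: (measurable_nat_neq (@bmfun_ZZ R n _ _ a1 a2).1 (bmfun_crs n (- p) p M).1).
have m2 : measurable_fun setT e2.
  exact: (measurable_nat_neq (@bmfun_ZZ R n' _ _ b1 b2).1 (bmfun_crs n' (- p') p' M).1).
have m1W : measurable_fun setT (fun c : n'.+1.-tuple R => e1 (lact W c)).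
  exact: (measurableT_comp m1 (measurable_lact W)).
have h1W : Pr (gauss R n'.+1) (fun c => e1 (lact W c)) <= l%:R ^+ 3 / M%:R ^+ 2.
  by rewrite /Pr (Ex_lact Wu (@bmfun_bool _ _ R _ m1)).
pose u i : R := cell (- (l%:R / 2)) (l%:R / 2) M i.
pose e3 i (c : n'.+1.-tuple R) := FF (lact W c) (u i / Num.sqrt n%:R) * FF c (u i / Num.sqrt n'%:R) <= 0.
have m3 i : measurable_fun setT (e3 i).
  apply: measurable_fun_ler; last exact: measurable_cst.
  apply: measurable_funM; last exact: measurable_FF.
  exact: (measurableT_comp (@measurable_FF R n _) (measurable_lact W)).
have mh : measurable_fun setT (fun c : n'.+1.-tuple R => has (e3^~ c) (iota 0 M.+1)) by exact: measurable_has.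
have l1 : 1 <= l%:R :> R by rewrite ler1n; case/andP: lM.
have h3 : Pr (gauss R n'.+1) (fun c => has (e3^~ c) (iota 0 M.+1)) <= M.+1%:R * (3 * l%:R ^+ 4 / n%:R).
  apply: (le_trans (@Pr_has _ _ R (gauss R n'.+1) _ (iota 0 M.+1) e3 m3)).
  apply: (@le_trans _ _ (\sum_(i <- iota 0 M.+1) (3 * l%:R ^+ 4 / n%:R))); last first.
    by rewrite big_const_seq count_predT size_iota iter_addr_0 -[leLHS]mulr_natl.
  rewrite big_seq [leRHS]big_seq; apply: ler_sum => i; rewrite mem_iota => /andP[_ iM].
  apply: Pr_grid_mismatch => //; rewrite ler_norml.
  have l2 : - (l%:R / 2) <= l%:R / 2 :> R by lra.
  by rewrite /u cell_ge //= cell_le_end // -ltnS.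
have pE : - p = (- (l%:R / 2)) / Num.sqrt n%:R by rewrite mulNr.
have pE' : - p' = (- (l%:R / 2)) / Num.sqrt n'%:R by rewrite mulNr.
have crsE (c : n'.+1.-tuple R) : ~~ has (e3^~ c) (iota 0 M.+1) ->
    crs (- p) p M (lact W c) = crs (- p') p' M c.
  rewrite -all_predC => /allP h; apply: eq_bigr => j _; rewrite /cross; congr (nat_of_bool _).
  have jM := ltn_ord j; rewrite pE pE' /p /p' /half_arc !cell_scale.
  by apply: same_sign; rewrite ltNge; apply: h; rewrite mem_iota /= add0n ltnS // ltnW.
pose bad (c : n'.+1.-tuple R) := e1 (lact W c) || (e2 c || has (e3^~ c) (iota 0 M.+1)).
have mbad : measurable_fun setT bad by apply: measurable_or => //; exact: measurable_or.
have mne : measurable_fun setT (fun c : n'.+1.-tuple R => ZZ (- p) p (lact W c) != ZZ (- p') p' c).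
  apply: (measurable_nat_neq _ (@bmfun_ZZ R n' _ _ b1 b2).1).
  exact: (measurableT_comp (@bmfun_ZZ R n _ _ a1 a2).1 (measurable_lact W)).
have sub (c : n'.+1.-tuple R) : ZZ (- p) p (lact W c) != ZZ (- p') p' c -> bad c.
  move=> ne; rewrite /bad; case: (boolP (e1 (lact W c))) => [//|n1].
  case: (boolP (e2 c)) => [//|n2]; case: (boolP (has (e3^~ c) (iota 0 M.+1))) => [//|n3].
  exfalso; move/negP: ne; apply; move: n1 n2; rewrite /e1 /e2 !negbK => /eqP -> /eqP ->.
  by apply/eqP; exact: crsE n3.
apply: (le_trans (Pr_le _ mne mbad sub)).
apply: (le_trans (Pr_or _ m1W (measurable_or m2 mh))).
have := Pr_or (gauss R n'.+1) m2 mh.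
have -> : 2 * l%:R ^+ 3 / M%:R ^+ 2 = l%:R ^+ 3 / M%:R ^+ 2 + l%:R ^+ 3 / M%:R ^+ 2 :> R by ring.
move: h1W h2 h3; rewrite -/e2.
move: (Pr _ (fun c => e1 _)) (Pr _ e2) (Pr _ (fun c => has _ _)) (Pr _ (fun c => e2 c || _)).
by move=> x1 x2 x3 x4; move: (l%:R ^+ 3 / M%:R ^+ 2) (M.+1%:R * _) => y1 y2; lra.
Qed.

(** The counts differ on a rare event only. There [Ex_mul_le] with threshold [l ^+ k.+1] trades a
    moment of order up to [k * r.+1] for the term [l ^+ k.+1 / l ^+ r], which the free parameter [r]
    makes as small as wanted. *)
Lemma moments_close k r : exists C : R, 0 <= C /\ forall n n' (l M j : nat),
  (0 < n)%N -> (n <= n')%N -> (0 < l <= M)%N -> 2 * l%:R <= Num.sqrt n%:R :> R -> (j <= k)%N ->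
  [/\ 0 <= Ex (gauss R n.+1) (fun c => (ZZ (- half_arc n l) (half_arc n l) c)%:R ^+ j) <= C * l%:R ^+ k.+1,
   0 <= Ex (gauss R n'.+1) (fun c => (ZZ (- half_arc n' l) (half_arc n' l) c)%:R ^+ j) <= C * l%:R ^+ k.+1 &
  `|Ex (gauss R n.+1) (fun c => (ZZ (- half_arc n l) (half_arc n l) c)%:R ^+ j) -
    Ex (gauss R n'.+1) (fun c => (ZZ (- half_arc n' l) (half_arc n' l) c)%:R ^+ j)| <=
  C * (l%:R ^+ k.+1 * (l%:R ^+ 3 / M%:R ^+ 2 + M%:R * l%:R ^+ 4 / n%:R) + l%:R ^+ k.+1 / l%:R ^+ r)].
Proof.
have [Bf hB] := choice (fun p : nat => Ex_moment R p).
pose B := \sum_(p < (k * r.+1).+1) Bf p.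
have B0 (p : nat) : 0 <= Bf p by have [] := hB p.
have BfB (p : nat) : (p <= k * r.+1)%N -> Bf p <= B.
  move=> pk; rewrite /B (bigD1 (Ordinal (pk : (p < (k * r.+1).+1)%N))) //= lerDl.
  by apply: sumr_ge0.
have BB : 0 <= B by apply: sumr_ge0.
exists (12 + 2 * B); split; first by lra.
move=> n n' l M j n0 nn' lM ln jk; have /andP[l0 lM'] := lM.
have n'0 : (0 < n')%N by apply: leq_trans nn'.
have ln' : 2 * l%:R <= Num.sqrt n'%:R :> R by apply: (le_trans ln); rewrite ler_wsqrtr // ler_nat.
have [a1 a2 a3] := half_arcP n0 ln; have [b1 b2 b3] := half_arcP n'0 ln'.
have l1 : 1 <= l%:R :> R by rewrite ler1n.
have lR : 0 < l%:R :> R by lra.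
have MR : 0 < M%:R :> R by rewrite ltr0n; apply: leq_trans lM'.
have nR : 0 < n%:R :> R by rewrite ltr0n.
have mom1 (p : nat) : (p <= k * r.+1)%N ->
    Ex (gauss R n.+1) (fun c => (ZZ (- half_arc n l) (half_arc n l) c)%:R ^+ p) <= B * l%:R ^+ p.+1.
  move=> pk; have [_ h] := hB p; apply: (le_trans (h n l _ _ n0 l0 a1 a2 _)); first by rewrite a3.
  by rewrite ler_wpM2r ?exprn_ge0 ?BfB.
have mom2 (p : nat) : (p <= k * r.+1)%N ->
    Ex (gauss R n'.+1) (fun c => (ZZ (- half_arc n' l) (half_arc n' l) c)%:R ^+ p) <= B * l%:R ^+ p.+1.
  move=> pk; have [_ h] := hB p; apply: (le_trans (h n' l _ _ n'0 l0 b1 b2 _)); first by rewrite b3.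
  by rewrite ler_wpM2r ?exprn_ge0 ?BfB.
have jkr : (j <= k * r.+1)%N by apply: (leq_trans jk); rewrite leq_pmulr.
have up x : x <= B * l%:R ^+ j.+1 -> x <= (12 + 2 * B) * l%:R ^+ k.+1.
  move=> h; apply: (le_trans h); apply: ler_pM; rewrite ?exprn_ge0 ?(ltW lR) //; first lra.
  by rewrite ler_weXn2l // ltnS.
have ge0' n1 p q : 0 <= Ex (gauss R n1.+1) (fun c => (ZZ p q c)%:R ^+ j).
  by apply: Ex_ge0 => c; rewrite exprn_ge0.
split; [by rewrite ge0' /= up // mom1|by rewrite ge0' /= up // mom2|].
pose W := proj_mx R n n'; have Wu := @proj_mx_unitary R n n' nn'.
pose Xn (c : n.+1.-tuple R) : R := (ZZ (- half_arc n l) (half_arc n l) c)%:R.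
pose X' (c : n'.+1.-tuple R) : R := (ZZ (- half_arc n' l) (half_arc n' l) c)%:R.
have bXn (p : nat) : bmfun (fun c => Xn c ^+ p) by apply: bmfunX; exact: bmfun_ZZ.
have bX' (p : nat) : bmfun (fun c => X' c ^+ p) by apply: bmfunX; exact: bmfun_ZZ.
pose X (c : n'.+1.-tuple R) := Xn (lact W c).
have bX (p : nat) : bmfun (fun c => X c ^+ p) by apply: (bmfun_comp (measurable_lact W) (bXn p)).
have EX (p : nat) : Ex (gauss R n'.+1) (fun c => X c ^+ p) = Ex (gauss R n.+1) (fun c => Xn c ^+ p).
  exact: (Ex_lact Wu (bXn p)).
pose bad (c : n'.+1.-tuple R) := ZZ (- half_arc n l) (half_arc n l) (lact W c) !=
  ZZ (- half_arc n' l) (half_arc n' l) c.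
have mbad : measurable_fun setT bad.
  apply: (measurable_nat_neq _ (@bmfun_ZZ R n' _ _ b1 b2).1).
  exact: (measurableT_comp (@bmfun_ZZ R n _ _ a1 a2).1 (measurable_lact W)).
have bb := @bmfun_bool _ _ R _ mbad.
have hbad := Pr_ZZ_mismatch n0 nn' lM ln; rewrite -/bad in hbad.
have X0 c : 0 <= X c ^+ j by rewrite exprn_ge0.
have X'0 c : 0 <= X' c ^+ j by rewrite exprn_ge0.
have b01 c : 0 <= (bad c)%:R :> R by [].
pose lam : R := l%:R ^+ k.+1; have lam0 : 0 < lam by rewrite exprn_gt0.
have holder Z : (forall p : nat, bmfun (fun c => Z c ^+ p)) -> (forall c, 0 <= Z c ^+ j) ->
    Ex (gauss R n'.+1) (fun c => Z c ^+ (j * r.+1)) <= B * l%:R ^+ (j * r.+1).+1 ->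
    Ex (gauss R n'.+1) (fun c => (bad c)%:R * Z c ^+ j) <= lam * Pr (gauss R n'.+1) bad + B * (l%:R ^+ k.+1 / l%:R ^+ r).
  move=> bZ Z0 hZ.
  apply: (le_trans (@Ex_mul_le _ _ R (gauss R n'.+1) _ _ lam r bb (bZ j) lam0 b01 Z0)).
  rewrite lerD2l ler_pdivrMr ?exprn_gt0 //.
  apply: (@le_trans _ _ (Ex (gauss R n'.+1) (fun c => Z c ^+ (j * r.+1)))).
    apply: Ex_le => [||c].
    - by apply: bmfunM => //; apply: bmfunX.
    - exact: bZ.
    - by rewrite -exprM; case: (bad c); rewrite ?mul1r // mul0r exprM exprn_ge0.
  apply: (le_trans hZ); rewrite -mulrA ler_wpM2l // mulrAC ler_pdivlMr ?exprn_gt0 //.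
  rewrite /lam -exprM -!exprD ler_weXn2l //.
  have : (j * r.+1 <= k * r.+1)%N by rewrite leq_mul2r jk orbT.
  by rewrite mulSn mulnS; clear; lia.
have step : `|Ex (gauss R n.+1) (fun c => Xn c ^+ j) - Ex (gauss R n'.+1) (fun c => X' c ^+ j)| <=
    Ex (gauss R n'.+1) (fun c => (bad c)%:R * X c ^+ j) + Ex (gauss R n'.+1) (fun c => (bad c)%:R * X' c ^+ j).
  rewrite -EX -ExB // -ExD; [|exact: bmfunM|exact: bmfunM].
  apply: (le_trans (Ex_norm _ (bmfunB (bX j) (bX' j)))); apply: Ex_le.
  - by apply: bmfun_norm; exact: bmfunB.
  - by apply: bmfunD; exact: bmfunM.
  move=> c; have := X0 c; have := X'0 c; case: (boolP (bad c)) => bc.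
    by rewrite !mul1r ler_norml => *; apply/andP; split; lra.
  by move: bc; rewrite /bad negbK /X /Xn /X' => /eqP ->; rewrite subrr normr0 !mul0r addr0.
apply: (le_trans step).
have jr : (j * r.+1 <= k * r.+1)%N by rewrite leq_mul2r jk orbT.
have e1 : Ex (gauss R n'.+1) (fun c => X c ^+ (j * r.+1)) <= B * l%:R ^+ (j * r.+1).+1.
  by rewrite EX; exact: mom1.
have s1 := holder X bX X0 e1; have s2 := holder X' bX' X'0 (mom2 _ jr).
have M1 : M.+1%:R <= 2 * M%:R :> R by rewrite -(natr1 M); have : 1 <= M%:R :> R by [rewrite ler1n; apply: leq_trans lM']; lra.
pose dl : R := l%:R ^+ 3 / M%:R ^+ 2 + M%:R * l%:R ^+ 4 / n%:R.
have t1 : 0 <= l%:R ^+ 3 / M%:R ^+ 2 :> R by rewrite divr_ge0 ?exprn_ge0.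
have t2 : 0 <= l%:R ^+ 4 / n%:R :> R by rewrite divr_ge0 ?exprn_ge0.
have hb : Pr (gauss R n'.+1) bad <= 6 * dl.
  apply: (le_trans hbad); have := ler_wpM2r t2 M1; rewrite /dl -/half_arc.
  have -> : M.+1%:R * (3 * l%:R ^+ 4 / n%:R) = 3 * (M.+1%:R * (l%:R ^+ 4 / n%:R)) :> R by ring.
  have -> : M%:R * l%:R ^+ 4 / n%:R = M%:R * (l%:R ^+ 4 / n%:R) :> R by ring.
  have -> : 2 * l%:R ^+ 3 / M%:R ^+ 2 = 2 * (l%:R ^+ 3 / M%:R ^+ 2) :> R by ring.
  move: t1; move: (l%:R ^+ 3 / M%:R ^+ 2) (M.+1%:R * _) => y1 y2.
  have -> : 2 * M%:R * (l%:R ^+ 4 / n%:R) = 2 * (M%:R * (l%:R ^+ 4 / n%:R)) :> R by ring.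
  move: (M%:R * _) => y3; lra.
have hl := ler_wpM2l (ltW lam0) hb.
have dl0 : 0 <= lam * dl by rewrite mulr_ge0 ?(ltW lam0) // addr_ge0 // -mulrA mulr_ge0.
have q0 : 0 <= l%:R ^+ k.+1 / l%:R ^+ r :> R by rewrite divr_ge0 ?exprn_ge0.
have Bd : 0 <= B * (lam * dl) by rewrite mulr_ge0.
have -> : (12 + 2 * B) * (l%:R ^+ k.+1 * (l%:R ^+ 3 / M%:R ^+ 2 + M%:R * l%:R ^+ 4 / n%:R) + l%:R ^+ k.+1 / l%:R ^+ r) =
  12 * (lam * dl) + 2 * (B * (lam * dl)) + 12 * (l%:R ^+ k.+1 / l%:R ^+ r) + 2 * (B * (l%:R ^+ k.+1 / l%:R ^+ r)).
  by rewrite /lam /dl; ring.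
move: s1 s2 hl; rewrite (mulrCA lam 6).
move: (lam * Pr _ _) (lam * dl) (l%:R ^+ k.+1 / l%:R ^+ r) (Ex _ (fun c => _ * X c ^+ j)) (Ex _ (fun c => _ * X' c ^+ j)) dl0 q0 Bd.
by move=> z1 z2 z3 z4 z5; move: (B * z2) (B * z3) => z6 z7; lra.
Qed.

End degree_comparison.

(** * Convergence of the slopes at rate [1 / sqrt n] *)

Section slope_limit.
Variable R : realType.
Implicit Types (n k l L : nat).

(** Induction on [q] with [t = s ^+ 2]: one copy of [s ^+ L] absorbs a factor [L], because
    [L * s ^+ L] is at most a geometric sum. *)
Lemma polynomial_geometric_bounded q (t : R) : 0 < t -> t < 1 ->
  exists S : R, forall L, L%:R ^+ q * t ^+ L <= S.
Proof.
elim: q t => [|q IH] t t0 t1.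
  by exists 1 => L; rewrite mul1r exprn_ile1 // ltW.
pose s := Num.sqrt t; have s0 : 0 < s by rewrite sqrtr_gt0.
have sE : s ^+ 2 = t by rewrite sqr_sqrtr // ltW.
have s1 : s < 1 by rewrite -(@ltr_pXn2r _ 2) ?nnegrE ?(ltW s0) // sE expr1n.
have [S hS] := IH s s0 s1; exists ((1 - s)^-1 * S) => L.
have -> : L%:R ^+ q.+1 * t ^+ L = (L%:R * s ^+ L) * (L%:R ^+ q * s ^+ L).
  by rewrite -sE -exprM mulnC exprM exprS; ring.
apply: ler_pM; rewrite ?mulr_ge0 ?exprn_ge0 ?(ltW s0) ?hS //.
have s01 : 0 <= s < 1 by rewrite (ltW s0).
apply: le_trans (geometric_le L s01).
have -> : L%:R * s ^+ L = \sum_(i < L) s ^+ L by rewrite sumr_const card_ord -[RHS]mulr_natl.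
by apply: ler_sum => i _; apply: ler_wiXn2l; rewrite ?(ltW s0) ?(ltW s1) // ltnW.
Qed.

(** Put [z = l ^+ ee k]. With a grid of size [z ^+ 2] and a degree of order at least [z ^+ 6],
    moments differ by about [l ^+ (k.+1 + 4) / z ^+ 4], and the Lipschitz factor of the cumulant
    adds [l ^+ (k.+1 * k)]. The exponent makes these powers of [l] exactly one [z], which leaves
    [1 / z ^+ 3], the size of [1 / sqrt n] when the degree is of order [z ^+ 6]. *)
Let ee k := (k.+1 * k + k.+1 + 4)%N.

Lemma arcK_half_arc n k l : (0 < n)%N -> 2 * l%:R <= Num.sqrt n%:R :> R ->
  arcK n k (l%:R : R) = ZK n k (- half_arc R n l) (half_arc R n l).
Proof.
move=> n0 ln; have [a1 a2 _] := half_arcP n0 ln.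
rewrite -(@ZK_rot R n k _ _ (half_arc R n l) a1 a2) addNr /arcK /half_arc; congr (ZK _ _ _ _).
by field; rewrite gt_eqF // sqrtr_gt0 ltr0n.
Qed.

(** The constant [A] leaves room for the length [L.+1] next to an extremal [L]. *)
Lemma arcK_compare k (A : R) : 0 <= A -> exists C : R, 0 <= C /\ forall n n' l,
  (0 < n)%N -> (n <= n')%N -> (0 < l)%N -> 2 * l%:R <= Num.sqrt n%:R :> R ->
  (l%:R ^+ ee k) ^+ 6 <= A * n%:R :> R ->
  `|arcK n k (l%:R : R) - arcK n' k l%:R| <= C / (l%:R ^+ ee k) ^+ 3.
Proof.
(* With [r = 4 * ee k] the power [l ^+ r] is [z ^+ 4], in line with the other two error terms. *)
move=> A0; have [C0 [C00 hC]] := moments_close R k (4 * ee k).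
have K1 := kap_lip_ge1 R k.
have C1 : 0 <= (C0 + 1) ^+ k by rewrite exprn_ge0 //; lra.
exists (kap_lip R k * (C0 + 1) ^+ k * (C0 * (A + 2))); split.
  by rewrite !mulr_ge0 //; lra.
move=> n n' l n0 nn' l0 ln lA.
have ln' : 2 * l%:R <= Num.sqrt n'%:R :> R by apply: (le_trans ln); rewrite ler_wsqrtr // ler_nat.
have n'0 : (0 < n')%N by apply: leq_trans nn'.
rewrite !arcK_half_arc //.
have lM : (0 < l <= (l ^ ee k) ^ 2)%N.
  rewrite l0 /= -expnM -[X in (X <= _)%N]expn1 leq_pexp2l //.
  by rewrite muln_gt0 /ee addnS.
have h := hC n n' l _ _ n0 nn' lM ln.
set M := ((l ^ ee k) ^ 2)%N in lM h; pose x : R := l%:R.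
have ME : M%:R = (x ^+ ee k) ^+ 2 by rewrite /M !natrX.
rewrite -/x in h lA *; pose z := x ^+ ee k; rewrite -/z in ME lA *.
have x1 : 1 <= x by rewrite ler1n.
have x0 : 0 < x by lra.
have z0 : 0 < z by rewrite exprn_gt0.
have nR : 0 < n%:R :> R by rewrite ltr0n.
pose B := (C0 + 1) * x ^+ k.+1.
have xk1 : 1 <= x ^+ k.+1 by rewrite exprn_ege1.
have B1 : 1 <= B by rewrite /B; apply: (@le_trans _ _ (1 * 1)); [lra|apply: ler_pM; lra].
have BC : C0 * x ^+ k.+1 <= B by rewrite ler_wpM2r ?exprn_ge0 ?(ltW x0) //; lra.
pose d := C0 * (x ^+ k.+1 * (x ^+ 3 / M%:R ^+ 2 + M%:R * x ^+ 4 / n%:R) + x ^+ k.+1 / x ^+ (4 * ee k)).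
have [_ _ hd0] := h 0%N (leq0n k).
have d0 : 0 <= d by apply: le_trans hd0.
apply: (@le_trans _ _ (kap_lip R k * B ^+ k * d)).
  apply: kap1_perturb => // j jk; have [/andP[p1 p2] /andP[p3 p4] p5] := h j jk.
  - by rewrite ger0_norm //; apply: (le_trans p2).
  - by rewrite ger0_norm //; apply: (le_trans p4).
  - exact: p5.
have x4 : 1 <= x ^+ 4 by rewrite exprn_ege1.
have x34 : x ^+ 3 <= x ^+ 4 by rewrite ler_weXn2l.
have z4 : 0 < z ^+ 4 by rewrite exprn_gt0.
have q1 : x ^+ 3 / M%:R ^+ 2 <= x ^+ 4 / z ^+ 4.
  by rewrite ME -exprM ler_wpM2r // invr_ge0 ltW.
have q2 : M%:R * x ^+ 4 / n%:R <= A * (x ^+ 4 / z ^+ 4).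
  rewrite ME ler_pdivrMr //.
  have -> : A * (x ^+ 4 / z ^+ 4) * n%:R = (A * n%:R) * (x ^+ 4 / z ^+ 4) by ring.
  apply: (@le_trans _ _ (z ^+ 6 * (x ^+ 4 / z ^+ 4))); last first.
    by rewrite ler_wpM2r // divr_ge0 ?ltW // exprn_gt0.
  by have -> : z ^+ 6 * (x ^+ 4 / z ^+ 4) = z ^+ 2 * x ^+ 4 by field; rewrite gt_eqF.
have q3 : x ^+ k.+1 / x ^+ (4 * ee k) <= x ^+ k.+1 * (x ^+ 4 / z ^+ 4).
  rewrite mulnC exprM -/z ler_wpM2l ?exprn_ge0 ?(ltW x0) // ler_peMl // invr_ge0 ltW //.
have dle : d <= C0 * ((A + 2) * (x ^+ k.+1 * (x ^+ 4 / z ^+ 4))).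
  rewrite /d ler_wpM2l //.
  have w : x ^+ 3 / M%:R ^+ 2 + M%:R * x ^+ 4 / n%:R <= (A + 1) * (x ^+ 4 / z ^+ 4) by lra.
  have xk0 : 0 <= x ^+ k.+1 by rewrite exprn_ge0 ?(ltW x0).
  have := ler_wpM2l xk0 w; rewrite (mulrCA (x ^+ k.+1) (A + 1)).
  by move: q3; move: (x ^+ k.+1 * (x ^+ 4 / z ^+ 4)) => X; lra.
have zE : z = x ^+ (k.+1 * k) * x ^+ k.+1 * x ^+ 4 by rewrite -!exprD.
have -> : kap_lip R k * (C0 + 1) ^+ k * (C0 * (A + 2)) / z ^+ 3 =
    kap_lip R k * B ^+ k * (C0 * ((A + 2) * (x ^+ k.+1 * (x ^+ 4 / z ^+ 4)))).
  have -> : B ^+ k = (C0 + 1) ^+ k * x ^+ (k.+1 * k) by rewrite /B (exprMn k) exprM.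
  have zi : 1 / z ^+ 3 = z / z ^+ 4 by field; rewrite gt_eqF.
  transitivity (kap_lip R k * (C0 + 1) ^+ k * (C0 * (A + 2)) * (z / z ^+ 4)); first by rewrite -zi; ring.
  rewrite {1}zE; move: (x ^+ (k.+1 * k)) (x ^+ k.+1) (x ^+ 4) (z ^+ 4)^-1 ((C0 + 1) ^+ k) (kap_lip R k).
  by move=> *; ring.
by rewrite ler_wpM2l // mulr_ge0 ?exprn_ge0 //; lra.
Qed.

Lemma sqrt_ge1 n : (0 < n)%N -> 1 <= Num.sqrt n%:R :> R.
Proof. by move=> n0; rewrite -[leLHS]sqrtr1 ler_wsqrtr // ler1n. Qed.

(** A slope is the unit difference at [L] up to [K * t ^+ L], and unit differences of two degrees
    are compared by [arcK_compare]. [L] is the largest integer with [(L ^ ee k) ^ 6 <= n], so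
    [sqrt n] is [z ^+ 3] up to the factor [D], and both errors times [sqrt n] stay bounded. *)
Lemma arcK_slope_close k (c : nat -> R) (K t : R) : 0 <= K -> 0 < t -> t < 1 ->
  (forall n, (0 < n)%N -> forall L : nat, (L.*2.+1)%:R <= (pi : R) * Num.sqrt n%:R ->
      `|arcK n k L.+1%:R - arcK n k L%:R - c n| <= K * t ^+ L) ->
  exists K' : R, forall n n', (0 < n)%N -> (n <= n')%N -> `|c n - c n'| * Num.sqrt n%:R <= K'.
Proof.
move=> K0 t0 t1 hc; pose e := ee k; have p2 := pi_ge2 R.
have e6 (X : R) : (X ^+ 3) ^+ 2 = X ^+ 6 by rewrite -exprM.
pose D : R := (2 ^+ e) ^+ 3; have D1 : 1 <= D by rewrite /D !exprn_ege1 // ler1n.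
have [C [C0 hC]] := @arcK_compare k (D ^+ 2) (sqr_ge0 _).
have [S hS] := polynomial_geometric_bounded (e * 3) t0 t1.
have [B [B1 hB]] := moments_upto R k.
pose b : R := kap_cst R k * B ^+ k.
have Fb n (x : R) : (0 < n)%N -> 0 <= x <= 1 -> `|arcK n k x| <= b.
  move=> n0 /andP[x0 x1]; have s0 : 0 < Num.sqrt n%:R :> R by rewrite sqrtr_gt0 ltr0n.
  apply: kap1_bound => // j jk.
  have /andP[g1 g2] : 0 <= Ex (gauss R n.+1) (fun c => (ZZ 0 (x / Num.sqrt n%:R) c)%:R ^+ j) <= B.
    by apply: hB => //; [rewrite divr_ge0 // ltW|rewrite subr0 mulrC divfK // gt_eqF].
  by rewrite ger0_norm.
have cb n : (0 < n)%N -> `|c n| <= 2 * b + K.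
  move=> n0; have s1 := sqrt_ge1 n0.
  have h : (0.*2.+1)%:R <= (pi : R) * Num.sqrt n%:R.
    by apply: (@le_trans _ _ (1 * 1)); [rewrite mulr1|apply: ler_pM => //; lra].
  have i1 : 0 <= (1 : R) <= 1 by rewrite lexx ler01.
  have i0 : 0 <= (0 : R) <= 1 by rewrite lexx ler01.
  have := hc n n0 0%N h; have f1 := Fb n 1 n0 i1; have f0 := Fb n 0 n0 i0.
  rewrite expr0 mulr1; move: f1 f0; rewrite !ler_norml; move: (arcK n k 1) (arcK n k 0) => *; lra.
exists (2 * (2 * b + K) * D + (2 * K * D * S + 2 * C * D)) => n n' n0 nn'.
have n'0 : (0 < n')%N by apply: leq_trans nn'.
have b0 : 0 <= b by apply: le_trans (Fb n 0 n0 _); rewrite ?lexx ?ler01.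
have S0 : 0 <= S by apply: le_trans (hS 0%N); rewrite mulr_ge0 ?exprn_ge0 // ltW.
have e0 : (0 < e)%N by rewrite /e /ee addnS.
have cn := cb n n0; have cn' := cb n' n'0.
have exL : exists L, ((L ^ e) ^ 6 <= n)%N by exists 1%N; rewrite !exp1n.
have ubL L : ((L ^ e) ^ 6 <= n)%N -> (L <= n)%N.
  move=> h; case: L h => // L; apply: leq_trans; rewrite -expnM -[X in (X <= _)%N]expn1 leq_pexp2l //.
  by rewrite muln_gt0 e0.
have [L hL mL] := ex_maxnP exL ubL.
have L0 : (0 < L)%N by apply: mL; rewrite !exp1n.
have sn0 := sqrtr_ge0 (n%:R : R).
have sD : Num.sqrt n%:R <= D * (L%:R ^+ e) ^+ 3.
  have h : (n <= (L.+1 ^ e) ^ 6)%N.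
    by rewrite leqNgt; apply/negP => /ltnW /mL; rewrite ltnn.
  have -> : D * (L%:R ^+ e) ^+ 3 = ((2 * L%:R) ^+ e) ^+ 3 by rewrite /D -exprMn -exprMn.
  rewrite -(@ler_pXn2r _ 2) ?nnegrE ?exprn_ge0 ?mulr_ge0 // sqr_sqrtr // e6.
  apply: (@le_trans _ _ (((L.+1 ^ e) ^ 6)%N%:R)); first by rewrite ler_nat.
  rewrite natrX natrX lerXn2r ?nnegrE ?exprn_ge0 ?mulr_ge0 // lerXn2r ?nnegrE ?mulr_ge0 //.
  by rewrite -natrM ler_nat; clear -L0; lia.
have t1' : 0 <= 2 * K * D * S + 2 * C * D by rewrite addr_ge0 ?mulr_ge0 //; lra.
have t2' : 0 <= 2 * (2 * b + K) * D by rewrite !mulr_ge0 //; lra.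
(* For [L = 1] the degree is bounded and the crude bound on slopes suffices; from [L = 2] on, an arc
   of length [L.+1] is short enough for the comparison. *)
have [L1|L2] := leqP L 1.
  have {}L1 : L = 1%N by apply/eqP; rewrite eqn_leq L1.
  rewrite L1 expr1n expr1n mulr1 in sD.
  have cc : `|c n - c n'| <= 2 * (2 * b + K) by move: cn cn'; rewrite !ler_norml => *; apply/andP; split; lra.
  have : `|c n - c n'| * Num.sqrt n%:R <= 2 * (2 * b + K) * D by apply: ler_pM.
  lra.
pose z : R := L%:R ^+ e; have L1R : 1 <= L%:R :> R by rewrite ler1n.
have z1 : 1 <= z by rewrite exprn_ege1.
have zn : z ^+ 3 <= Num.sqrt n%:R.
  rewrite -(@ler_pXn2r _ 2) ?nnegrE ?exprn_ge0 // sqr_sqrtr // e6 /z -!natrX ler_nat; exact: hL.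
have sl : 2 * L.+1%:R <= Num.sqrt n%:R :> R.
  apply: le_trans zn; apply: (@le_trans _ _ (L%:R ^+ 3)); last first.
    by rewrite lerXn2r ?nnegrE ?exprn_ge0 // /z -[leLHS]expr1 ler_weXn2l.
  rewrite -natrX -natrM ler_nat; clear -L2.
  have : (2 * 2 * L <= L * L * L)%N by rewrite leq_mul2r leq_mul ?orbT.
  by rewrite !expnS expn0; lia.
have sl0 : 2 * L%:R <= Num.sqrt n%:R :> R by apply: le_trans sl; rewrite ler_pM2l // ler_nat.
have grid m : (n <= m)%N -> (L.*2.+1)%:R <= (pi : R) * Num.sqrt m%:R.
  move=> nm; apply: (@le_trans _ _ (Num.sqrt m%:R)); last by rewrite ler_peMl ?sqrtr_ge0 //; lra.
  apply: (@le_trans _ _ (Num.sqrt n%:R)); last by rewrite ler_wsqrtr // ler_nat.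
  by apply: le_trans sl; rewrite -natrM ler_nat; clear; lia.
have s1 := hc n n0 L (grid n (leqnn n)); have s2 := hc n' n'0 L (grid n' nn').
have hz (l : nat) : (l <= L.+1)%N -> (l%:R ^+ ee k) ^+ 6 <= D ^+ 2 * n%:R :> R.
  move=> lL; apply: (@le_trans _ _ (((2 * L%:R) ^+ ee k) ^+ 6)).
    rewrite lerXn2r ?nnegrE ?exprn_ge0 ?mulr_ge0 // lerXn2r ?nnegrE ?mulr_ge0 //.
    by rewrite -natrM ler_nat; clear -lL L2; lia.
  have -> : ((2 * L%:R) ^+ ee k) ^+ 6 = D ^+ 2 * (L%:R ^+ e) ^+ 6 :> R.
    by rewrite (exprMn (ee k)) (exprMn 6) /D e6.
  by rewrite ler_wpM2l ?sqr_ge0 // -!natrX ler_nat.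
have s3 := hC n n' L n0 nn' L0 sl0 (hz L (leqnSn L)).
have s4 := hC n n' L.+1 n0 nn' isT sl (hz L.+1 (leqnn _)).
rewrite -/e -/z in s3; rewrite -/e in s4.
have z3 : 0 < z ^+ 3 by rewrite exprn_gt0 //; lra.
have s4' : C / (L.+1%:R ^+ e) ^+ 3 <= C / z ^+ 3.
  have zl : 0 < (L.+1%:R ^+ e) ^+ 3 :> R by do 2 apply: exprn_gt0; rewrite ltr0n.
  rewrite ler_wpM2l // lef_pV2 ?posrE //.
  by rewrite lerXn2r ?nnegrE ?exprn_ge0 // lerXn2r ?nnegrE // ler_nat.
have hd : `|c n - c n'| <= 2 * K * t ^+ L + 2 * (C / z ^+ 3).
  move: s1 s2 s3 (le_trans s4 s4'); rewrite !ler_norml.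
  move: (arcK n k L.+1%:R) (arcK n k L%:R) (arcK n' k L.+1%:R) (arcK n' k L%:R) (t ^+ L) (C / z ^+ 3).
  clear => f1 f0 g1 g0 T Q /andP[a1 a2] /andP[a3 a4] /andP[a5 a6] /andP[a7 a8].
  by apply/andP; split; lra.
have tL : 0 <= t ^+ L by rewrite exprn_ge0 // ltW.
have Q0 : 0 <= C / z ^+ 3 by rewrite divr_ge0 // ltW.
have : `|c n - c n'| * Num.sqrt n%:R <= (2 * K * t ^+ L + 2 * (C / z ^+ 3)) * (D * z ^+ 3).
  by apply: ler_pM.
have -> : (2 * K * t ^+ L + 2 * (C / z ^+ 3)) * (D * z ^+ 3) =
    2 * K * D * (L%:R ^+ (e * 3) * t ^+ L) + 2 * C * D.
  by rewrite exprM -/z; field; rewrite gt_eqF //; lra.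
have KD : 0 <= 2 * K * D by rewrite !mulr_ge0 //; lra.
have := ler_wpM2l KD (hS L).
by move: t2' (2 * K * D * _) (2 * K * D * _) (2 * C * D) => ? *; lra.
Qed.

(** The intervals of radius [w n] around [c n] pairwise intersect, so the supremum of their left
    ends lies in all of them. The error [w n], of order [1 / sqrt n], meets lengths of at most
    [pi * sqrt n]. *)
Theorem arcK_asymptotics k : exists beta K : R, forall n (l : R), (0 < n)%N -> 0 <= l ->
  l <= (pi : R) * Num.sqrt n%:R -> `|arcK n k l - beta * l| <= K.
Proof.
have [c [K [t [K0 t0 t1 h]]]] := arcK_linear R k.
have hs n : (0 < n)%N -> forall L, (L.*2.+1)%:R <= (pi : R) * Num.sqrt n%:R ->
    `|arcK n k L.+1%:R - arcK n k L%:R - c n| <= K * t ^+ L by move=> n0; exact: (h n n0).2.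
have [K' hK'] := arcK_slope_close K0 t0 t1 hs.
pose w n : R := K' / Num.sqrt n%:R.
have K'0 : 0 <= K' by have := hK' 1%N 1%N isT (leqnn 1); rewrite subrr normr0 mul0r.
have w0 n : 0 <= w n by rewrite divr_ge0 ?sqrtr_ge0.
have cw n n' : (0 < n)%N -> (n <= n')%N -> `|c n - c n'| <= w n.
  by move=> n0 nn'; rewrite ler_pdivlMr ?hK' // sqrtr_gt0 ltr0n.
have cross n n' : (0 < n)%N -> (0 < n')%N -> c n - w n <= c n' + w n'.
  move=> n0 n'0; have v1 := w0 n; have v2 := w0 n'; have [nn'|/ltnW nn'] := leqP n n'.
    by have := cw _ _ n0 nn'; rewrite ler_norml => /andP[]; lra.
  by have := cw _ _ n'0 nn'; rewrite ler_norml => /andP[]; lra.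
pose S : set R := [set x | exists2 n, (0 < n)%N & x = c n - w n].
have S0 : S !=set0 by exists (c 1%N - w 1%N); exists 1%N.
have Sub n' : (0 < n')%N -> ubound S (c n' + w n').
  by move=> n'0 _ [n n0 ->]; exact: cross.
have hS : has_ubound S by exists (c 1%N + w 1%N); exact: Sub.
have close n : (0 < n)%N -> `|c n - sup S| <= w n.
  move=> n0; have u1 : c n - w n <= sup S by apply: ub_le_sup => //; exists n.
  have u2 : sup S <= c n + w n by apply: ge_sup => //; exact: Sub.
  by rewrite ler_norml; apply/andP; split; lra.
exists (sup S), (K + K' * pi) => n l n0 l0 lp.
have h1 := (h n n0).1 l l0 lp; have h2 := close n n0.
have -> : arcK n k l - sup S * l = (arcK n k l - c n * l) + (c n - sup S) * l by ring.
apply: (le_trans (ler_normD _ _)); apply: lerD => //.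
rewrite normrM (ger0_norm l0); apply: (@le_trans _ _ (w n * ((pi : R) * Num.sqrt n%:R))).
  by apply: ler_pM.
have sn : Num.sqrt n%:R != 0 :> R by rewrite gt_eqF // sqrtr_gt0 ltr0n.
by rewrite /w (mulrC (pi : R)) mulrA divfK.
Qed.

End slope_limit.

(** * Real zeros of elliptic polynomials *)

Section real_zeros.
Variable R : realType.
Implicit Types (n k : nat) (a b : \bar R).

(** Infinite ends become the two ends of a half turn, so every interval turns into an arc of length
    at most [pi]. *)
Definition arc_end (e : \bar R) : R :=
  match e with EFin r => atan r | +oo%E => pi / 2 | -oo%E => - (pi / 2) end.

Lemma lt_atanE (x y : R) : (atan x < atan y) = (x < y).
Proof.
apply/idP/idP; first by rewrite !ltNge; apply: contra => /le_atan.
rewrite !lt_neqAle => /andP[ne /le_atan ->]; rewrite andbT.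
by apply: contraNneq ne => h; rewrite -(atanK x) h atanK.
Qed.

Lemma arc_end_lt (e : \bar R) (x : R) : (e < x%:E)%E = (arc_end e < atan x).
Proof.
case: e => [r| |] /=; first by rewrite lte_fin lt_atanE.
  by apply/esym/negbTE; rewrite -leNgt ltW // atan_ltpi2.
by rewrite ltNyr atan_gtNpi2.
Qed.

Lemma lt_arc_end (e : \bar R) (x : R) : (x%:E < e)%E = (atan x < arc_end e).
Proof.
case: e => [r| |] /=; first by rewrite lte_fin lt_atanE.
  by rewrite ltry atan_ltpi2.
by apply/esym/negbTE; rewrite -leNgt ltW // atan_gtNpi2.
Qed.

Lemma arc_end_bound (e : \bar R) : - (pi / 2) <= arc_end e <= pi / 2.
Proof.
have p0 := @pi_gt0 R; case: e => [r| |] /=; last 2 first.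
- by apply/andP; split; lra.
- by apply/andP; split; lra.
by rewrite !ltW ?atan_ltpi2 ?atan_gtNpi2.
Qed.

Lemma arc_end_mono a b : (a < b)%E -> arc_end a < arc_end b.
Proof.
have p0 := @pi_gt0 R; case: b => [r| |] //=; last by rewrite ltNge leNye.
  by rewrite arc_end_lt.
by case: a => [r| |] //= _; [rewrite atan_ltpi2|lra].
Qed.

Lemma FF_zero n (c : n.+1.-tuple R) t : ~~ nonzero c -> FF c t = 0.
Proof.
rewrite negb_exists => /forallP c0; rewrite /FF /dot big1 // => i _.
by have := c0 i; rewrite negbK => /eqP ->; rewrite mulr0.
Qed.

(** The half-open arc exceeds the open interval by its left end only. For [a = -oo] that end is the
    point at infinity, where [FF] reads off the leading coefficient up to sign. *)
Lemma ZZ_num_real_zeros n (c : n.+1.-tuple R) a b : (a < b)%E -> nonzero c ->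
  ZZ (arc_end a) (arc_end b) c =
  (num_real_zeros (ppoly c) a b + (FF c (arc_end a) == 0%R))%N.
Proof.
move=> ab c0; have AB := arc_end_mono ab; have p0 := @pi_gt0 R.
have /andP[A1 A2] := arc_end_bound a; have /andP[B1 B2] := arc_end_bound b.
rewrite /ZZ c0; set A := arc_end a in AB A1 A2 *; set B := arc_end b in AB B1 B2 *.
have BA : B <= A + pi by lra.
have [fz _] := zeros_finite c0 BA.
pose T := [set t : R | A < t < B /\ FF c t = 0].
have Tz : T `<=` zeros c A B by move=> t [/andP[/ltW h1 h2] h3]; split; rewrite ?h1.
have fT : finite_set T := sub_finite_set Tz fz.
have Tpi t : T t -> - (pi / 2) < t < pi / 2.
  by move=> [/andP[h1 h2] _]; rewrite (le_lt_trans A1 h1) (lt_le_trans h2 B2).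
have -> : num_real_zeros (ppoly c) a b = crd T.
  rewrite -(@crd_image R (@tan R) T fT); last first.
    by move=> x y; rewrite !inE => xT yT; apply: tan_injective; exact: Tpi.
  rewrite /num_real_zeros /crd; congr (#|` fset_set _|); apply/seteqP; split => [x /= [h rx]|_ [t Tt <-]].
    exists (atan x); last by rewrite atanK.
    split; first by rewrite -arc_end_lt -lt_arc_end.
    by rewrite FF_ppoly ?atanK ?(eqP rx) ?mulr0 // gt_eqF // cos_gt0_pihalf // atan_gtNpi2 atan_ltpi2.
  have tp := Tpi t Tt; have [tAB tz] := Tt.
  have ct : cos t != 0 by rewrite gt_eqF // cos_gt0_pihalf.
  have tI : t \in `](- (pi / 2)), (pi / 2)[ by rewrite in_itv.
  split; first by rewrite arc_end_lt lt_arc_end (tanK tI).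
  move/eqP: tz; rewrite FF_ppoly // mulf_eq0 expf_eq0 (negbTE ct) andbF /= => h.
  exact: h.
have [A0|A0] := eqVneq (FF c A) 0; last first.
  rewrite addn0; congr crd; apply/seteqP; split => // t [/andP[h1 h2] h3]; split => //.
  by rewrite h2 andbT lt_neqAle h1 andbT; apply: contraNneq A0 => ->; rewrite h3.
have -> : zeros c A B = T `|` [set A].
  apply/seteqP; split => [t [/andP[h1 h2] h3]|t [/Tz //|->]]; last by split; rewrite ?lexx.
  have [->|tA] := eqVneq t A; [by right|left; split => //].
  by rewrite h2 andbT lt_neqAle h1 eq_sym tA.
have f1 : finite_set [set A] by exact: finite_set1.
have TA : T `&` [set A] = set0.
  by rewrite -subset0 => t [[/andP[h1 _] _] /= tA]; move: h1; rewrite tA ltxx.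
rewrite (crdU fT f1 TA); congr addn; apply/eqP; rewrite eqn_leq; apply/andP; split.
  by apply: crd_le1 => x y -> ->.
exact: (@crd1_gt0 R [set A] A).
Qed.

Lemma measurable_FF_eq0 n t : measurable_fun setT (fun c : n.+1.-tuple R => FF c t == 0).
Proof.
apply: (@measurable_fun_bool _ _ _ _ true); rewrite setTI.
rewrite (_ : _ @^-1` _ = (fun c : n.+1.-tuple R => FF c t) @^-1` [set 0]).
  by apply: measurable_preimage; [exact: measurable_FF|exact: measurable_set1].
by apply/seteqP; split => c /= /eqP.
Qed.

Definition real_zero_count n a b (c : n.+1.-tuple R) : nat := num_real_zeros (ppoly c) a b.

(** The zero tuple is outside the reach of [ZZ_num_real_zeros]; whatever is counted for the zero
    polynomial is kept as a term of the bound. *)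
Lemma real_zero_count_le n a b (c : n.+1.-tuple R) : (a < b)%E ->
  (real_zero_count a b c <= num_real_zeros (0%R : {poly R}) a b + n.+1)%N.
Proof.
move=> ab; have p0 := @pi_gt0 R.
have /andP[A1 A2] := arc_end_bound a; have /andP[B1 B2] := arc_end_bound b.
case: (boolP (nonzero c)) => [c0|c0].
  apply: (@leq_trans n.+1); last exact: leq_addl.
  apply: (@leq_trans (ZZ (arc_end a) (arc_end b) c)); last by apply: ZZ_le; lra.
  by rewrite ZZ_num_real_zeros // leq_addr.
rewrite /real_zero_count (_ : ppoly c = 0) ?leq_addr //.
move: c0; rewrite negb_exists => /forallP c0; apply/polyP => i.
rewrite coef_poly coef0; case: ifP => // lt_i.
by have := c0 (Ordinal lt_i); rewrite negbK (tnth_nth 0) => /eqP ->; rewrite mul0r.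
Qed.

Lemma bmfun_real_zero_count n a b : (a < b)%E ->
  bmfun (fun c : n.+1.-tuple R => (real_zero_count a b c)%:R : R).
Proof.
move=> ab; have p0 := @pi_gt0 R; have AB := arc_end_mono ab.
have /andP[A1 A2] := arc_end_bound a; have /andP[B1 B2] := arc_end_bound b.
split; last first.
  exists (num_real_zeros (0%R : {poly R}) a b + n.+1)%N%:R => c.
  by rewrite ger0_norm // ler_nat real_zero_count_le.
pose N0 := num_real_zeros (0%R : {poly R}) a b.
rewrite (_ : (fun c => _) = (fun c : n.+1.-tuple R => if nonzero c then
   (ZZ (arc_end a) (arc_end b) c)%:R - (FF c (arc_end a) == 0)%:R else N0%:R : R)).
  apply: measurable_fun_ifT; [exact: (@measurable_nonzero R n.+1)| |exact: measurable_cst].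
  apply: measurable_funB; first by apply: measurable_ZZ; lra.
  exact: (@bmfun_bool _ _ R _ (@measurable_FF_eq0 n _)).1.
apply/funext => c; case: ifP => c0; first by rewrite ZZ_num_real_zeros // natrD addrK.
rewrite /real_zero_count (_ : ppoly c = 0) //.
move: c0 => /negbT; rewrite negb_exists => /forallP c0; apply/polyP => i.
rewrite coef_poly coef0; case: ifP => // lt_i.
by have := c0 (Ordinal lt_i); rewrite negbK (tnth_nth 0) => /eqP ->; rewrite mul0r.
Qed.

(** The counts can differ only when [FF] vanishes at the left end of the arc, a null event that
    includes the zero tuple. *)
Lemma Ex_real_zero_count n a b j : (a < b)%E ->
  Ex (gauss R n.+1) (fun c => (real_zero_count a b c)%:R ^+ j) =
  Ex (gauss R n.+1) (fun c => (ZZ (arc_end a) (arc_end b) c)%:R ^+ j).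
Proof.
move=> ab; have p0 := @pi_gt0 R; have AB := arc_end_mono ab.
have /andP[A1 A2] := arc_end_bound a; have /andP[B1 B2] := arc_end_bound b.
apply: (@Ex_eq_ae _ _ R (gauss R n.+1) _ _ (fun c => FF c (arc_end a) == 0)).
- by apply: bmfunX; exact: bmfun_real_zero_count.
- by apply: bmfunX; apply: bmfun_ZZ; lra.
- exact: measurable_FF_eq0.
- exact: Pr_FF_eq0.
move=> c c0; have nz : nonzero c by apply: contraNT c0 => /FF_zero ->.
by rewrite ZZ_num_real_zeros // (negbTE c0) addn0.
Qed.

End real_zeros.

Section independent_gaussians.
Context d (T : measurableType d) (R : realType) (P : probability T R).
Variable omega : nat -> {RV P >-> R}.
Hypotheses (ind : independent_RVs omega) (gau : forall j, standard_gaussian (omega j)).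

Definition coefs n (w : T) : n.-tuple R := [tuple omega i w | i < n].

Lemma std_gaussian_coefs n : std_gaussian P (coefs n.+1).
Proof.
split=> [|B mB].
  apply/measurable_fun_tnthP => i.
  rewrite (_ : _ \o _ = omega i); first exact: measurable_funPT.
  by apply/funext => w /=; rewrite tnth_mktuple.
pose J := seq_fset tt (index_iota 0 n.+1).
have memJ j : (j \in J) = (j < n.+1)%N by rewrite seq_fsetE mem_index_iota.
(* [independent_RVs] takes a family of sets over all of [nat]; only its values at indices below
   [n.+1] matter for the finite set [J]. *)
pose B' j := B (inord j).
have -> : coefs n.+1 @^-1` box B = \bigcap_(j in [set` J]) (omega j @^-1` B' j).
  apply/seteqP; split => w /= h.
    move=> j /=; rewrite memJ => jn.
    by have := h (inord j); rewrite tnth_mktuple inordK.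
  move=> i; rewrite tnth_mktuple; have := h (i : nat); rewrite /B' /= inord_val; apply.
  by rewrite /= memJ.
rewrite ind; last by move=> j; exact: mB.
rewrite (perm_big (index_iota 0 n.+1)); last first.
  by apply: uniq_perm; rewrite ?fset_uniq ?iota_uniq // => x; rewrite memJ mem_index_iota.
rewrite big_mkord; apply: eq_bigr => i _.
have -> : P (omega i @^-1` B' i) = distribution P (omega i) (B i) by rewrite /B' inord_val.
by rewrite gau ?normal01E.
Qed.

Lemma elliptic_zerosE n a b : elliptic_zeros omega n a b =
  (fun w => (real_zero_count a b (coefs n.+1 w))%:R).
Proof.
apply/funext => w; rewrite /elliptic_zeros /real_zero_count; congr (num_real_zeros _ a b)%:R.
apply/polyP => i; rewrite !coef_poly; case: ifP => // lt_i.
by rewrite -(tnth_nth 0 (coefs n.+1 w) (Ordinal lt_i)) tnth_mktuple.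
Qed.

Lemma moment_elliptic_zeros n a b j : (a < b)%E ->
  Ex P (fun w => (real_zero_count a b (coefs n.+1 w))%:R ^+ j) =
  Ex (gauss R n.+1) (fun c => (ZZ (arc_end a) (arc_end b) c)%:R ^+ j).
Proof.
move=> ab; rewrite -Ex_real_zero_count //.
by rewrite -(Ex_law (std_gaussian_coefs n)) //; apply: bmfunX; exact: bmfun_real_zero_count.
Qed.

Lemma arc_length_bound n a b : (a < b)%E ->
  [/\ arc_end a <= arc_end b, arc_end b <= arc_end a + pi,
   0 <= Num.sqrt n%:R * (arc_end b - arc_end a) &
   Num.sqrt n%:R * (arc_end b - arc_end a) <= (pi : R) * Num.sqrt n%:R].
Proof.
move=> ab; have p0 := @pi_gt0 R; have AB := arc_end_mono ab.
have /andP[A1 A2] := arc_end_bound a; have /andP[B1 B2] := arc_end_bound b.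
split; [lra|lra| |].
  by rewrite mulr_ge0 ?sqrtr_ge0 // subr_ge0 ltW.
by rewrite mulrC ler_wpM2r ?sqrtr_ge0 //; lra.
Qed.

(** Cumulants are functions of the moments, which may be computed under [gauss] and, after a
    rotation, on the arc of the same length that starts at 0. *)
Lemma cumulant_elliptic_zeros n k a b : (0 < n)%N -> (0 < k)%N -> (a < b)%E ->
  cumulant P k (elliptic_zeros omega n a b) =
  arcK n k (Num.sqrt n%:R * (arc_end b - arc_end a)).
Proof.
move=> n0 k0 ab; have [h1 h2 _ _] := arc_length_bound n ab; rewrite elliptic_zerosE.
rewrite (@cumulant_bounded_nat R _ T P (fun w => real_zero_count a b (coefs n.+1 w))
   (num_real_zeros (0%R : {poly R}) a b + n.+1).+1 k k0); last 2 first.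
- exact: (measurableT_comp (bmfun_real_zero_count n ab).1 (std_gaussian_coefs n).1).
- by move=> w; rewrite ltnS real_zero_count_le.
rewrite /arcK; have -> : Num.sqrt n%:R * (arc_end b - arc_end a) / Num.sqrt n%:R = arc_end b - arc_end a.
  by rewrite mulrC mulKf // gt_eqF // sqrtr_gt0 ltr0n.
rewrite -(subrr (arc_end a)) ZK_rot //; apply: eq_kap1 => j.
exact: moment_elliptic_zeros.
Qed.

Lemma expectation_elliptic_zeros n a b : (0 < n)%N -> (a < b)%E ->
  fine ('E_P[elliptic_zeros omega n a b])%E = Num.sqrt n%:R * (arc_end b - arc_end a) / pi.
Proof.
move=> n0 ab; have [h1 h2 _ _] := arc_length_bound n ab; rewrite elliptic_zerosE unlock.
have bN := bmfun_comp (std_gaussian_coefs n).1 (bmfun_real_zero_count n ab).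
rewrite -(EFin_Ex P bN) /= -(Ex_ZZ n0 h1 h2).
exact: (moment_elliptic_zeros n 1 ab).
Qed.

End independent_gaussians.

Theorem theorem1p4 (R : realType) (k : nat) (hk : (0 < k)%N) :
  exists beta : R,
    forall (d : measure_display) (T : measurableType d) (P : probability T R)
      (omega : nat -> {RV P >-> R}),
      independent_RVs omega ->
      (forall j : nat, standard_gaussian (omega j)) ->
      forall a b : nat -> \bar R, (forall n : nat, (a n < b n)%E) ->
        (fun n : nat => cumulant P k (elliptic_zeros omega n (a n) (b n))) =
        (fun n : nat => beta * fine ('E_P[elliptic_zeros omega n (a n) (b n)])%E)
          +O_ \oo (fun=> 1 : R).
Proof.
have [beta [K hK]] := arcK_asymptotics R k.
(* Here [beta] is a slope per unit of rescaled length, and the mean grows by [1 / pi] per unit,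
   whence the factor [pi]. *)
exists (beta * pi) => d T P omega ind gau a b ab; apply/eqaddOP.
near=> C; near=> n.
have n0 : (0 < n)%N by near: n; exists 1%N.
rewrite normr1 mulr1.
have [_ _ l0 l1] := arc_length_bound n (ab n).
have -> : ((fun n => cumulant P k (elliptic_zeros omega n (a n) (b n))) -
    (fun n => beta * pi * fine ('E_P[elliptic_zeros omega n (a n) (b n)])%E)) n =
    cumulant P k (elliptic_zeros omega n (a n) (b n)) -
    beta * pi * fine ('E_P[elliptic_zeros omega n (a n) (b n)])%E by [].
rewrite cumulant_elliptic_zeros // expectation_elliptic_zeros //.
have -> : beta * pi * (Num.sqrt n%:R * (arc_end (b n) - arc_end (a n)) / pi) =
    beta * (Num.sqrt n%:R * (arc_end (b n) - arc_end (a n))).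
  have pn : (pi : R) != 0 by rewrite gt_eqF // pi_gt0.
  by rewrite -mulrA [pi * _]mulrC divfK.
apply: (le_trans (hK n _ n0 l0 l1)).
by near: C; apply: nbhs_pinfty_ge; rewrite num_real.
Unshelve. all: by end_near.
Qed.
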